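(* Let $G$ be a group and let $\mathbf{A}$ be a small pre-additive category (respectively, a small marked pre-additive category). Write $\mathbf{preAdd}^{(+)}$ for $\mathbf{preAdd}$ (respectively $\mathbf{preAdd}^{+}$). Let $\underline{\mathbf{A}}\in\mathrm{Fun}(BG,\mathbf{preAdd}^{(+)})$ be the constant functor with value $\mathbf{A}$, i.e. $\mathbf{A}$ with trivial $G$-action. Then there is a natural equivalence $$\operatorname{colim}_{BG}\ \ell_{\mathbf{preAdd}^{(+)},BG}(\underline{\mathbf{A}})\simeq \ell_{\mathbf{preAdd}^{(+)}}(\mathbf{A}\sharp BG)$$ in the $\infty$-category $\mathbf{preAdd}^{(+)}_\infty$.
   Context: ''Small'' is relative to a fixed universe. $\mathbf{preAdd}$ is the category of small pre-additive ($\mathrm{Ab}$-enriched) categories and enriched functors. A marking on a category is a wide subgroupoid of its groupoid of isomorphisms (its morphisms are the marked isomorphisms); $\mathbf{preAdd}^{+}$ is the category of small pre-additive categories with a marking and enriched functors preserving marked isomorphisms. Weak equivalences are the morphisms invertible up to natural isomorphism (with marked components in the marked case), and $\ell_{\mathbf{preAdd}^{(+)}}\colon\mathbf{preAdd}^{(+)}\to\mathbf{preAdd}^{(+)}_\infty$ is the $\infty$-categorical localization at them. $BG$ is the groupoid with one object with automorphism group $G$, and $\ell_{\mathbf{preAdd}^{(+)},BG}\colon \mathrm{Fun}(BG,\mathbf{preAdd}^{(+)})\to\mathrm{Fun}(BG,\mathbf{preAdd}^{(+)}_\infty)$ is post-composition with $\ell_{\mathbf{preAdd}^{(+)}}$.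 For a groupoid $\Gamma$, $\mathbf{A}\sharp \Gamma$ is the following (marked) pre-additive category: objects are pairs $(A,x)$ with $A$ an object of $\mathbf{A}$ and $x$ an object of $\Gamma$; $\mathrm{Hom}((A,x),(A',x'))=\mathrm{Hom}_{\mathbf{A}}(A,A')\otimes\mathbb{Z}[\mathrm{Hom}_{\Gamma}(x,x')]$ with the obvious composition; in the marked case, the marked isomorphisms are the morphisms $a\otimes\gamma$ with $a$ a marked isomorphism of $\mathbf{A}$ and $\gamma$ a morphism of $\Gamma$. *)

(* Defs.v *)
From HB Require Import structures.
From mathcomp Require Import all_boot all_order all_algebra.
From mathcomp Require Import finmap.
From mathcomp.multinomials Require Import monalg.
From Stdlib Require Import FunctionalExtensionality ProofIrrelevance.

Set Implicit Arguments.
Unset Strict Implicit.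
Unset Printing Implicit Defensive.
Set Primitive Projections.

Import GRing.Theory.

Record category := Category {
  ob :> Type;
  hom : ob -> ob -> Type;
  idm : forall x, hom x x;
  cmp : forall x y z, hom y z -> hom x y -> hom x z;
  cmpA : forall w x y z (h : hom y z) (g : hom x y) (f : hom w x),
    cmp h (cmp g f) = cmp (cmp h g) f;
  cmp1m : forall x y (f : hom x y), cmp (idm y) f = f;
  cmpm1 : forall x y (f : hom x y), cmp f (idm x) = f }.

Record functor (C D : category) := Functor {
  fob :> C -> D;
  fmor : forall x y, hom x y -> hom (fob x) (fob y);
  fmor1 : forall x, fmor (idm x) = idm (fob x);
  fmorM : forall x y z (g : hom y z) (f : hom x y),
    fmor (cmp g f) = cmp (fmor g) (fmor f) }.

(* Hom-sets carry a choice structure so that Z[Hom(x, y)] can be formed;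
   classically this is no restriction. *)
Record groupoid := Groupoid {
  gob :> Type;
  ghom : gob -> gob -> choiceType;
  gid : forall x, ghom x x;
  gcmp : forall x y z, ghom y z -> ghom x y -> ghom x z;
  ginv : forall x y, ghom x y -> ghom y x;
  gcmpA : forall w x y z (h : ghom y z) (g : ghom x y) (f : ghom w x),
    gcmp h (gcmp g f) = gcmp (gcmp h g) f;
  gcmp1m : forall x y (f : ghom x y), gcmp (gid y) f = f;
  gcmpm1 : forall x y (f : ghom x y), gcmp f (gid x) = f;
  gcmpVm : forall x y (f : ghom x y), gcmp (ginv f) f = gid x;
  gcmpmV : forall x y (f : ghom x y), gcmp f (ginv f) = gid y }.

Coercion groupoid_category (Gamma : groupoid) : category :=
  @Category Gamma (@ghom Gamma) (@gid Gamma) (@gcmp Gamma) (@gcmpA Gamma)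
    (@gcmp1m Gamma) (@gcmpm1 Gamma).

Definition BG (G : groupType) : groupoid :=
  @Groupoid unit (fun _ _ => G) (fun _ => 1%g) (fun _ _ _ g h => (g * h)%g)
    (fun _ _ g => g^-1%g) (fun _ _ _ _ => @mulgA G)
    (fun _ _ => @mul1g G) (fun _ _ => @mulg1 G)
    (fun _ _ => @mulVg G) (fun _ _ => @mulgV G).

Section PreAdditive.
Local Open Scope ring_scope.

(* The choice structure contained in a zmodType is not preserved by functors:
   classically every abelian group carries one, and two choices on the same
   group give isomorphic objects of preAdd. *)
Record preadd := Preadd {
  pob :> Type;
  phom : pob -> pob -> zmodType;
  pid : forall x, phom x x;
  pcmp : forall x y z, phom y z -> phom x y -> phom x z;
  pcmpA : forall w x y z (h : phom y z) (g : phom x y) (f : phom w x),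
    pcmp h (pcmp g f) = pcmp (pcmp h g) f;
  pcmp1m : forall x y (f : phom x y), pcmp (pid y) f = f;
  pcmpm1 : forall x y (f : phom x y), pcmp f (pid x) = f;
  pcmpDl : forall x y z (g g' : phom y z) (f : phom x y),
    pcmp (g + g') f = pcmp g f + pcmp g' f;
  pcmpDr : forall x y z (g : phom y z) (f f' : phom x y),
    pcmp g (f + f') = pcmp g f + pcmp g f' }.

Definition p_inverse (A : preadd) (x y : A) (f : phom x y) (g : phom y x) :=
  pcmp g f = pid x /\ pcmp f g = pid y.

Definition p_iso (A : preadd) (x y : A) (f : phom x y) :=
  exists g : phom y x, p_inverse f g.

Record pfunctor (A B : preadd) := Pfunctor {
  pfob :> A -> B;
  pfmor : forall x y, phom x y -> phom (pfob x) (pfob y);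
  pfmor1 : forall x, pfmor (pid x) = pid (pfob x);
  pfmorM : forall x y z (g : phom y z) (f : phom x y),
    pfmor (pcmp g f) = pcmp (pfmor g) (pfmor f);
  pfmorD : forall x y (f f' : phom x y), pfmor (f + f') = pfmor f + pfmor f' }.

Lemma pfunctor_eq (A B : preadd) (o : A -> B)
    (m m' : forall x y, phom x y -> phom (o x) (o y)) h1 h2 h3 h1' h2' h3' :
  m = m' -> @Pfunctor A B o m h1 h2 h3 = @Pfunctor A B o m' h1' h2' h3'.
Proof. by move=> e; subst m'; f_equal; apply: proof_irrelevance. Qed.

Definition pfunctor_id (A : preadd) : pfunctor A A :=
  @Pfunctor A A (fun x => x) (fun _ _ f => f) (fun _ => erefl)
    (fun _ _ _ _ _ => erefl) (fun _ _ _ _ => erefl).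

Definition pfunctor_comp (A B C : preadd) (F : pfunctor B C) (H : pfunctor A B) :
  pfunctor A C.
Proof.
refine (@Pfunctor A C (fun x => F (H x)) (fun _ _ f => pfmor F (pfmor H f)) _ _ _).
- by move=> x; rewrite !pfmor1.
- by move=> x y z g f; rewrite !pfmorM.
- by move=> x y f f'; rewrite !pfmorD.
Defined.

Record mpreadd := Mpreadd {
  mp :> preadd;
  marked : forall x y : mp, phom x y -> Prop;
  marked_iso : forall x y (f : phom x y), marked f -> p_iso f;
  marked_id : forall x : mp, marked (pid x);
  marked_cmp : forall x y z (g : phom y z) (f : phom x y),
    marked g -> marked f -> marked (pcmp g f);
  marked_inv : forall x y (f : phom x y) (g : phom y x),
    marked f -> p_inverse f g -> marked g }.

Record mpfunctor (A B : mpreadd) := Mpfunctor {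
  mpf :> pfunctor A B;
  mpf_marked : forall x y (f : phom x y), marked f -> marked (pfmor mpf f) }.

Lemma mpfunctor_eq (A B : mpreadd) (F H : mpfunctor A B) :
  mpf F = mpf H -> F = H.
Proof.
case: F => F hF; case: H => H hH /= e; subst H.
by f_equal; apply: proof_irrelevance.
Qed.

Definition mpfunctor_id (A : mpreadd) : mpfunctor A A :=
  @Mpfunctor A A (pfunctor_id A) (fun _ _ _ h => h).

Definition mpfunctor_comp (A B C : mpreadd) (F : mpfunctor B C)
    (H : mpfunctor A B) : mpfunctor A C :=
  @Mpfunctor A C (pfunctor_comp F H)
    (fun _ _ _ h => mpf_marked F (mpf_marked H h)).

Definition preAdd : category.
Proof.
refine (@Category preadd pfunctor pfunctor_id pfunctor_comp _ _ _).
- by move=> *; apply: pfunctor_eq.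
- by move=> *; apply: pfunctor_eq.
- by move=> *; apply: pfunctor_eq.
Defined.

Definition preAddplus : category.
Proof.
refine (@Category mpreadd mpfunctor mpfunctor_id mpfunctor_comp _ _ _).
- by move=> *; apply: mpfunctor_eq; apply: pfunctor_eq.
- by move=> *; apply: mpfunctor_eq; apply: pfunctor_eq.
- by move=> *; apply: mpfunctor_eq; apply: pfunctor_eq.
Defined.

Definition nat_iso (A B : preadd) (P : forall x y : B, phom x y -> Prop)
    (F H : pfunctor A B) :=
  exists eta : forall x, phom (F x) (H x),
    (forall x, p_iso (eta x) /\ P _ _ (eta x)) /\
    (forall x y (f : phom x y),
       pcmp (eta y) (pfmor F f) = pcmp (pfmor H f) (eta x)).

Definition preadd_weq (A B : preAdd) (F : hom A B) : Prop :=
  exists H : hom B A,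
    nat_iso (fun _ _ _ => True) (cmp H F) (idm A) /\
    nat_iso (fun _ _ _ => True) (cmp F H) (idm B).

Definition mpreadd_weq (A B : preAddplus) (F : hom A B) : Prop :=
  exists H : hom B A,
    nat_iso (@marked A) (mpf (cmp H F)) (mpf (idm A)) /\
    nat_iso (@marked B) (mpf (cmp F H)) (mpf (idm B)).

(* It is realised as {malg M[S]}, the finitely supported functions S -> M,
   with m (x) s = << m *g s >>; see [tensZ_universal]. *)

Section TensZ.
Variables (M : zmodType) (S : choiceType).

Definition tensZ : zmodType := {malg M[S]}.
Definition tens (m : M) (s : S) : tensZ := << m *g s >>.

Definition tens_lift (P : zmodType) (f : S -> M -> P) (x : tensZ) : P :=
  \sum_(s <- msupp x) f s x@_s.

Section Lift.
Variables (P : zmodType) (f : S -> M -> P).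
Hypothesis fD : forall s, {morph f s : a b / a + b}.

Lemma tens_morph0 (Q : zmodType) (g : Q -> P) :
  {morph g : a b / a + b} -> g 0 = 0.
Proof. by move=> gD; apply: (addIr (g 0)); rewrite -gD !add0r. Qed.

Lemma tens_liftw (d : {fset S}) (x : tensZ) : (msupp x `<=` d)%fset ->
  tens_lift f x = \sum_(s <- d) f s x@_s.
Proof.
move=> le; rewrite /tens_lift (big_fset_incl _ le) // => s _ /mcoeff_outdom ->.
exact: tens_morph0.
Qed.

Lemma tens_liftD : {morph tens_lift f : x y / x + y}.
Proof.
move=> x y; rewrite (tens_liftw (msuppD_le x y)).
rewrite (tens_liftw (fsubsetUl (msupp x) (msupp y))).
rewrite (tens_liftw (fsubsetUr (msupp x) (msupp y))) -big_split /=.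
by apply: eq_bigr => s _; rewrite mcoeffD fD.
Qed.

Lemma tens_liftU m s : tens_lift f (tens m s) = f s m.
Proof.
rewrite (tens_liftw (@msuppU_le _ _ s m)) big_seq_fset1.
by rewrite mcoeffUU.
Qed.
End Lift.

Lemma tensDl s : {morph tens^~ s : a b / a + b}.
Proof. by move=> a b; rewrite /tens monalgUD. Qed.

Lemma tens_ext (P : zmodType) (g h : tensZ -> P) :
  {morph g : x y / x + y} -> {morph h : x y / x + y} ->
  (forall m s, g (tens m s) = h (tens m s)) -> g =1 h.
Proof.
move=> gD hD e x; rewrite (monalgE x).
rewrite (big_morph g gD (tens_morph0 gD)) (big_morph h hD (tens_morph0 hD)).
by apply: eq_bigr => s _; apply: e.
Qed.

Definition tens_pair (m : M) (z : {malg S}) : tensZ :=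
  \sum_(s <- msupp z) tens (m *~ z@_s) s.
End TensZ.

Lemma tens_pairU (M : zmodType) (S : choiceType) (m : M) (s : S) :
  tens_pair m << s >> = tens m s.
Proof.
rewrite -[LHS]/(@tens_lift int S _ (fun s k => tens (m *~ k) s) _).
rewrite (@tens_liftU int S _ (fun s k => tens (m *~ k) s)) ?mulr1z //.
by move=> t a b; rewrite mulrzDr tensDl.
Qed.

Lemma tensZ_universal (M : zmodType) (S : choiceType) :
  [/\ forall z, {morph (@tens_pair M S)^~ z : a b / a + b},
      forall m, {morph @tens_pair M S m : z z' / z + z'} &
      forall (P : zmodType) (b : M -> {malg S} -> P),
        (forall z, {morph b^~ z : m m' / m + m'}) ->
        (forall m, {morph b m : z z' / z + z'}) ->
        exists! u : tensZ M S -> P,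
          {morph u : x y / x + y} /\ forall m z, u (tens_pair m z) = b m z].
Proof.
have pD m : {morph @tens_pair M S m : z z' / z + z'}.
  move=> z z'.
  rewrite -![tens_pair m _]/(@tens_lift int S _ (fun s k => tens (m *~ k) s) _).
  by rewrite tens_liftD // => s a b; rewrite mulrzDr tensDl.
split=> //.
  move=> z m m'; rewrite /tens_pair -big_split /=; apply: eq_bigr => s _.
  by rewrite mulrzDl tensDl.
move=> P b bDl bDr.
have fD s : {morph (fun m => b m << s >>) : m m' / m + m'} by move=> m m'; apply: bDl.
exists (tens_lift (fun s m => b m << s >>)); split.
  split; first exact: tens_liftD.
  move=> m; apply: (@tens_ext int S).
  - by move=> z z'; rewrite pD tens_liftD.
  - exact: bDr.
  move=> k s; rewrite -[tens k s]/(<< k *g s >>).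
  have -> : (<< k *g s >> : {malg S}) = << s >> *~ k.
    apply/malgP => t; rewrite mcoeffU.
    have -> : (<< s >> *~ k)@_t = (<< s >> : {malg S})@_t *~ k.
      by rewrite -!/(mcoeff t _) raddfMz.
    by rewrite mcoeffU; case: (s == t); rewrite ?mulr1n ?mulr0n ?mul0rz ?intz.
  have mz (Q : zmodType) (g : {malg S} -> Q) : {morph g : x y / x + y} ->
      forall x j, g (x *~ j) = g x *~ j.
    move=> gD x j.
    have gn n : g (x *+ n) = g x *+ n.
      elim: n => [|n IH]; first by rewrite !mulr0n (tens_morph0 gD).
      by rewrite !mulrS gD IH.
    have gN y : g (- y) = - g y.
      by apply: (addIr (g y)); rewrite -gD !addNr (tens_morph0 gD).
    by case: j => n; rewrite /intmul ?gN gn.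
  rewrite (mz _ (b m) (bDr m)).
  rewrite (mz _ (fun z => tens_lift (fun s m => b m << s >>) (tens_pair m z))).
    by rewrite tens_pairU tens_liftU.
  by move=> z z'; rewrite pD tens_liftD.
move=> u [uD uE]; apply: functional_extensionality.
apply: tens_ext => //; first exact: tens_liftD.
by move=> m s; rewrite tens_liftU // -tens_pairU uE.
Qed.

Record sharp_ob (A : preadd) (Gamma : groupoid) := SharpOb {
  sh1 : A;
  sh2 : Gamma }.

Section Sharp.
Variable Gamma : groupoid.

Section Obj.
Variable A : preadd.
Local Notation S := (sharp_ob A Gamma).

Definition sharp_hom (X Y : S) : zmodType :=
  tensZ (phom (sh1 X) (sh1 Y)) (ghom (sh2 X) (sh2 Y)).

Definition sharp_id (X : S) : sharp_hom X X := tens (pid _) (gid _).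

(* (a (x) g) o (b (x) h) = (a o b) (x) (g o h), extended biadditively;
   see [sharp_cmpU] *)
Definition sharp_cmp (X Y Z : S) (u : sharp_hom Y Z) (v : sharp_hom X Y) :
    sharp_hom X Z :=
  tens_lift (fun g a => tens_lift (fun h b => tens (pcmp a b) (gcmp g h)) v) u.

Section Cmp.
Variables X Y Z : S.

Let inD (g : ghom (sh2 Y) (sh2 Z)) (a : phom (sh1 Y) (sh1 Z))
    (h : ghom (sh2 X) (sh2 Y)) :
  {morph (fun b : phom (sh1 X) (sh1 Y) => tens (pcmp a b) (gcmp g h))
     : b b' / b + b'}.
Proof. by move=> b b'; rewrite pcmpDr tensDl. Qed.

Let outD (v : sharp_hom X Y) (g : ghom (sh2 Y) (sh2 Z)) :
  {morph (fun a : phom (sh1 Y) (sh1 Z) => tens_lift (fun h b =>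
      tens (pcmp a b) (gcmp g h) : sharp_hom X Z) v) : a a' / a + a'}.
Proof.
move=> a a'; rewrite /tens_lift -big_split /=; apply: eq_bigr => h _.
by rewrite pcmpDl tensDl.
Qed.

Lemma sharp_cmpDl (v : sharp_hom X Y) :
  {morph (fun u : sharp_hom Y Z => sharp_cmp u v) : u u' / u + u'}.
Proof. exact: tens_liftD (outD v). Qed.

Lemma sharp_cmpDr (u : sharp_hom Y Z) :
  {morph (fun v : sharp_hom X Y => sharp_cmp u v) : v v' / v + v'}.
Proof.
move=> v v'; rewrite /sharp_cmp /(tens_lift _ u) -big_split /=.
apply: eq_bigr => g _.
exact: (tens_liftD (@inD g (mcoeff g u)) v v').
Qed.

Lemma sharp_cmpU (a : phom (sh1 Y) (sh1 Z)) (g : ghom (sh2 Y) (sh2 Z))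
    (b : phom (sh1 X) (sh1 Y)) (h : ghom (sh2 X) (sh2 Y)) :
  sharp_cmp (tens a g) (tens b h) = tens (pcmp a b) (gcmp g h).
Proof. by rewrite /sharp_cmp tens_liftU // tens_liftU. Qed.
End Cmp.

Lemma sharp_cmpA (W X Y Z : S) (h : sharp_hom Y Z) (g : sharp_hom X Y)
    (f : sharp_hom W X) :
  sharp_cmp h (sharp_cmp g f) = sharp_cmp (sharp_cmp h g) f.
Proof.
move: h; apply: tens_ext => [u u'|u u'|a r]; [exact: sharp_cmpDl| |].
  by rewrite !sharp_cmpDl.
move: g; apply: tens_ext => [u u'|u u'|b s].
- by rewrite sharp_cmpDl sharp_cmpDr.
- by rewrite sharp_cmpDr sharp_cmpDl.
move: f; apply: tens_ext => [u u'|u u'|c t]; last first.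
- by rewrite !sharp_cmpU pcmpA gcmpA.
- exact: sharp_cmpDr.
by rewrite !sharp_cmpDr.
Qed.

Lemma sharp_cmp1m (X Y : S) (f : sharp_hom X Y) :
  sharp_cmp (sharp_id Y) f = f.
Proof.
move: f; apply: tens_ext => [u u'|//|a r]; first exact: sharp_cmpDr.
by rewrite /sharp_id sharp_cmpU pcmp1m gcmp1m.
Qed.

Lemma sharp_cmpm1 (X Y : S) (f : sharp_hom X Y) :
  sharp_cmp f (sharp_id X) = f.
Proof.
move: f; apply: tens_ext => [u u'|//|a r]; first exact: sharp_cmpDl.
by rewrite /sharp_id sharp_cmpU pcmpm1 gcmpm1.
Qed.

Definition sharp : preadd.
Proof.
refine (@Preadd S sharp_hom sharp_id sharp_cmp _ _ _ _ _).
- exact: sharp_cmpA.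
- exact: sharp_cmp1m.
- exact: sharp_cmpm1.
- by move=> X Y Z g g' f; apply: (sharp_cmpDl f).
- by move=> X Y Z g f f'; apply: (sharp_cmpDr g).
Defined.
End Obj.

Section Mor.
Variables (A B : preadd) (F : pfunctor A B).

Definition sharp_fob (X : sharp A) : sharp B := SharpOb (F (sh1 X)) (sh2 X).

Definition sharp_fmor (X Y : sharp A) (u : phom X Y) :
    phom (sharp_fob X) (sharp_fob Y) :=
  tens_lift (fun g a => tens (pfmor F a) g) u.

Let fD (X Y : sharp A) (g : ghom (sh2 X) (sh2 Y)) :
  {morph (fun a : phom (sh1 X) (sh1 Y) => tens (pfmor F a) g) : a a' / a + a'}.
Proof. by move=> a a'; rewrite pfmorD tensDl. Qed.

Lemma sharp_fmorD (X Y : sharp A) : {morph @sharp_fmor X Y : u v / u + v}.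
Proof. exact: tens_liftD (@fD X Y). Qed.

Lemma sharp_fmorU (X Y : sharp A) (a : phom (sh1 X) (sh1 Y))
    (g : ghom (sh2 X) (sh2 Y)) :
  sharp_fmor (tens a g : phom X Y) = tens (pfmor F a) g.
Proof. exact: tens_liftU (@fD X Y) _ _. Qed.

Lemma sharp_fmorM (X Y Z : sharp A) (g : phom Y Z) (f : phom X Y) :
  sharp_fmor (pcmp g f) = pcmp (sharp_fmor g) (sharp_fmor f).
Proof.
move: g; apply: tens_ext => [u u'|u u'|a r].
- by rewrite pcmpDl sharp_fmorD.
- by rewrite sharp_fmorD pcmpDl.
move: f; apply: tens_ext => [u u'|u u'|b s].
- by rewrite pcmpDr sharp_fmorD.
- by rewrite sharp_fmorD pcmpDr.
by rewrite /= sharp_cmpU !sharp_fmorU sharp_cmpU pfmorM.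
Qed.

Definition sharp_map : pfunctor (sharp A) (sharp B).
Proof.
refine (@Pfunctor (sharp A) (sharp B) sharp_fob sharp_fmor _ _ _).
- by move=> X; rewrite sharp_fmorU pfmor1.
- exact: sharp_fmorM.
- exact: sharp_fmorD.
Defined.
End Mor.

Lemma sharp_map_id (A : preadd) :
  sharp_map (pfunctor_id A) = pfunctor_id (sharp A).
Proof.
apply: pfunctor_eq; do 2 (apply: functional_extensionality_dep => ?).
apply: functional_extensionality; apply: tens_ext => //.
  exact: (@sharp_fmorD _ _ (pfunctor_id A)).
by move=> m s; exact: (sharp_fmorU (pfunctor_id A)).
Qed.

Lemma sharp_map_comp (A B C : preadd) (F : pfunctor B C) (H : pfunctor A B) :
  sharp_map (pfunctor_comp F H) = pfunctor_comp (sharp_map F) (sharp_map H).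
Proof.
apply: pfunctor_eq; apply: functional_extensionality_dep => X.
apply: functional_extensionality_dep => Y; apply: functional_extensionality.
apply: tens_ext => [u u'|u u'|m s] /=.
- exact: (@sharp_fmorD _ _ (pfunctor_comp F H)).
- by rewrite !sharp_fmorD.
by rewrite !sharp_fmorU.
Qed.

Definition sharp_functor : functor preAdd preAdd :=
  @Functor preAdd preAdd sharp (@sharp_map) sharp_map_id (@sharp_map_comp).

Definition sharp_marked (A : mpreadd) (X Y : sharp A) (u : phom X Y) : Prop :=
  exists (a : phom (sh1 X) (sh1 Y)) (g : ghom (sh2 X) (sh2 Y)),
    marked a /\ u = tens a g.

Lemma sharp_inverse (A : preadd) (X Y : sharp A) (a : phom (sh1 X) (sh1 Y))
    (b : phom (sh1 Y) (sh1 X)) (g : ghom (sh2 X) (sh2 Y)) :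
  p_inverse a b -> p_inverse (tens a g : phom X Y) (tens b (ginv g)).
Proof.
by case=> ba ab; split; rewrite /= sharp_cmpU ?ba ?ab ?gcmpVm ?gcmpmV.
Qed.

Definition msharp (A : mpreadd) : mpreadd.
Proof.
refine (@Mpreadd (sharp A) (@sharp_marked A) _ _ _ _).
- move=> X Y _ [a [g [ma ->]]]; have [b ab] := marked_iso ma.
  by exists (tens b (ginv g)); apply: sharp_inverse.
- by move=> X; exists (pid _), (gid _); split=> //; apply: marked_id.
- move=> X Y Z _ _ [a [g [ma ->]]] [b [h [mb ->]]].
  by exists (pcmp a b), (gcmp g h); split; [apply: marked_cmp|apply: sharp_cmpU].
- move=> X Y _ v [a [g [ma ->]]] [va av]; have [b ab] := marked_iso ma.
  exists b, (ginv g); split; first exact: marked_inv ma ab.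
  have [ba' ab'] := sharp_inverse g ab.
  by rewrite -[v]pcmpm1 -ab' pcmpA va pcmp1m.
Defined.

Definition msharp_map (A B : mpreadd) (F : mpfunctor A B) :
  mpfunctor (msharp A) (msharp B).
Proof.
refine (@Mpfunctor (msharp A) (msharp B) (sharp_map F) _).
move=> X Y _ [a [g [ma ->]]]; exists (pfmor F a), g.
by split; [apply: mpf_marked|apply: sharp_fmorU].
Defined.

Lemma msharp_map_id (A : mpreadd) :
  msharp_map (mpfunctor_id A) = mpfunctor_id (msharp A).
Proof. by apply: mpfunctor_eq; apply: sharp_map_id. Qed.

Lemma msharp_map_comp (A B C : mpreadd) (F : mpfunctor B C)
    (H : mpfunctor A B) :
  msharp_map (mpfunctor_comp F H) =
  mpfunctor_comp (msharp_map F) (msharp_map H).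
Proof. by apply: mpfunctor_eq; apply: sharp_map_comp. Qed.

Definition msharp_functor : functor preAddplus preAddplus :=
  @Functor preAddplus preAddplus msharp (@msharp_map) msharp_map_id
    (@msharp_map_comp).
End Sharp.
End PreAdditive.

Record delta (m n : nat) := Delta {
  dfun :> 'I_m.+1 -> 'I_n.+1;
  dmono : forall i j : 'I_m.+1, i <= j -> dfun i <= dfun j }.

Definition did n : delta n n := @Delta n n id (fun _ _ => id).

Definition dcomp k m n (f : delta m n) (g : delta k m) : delta k n :=
  @Delta k n (fun i => f (g i)) (fun _ _ h => dmono f (dmono g h)).

Definition dconst m n (i : 'I_n.+1) : delta m n :=
  @Delta m n (fun _ => i) (fun _ _ _ => leqnn i).

Lemma delta_eq m n (f g : delta m n) : (forall i, f i = g i) -> f = g.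
Proof.
case: f => f hf; case: g => g hg /= e.
have E : f = g by apply: functional_extensionality.
by subst g; f_equal; apply: proof_irrelevance.
Qed.

Lemma dcomp_const k m n (f : delta m n) (i : 'I_m.+1) :
  dcomp f (dconst k i) = dconst k (f i).
Proof. exact: delta_eq. Qed.

Lemma dconst_comp k m n (f : delta k m) (i : 'I_n.+1) :
  dcomp (dconst m i) f = dconst k i.
Proof. exact: delta_eq. Qed.

Definition dedge n (i j : 'I_n.+1) (le : i <= j) : delta 1 n.
Proof.
refine (@Delta 1 n (fun k => if k == ord0 then i else j) _).
by case=> [[|[|k]] hk] [[|[|l]] hl].
Defined.

Record sset := SSet {
  simp :> nat -> Type;
  act : forall m n, delta m n -> simp n -> simp m;
  act1 : forall n (x : simp n), act (did n) x = x;
  actM : forall k m n (f : delta m n) (g : delta k m) (x : simp n),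
    act (dcomp f g) x = act g (act f x) }.

Record smap (X Y : sset) := Smap {
  sfun :> forall n, X n -> Y n;
  smapP : forall m n (f : delta m n) (x : X n),
    sfun (act f x) = act f (sfun x) }.

Lemma smap_eq (X Y : sset) (f g : smap X Y) :
  (forall n x, f n x = g n x) -> f = g.
Proof.
case: f => f hf; case: g => g hg /= e.
have E : f = g.
  apply: functional_extensionality_dep => n.
  by apply: functional_extensionality => x; apply: e.
by subst g; f_equal; apply: proof_irrelevance.
Qed.

Definition sid (X : sset) : smap X X :=
  @Smap X X (fun _ x => x) (fun _ _ _ _ => erefl).

Definition scomp (X Y Z : sset) (g : smap Y Z) (f : smap X Y) : smap X Z.
Proof.
refine (@Smap X Z (fun n x => g n (f n x)) _).
by move=> m n h x; rewrite !smapP.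
Defined.

Definition sprod (X Y : sset) : sset.
Proof.
refine (@SSet (fun n => (X n * Y n)%type)
  (fun _ _ f x => (act f x.1, act f x.2)) _ _).
- by move=> n [x y] /=; rewrite !act1.
- by move=> k m n f g [x y] /=; rewrite !actM.
Defined.

Definition simplex (n : nat) : sset :=
  @SSet (fun m => delta m n) (fun _ _ g f => dcomp f g)
    (fun _ _ => erefl) (fun _ _ _ _ _ _ => erefl).

Definition ssub (X : sset) (P : forall n, X n -> Prop)
    (PC : forall m n (f : delta m n) (x : X n), P n x -> P m (act f x)) : sset.
Proof.
refine (@SSet (fun n => {x : X n | P n x})
  (fun _ _ f x => exist _ (act f (sval x)) (PC _ _ f _ (svalP x))) _ _).
- move=> n [x Px]; apply: eq_sig_hprop => /=; last exact: act1.
  by move=> *; apply: proof_irrelevance.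
- move=> k m n f g [x Px]; apply: eq_sig_hprop => /=; last exact: actM.
  by move=> *; apply: proof_irrelevance.
Defined.

Definition full_ssub (X : sset) (P : X 0 -> Prop) : sset.
Proof.
refine (@ssub X (fun n x => forall i, P (act (dconst 0 i) x)) _).
by move=> m n f x Px i; rewrite -actM dcomp_const; apply: Px.
Defined.

Definition sprod_dmap (X : sset) m n (f : delta m n) :
  smap (sprod X (simplex m)) (sprod X (simplex n)) :=
  @Smap (sprod X (simplex m)) (sprod X (simplex n))
    (fun _ x => (x.1, dcomp f x.2)) (fun _ _ _ _ => erefl).

Definition sFun (X Y : sset) : sset.
Proof.
refine (@SSet (fun n => smap (sprod X (simplex n)) Y)
  (fun _ _ f s => scomp s (sprod_dmap X f)) _ _).
- by move=> n s; apply: smap_eq => m [].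
- by move=> k m n f g s; apply: smap_eq.
Defined.

Definition sFun_vertex (X Y : sset) (f : smap X Y) : sFun X Y 0 :=
  @Smap (sprod X (simplex 0)) Y (fun n x => f n x.1)
    (fun _ _ g x => smapP f g x.1).

Definition precomp_simp (X Y Z : sset) (f : smap X Y) n (s : sFun Y Z n) :
  sFun X Z n.
Proof.
refine (@Smap (sprod X (simplex n)) Z (fun m x => s m (f m x.1, x.2)) _).
by move=> m k g x; rewrite -(smapP s) /= (smapP f).
Defined.

Definition precomp (X Y Z : sset) (f : smap X Y) :
  smap (sFun Y Z) (sFun X Z).
Proof.
refine (@Smap (sFun Y Z) (sFun X Z) (precomp_simp f) _).
by move=> m n g s; apply: smap_eq.
Defined.

Definition postcomp (K X Y : sset) (f : smap X Y) :
  smap (sFun K X) (sFun K Y).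
Proof.
refine (@Smap (sFun K X) (sFun K Y) (fun n s => scomp f s) _).
by move=> m n g s; apply: smap_eq.
Defined.

Definition const_diagram_simp (K X : sset) n (x : X n) : sFun K X n.
Proof.
refine (@Smap (sprod K (simplex n)) X (fun m kf => act kf.2 x) _).
by move=> m k g kf; apply: actM.
Defined.

(* Since nerve (Fun(J, C)) = Fun(nerve J, nerve C), for nerves this is the
   functor C -> Fun(J, C) sending an object to the constant functor on it. *)
Definition const_diagram (K X : sset) : smap X (sFun K X).
Proof.
refine (@Smap X (sFun K X) (@const_diagram_simp K X) _).
by move=> m n g x; apply: smap_eq => k kf /=; rewrite actM.
Defined.

Definition boundary (n : nat) : sset.
Proof.
refine (@ssub (simplex n)
  (fun m (f : delta m n) => exists i, forall j, f j <> i) _).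
by move=> k m g f [i hi]; exists i => j; apply: hi.
Defined.

Definition horn (n : nat) (k : 'I_n.+1) : sset.
Proof.
refine (@ssub (simplex n)
  (fun m (f : delta m n) => exists i, i <> k /\ forall j, f j <> i) _).
by move=> l m g f [i [ik hi]]; exists i; split=> // j; apply: hi.
Defined.

(* By Yoneda, a map Delta^n -> X is an n-simplex of X. *)
Definition quasicategory (X : sset) : Prop :=
  forall n (k : 'I_n.+1), 0 < k < n -> forall h : smap (horn k) X,
    exists x : X n, forall m (f : horn k m), act (sval f) x = h m f.

Definition source (X : sset) (e : X 1) : X 0 := act (dconst 0 ord0) e.
Definition target (X : sset) (e : X 1) : X 0 := act (dconst 0 ord_max) e.
Definition degenerate (X : sset) n (x : X 0) : X n := act (dconst n ord0) x.

Definition d01 : delta 1 2 := @dedge 2 ord0 (@Ordinal 3 1 isT) isT.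
Definition d12 : delta 1 2 := @dedge 2 (@Ordinal 3 1 isT) ord_max isT.
Definition d02 : delta 1 2 := @dedge 2 ord0 ord_max isT.

Definition composite (X : sset) (s : X 2) (f g e : X 1) : Prop :=
  [/\ act d01 s = f, act d12 s = g & act d02 s = e].

Definition is_equivalence (X : sset) (f : X 1) : Prop :=
  exists (g : X 1) (s t : X 2),
    composite s f g (degenerate 1 (source f)) /\
    composite t g f (degenerate 1 (target f)).

Definition naturally_equivalent (X Y : sset) (f g : smap X Y) : Prop :=
  exists e : sFun X Y 1,
    [/\ is_equivalence e, source e = sFun_vertex f & target e = sFun_vertex g].

Definition categorical_equivalence (X Y : sset) (f : smap X Y) : Prop :=
  exists g : smap Y X,
    naturally_equivalent (scomp g f) (sid X) /\
    naturally_equivalent (scomp f g) (sid Y).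

Definition sFun_inverting (X : sset) (W : X 1 -> Prop) (D : sset) : sset :=
  @full_ssub (sFun X D) (fun F : smap (sprod X (simplex 0)) D =>
    forall e : X 1, W e -> is_equivalence (F 1 (e, dconst 1 ord0))).

(* ell : X -> L exhibits L as the localization X[W^-1]: for every
   quasi-category D, restriction along ell is an equivalence from Fun(L, D) to
   the functors X -> D inverting W.  The factorization R is unique, and D = L
   shows that ell itself inverts W. *)
Definition is_localization (X : sset) (W : X 1 -> Prop) (L : sset)
    (ell : smap X L) : Prop :=
  quasicategory L /\
  forall D : sset, quasicategory D ->
    exists R : smap (sFun L D) (sFun_inverting W D),
      (forall n (F : sFun L D n), sval (R n F) = precomp D ell n F) /\
      categorical_equivalence R.

(* The comma construction p / c for a map c : L -> Q and a vertex p of Q: its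
   n-simplices are pairs of an n-simplex x of L and a transformation
   Delta^1 x Delta^n -> Q from the constant map p to c(x).  For c the constant
   diagram map L -> Fun(K, L) this is the (fat) slice of cocones under p. *)
Section Comma.
Variables (L Q : sset) (c : smap L Q) (p : Q 0).

Record comma_simp (n : nat) := CommaSimp {
  apex : L n;
  leg : smap (sprod (simplex 1) (simplex n)) Q;
  leg0 : forall m (f : delta m n),
    leg m (dconst m ord0, f) = degenerate m p;
  leg1 : forall m (f : delta m n),
    leg m (dconst m ord_max, f) = act f (c n apex) }.

Lemma comma_eq n (x y : comma_simp n) :
  apex x = apex y -> leg x = leg y -> x = y.
Proof.
case: x => x h h0 h1; case: y => y k k0 k1 /= exy ehk; subst y k.
by f_equal; apply: proof_irrelevance.
Qed.

Definition comma_act m n (f : delta m n) (x : comma_simp n) : comma_simp m.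
Proof.
refine (@CommaSimp m (act f (apex x)) (scomp (leg x) (sprod_dmap _ f)) _ _).
- by move=> k g; apply: leg0.
- by move=> k g; rewrite smapP -actM; apply: leg1.
Defined.

Definition comma : sset.
Proof.
refine (@SSet comma_simp comma_act _ _).
- by move=> n x; apply: comma_eq; [apply: act1|apply: smap_eq => k []].
- by move=> k m n f g x; apply: comma_eq; [apply: actM|apply: smap_eq => j []].
Defined.
End Comma.

(* Joyal's definition of an initial object of a quasi-category: every map from
   the boundary of an (n+1)-simplex with initial vertex x extends. *)
Definition is_initial (X : sset) (x : X 0) : Prop :=
  forall n (b : smap (boundary n.+1) X),
    (forall v : boundary n.+1 0, sval v = dconst 0 ord0 -> b 0 v = x) ->
    exists y : X n.+1, forall m (f : boundary n.+1 m), act (sval f) y = b m f.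

Definition is_colimit_cocone (K L : sset) (p : sFun K L 0) (x : L 0)
    (alpha : smap (simplex 1) (sFun K L)) : Prop :=
  exists y : comma (const_diagram K L) p 0,
    [/\ apex y = x, forall m (t : delta m 1) f, leg y m (t, f) = alpha m t &
        is_initial y].

Definition at_vertex (I Q : sset) (T : smap (sprod I (simplex 1)) Q) (i : I 0) :
  smap (simplex 1) Q.
Proof.
refine (@Smap (simplex 1) Q (fun m t => T m (degenerate m i, t)) _).
by move=> m n f t; rewrite -smapP /= -actM.
Defined.

(* "colim_K D(i) = F(i), naturally in i": there is a natural transformation T
   from D to the constant diagrams on F which, at every object i of I, is a
   colimit cocone of D(i) with apex F(i). *)
Definition natural_colimit (I K L : sset) (D : smap I (sFun K L))
    (F : smap I L) : Prop :=
  exists T : smap (sprod I (simplex 1)) (sFun K L),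
    [/\ forall n (s : I n), T n (s, dconst n ord0) = D n s,
        forall n (s : I n),
          T n (s, dconst n ord_max) = const_diagram K L n (F n s) &
        forall i : I 0, is_colimit_cocone (D 0 i) (F 0 i) (at_vertex T i)].

Record nerve_simp (C : category) (n : nat) := NerveSimp {
  nob : 'I_n.+1 -> C;
  nmor : forall i j : 'I_n.+1, i <= j -> hom (nob i) (nob j);
  nmor1 : forall (i : 'I_n.+1) (h : i <= i), nmor h = idm (nob i);
  nmorM : forall (i j k : 'I_n.+1) (hij : i <= j) (hjk : j <= k) (hik : i <= k),
    nmor hik = cmp (nmor hjk) (nmor hij) }.

Definition nerve_act (C : category) m n (f : delta m n) (x : nerve_simp C n) :
    nerve_simp C m :=
  @NerveSimp C m (fun i => nob x (f i)) (fun _ _ h => nmor x (dmono f h))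
    (fun _ _ => nmor1 x _) (fun _ _ _ _ _ _ => nmorM x _ _ _).

Definition nerve (C : category) : sset :=
  @SSet (nerve_simp C) (@nerve_act C) (fun _ _ => erefl)
    (fun _ _ _ _ _ _ => erefl).

Definition nerve_map_simp (C D : category) (F : functor C D) n
    (x : nerve_simp C n) : nerve_simp D n.
Proof.
refine (@NerveSimp D n (fun i => fob F (nob x i))
  (fun _ _ h => fmor F (nmor x h)) _ _).
- by move=> i h; rewrite nmor1 fmor1.
- by move=> i j k hij hjk hik; rewrite (nmorM x hij hjk) fmorM.
Defined.

Definition nerve_map (C D : category) (F : functor C D) :
  smap (nerve C) (nerve D).
Proof.
refine (@Smap (nerve C) (nerve D) (nerve_map_simp F) _).
by move=> m n f x; rewrite /= /nerve_act /nerve_map_simp /=; f_equal;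
   apply: proof_irrelevance.
Defined.

Definition nerve_class (C : category) (W : forall x y : C, hom x y -> Prop)
    (e : nerve C 1) : Prop :=
  W _ _ (@nmor C 1 e ord0 ord_max isT).

(* Main.v *)
(* A mapping-out statement in the localization is checked on a concrete model:
   the simplicial set [D2] of normalized pseudofunctors from the ordinals to the
   (2,1)-category of pre-additive categories, functors and natural isomorphisms.
   [D2] is a quasi-category, the nerve of the category maps to it by [strict],
   and this map inverts the weak equivalences.  Conversely every functor
   inverting them extends along [strict], since a simplex of [D2] can be
   rectified; hence the localization is a retract, up to equivalence, of [D2].
   There the 2-cells of the functors A -> A # BG carry the cocone [Gam], and a
   functor out of A # BG is a functor out of A with a compatible action of G.
   This universal property, in the form that cocones on the boundary of a simplex
   fill (dimensions 1 to 3 being the only ones in which D2 is not coskeletal),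
   gives initiality of the cocone; fillings are transported to the localization
   by the homotopy extension property along natural equivalences. *)

Require Import Defs.
From mathcomp Require Import all_boot zify boolp.
From Stdlib Require Import FunctionalExtensionality ProofIrrelevance StrictProp.

Set Implicit Arguments.
Unset Strict Implicit.
Unset Printing Implicit Defensive.
Set Primitive Projections.

(** Initiality asks for exact fillings, while the localization is only known up to equivalence;
    explicit extension problems bridge this gap. Most of them are solved by one device: a matching
    of the missing nondegenerate simplices, each pair being added by one horn filler. The strict
    replacement of a pseudofunctor does not give back a simplex that is already strict. Hence a
    simplex of [D2] is joined to its replacement by a cylinder, over which the map [s] from [D2] to
    the localization is built cell by cell; its values are controlled on strict simplices only. The
    leg from [A] to [A # BG] is not strict, so [s] of it is not known. This is why [Gam] lives over
    a 2-simplex: its vertex 0 carries [A] times the indiscrete category on [G], with [G]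
    translating. The edges 01 and 02 are strict and 01 is a weak equivalence, so filling an outer
    horn compares [r (s Gam)] with [Gam] on the edge 12. The boolean [b] treats the unmarked case as
    that of maximal markings. *)

Notation dfext := functional_extensionality_dep.
Notation fext := functional_extensionality.
Notation pirr := Prop_irrelevance.

(** * Monotone maps, partial simplicial maps and the attachment of simplices *)

Definition dsurj m n (f : delta m n) := forall i, exists j, f j = i.

Definition dfc n (i : 'I_n.+2) : delta n n.+1.
Proof.
refine (@Delta n n.+1 (lift i) _) => a b ab.
by rewrite /= leq_bump2.
Defined.
Lemma dfN n (i : 'I_n.+2) j : dfc i j <> i.
Proof. by move=> /= e; move: (neq_lift i j); rewrite e eqxx. Qed.

Lemma dfactor m n (f : delta m n.+1) i :
 (forall j, f j <> i) -> exists f' : delta m n, f = dcomp (dfc i) f'.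
Proof.
move=> fi; pose g j := odflt ord0 (unlift i (f j)).
have gE j : lift i (g j) = f j.
rewrite /g; case: unliftP => [j' ->//|e]; by case: (fi j).
have gm (a b : 'I_m.+1) : a <= b -> g a <= g b.
by move=> ab; rewrite -(leq_bump2 i); have := dmono f ab; rewrite -!gE.
exists (Delta gm); apply: delta_eq => j; exact/esym/gE.
Qed.

Lemma dsurjN m n (f : delta m n) : ~ dsurj f -> exists i, forall j, f j <> i.
Proof.
move=> h; apply: contrapT => k; apply: h => i; apply: contrapT => h.
by apply: k; exists i => j e; apply: h; exists j.
Qed.

(** Any choice of preimages is monotone, and the preimage of [f x] may be taken to be [x]; so every
    point lies on a section. *)
Lemma dsection m n (f : delta m n) : dsurj f ->
 forall x, exists s : delta n m, dcomp f s = did n /\ s (f x) = x.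
Proof.
move=> sf x.
have [g gP] := choice sf.
pose s j := if j == f x then x else g j.
have sE j : f (s j) = j by rewrite /s; case: eqP => [->|].
have sm (a b : 'I_n.+1) : a <= b -> s a <= s b.
rewrite leq_eqVlt => /orP[/eqP/val_inj->//|ab].
rewrite leqNgt; apply/negP => /ltnW /(dmono f); rewrite !sE.
by rewrite leqNgt ab.
exists (Delta sm); split; first exact: delta_eq.
by rewrite /= /s eqxx.
Qed.

(** A strictly increasing map grows by at least [d] over [d] steps; counting from the first and from
    the last vertex squeezes [f i] to [i]. *)
Lemma dinj_endo n (f : delta n n) : injective f -> f = did n.
Proof.
move=> inj.
have st (i j : 'I_n.+1) : i < j -> f i < f j.
move=> ij; rewrite ltn_neqAle (dmono f (ltnW ij)) andbT.
by apply/eqP => /val_inj/inj e; move: ij; rewrite e ltnn.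
have up d (i j : 'I_n.+1) : j = i + d :> nat -> f i + d <= f j.
elim: d j => [|d IH] j e.
by have -> : j = i by [apply: val_inj; rewrite /= e addn0]; rewrite addn0.
have lt : i + d < n.+1 by have := ltn_ord j; lia.
have := IH (Ordinal lt) erefl; have := st (Ordinal lt) j.
by rewrite /=; lia.
apply: delta_eq => i; apply: val_inj => /=.
have := up (n - i) i ord_max; have := up i ord0 i.
by have := ltn_ord (f ord_max); have := ltn_ord i => /=; lia.
Qed.

Lemma dsurj_endo n (f : delta n n) : dsurj f -> f = did n.
Proof.
move=> sf; have [s [fs _]] := dsection sf ord0.
have fsE i : f (s i) = i by move: (f_equal (fun h : delta n n => h i) fs).
have si : injective s by move=> a b e; rewrite -(fsE a) e fsE.
by apply: delta_eq => i; rewrite -{2}(fsE i) (dinj_endo si).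
Qed.

Lemma dsurj_leq m n (f : delta m n) : dsurj f -> n <= m.
Proof.
move=> sf; have [s [fs _]] := dsection sf ord0.
have fsE i : f (s i) = i by move: (f_equal (fun h : delta n n => h i) fs).
have si : injective s by move=> a b e; rewrite -(fsE a) e fsE.
by have := leq_card _ si; rewrite !card_ord.
Qed.

(** The uniqueness half of Eilenberg-Zilber: a monotone surjection is determined by its sections,
    since each point lies on one of them. *)
Lemma dsurj_eq k m n (f g : delta m n) : k = n -> dsurj f ->
 (forall s : delta n m, dcomp f s = did n -> dcomp g s = did n) -> f = g.
Proof.
move=> _ sf h; apply: delta_eq => x; have [s [fs e]] := dsection sf x.
have := f_equal (fun u : delta n n => u (f x)) (h s fs).
by rewrite /= e.
Qed.

(** A map defined on a subcomplex of [V], encoded as a functional relation: the domain needs no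
    subobject type, and compatible pieces or chains are glued by taking unions of relations. *)
Record partmap (V X : sset) := Partmap {
 prel :> forall n, V n -> X n -> Prop;
 prel_act : forall m n (f : delta m n) x y,
  prel x y -> prel (act f x) (act f y);
 prel_fun : forall n (x : V n) y y', prel x y -> prel x y' -> y = y' }.

Definition pdom (V X : sset) (G : partmap V X) n (x : V n) := exists y, G n x y.
Definition pext (V X : sset) (G G' : partmap V X) :=
 forall n x y, G n x y -> G' n x y.

Lemma pdom_act (V X : sset) (G : partmap V X) m n (f : delta m n) (x : V n) :
 pdom G x -> pdom G (act f x).
Proof. by case=> y /(prel_act f) h; exists (act f y). Qed.

(** The values on all [act f z] are forced. The first hypothesis makes them agree with [G]; the
    second says that simplices of [z] outside the domain are free, so that the value does not depend
    on the chosen [f]. *)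
Lemma attach (V X : sset) (G : partmap V X) n (z : V n) (w : X n) :
 (forall m (f : delta m n) y, G m (act f z) y -> y = act f w) ->
 (forall m (f g : delta m n), act f z = act g z -> ~ pdom G (act f z) -> f = g) ->
 exists G' : partmap V X, [/\ pext G G', G' n z w &
  forall m x y, G' m x y -> G m x y \/ exists f, x = act f z /\ y = act f w].
Proof.
move=> A B.
pose R m x y := G m x y \/ exists f, x = act f z /\ y = act f w.
have Ra m k (f : delta m k) x y : R k x y -> R m (act f x) (act f y).
case=> [h|[g [-> ->]]]; first by left; apply: prel_act.
by right; exists (dcomp g f); rewrite -!actM.
have Rf k (x : V k) y y' : R k x y -> R k x y' -> y = y'.
case=> [h|[g [-> ->]]] [h'|[g' [e' ->]]].
- exact: prel_fun h h'.
- by move: h; rewrite e' => /A.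
- by move: h' => /A.
have [d|nd] := pselect (pdom G (act g z)); last by rewrite (B _ _ _ e' nd).
by case: d => u hu; rewrite -(A _ _ _ hu); apply: A; rewrite -e'.
exists (Partmap Ra Rf); split=> //.
- by move=> m x y h; left.
- by right; exists (did n); rewrite !act1.
Qed.

(** Once the boundary is defined, the simplices of [z] outside the domain come from surjections, and
    these are compared by their sections. *)
Lemma attach_cell (V X : sset) (G : partmap V X) n (z : V n) (w : X n) :
 ~ pdom G z ->
 (forall m (f : delta m n), ~ dsurj f -> G m (act f z) (act f w)) ->
 exists G' : partmap V X, [/\ pext G G', G' n z w &
  forall m x y, G' m x y -> G m x y \/ exists f, x = act f z /\ y = act f w].
Proof.
move=> nz h; have sj m (f : delta m n) : ~ pdom G (act f z) -> dsurj f.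
by move=> nd; apply: contrapT => /h; exact: (fun k => nd (ex_intro _ _ k)).
have nd m (f : delta m n) : dsurj f -> ~ pdom G (act f z).
move=> /dsection/(_ ord0)[s [fs _]] d; apply: nz.
by rewrite -(act1 z) -fs actM; apply: pdom_act.
apply: attach => m f.
move=> y hy; have [/nd[]|/h h'] := pselect (dsurj f); first by exists y.
exact: prel_fun hy h'.
move=> g e d; apply: (@dsurj_eq n) => //; first exact: sj.
move=> s fs; apply: dsurj_endo; apply: sj.
by rewrite actM -e -actM fs act1.
Qed.

(** Two simplices enter at once, [z] and its face opposite [k]. Freeness now also has to exclude
    that [z] is a degeneracy of that face. *)
Lemma attach_horn (V X : sset) (G : partmap V X) n (z : V n.+1) (w : X n.+1)
  (k : 'I_n.+2) :
 ~ pdom G (act (dfc k) z) ->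
 (forall i, i <> k -> G n (act (dfc i) z) (act (dfc i) w)) ->
 exists G' : partmap V X, [/\ pext G G', G' n.+1 z w &
  forall m x y, G' m x y -> G m x y \/
    exists f : delta m n.+1, [/\ x = act f z, y = act f w & ~ pdom G x]].
Proof.
move=> nk h.
have nz : ~ pdom G z by move=> /(pdom_act (dfc k)).
have fac m (f : delta m n.+1) i : i <> k -> (forall j, f j <> i) ->
G m (act f z) (act f w).
move=> ik /dfactor[f' ->]; rewrite !actM; apply: prel_act; exact: h.
have low m (f : delta m n) : ~ dsurj f -> pdom G (act f (act (dfc k) z)).
move=> /dsurjN[i fi]; rewrite -actM; exists (act (dcomp (dfc k) f) w).
apply: (fac _ _ (dfc k i)); first exact: dfN.
by move=> j /= /lift_inj e; apply: (fi j).
(* If [z] is the degeneracy along [u] of its [k]-th face, then [u] identifies two vertices, one of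
   which, [i], differs from [k]. Then [u] after the [i]-th face map is the identity, so the faces of
   [z] at [i] and at [k] coincide, although only the former is in the domain. *)
have bad (u : delta n.+1 n) : z <> act u (act (dfc k) z).
move=> e; have su : dsurj u.
by apply: contrapT => /low; rewrite -e.
have [x [y [xy uxy]]] : exists x y, x <> y /\ u x = u y.
apply: contrapT => ne.
have /leq_card : injective u.
by move=> x y e'; apply: contrapT => xy; apply: ne; exists x, y.
by rewrite !card_ord ltnn.
have [i [j [ij ik uij]]] : exists i j, [/\ i <> j, i <> k & u i = u j].
have [xk|xk] := eqVneq x k; last by exists x, y; split=> //; apply/eqP.
by exists y, x; split=> // [e'|e']; apply: xy; rewrite ?e' ?xk.
have si : dsurj (dcomp u (dfc i)).
move=> a; have [b <-] := su a; have [->|bi] := eqVneq b i.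
rewrite uij; have /unlift_some[j' e' _] : i != j by apply/eqP.
by exists j'; rewrite /= -e'.
have /unlift_some[b' e' _] : i != b by rewrite eq_sym.
by exists b'; rewrite /= -e'.
have := h i ik; rewrite [X in act _ X]e -actM (dsurj_endo si) act1 => hi.
by apply: nk; exists (act (dfc i) w).
have cls m (f : delta m n.+1) : ~ pdom G (act f z) ->
dsurj f \/ exists2 f' : delta m n, f = dcomp (dfc k) f' & dsurj f'.
move=> nd; have [|/dsurjN[i fi]] := pselect (dsurj f); first by left.
have [ik|ik] := eqVneq i k; last first.
by case: nd; exists (act f w); apply: (fac _ _ i) => //; apply/eqP.
right; move: fi; rewrite ik => /dfactor[f' fE]; exists f' => //.
by apply: contrapT => /low; rewrite -actM -fE.
have fE m (f g : delta m n.+1) : act f z = act g z -> ~ pdom G (act f z) -> f = g.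
move=> e nd.
have mixed m' (u : delta m' n.+1) (v : delta m' n) : dsurj u ->
act u z <> act v (act (dfc k) z).
move=> /dsection/(_ ord0)[s [us _]] e'; apply: (bad (dcomp v s)).
by rewrite actM -e' -actM us act1.
case: (cls _ _ nd) => [sf|[f' ef sf]]; move: (nd); rewrite {1}e => /cls [sg|[g' eg sg]].
- apply: (@dsurj_eq n.+1) => // s fs; apply: dsurj_endo; apply: contrapT.
move=> ns; have zE : z = act (dcomp g s) z by rewrite actM -e -actM fs act1.
move/dsurjN: ns => [i gi]; have [ik|/eqP ik] := eqVneq i k.
move: gi; rewrite ik => /dfactor[v gE].
by apply: (bad v); rewrite -actM -gE.
by apply: nz; rewrite zE; exists (act (dcomp g s) w); apply: fac gi.
- by case: (mixed _ _ g' sf); rewrite e eg actM.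
- by case: (mixed _ _ f' sg); rewrite -e ef actM.
rewrite ef eg; congr dcomp; apply: (@dsurj_eq n) => // s fs.
apply: dsurj_endo; apply: contrapT => /low; apply: contra_not nk.
rewrite actM -(actM (dfc k)) -eg -e ef actM -actM fs act1; exact: id.
have A m (f : delta m n.+1) y : G m (act f z) y -> y = act f w.
move=> hy; have [i fi] : exists i, forall j, f j <> i.
apply: dsurjN => /dsection/(_ ord0)[s [us _]]; apply: nz.
by rewrite -(act1 z) -us actM; apply: pdom_act; exists y.
have [ik|/eqP ik] := eqVneq i k; last exact: prel_fun hy (fac _ _ _ ik fi).
move: fi; rewrite ik => /dfactor[f' fE'].
have hy' : G m (act f' (act (dfc k) z)) y by rewrite -actM -fE'.
have [/dsection/(_ ord0)[s [us _]]|/dsurjN[j f'j]] := pselect (dsurj f').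
by case: nk; rewrite -(act1 (act _ z)) -us actM; apply: pdom_act; exists y.
apply: (prel_fun hy); apply: (fac _ _ (dfc k j)); first exact: dfN.
by move=> a; rewrite fE' /= => /lift_inj e'; apply: (f'j a).
have [G' [e1 e2 e3]] := attach A fE.
exists G'; split=> // m x y /e3 [|[f [xE yE]]]; first by left.
have [[u hu]|nd] := pselect (pdom G x); last by right; exists f.
by left; move: (hu); rewrite {1}xE => /A uE; rewrite yE -uE.
Qed.

(* Bourbaki-Witt: unlike the Zorn lemma of mathcomp-classical, this version has
  no upper bound on the universe of T. *)
Section BourbakiWitt.
Variables (T : Type) (le : T -> T -> Prop) (sup : (T -> Prop) -> T) (s : T -> T).
Hypotheses (le_refl : forall x, le x x)
 (le_trans : forall y x z, le x y -> le y z -> le x z)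
 (le_anti : forall x y, le x y -> le y x -> x = y)
 (le_s : forall x, le x (s x)).

Let chain (A : T -> Prop) := forall x y, A x -> A y -> le x y \/ le y x.

Hypotheses (sup_ub : forall A x, chain A -> A x -> le x (sup A))
 (sup_least : forall (A : T -> Prop) y, chain A -> (exists x, A x) ->
 (forall x, A x -> le x y) -> le (sup A) y).

Inductive tower : T -> Prop :=
| tower_s x : tower x -> tower (s x)
| tower_sup A x : chain A -> A x -> (forall x, A x -> tower x) -> tower (sup A)
| tower_bot : tower (sup (fun _ => False)).

Hypothesis sup_bot : forall x, le (sup (fun _ => False)) x.

Let extreme c := forall x, tower x -> le x c -> x <> c -> le (s x) c.

Let extreme_cmp c : extreme c -> forall x, tower x -> le x c \/ le (s c) x.
Proof.
move=> ec x; elim=> {x} [x tx [xc|cx]|A a cA Aa tA IH|].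
- have [->|ne] := pselect (x = c); first by right.
by left; apply: ec.
- by right; apply: le_trans cx (le_s _).
- have [[b [Ab cb]]|ne] := pselect (exists b, A b /\ le (s c) b).
by right; apply: le_trans cb (sup_ub _ _).
left; apply: sup_least => //; first by exists a.
by move=> b Ab; case: (IH _ Ab) => // cb; case: ne; exists b.
by left.
Qed.

Let tower_extreme c : tower c -> extreme c.
Proof.
elim=> {c} [c tc ec|A a cA Aa tA IH|] x tx xc ne.
- case: (extreme_cmp ec tx) => [xc'|cx]; last by case: ne; apply: le_anti.
have [->//|ne'] := pselect (x = c).
exact: le_trans (ec _ tx xc' ne') (le_s _).
- have [[b [Ab bx]]|al] := pselect (exists b, A b /\ ~ le b x).
case: (extreme_cmp (IH _ Ab) tx) => [xb|sb]; last first.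
by case: bx; apply: le_trans (le_s _) sb.
have [e|ne'] := pselect (x = b); first by case: bx; rewrite e.
exact: le_trans (IH _ Ab _ tx xb ne') (sup_ub _ _).
case: ne; apply: le_anti => //; apply: sup_least => //; first by exists a.
by move=> b Ab; apply: contrapT => nb; apply: al; exists b.
by case: ne; apply: le_anti.
Qed.

(** The tower generated by [s] and by suprema of chains is itself a chain; its supremum belongs to
    it and so is fixed by [s]. *)
Lemma bourbaki_witt : exists x, s x = x.
Proof.
have cT : chain tower.
move=> x y tx ty; case: (extreme_cmp (tower_extreme ty) tx) => [|h]; first by left.
by right; apply: le_trans (le_s _) h.
have tt : tower (sup tower) by apply: tower_sup tower_bot _.
by exists (sup tower); apply: le_anti; [apply: sup_ub cT (tower_s tt)|apply: le_s].
Qed.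
End BourbakiWitt.

(** * Transfinite extension of partial maps *)

Lemma partmap_eq (V X : sset) (G G' : partmap V X) : pext G G' -> pext G' G -> G = G'.
Proof.
case: G => R Ra Rf; case: G' => R' Ra' Rf' h h'.
have e : R = R'.
apply: dfext => n.
apply: fext => x; apply: fext => y.
by apply: propext; split; [apply: h|apply: h'].
by subst R'; f_equal; apply: proof_irrelevance.
Qed.

(** [R] constrains the values. [P x z] records that [z] has to be defined as soon as [x] is, so that
    the two members of a matched pair are always added together. *)
Definition pclosed (V X : sset) (R : forall n, V n -> X n -> Prop)
  (P : forall n, V n -> V n.+1 -> Prop) (G : partmap V X) :=
 (forall n x y, G n x y -> R n x y) /\
 (forall n x z, P n x z -> pdom G x -> pdom G z).

(** Closed extensions of [G0] are ordered by inclusion and chains have unions. If each one that is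
    not total can be properly enlarged, a fixed point of a chosen enlargement is total. *)
Lemma extend_total (V X : sset) (R : forall n, V n -> X n -> Prop)
  (P : forall n, V n -> V n.+1 -> Prop) (G0 : partmap V X) :
 pclosed R P G0 ->
 (forall G, pext G0 G -> pclosed R P G ->
   (exists n (x : V n), ~ pdom G x) ->
   exists G' n (x : V n), [/\ pext G G', pclosed R P G', pdom G' x & ~ pdom G x]) ->
 exists h : smap V X, (forall n x y, G0 n x y -> h n x = y) /\
            forall n x, R n x (h n x).
Proof.
move=> c0 prog.
pose T := {G : partmap V X | pext G0 G /\ pclosed R P G}.
pose le (a b : T) := pext (sval a) (sval b).
pose chain (A : T -> Prop) := forall x y, A x -> A y -> le x y \/ le y x.
pose U (A : T -> Prop) n x y := G0 n x y \/ exists2 G : T, A G & sval G n x y.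
have Ua A m n (f : delta m n) x y : U A n x y -> U A m (act f x) (act f y).
by case=> [h|[G AG h]]; [left|right; exists G] => //; apply: prel_act.
have Uf A : chain A -> forall n (x : V n) y y', U A n x y -> U A n x y' -> y = y'.
move=> cA n x y y'; case=> [h|[G AG h]] [h'|[G' AG' h']].
- exact: prel_fun h h'.
- by apply: (prel_fun _ h'); apply: (svalP G').1.
- by apply: (prel_fun h); apply: (svalP G).1.
by case: (cA _ _ AG AG') => le'; [move/le' in h|move/le' in h'];
apply: prel_fun h h'.
have Uc A (cA : chain A) : pext G0 (Partmap (@Ua A) (Uf A cA)) /\
pclosed R P (Partmap (@Ua A) (Uf A cA)).
split; first by move=> n x y h; left.
split=> [n x y|n x z Pxz].
by case=> [|[G AG]]; [apply: c0.1|apply: (svalP G).2.1].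
case=> y [h|[G AG h]].
by have [|u hu] := c0.2 _ _ _ Pxz; [exists y|exists u; left].
have [|u hu] := (svalP G).2.2 _ _ _ Pxz; first by exists y.
by exists u; right; exists G.
have c00 : pext G0 G0 /\ pclosed R P G0 by split.
(* Suprema matter for chains only; any other family gets the junk value [G0]. *)
pose sup A : T := match pselect (chain A) with
| left cA => exist _ _ (Uc A cA) | right _ => exist _ _ c00 end.
have supE A (cA : chain A) n x y : sval (sup A) n x y <-> U A n x y.
by rewrite /sup; case: pselect.
(* The second clause is what makes a fixed point of the chosen step total. *)
pose st t (t' : T) := le t t' /\ (t = t' -> forall n (x : V n), pdom (sval t) x).
have ex t : exists t', st t t'.
have [h|h] := pselect (exists n (x : V n), ~ pdom (sval t) x).
have [G' [n [x [e1 c1 d1 fd2]]]] := prog _ (svalP t).1 (svalP t).2 h.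
have p1 : pext G0 G' by move=> ? ? ? /(svalP t).1/e1.
exists (exist _ G' (conj p1 c1)); split=> // e; case: fd2.
by rewrite e.
exists t; split=> // _ n x; apply: contrapT => nx; apply: h.
by exists n, x.
pose s t := projT1 (cid (ex t)).
have sP t : st t (s t) := projT2 (cid (ex t)).
have cF : chain (fun _ => False) by [].
have [|||||||G fG] := @bourbaki_witt T le sup s.
- by move=> x.
- by move=> y x z xy yz n a b /xy/yz.
- move=> x y xy yx; case: x y xy yx => [G cG] [G' cG'] /= h h'.
have e : G = G' := partmap_eq h h'.
subst G'; f_equal; exact: proof_irrelevance.
- by move=> x; apply: (sP x).1.
- by move=> A x cA Ax n a b h; apply/supE => //; right; exists x.
- move=> A y cA _ h n a b /(supE _ cA)[|[G AG]]; last exact: h.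
exact: (svalP y).1.
- by move=> x n a b /(supE _ cF)[|[]//]; apply: (svalP x).1.
have tG n (x : V n) : pdom (sval G) x by apply: (sP G).2.
pose h n x := projT1 (cid (tG n x)).
have hP n x : sval G n x (h n x) := projT2 (cid (tG n x)).
have ha m n (f : delta m n) x : h m (act f x) = act f (h n x).
by apply: prel_fun (hP _ _) _; apply: prel_act.
exists (Smap ha); split=> n x.
by move=> y /(svalP G).1 hy; apply: prel_fun (hP _ _) hy.
exact: (svalP G).2.1 (hP _ _).
Qed.

(** * Extension along a matching of simplices *)

Definition edge01 n : delta 1 n.+1 := @dedge n.+1 ord0 (@Ordinal n.+2 1 isT) isT.

Definition nondeg (V : sset) n (x : V n) :=
 forall m (f : delta n m) (x' : V m), x = act f x' -> n <= m.

Lemma act_factor (V : sset) m n (f : delta m n) (x : V n) i :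
 (forall j, f j <> i) -> exists l (y : V l) g, l < n /\ act f x = act g y.
Proof.
case: n f x i => [f x i fi|n f x i fi]; first by case: (fi ord0); rewrite !ord1.
have [f' ->] := dfactor fi.
by exists n, (act (dfc i) x), f'; rewrite actM.
Qed.

Lemma nat_min (P : nat -> Prop) :
 (exists n, P n) -> exists n, P n /\ forall m, m < n -> ~ P m.
Proof.
case=> n; elim/ltn_ind: n => n IH Pn.
have [[m [mn Pm]]|h] := pselect (exists m, m < n /\ P m); first exact: IH mn Pm.
by exists n; split=> // m mn Pm; apply: h; exists m.
Qed.

Lemma horn_map (V X : sset) (G : partmap V X) n (z : V n.+1) (k : 'I_n.+2) :
 (forall i, i <> k -> pdom G (act (dfc i) z)) ->
 exists h : smap (horn k) X, forall m (f : horn k m), G m (act (sval f) z) (h m f).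
Proof.
move=> dk.
have df m (f : horn k m) : pdom G (act (sval f) z).
case: f => f [i [ik /dfactor[f' fE]]] /=.
by rewrite fE actM; apply: pdom_act; apply: dk.
pose h m f := projT1 (cid (df m f)).
have hP m f : G m (act (sval f) z) (h m f) := projT2 (cid (df m f)).
have ha m l (g : delta m l) f : h m (act g f) = act g (h l f).
by apply: prel_fun (hP _ _) _; rewrite /= actM; apply: prel_act.
by exists (Smap ha).
Qed.
(** Joyal's special outer horns: the horn at 0, in dimension at least 2, whose first edge is sent to
    an equivalence. *)
Definition special_filling (X : sset) := forall n (h : smap (@horn n.+2 ord0) X) e,
 sval e = edge01 n.+1 -> is_equivalence (h 1 e) ->
 exists x : X n.+2, forall m (f : @horn n.+2 ord0 m), act (sval f) x = h m f.

Lemma special_fill (X : sset) n (k : 'I_n.+2) (h : smap (horn k) X) f1 :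
 special_filling X -> 0 < n -> k = ord0 -> sval f1 = edge01 n ->
 is_equivalence (h 1 f1) ->
 exists x : X n.+1, forall m (f : horn k m), act (sval f) x = h m f.
Proof.
by move=> sX; case: n k h f1 => // n k h f1 _ k0; subst k; apply: sX.
Qed.

Section Pairing.
Variables (V X : sset) (G0 : partmap V X).
(** A matching in the style of regular pairings: [x] is the face of [z] opposite [k], and filling
    the horn of [z] at [k] defines both. The measure [mu] orders the pairs whose smaller members
    have the same dimension. *)
Variable Pair : forall n, V n -> V n.+1 -> 'I_n.+2 -> Prop.
Variable mu : forall n, V n -> nat.
Hypothesis qX : quasicategory X.

Inductive paired : forall n, V n -> Prop :=
| Paired n (y : V n) z k : Pair y z k -> paired z.

Hypotheses (Pair_face : forall n (x : V n) z k, Pair x z k -> act (dfc k) z = x)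
 (Pair_fun : forall n (x : V n) z z' k k',
 Pair x z k -> Pair x z' k' -> z = z')
 (Pair_nd : forall n (x : V n) z k, Pair x z k -> nondeg x)
 (Pair_out : forall n (x : V n) z k, Pair x z k -> ~ pdom G0 x)
 (Pair_disj : forall n (x : V n) z k z' k',
 Pair x z k -> ~ Pair z z' k')
 (step : forall n (x : V n), nondeg x -> ~ pdom G0 x ->
 paired x \/ exists z k, [/\ Pair x z k,
  0 < k < n.+1 \/ [/\ special_filling X, k = ord0, 0 < n & exists e,
    G0 1 (act (edge01 n) z) e /\ is_equivalence e] &
  forall i, i <> k -> [\/ pdom G0 (act (dfc i) z), ~ nondeg (act (dfc i) z),
   paired (act (dfc i) z) | mu (act (dfc i) z) < mu x]]).

(** Take an undefined simplex of least dimension and, in that dimension, of least [mu]. By [step]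
    all other faces of its partner are already defined, so the remaining horn can be filled and the
    partial map grows. *)
Lemma pair_ext : exists h : smap V X, forall n x y, G0 n x y -> h n x = y.
Proof.
pose P n x z := exists k, @Pair n x z k.
have [|G p0 [_ cl] [n0 [x0 nx0]]|h [hE _]] :=
@extend_total V X (fun _ _ _ => True) P G0; last by exists h.
by split=> // n x z [k /Pair_out h] /h.
have [n [[x1 nx1] nmin]] := nat_min (ex_intro (fun n => exists x : V n, ~ pdom G x)
n0 (ex_intro _ x0 nx0)).
have low m (y : V m) : m < n -> pdom G y.
by move=> mn; apply: contrapT => ny; apply: (nmin _ mn); exists y.
have [_ [[x [<- nx]] xmin]] := nat_min (ex_intro
(fun k => exists x : V n, mu x = k /\ ~ pdom G x) (mu x1)
(ex_intro _ x1 (conj erefl nx1))).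
(* The partner of a paired simplex of dimension at most [n] is its face, of dimension below [n],
   where everything is defined; closedness of the domain then gives the simplex itself. *)
have lowp m (y : V m) : m <= n -> paired y -> pdom G y.
move=> mn py; case: py mn => {m y} m y z k Pyz mn.
by apply: (cl _ y) (low _ _ mn); exists k.
have degen m (y : V m) : m <= n -> ~ nondeg y -> pdom G y.
move=> mn nd; apply: contrapT => ny; apply: nd => m' f y' yE.
rewrite leqNgt; apply/negP => lt; apply: ny; rewrite yE; apply: pdom_act.
by apply: low; lia.
have ndx : nondeg x by apply: contrapT => nd; apply: nx; apply: degen nd.
have nx' : ~ pdom G0 x by case=> y /p0 hy; apply: nx; exists y.
case: (step ndx nx') => [/(lowp _ _ (leqnn _))//|[z [k [Pxz fillc faces]]]].
have fd i : i <> k -> pdom G (act (dfc i) z).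
move=> /faces[[y hy]|nd|pd|lt].
- by exists y; apply: p0.
- exact: degen.
- exact: lowp.
by apply: contrapT => ny; apply: (xmin _ lt); exists (act (dfc i) z).
have [h hP] := horn_map fd.
have [w wE] : exists w : X n.+1, forall m (f : horn k m), act (sval f) w = h m f.
case: fillc => [/qX //|[sX k0 n_gt0 [e [Ge eqe]]]].
have hf : exists i, i <> k /\ forall j, edge01 n j <> i.
exists ord_max; split=> [/(f_equal val)|j]; first by rewrite k0.
by rewrite /edge01 /=; case: ifP => _ /(f_equal val) /= [e'] //; rewrite -e' in n_gt0.
pose f1 : horn k 1 := exist _ (edge01 n) hf.
apply: (special_fill sX n_gt0 k0 (f1 := f1)) => //.
by rewrite (prel_fun (hP _ f1) (p0 _ _ _ Ge)).
have wG i : i <> k -> G n (act (dfc i) z) (act (dfc i) w).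
move=> ik; have hf : exists j, j <> k /\ forall l, dfc i l <> j.
by exists i; split=> // l; apply: dfN.
by have := hP _ (exist _ (dfc i) hf); rewrite -wE.
have nk : ~ pdom G (act (dfc k) z) by rewrite (Pair_face Pxz).
have [G' [e1 e2 e3]] := attach_horn nk wG.
exists G', n, x; split=> //; last first.
by exists (act (dfc k) w); rewrite -(Pair_face Pxz); apply: prel_act.
(* Closedness of the enlarged domain: a new simplex that is the smaller member of a pair must be
   [x], because [z] is a larger member and the other new simplices are degenerate. *)
split=> // m y z' [k' Pyz'] [v /e3[hv|[f [yE vE ny]]]].
have [|u /e1 hu] := cl _ _ _ (ex_intro _ k' Pyz'); first by exists v.
by exists u.
have ndy := Pair_nd Pyz'.
have [sf|/dsurjN[i fi]] := pselect (dsurj f).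
have mE : m = n.+1.
by apply/eqP; rewrite eqn_leq (dsurj_leq sf) andbT; apply: ndy yE.
subst m; move: yE; rewrite (dsurj_endo sf) act1 => yE; subst y.
by case: (Pair_disj Pxz Pyz').
have [ik|/eqP ik] := eqVneq i k; last first.
case: ny; rewrite yE; have [f' ->] := dfactor fi.
by rewrite actM; apply: pdom_act; apply: fd.
subst i; have [f' fE] := dfactor fi.
have yE' : y = act f' x by rewrite yE fE actM (Pair_face Pxz).
have mn : m <= n by apply: ndy yE'.
have sf : dsurj f'.
apply: contrapT => /dsurjN[i fi']; apply: ny; rewrite yE'.
have [l [y' [g [ln ->]]]] := act_factor x fi'.
by apply: pdom_act; apply: low.
have mE : m = n by apply/eqP; rewrite eqn_leq mn (dsurj_leq sf).
subst m; move: yE'; rewrite (dsurj_endo sf) act1 => yE'; rewrite yE' in Pyz'.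
by rewrite (Pair_fun Pyz' Pxz); exists w.
Qed.
End Pairing.

Lemma sigE T (P : T -> Prop) (x y : {x | P x}) : sval x = sval y -> x = y.
Proof. by case: x => x p; case: y => y q /= e; subst y; f_equal; apply: pirr. Qed.

Definition pm_sub (X Y : sset) (P : forall n, Y n -> Prop) PC
 (h : smap (@ssub Y P PC) X) : partmap Y X.
Proof.
refine (@Partmap Y X (fun n x y => exists p, h n (exist _ x p) = y) _ _).
- move=> m n f x _ [p <-]; exists (PC _ _ f _ p).
by rewrite -smapP; congr (h m _); apply: sigE.
- by move=> n x y y' [p <-] [p' <-]; rewrite (pirr p p').
Defined.

Definition pm_pre (V W X : sset) (q : smap V W) (G : partmap W X) : partmap V X.
Proof.
refine (@Partmap V X (fun n x y => G n (q n x) y) _ _).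
- by move=> m n f x y; rewrite smapP; apply: prel_act.
- by move=> n x y y'; apply: prel_fun.
Defined.

Definition pm_restr (V X : sset) (G : partmap V X) (P : forall n, V n -> Prop)
 (PC : forall m n (f : delta m n) (x : V n), P n x -> P m (act f x)) : partmap V X.
Proof.
refine (@Partmap V X (fun n x y => P n x /\ G n x y) _ _).
- by move=> m n f x y [p h]; split; [apply: PC|apply: prel_act].
- by move=> n x y y' [_ h] [_]; apply: prel_fun h.
Defined.

Definition pm_union (V X : sset) (G H : partmap V X)
 (c : forall n x y y', G n x y -> H n x y' -> y = y') : partmap V X.
Proof.
refine (@Partmap V X (fun n x y => G n x y \/ H n x y) _ _).
- by move=> m n f x y [h|h]; [left|right]; apply: prel_act.
- move=> n x y y' [h|h] [h'|h'].
+ exact: prel_fun h h'.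
+ exact: c h h'.
+ exact/esym/(c _ _ _ _ h' h).
+ exact: prel_fun h h'.
Defined.

Definition pm_smap (V X : sset) (h : smap V X) : partmap V X.
Proof.
refine (@Partmap V X (fun n x y => h n x = y) _ _).
- by move=> m n f x y <-; rewrite smapP.
- by move=> n x y y' <-.
Defined.

(** * Subcomplexes of a simplex described by sets of vertices *)

Definition dpost m n (p : delta m n) : smap (simplex m) (simplex n) :=
 @Smap (simplex m) (simplex n) (fun _ f => dcomp p f) (fun _ _ _ _ => erefl).

Definition yoneda (X : sset) n (x : X n) : smap (simplex n) X :=
 @Smap (simplex n) X (fun _ f => act f x) (fun _ _ g f => actM f g x).

Definition dins m n (f : delta m n) (v : 'I_m.+2) (i : 'I_n.+1)
 (h1 : forall j : 'I_m.+1, j < v -> f j <= i)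
 (h2 : forall j : 'I_m.+1, v <= j -> i <= f j) : delta m.+1 n.
Proof.
refine (@Delta m.+1 n (fun j => if unlift v j is Some j' then f j' else i) _).
move=> a b ab; case: unliftP => [a' aE|aE]; case: unliftP => [b' bE|bE] //.
- by apply: dmono; rewrite -(leq_bump2 v); move: ab; rewrite aE bE.
- by apply: h1; move: ab; rewrite aE bE /= /bump; lia.
- by apply: h2; move: ab; rewrite aE bE /= /bump; lia.
Defined.
Lemma dins_face m n (f : delta m n) v i h1 h2 :
 dcomp (@dins m n f v i h1 h2) (dfc v) = f.
Proof. by apply: delta_eq => j /=; rewrite liftK. Qed.
Lemma dins_at m n (f : delta m n) v i h1 h2 : @dins m n f v i h1 h2 v = i.
Proof. by rewrite /= unlift_none. Qed.

Definition ddeg n (i : 'I_n.+1) : delta n.+1 n.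
Proof.
refine (@Delta n.+1 n (fun j => inord (if j <= i then j : nat else j.-1)) _).
move=> a b ab; have := ltn_ord a; have := ltn_ord b; have := ltn_ord i.
by move=> *; rewrite !inordK; do ?case: ifP => ?; lia.
Defined.

Lemma dgE n (i : 'I_n.+1) (j : 'I_n.+2) :
 ddeg i j = (if j <= i then j : nat else j.-1) :> nat.
Proof.
by have := ltn_ord j; have := ltn_ord i => *; rewrite inordK //; case: ifP => ?; lia.
Qed.
Lemma dfE n (i : 'I_n.+2) (j : 'I_n.+1) :
 dfc i j = (if j < i then j : nat else j.+1) :> nat.
Proof. by rewrite /= /bump; case: ltnP => _; rewrite ?add1n. Qed.
Lemma deltaP m n (f g : delta m n) : (forall i, f i = g i :> nat) -> f = g.
Proof. by move=> e; apply: delta_eq => i; apply: val_inj; apply: e. Qed.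

Lemma delta_degen m n (f : delta m.+1 n) (a b : 'I_m.+2) :
 a < b -> f a = f b -> exists i, f = dcomp (dcomp f (dfc b)) (ddeg i).
Proof.
move=> ab e; have lt : b.-1 < m.+1 by have := ltn_ord b; lia.
exists (Ordinal lt); apply: delta_eq => j; change (f j = f (dfc b (ddeg (Ordinal lt) j))).
have [jb|jb] := eqVneq j b; last first.
congr (f _); apply: ord_inj; rewrite dfE dgE /=.
have {}jb : j <> b :> nat by move/ord_inj => e'; rewrite e' eqxx in jb.
by case: (leqP j b.-1) => h1; case: ltnP => h2; lia.
rewrite jb; set c := dfc b _.
have cE : c = b.-1 :> nat.
by rewrite /c dfE dgE /=; case: (leqP b b.-1) => h1; case: ltnP => h2; lia.
have ac : a <= c by lia.
have cb : c <= b by lia.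
apply: val_inj; have /= := dmono f ac; have /= := dmono f cb; rewrite e.
by lia.
Qed.

Lemma nondeg_inj (V : sset) m n (f : delta m n) (x : V n) :
 nondeg (act f x) -> injective f.
Proof.
move=> nd a b e; apply: contrapT => ab.
wlog lt : a b e ab / a < b.
move=> w; have [lt|lt|/val_inj//] := ltngtP a b; first exact: w lt.
by apply: (w b a) => // e'; apply: ab.
case: m f a b e ab lt nd => [|m] f a b e ab lt nd.
by case: ab; rewrite (ord1 a) (ord1 b).
have [i fE] := delta_degen lt e.
by have := nd _ (ddeg i) (act (dcomp f (dfc b)) x); rewrite -actM -fE ltnn => /(_ erefl).
Qed.
Definition dim m n (f : delta m n) : {set 'I_n.+1} := [set f j | j : 'I_m.+1].

Lemma dimP m n (f : delta m n) i : reflect (exists j, f j = i) (i \in dim f).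
Proof.
apply: (iffP imsetP) => [[j _ ->]|[j <-]]; first by exists j.
by exists j.
Qed.
Lemma dim_comp k m n (f : delta m n) (g : delta k m) :
 dim (dcomp f g) \subset dim f.
Proof. by apply/fintype.subsetP => i /dimP[j <-]; apply/dimP; exists (g j). Qed.
Lemma inj_leq m n (f : delta m n) : injective f -> m <= n.
Proof. by move=> /leq_card; rewrite !card_ord. Qed.

(** A face without the vertex [i] is matched with the face obtained by inserting [i]. The missing
    sets of vertices are stable under adding and removing [i], and having a vertex on each side of
    [i] makes every horn inner. *)
Lemma toggle (X : sset) N (G : partmap (simplex N) X) (i : 'I_N.+1)
  (U K : {set 'I_N.+1} -> Prop) :
 quasicategory X ->
 (forall m (f : simplex N m), pdom G f <-> U (dim f)) ->
 (forall S, U S -> K S) ->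
 (forall S T : {set 'I_N.+1}, S \subset T -> K T -> K S) ->
 (forall S, K S -> ~ U S -> [/\ K (i |: S), ~ U (S :\ i),
   exists2 a, a \in S & a < i & exists2 b, b \in S & i < b]) ->
 exists G' : partmap (simplex N) X,
  pext G G' /\ forall m (f : simplex N m), pdom G' f <-> K (dim f).
Proof.
move=> qX dG UK Kd tog.
have PC m n (f : delta m n) (x : simplex N n) : K (dim x) -> K (dim (act f x)).
exact: (Kd _ _ (dim_comp x f)).
pose V := ssub PC.
have ia : forall m n (f : delta m n) (x : V n), sval (act f x) = act f (sval x) by [].
pose G0 : partmap V X := pm_pre (@Smap V (simplex N) (fun _ x => sval x) ia) G.
have dG0 n (x : V n) : pdom G0 x <-> U (dim (sval x)) by apply: dG.
pose Pair n (x : V n) (z : V n.+1) (k : 'I_n.+2) :=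
[/\ nondeg x, i \notin dim (sval x), ~ U (dim (sval x)),
act (dfc k) z = x & sval z k = i].
have ndi n (x : V n) : nondeg x -> injective (sval x).
case: x => f Kf nd a b e; apply: contrapT => ab.
wlog lt : a b e ab / a < b.
move=> w; have [lt|lt|/val_inj//] := ltngtP a b; first exact: w lt.
by apply: (w b a) => // e'; apply: ab.
case: n f Kf a b e ab lt nd => [|n] f Kf a b e ab lt nd.
by case: ab; rewrite (ord1 a) (ord1 b).
have [j fE] := delta_degen lt e.
pose x : V n.+1 := exist _ f Kf.
have E : x = act (ddeg j) (act (dfc b) x) by apply: sigE.
by have := nd _ _ _ E; rewrite ltnn.
have ndj n (x : V n) : injective (sval x) -> nondeg x.
move=> inj m f x' xE; apply: (@inj_leq _ _ f) => a b e; apply: inj.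
by rewrite xE /= e.
have typeI n (w : V n) : nondeg w -> ~ U (dim (sval w)) -> i \in dim (sval w) ->
paired Pair w.
case: n w => [|n] w nd nU /dimP[v vE].
have [_ _ [a /dimP[j <-]]] := tog _ (svalP w) nU.
by rewrite -vE (ord1 j) (ord1 v) ltnn.
apply: (@Paired _ _ _ (act (dfc v) w) w v); split=> //.
- by apply: ndj => a b /(ndi _ _ nd)/lift_inj.
- by apply/negP => /dimP[j]; rewrite -vE => /(ndi _ _ nd)/dfN.
have -> : dim (sval (act (dfc v) w)) = dim (sval w) :\ i.
apply/setP => a; apply/dimP/idP => [[j <-]|].
rewrite in_setD1; apply/andP; split; last by apply/dimP; exists (dfc v j).
by apply/eqP; rewrite -vE => /(ndi _ _ nd)/dfN.
rewrite in_setD1 => /andP[ai /dimP[j jE]].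
have jv : v != j by apply: contraNneq ai => ve; rewrite -jE -ve vE.
by have [j' e _] := unlift_some jv; exists j'; rewrite /= -e jE.
by have [] := tog _ (svalP w) nU.
(* The position of [i] in [z] is the number of entries of [x] below [i]; this is why the partner is
   unique. *)
have pos n (x : V n) (z : V n.+1) k : act (dfc k) z = x -> sval z k = i ->
i \notin dim (sval x) -> forall j : 'I_n.+1, (j < k) = (sval x j < i).
move=> <- zk ni j.
have ne : sval z (dfc k j) != i.
by apply: contraNneq ni => e; apply/dimP; exists j.
have jE := dfE k j; move: jE; case: ltnP => jk jE; apply/esym.
rewrite /= ltn_neqAle; apply/andP; split; first exact: ne.
by rewrite -zk; apply: (dmono (sval z)); rewrite jE ltnW.
apply/negbTE; rewrite -leqNgt -zk; apply: (dmono (sval z)).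
by rewrite jE; lia.
have [||||||h hE] := @pair_ext V X G0 Pair (fun _ _ => 0) qX.
- by move=> n x z k [].
- move=> n x z z' k k' [_ ni _ zx zk] [_ _ _ zx' zk'].
have kk : k = k'.
have p1 := pos _ _ _ _ zx zk ni; have p2 := pos _ _ _ _ zx' zk' ni.
apply: val_inj => /=; apply/eqP; rewrite eqn_leq; apply/andP; split; rewrite leqNgt.
apply/negP => lt; have l : k' < n.+1 by have := ltn_ord k; lia.
by move: (p1 (Ordinal l)) (p2 (Ordinal l)) => /=; rewrite lt ltnn => <-.
apply/negP => lt; have l : k < n.+1 by have := ltn_ord k'; lia.
by move: (p1 (Ordinal l)) (p2 (Ordinal l)) => /=; rewrite lt ltnn => <-.
subst k'; apply: sigE; apply: delta_eq => j.
have [e|ne] := eqVneq k j; first by rewrite -e zk zk'.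
have [j' -> _] := unlift_some ne.
by have := f_equal (fun u : V n => sval u j') zx; rewrite -zx'.
- by move=> n x z k [].
- by move=> n x z k [_ _ nU _ _] /dG0.
- move=> n x z k z' k' [_ _ _ _ zk] [_ /negP ni _ _ _]; apply: ni.
by apply/dimP; exists k.
- move=> n x nd /dG0 nU.
have [ii|ni] := boolP (i \in dim (sval x)); first by left; apply: typeI.
right; have [Ki nUi [a /dimP[ja jaE] ai] [b /dimP[jb jbE] ib]] := tog _ (svalP x) nU.
have [v vP] : exists v : 'I_n.+2, forall j : 'I_n.+1, (j < v) = (sval x j < i).
pose Q k := k = n.+1 \/ exists2 j : 'I_n.+1, j = k :> nat & i <= sval x j.
have [k [Qk kmin]] := nat_min (ex_intro Q n.+1 (or_introl erefl)).
have kn : k < n.+2 by case: Qk => [->//|[j <- _]]; have := ltn_ord j; lia.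
exists (Ordinal kn) => j /=; apply/idP/idP => [jk|lt].
by rewrite ltnNge; apply/negP => h; apply: (kmin j jk); right; exists j.
rewrite ltnNge; apply/negP => kj.
case: Qk => [e|[j' e h]]; first by have := ltn_ord j; lia.
have /(dmono (sval x)) : j' <= j by rewrite e.
by move=> le; move: (leq_trans h le); rewrite leqNgt lt.
have h1 (j : 'I_n.+1) : j < v -> sval x j <= i by rewrite vP => /ltnW.
have h2 (j : 'I_n.+1) : v <= j -> i <= sval x j by rewrite leqNgt vP -leqNgt.
have zim : dim (dins h1 h2) = i |: dim (sval x).
apply/setP => c; rewrite in_setU1; apply/dimP/orP.
case=> j <- /=; case: unliftP => [j' _|_]; last by left.
by right; apply/dimP; exists j'.
case=> [/eqP->|/dimP[j <-]]; first by exists v; apply: dins_at.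
by exists (dfc v j); rewrite /= liftK.
have Kz : K (dim (dins h1 h2)) by rewrite zim.
pose z : V n.+1 := exist _ (dins h1 h2) Kz.
exists z, v; split.
- split=> //; last exact: dins_at.
by apply: sigE; apply: dins_face.
- left; apply/andP; split.
have := vP ja; rewrite jaE ai; lia.
have := vP jb; rewrite jbE; have := ltn_ord jb; lia.
move=> k kv; set w := act _ z.
have iw : i \in dim (sval w).
have vk : k != v by apply/eqP.
have [j jE _] := unlift_some vk.
apply/dimP; exists j; change (dins h1 h2 (lift k j) = i).
by rewrite -jE; apply: dins_at.
have [Uw|nUw] := pselect (U (dim (sval w))); first by constructor 1; apply/dG0.
have [ndw|] := pselect (nondeg w); last by constructor 2.
by constructor 3; apply: typeI.
exists (pm_sub h); split.
move=> m f y Gy; have Kf : K (dim f) by apply: UK; apply/dG; exists y.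
by exists Kf; apply: hE.
move=> m f; split=> [[y [p _]]//|p].
by exists (h m (exist _ f p)), p.
Qed.

Lemma dface_inj k n (i : 'I_n.+2) (f g : delta k n) :
 dcomp (dfc i) f = dcomp (dfc i) g -> f = g.
Proof.
move=> e; apply: delta_eq => j.
by have /lift_inj := f_equal (fun u : delta k n.+1 => u j) e.
Qed.

Lemma dface_dface n (i j : 'I_n.+2) : i <= j ->
 dcomp (dfc (lift ord0 j)) (dfc i) =
 dcomp (dfc (widen_ord (leqnSn _) i)) (dfc j).
Proof.
move=> ij; apply: deltaP => a; rewrite ![nat_of_ord (dcomp _ _ _)]dfE.
rewrite !dfE /= /bump /=.
by case: (ltnP a i) => ?; case: (ltnP a j) => ? /=; do ?case: ltnP => ?; lia.
Qed.

(** A simplex of the horn lying in two faces factors through their common face of codimension two,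
    so it suffices that the prescribed faces match there. *)
Lemma horn_faces (X : sset) n (k : 'I_n.+3) (s : 'I_n.+3 -> X n.+1) :
 quasicategory X -> 0 < k < n.+2 ->
 (forall i j : 'I_n.+2, i <= j -> widen_ord (leqnSn _) i <> k -> lift ord0 j <> k ->
   act (dfc j) (s (widen_ord (leqnSn _) i)) = act (dfc i) (s (lift ord0 j))) ->
 exists x : X n.+2, forall i, i <> k -> act (dfc i) x = s i.
Proof.
move=> qX k0 comp.
pose R m (f : simplex n.+2 m) y := exists i (u : delta m n.+1),
[/\ i <> k, f = dcomp (dfc i) u & y = act u (s i)].
have Ra m l (f : delta m l) x y : R l x y -> R m (act f x) (act f y).
by case=> i [u [ik -> ->]]; exists i, (dcomp u f); rewrite actM.
have key m (i i' : 'I_n.+3) (u u' : delta m n.+1) : i <> k -> i' <> k -> i < i' ->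
dcomp (dfc i) u = dcomp (dfc i') u' -> act u (s i) = act u' (s i').
move=> ik ik' lt e.
have li : i < n.+2 by have := ltn_ord i'; lia.
have lj : i'.-1 < n.+2 by have := ltn_ord i'; lia.
pose i0 := Ordinal li; pose j0 := Ordinal lj.
have iE : widen_ord (leqnSn _) i0 = i by apply: ord_inj.
have jE : lift ord0 j0 = i' by apply: ord_inj; rewrite /= /bump /=; lia.
have [v uE] : exists v, u = dcomp (dfc j0) v.
apply: dfactor => a ua.
have := f_equal (fun w : delta m n.+2 => w a) e => /= /(f_equal val) /= h.
apply: (@dfN _ i' (u' a)); apply: ord_inj => /=; rewrite -h ua /=.
by rewrite /bump; lia.
have u'E : u' = dcomp (dfc i0) v.
apply: (@dface_inj _ _ i'); rewrite -e uE -iE -{1}jE.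
have h : i0 <= j0 by rewrite /=; lia.
apply: delta_eq => a.
exact: (f_equal (fun w : delta n n.+2 => w (v a)) (esym (dface_dface h))).
rewrite uE u'E !actM -iE -jE comp //=; first by lia.
by rewrite iE.
by rewrite jE.
have Rf m (f : simplex n.+2 m) y y' : R m f y -> R m f y' -> y = y'.
case=> i [u [ik -> ->]] [i' [u' [ik' e ->]]].
have [lt|lt|/ord_inj ii] := ltngtP i i'; first exact: key e.
exact/esym/key/esym.
by subst i'; rewrite (dface_inj e).
pose G := @Partmap (simplex n.+2) X R Ra Rf.
have [|h hP] := @horn_map _ _ G n.+1 (did n.+2) k.
by move=> i ik; exists (s i), i, (did n.+1); split=> //; rewrite act1.
have [x xE] := qX _ k k0 h.
exists x => i ik.
have hf : exists j, j <> k /\ forall l, dfc i l <> j.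
by exists i; split=> // l; apply: dfN.
rewrite (xE _ (exist _ (dfc i) hf)).
by apply: (prel_fun (hP _ _)); exists i, (did n.+1); rewrite act1.
Qed.

(** * Low-dimensional horns and Joyal's special outer horns *)

Definition o1_3 : 'I_3 := @Ordinal 3 1 isT.
Definition o1_4 : 'I_4 := @Ordinal 4 1 isT.
Definition o2_4 : 'I_4 := @Ordinal 4 2 isT.

Definition d0 : delta 1 2 := dfc ord0.
Definition d1 : delta 1 2 := dfc o1_3.
Definition fd2 : delta 1 2 := dfc ord_max.

Lemma d01E : d01 = fd2. Proof. by apply: deltaP; case=> [[|[|]]]. Qed.
Lemma d12E : d12 = d0. Proof. by apply: deltaP; case=> [[|[|]]]. Qed.
Lemma d02E : d02 = d1. Proof. by apply: deltaP; case=> [[|[|]]]. Qed.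

Lemma ord3P (P : 'I_3 -> Prop) : P ord0 -> P o1_3 -> P ord_max -> forall i, P i.
Proof.
move=> p0 p1 p2 [[|[|[|//]]] i].
- by rewrite (_ : Ordinal i = ord0) //; apply: ord_inj.
- by rewrite (_ : Ordinal i = o1_3) //; apply: ord_inj.
- by rewrite (_ : Ordinal i = ord_max) //; apply: ord_inj.
Qed.

Lemma ord4P (P : 'I_4 -> Prop) :
 P ord0 -> P o1_4 -> P o2_4 -> P ord_max -> forall i, P i.
Proof.
move=> p0 p1 p2 p3 [[|[|[|[|//]]]] i].
- by rewrite (_ : Ordinal i = ord0) //; apply: ord_inj.
- by rewrite (_ : Ordinal i = o1_4) //; apply: ord_inj.
- by rewrite (_ : Ordinal i = o2_4) //; apply: ord_inj.
- by rewrite (_ : Ordinal i = ord_max) //; apply: ord_inj.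
Qed.

(* Three triangles matching along the edges of an inner 3-horn; triangle_i is the
  face opposite to i. *)
Lemma horn3_1 (X : sset) (t0 t2 t3 : X 2) : quasicategory X ->
 act d1 t0 = act d0 t2 -> act fd2 t0 = act d0 t3 -> act fd2 t2 = act fd2 t3 ->
 exists x : X 3, [/\ act (dfc ord0) x = t0, act (dfc o2_4) x = t2 &
           act (dfc ord_max) x = t3].
Proof.
move=> qX e02 e03 e23.
pose s (i : 'I_4) := match val i with 0 => t0 | 2 => t2 | _ => t3 end.
have [||x xE] := @horn_faces X 1 o1_4 s qX; first by [].
apply: ord3P; apply: ord3P => //= _ h1 h2;
by [case: h1; apply: ord_inj|case: h2; apply: ord_inj].
by exists x; split; rewrite xE.
Qed.

Lemma horn3_2 (X : sset) (t0 t1 t3 : X 2) : quasicategory X ->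
 act d0 t0 = act d0 t1 -> act fd2 t0 = act d0 t3 -> act fd2 t1 = act d1 t3 ->
 exists x : X 3, [/\ act (dfc ord0) x = t0, act (dfc o1_4) x = t1 &
           act (dfc ord_max) x = t3].
Proof.
move=> qX e01 e03 e13.
pose s (i : 'I_4) := match val i with 0 => t0 | 1 => t1 | _ => t3 end.
have [||x xE] := @horn_faces X 1 o2_4 s qX; first by [].
apply: ord3P; apply: ord3P => //= _ h1 h2;
by [case: h1; apply: ord_inj|case: h2; apply: ord_inj].
by exists x; split; rewrite xE.
Qed.

Definition dmk m n (p : nat -> nat) (mono : forall a b, a <= b -> p a <= p b)
 (bd : forall a, a <= m -> p a <= n) : delta m n.
Proof.
refine (@Delta m n (fun a => inord (p a)) _) => a b ab.
by rewrite !inordK ?mono // ltnS bd // -ltnS.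
Defined.
Lemma dmkE m n p mono bd (a : 'I_m.+1) : @dmk m n p mono bd a = p a :> nat.
Proof. by rewrite /= inordK // ltnS bd // -ltnS. Qed.
Definition dimclosed N (U : {set 'I_N.+1} -> Prop) :=
 forall S T : {set 'I_N.+1}, S \subset T -> U T -> U S.

Definition pm_on N (X : sset) (G : partmap (simplex N) X) U (Ud : dimclosed U) :
 partmap (simplex N) X :=
 @pm_restr _ _ G (fun m f => U (dim f))
  (fun m n f x => Ud _ _ (dim_comp x f)).

Lemma pm_sub_fun (Y X : sset) (P : forall n, Y n -> Prop) PC
  (h : smap (@ssub Y P PC) X) n (x x' : Y n) y y' :
 x = x' -> prel (pm_sub h) x y -> prel (pm_sub h) x' y' -> y = y'.
Proof. by move=> ->; apply: prel_fun. Qed.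

Lemma hornP n (k : 'I_n.+1) m (f : delta m n) (i : 'I_n.+1) :
 i <> k -> i \notin dim f -> exists i, i <> k /\ forall j, f j <> i.
Proof.
move=> ik /negP ni; exists i; split=> // j e.
by apply: ni; apply/dimP; exists j.
Qed.
Lemma dcE k m n (f : delta m n) (g : delta k m) i : dcomp f g i = f (g i).
Proof. by []. Qed.
(** The vertices below [l] will be copies of the vertices 0 and 1 of a horn, the others its later
    vertices in order; a face missing one of the latter projects into the horn. *)
Definition small l N (S : {set 'I_N.+1}) := exists2 r : 'I_N.+1, l <= r & r \notin S.
Definition avoids N a (S : {set 'I_N.+1}) := forall r : 'I_N.+1, r = a :> nat -> r \notin S.

Lemma small_d l N : dimclosed (@small l N).
Proof.
move=> S T /fintype.subsetP ST [r lr nr]; exists r => //.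
by apply: contra nr; apply: ST.
Qed.
Lemma avoids_d a N : dimclosed (@avoids a N).
Proof.
by move=> S T /fintype.subsetP ST av r /av; apply: contra; apply: ST.
Qed.
Lemma avoidsP N m (f : delta m N) a : avoids a (dim f) -> forall j, f j <> a :> nat.
Proof. by move=> av j /av/negP; apply; apply/dimP; exists j. Qed.

Arguments avoidsP {N m f a} _ _ _.

Lemma avoidsI N m (f : delta m N) a : (forall j, f j <> a :> nat) -> avoids a (dim f).
Proof. by move=> av r ra; apply/negP => /dimP[j jr]; apply: (av j); rewrite jr. Qed.
(** In the (n+4)-simplex the vertices 0, 1, 2, 3 stand for source, target, source, target of the
    first edge of the horn, and the vertices from 4 on for those of the horn from 2 on. [pA]
    respects this away from 1, [pB] away from 0 and 2, and [rho] reads the first four vertices in a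
    3-simplex. *)
Definition pA n : delta n.+4 n.+2.
Proof. by refine (@dmk n.+4 n.+2 (fun a => if a < 3 then 0 else a - 2) _ _) => *; do ?case: ifP; lia. Defined.
Definition pB n : delta n.+4 n.+2.
Proof. by refine (@dmk n.+4 n.+2 (fun a => if a < 4 then 1 else a - 2) _ _) => *; do ?case: ifP; lia. Defined.
Definition rho n : delta n.+4 3.
Proof. by refine (@dmk n.+4 3 (fun a => minn a 3) _ _) => *; lia. Defined.
Lemma pAE n (a : 'I_n.+4.+1) : pA n a = (if a < 3 then 0 else a - 2) :> nat. Proof. exact: dmkE. Qed.
Lemma pBE n (a : 'I_n.+4.+1) : pB n a = (if a < 4 then 1 else a - 2) :> nat. Proof. exact: dmkE. Qed.
Lemma rhoE n (a : 'I_n.+4.+1) : rho n a = minn a 3 :> nat. Proof. exact: dmkE. Qed.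
Definition UA N (S : {set 'I_N.+1}) := avoids 1 S /\ small 4 S.
Definition UB N (S : {set 'I_N.+1}) := (avoids 0 S /\ avoids 2 S) /\ small 4 S.
Definition UC N (S : {set 'I_N.+1}) := forall r, r \in S -> r < 4.

(** The letters a, b, d, z name the first four vertices of the second stage: a source, b and d
    target, z a second copy of the source, now placed after d. Each map reads in the first stage the
    face on the letters in its name. *)
Definition qabd n : delta n.+4 n.+4.
Proof. by refine (@dmk n.+4 n.+4 (fun a => if a == 2 then 3 else a) _ _) => *; do ?case: ifP; lia. Defined.
Definition qabz n : delta n.+4 n.+4.
Proof. by refine (@dmk n.+4 n.+4 (fun a => if a == 3 then 2 else a) _ _) => *; do ?case: ifP; lia. Defined.
Definition qbdz n : delta n.+4 n.+4.
Proof.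
by refine (@dmk n.+4 n.+4 (fun a => if a < 3 then 1 else if a == 3 then 2 else a) _ _) => *;
do ?case: ifP; lia.
Defined.
Definition paz n : delta n.+3 n.+2.
Proof. by refine (@dmk n.+3 n.+2 (fun a => if a < 3 then 0 else a - 1) _ _) => *; do ?case: ifP; lia. Defined.
Lemma qabdE n (a : 'I_n.+4.+1) : qabd n a = (if a == 2 :> nat then 3 else a) :> nat.
Proof. exact: dmkE. Qed.
Lemma qabzE n (a : 'I_n.+4.+1) : qabz n a = (if a == 3 :> nat then 2 else a) :> nat.
Proof. exact: dmkE. Qed.
Lemma qbdzE n (a : 'I_n.+4.+1) :
 qbdz n a = (if a < 3 then 1 else if a == 3 :> nat then 2 else a) :> nat.
Proof. exact: dmkE. Qed.
Lemma pazE n (a : 'I_n.+4) : paz n a = (if a < 3 then 0 else a - 1) :> nat.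
Proof. exact: dmkE. Qed.
Lemma dimA N : dimclosed (@UA N).
Proof. by move=> S T ST [/(avoids_d ST) ? /(small_d ST) ?]. Qed.
Lemma dB N : dimclosed (@UB N).
Proof. by move=> S T ST [[/(avoids_d ST) ? /(avoids_d ST) ?] /(small_d ST) ?]. Qed.
Lemma dC N : dimclosed (@UC N).
Proof. by move=> S T /fintype.subsetP ST U r /ST; apply: U. Qed.
Lemma edge01E n (k : 'I_2) : edge01 n k = k :> nat.
Proof. by case: k => [[|[|]]]. Qed.

Lemma mem_av N a (S : {set 'I_N.+1}) :
 ~ avoids a S -> exists2 r : 'I_N.+1, r = a :> nat & r \in S.
Proof.
move=> na; apply: contrapT => ne; apply: na => r ra; apply/negP => rS.
by apply: ne; exists r.
Qed.

Lemma mem_C N (S : {set 'I_N.+1}) : ~ UC S -> exists2 r : 'I_N.+1, 4 <= r & r \in S.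
Proof.
move=> na; apply: contrapT => ne; apply: na => r rS.
by rewrite ltnNge; apply/negP => r4; apply: ne; exists r.
Qed.

Lemma avU N a (o : 'I_N.+1) (S : {set 'I_N.+1}) :
 o <> a :> nat -> avoids a S -> avoids a (o |: S).
Proof.
move=> oa av r ra; rewrite in_setU1 (negbTE (av r ra)) orbF.
by apply/eqP => ro; apply: oa; rewrite -ro.
Qed.

Lemma smU N l (o : 'I_N.+1) (S : {set 'I_N.+1}) : o < l -> small l S -> small l (o |: S).
Proof.
move=> o4 [r r4 nr]; exists r => //; rewrite in_setU1 (negbTE nr) orbF.
by apply/eqP => ro; move: r4; rewrite ro leqNgt o4.
Qed.
Lemma memD N (o r : 'I_N.+1) (S : {set 'I_N.+1}) :
 r \in S -> r <> o :> nat -> r \in S :\ o.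
Proof. by move=> rS ro; rewrite in_setD1 rS andbT; apply/eqP => e; apply: ro; rewrite e. Qed.

Lemma small_map N M l l' m (f : delta m N) (p : delta N M) (s : 'I_N.+1 -> 'I_M.+1) :
 (forall a : 'I_N.+1, l <= a -> l' <= s a) ->
 (forall a b : 'I_N.+1, l <= a -> p b = s a -> b = a) ->
 small l (dim f) -> small l' (dim (dcomp p f)).
Proof.
move=> h1 h2 [r lr nr]; exists (s r); first exact: h1.
by apply: contra nr => /dimP[j /(h2 _ _ lr) e]; apply/dimP; exists j.
Qed.

Section Special.
Variables (X : sset) (n : nat) (h : smap (@horn n.+2 ord0) X).
Variable f1 : @horn n.+2 ord0 1.
Hypotheses (qX : quasicategory X)
 (f1E : sval f1 = edge01 n.+1)
 (eq1 : is_equivalence (h 1 f1)).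

Let e := h 1 f1.
Let hp := pm_sub h.

(** [H] has spine e, g, e with [g] inverse to [e], and both of its two-step edges are degenerate; it
    fills the horn at 2 made of the two inverse triangles and a degeneracy of [e]. *)
Lemma special_base : exists H : X 3,
 act (dfc o1_4) H = act (ddeg ord0) e /\
 act (dcomp (dfc ord0) d1) H = degenerate 1 (target e).
Proof.
have [g [s [t [[s1 s2 s3] [t1 t2 t3]]]]] := eq1.
rewrite d01E d12E d02E -/e in s1 s2 s3 t1 t2 t3.
have [|||H [H0 H1 H3]] := @horn3_2 X t (act (ddeg ord0) e) s qX.
- rewrite t2 -actM (_ : dcomp _ _ = did 1) ?act1 //.
by apply: deltaP; case=> [[|[|]]] // i; rewrite dcE dgE dfE.
- by rewrite t1 s2.
- rewrite s3 /degenerate /source -!actM; congr (act _ e).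
by apply: deltaP => -[[|[|]]] // i; rewrite dcE dgE dfE.
by exists H; split=> //; rewrite actM H0 t3.
Qed.

Local Notation N := n.+4.
(** Three compatible pieces start the construction: [pA] and [pB] read the horn, [rho] reads the
    inverse data [H]. Inner fillings then add every face that misses a vertex from 4 on. *)
Lemma special_stage1 : exists G : partmap (simplex N) X,
 [/\ forall m f, pdom G f <-> small 4 (dim (f : simplex N m)),
   forall m f y, UA (dim (f : simplex N m)) -> prel hp (dcomp (pA n) f) y -> prel G f y &
   forall m f y, UB (dim (f : simplex N m)) -> prel hp (dcomp (pB n) f) y -> prel G f y].
Proof.
have [H [H1 H02]] := special_base.
pose GA := pm_on (pm_pre (dpost (pA n)) hp) (@dimA N).
pose GB := pm_on (pm_pre (dpost (pB n)) hp) (@dB N).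
pose GC := pm_on (pm_smap (scomp (yoneda H) (dpost (rho n)))) (@dC N).
have cAB m (f : simplex N m) y y' : GA m f y -> GB m f y' -> y = y'.
move=> [[av _] hy] [[[a0 a2] _] hy'].
apply: (pm_sub_fun _ hy hy').
apply: deltaP => j; rewrite pAE pBE.
have := avoidsP av j; have := avoidsP a0 j; have := avoidsP a2 j => *.
by do ?case: ltnP => ?; lia.
have rC m (f : simplex N m) : UC (dim f) -> forall j, rho n (f j) = f j :> nat.
by move=> u j; rewrite rhoE; have := u (f j); case: dimP => [_ /(_ isT)|[]]; [lia|exists j].
have cAC m (f : simplex N m) y y' : GA m f y -> GC m f y' -> y = y'.
move=> [[av _] hy] [u <-].
have [w wE] : exists w, dcomp (rho n) f = dcomp (dfc o1_4) w.
apply: dfactor => j /(f_equal (@nat_of_ord _)) e1.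
by apply: (avoidsP av j); rewrite -(rC _ _ u) e1.
rewrite /= wE actM H1 -actM.
have := prel_act (p := hp) (dcomp (ddeg ord0) w) (ex_intro _ (svalP f1) erefl).
have -> : h 1 (exist _ (sval f1) (svalP f1)) = e by congr (h 1 _); apply: sigE.
apply: (pm_sub_fun _ hy).
apply: deltaP => j; rewrite f1E !dcE pAE edge01E dgE /=.
have /(f_equal (fun d : delta m 3 => d j : nat)) := wE.
by rewrite !dcE (rC _ _ u) dfE /= => ->; have := ltn_ord (w j); case: (ltnP (w j) 1) => ?; case: (leqP (w j) 0) => ?; do ?case: ltnP => ?; lia.
have cBC m (f : simplex N m) y y' : GB m f y -> GC m f y' -> y = y'.
move=> [[[a0 a2] _] hy] [u <-].
have [w wE] : exists w, dcomp (rho n) f = dcomp (dcomp (dfc ord0) d1) w.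
have [w0 w0E] : exists w, dcomp (rho n) f = dcomp (dfc ord0) w.
apply: dfactor => j /(f_equal (@nat_of_ord _)) e1.
by apply: (avoidsP a0 j); rewrite -(rC _ _ u) e1.
have [w1 w1E] : exists w, w0 = dcomp d1 w.
apply: dfactor => j e1; apply: (avoidsP a2 j).
have /(f_equal (fun d : delta m 3 => d j : nat)) := w0E.
by rewrite !dcE (rC _ _ u) dfE e1.
by exists w1; rewrite w0E w1E.
rewrite /= wE actM H02 /degenerate /target -!actM.
have := prel_act (p := hp) (dcomp (dconst 0 ord_max) (dcomp (dconst 1 ord0) w))
(ex_intro _ (svalP f1) erefl).
have -> : h 1 (exist _ (sval f1) (svalP f1)) = e by congr (h 1 _); apply: sigE.
rewrite actM; apply: (pm_sub_fun _ hy).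
apply: deltaP => j; rewrite f1E !dcE pBE edge01E /=.
have /(f_equal (fun d : delta m 3 => d j : nat)) := wE.
rewrite !dcE (rC _ _ u) /d1 !dfE /=.
by have := ltn_ord (w j); case: (ltnP (w j) 1) => ?; do ?case: ltnP => ?; lia.
pose GAB := pm_union cAB.
have cABC m (f : simplex N m) y y' : GAB m f y -> GC m f y' -> y = y'.
by case; [apply: cAC|apply: cBC].
pose G := pm_union cABC.
have hpd m (f : simplex n.+2 m) (r : 'I_n.+3) : r <> ord0 -> r \notin dim f ->
exists y, prel hp f y.
by move=> r0 nr; exists (h m (exist _ f (hornP r0 nr))), (hornP r0 nr).
have dG m (f : simplex N m) : pdom G f <-> [\/ UA (dim f), UB (dim f) | UC (dim f)].
split; first by case=> y [[[u _]|[u _]]|[u _]]; [constructor 1|constructor 2|constructor 3].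
have sm (p : delta N n.+2) : (forall a : 'I_N.+1, 4 <= a -> p a = a - 2 :> nat) ->
(forall a : 'I_N.+1, a < 4 -> p a <= 1) ->
small 4 (dim f) -> exists y, prel hp (dcomp p f) y.
move=> p1 p2 [r r4 nr]; apply: (hpd _ _ (inord (r - 2))).
by move=> /(f_equal val) /=; rewrite inordK; have := ltn_ord r; lia.
apply: contra nr => /dimP[j /(f_equal val) /=].
rewrite inordK; last by have := ltn_ord r; lia.
move=> e'; apply/dimP; exists j; apply: ord_inj.
have [lt|ge] := ltnP (f j) 4; first by have := p2 _ lt; lia.
by have := p1 _ ge; lia.
case=> u.
- have [||y hy] := sm (pA n) _ _ u.2; last by exists y; left; left.
by move=> a a4; rewrite pAE; case: ltnP => //; lia.
by move=> a a4; rewrite pAE; case: ltnP => //; lia.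
- have [||y hy] := sm (pB n) _ _ u.2; last by exists y; left; right.
by move=> a a4; rewrite pBE; case: ltnP => //; lia.
by move=> a a4; rewrite pBE; case: ltnP => //; lia.
- by exists (act (dcomp (rho n) f) H); right.
(* Toggling the vertex 3 adds the small faces without 0; toggling the vertex 2 adds the remaining
   small ones. *)
pose K1 (S : {set 'I_N.+1}) := [\/ UA S, UB S | UC S] \/ (avoids 0 S /\ small 4 S).
pose o2 : 'I_N.+1 := @Ordinal N.+1 2 isT.
pose o3 : 'I_N.+1 := @Ordinal N.+1 3 isT.
have [|||G1 [p1 dG1]] := @toggle X N G o3 (fun S => [\/ UA S, UB S | UC S]) K1 qX dG.
- by move=> S u; left.
- move=> S T ST [[u|u|u]|[u1 u2]].
+ by left; constructor 1; apply: dimA ST u.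
+ by left; constructor 2; apply: dB ST u.
+ by left; constructor 3; apply: dC ST u.
+ by right; split; [apply: avoids_d ST u1|apply: small_d ST u2].
- move=> S [//|[a0 sm]] nU.
have [|r1 r1E r1S] := mem_av (a := 1) (S := S); first by move=> a1; apply: nU; constructor 1.
have [|r2 r2E r2S] := mem_av (a := 2) (S := S); first by move=> a2; apply: nU; constructor 2.
have [|r4 r4E r4S] := mem_C (S := S); first by move=> u; apply: nU; constructor 3.
split.
+ by right; split; [apply: avU|apply: smU].
+ case=> u.
* by have /negP := u.1 r1 r1E; apply; apply: memD; rewrite //= r1E.
* by have /negP := u.1.2 r2 r2E; apply; apply: memD; rewrite //= r2E.
* by have := u r4 (memD r4S _); rewrite ltnNge r4E => /(_ _)/negP[] //=; lia.
+ by exists r1; rewrite ?r1E.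
+ by exists r4.
have [|||G2 [p2 dG2]] := @toggle X N G1 o2 K1 (@small 4 N) qX dG1.
- move=> S [[[]|[]|u]|[]] //; exists ord_max => //=; apply/negP => /u /=.
by rewrite ltnNge.
- exact: small_d.
- move=> S sm nU.
have [|r0 r0E r0S] := mem_av (a := 0) (S := S); first by move=> a0; apply: nU; right.
have [|r1 r1E r1S] := mem_av (a := 1) (S := S); first by move=> a1; apply: nU; left; constructor 1.
have [|r4 r4E r4S] := mem_C (S := S); first by move=> u; apply: nU; left; constructor 3.
split.
+ exact: smU.
+ case=> [[u|u|u]|[u _]].
* by have /negP := u.1 r1 r1E; apply; apply: memD; rewrite //= r1E.
* by have /negP := u.1.1 r0 r0E; apply; apply: memD; rewrite //= r0E.
* by have := u r4 (memD r4S _); rewrite ltnNge r4E => /(_ _)/negP[] //=; lia.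
* by have /negP := u r0 r0E; apply; apply: memD; rewrite //= r0E.
+ by exists r1; rewrite ?r1E.
+ by exists r4 => //=; lia.
exists G2; split=> // m f y u hy.
- by apply: p2; apply: p1; left; left.
- by apply: p2; apply: p1; left; right.
Qed.

(** The second copy z of the source is moved behind d. The faces omitting z, d or a are read off the
    first stage, and the vertex b is toggled. On a, d and the later vertices this is the given horn;
    with z in place of d it is degenerate along a, z. *)
Lemma special_stage2 : exists G : partmap (simplex N) X,
 [/\ forall m f, pdom G f <-> small 4 (dim (f : simplex N m)),
   forall m f y, avoids 1 (dim (f : simplex N m)) -> avoids 2 (dim f) ->
    small 4 (dim f) ->
    prel hp (dcomp (pA n) (dcomp (qabz n) f)) y -> prel G f y &
   forall m f y, avoids 1 (dim (f : simplex N m)) -> avoids 3 (dim f) ->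
    small 4 (dim f) ->
    prel hp (dcomp (pA n) (dcomp (qabd n) f)) y -> prel G f y].
Proof.
have [G1 [dG1 GA GB]] := special_stage1.
pose V a (S : {set 'I_N.+1}) := avoids a S /\ small 4 S.
have dV a : dimclosed (V a).
by move=> S T ST [u1 u2]; split; [apply: avoids_d ST u1|apply: small_d ST u2].
pose Gd := pm_on (pm_pre (dpost (qabd n)) G1) (dV 3).
pose Gz := pm_on (pm_pre (dpost (qabz n)) G1) (dV 2).
pose Gb := pm_on (pm_pre (dpost (qbdz n)) G1) (dV 0).
have smq m (f : simplex N m) (p : delta N N) :
(forall a : 'I_N.+1, 4 <= a -> p a = a) ->
(forall a : 'I_N.+1, a < 4 -> p a < 4) ->
small 4 (dim f) -> small 4 (dim (dcomp p f)).
move=> p1 p2; apply: (small_map (s := id)) => // a b a4 e1.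
have [b4|b4] := ltnP b 4; last by rewrite -e1 p1.
by have := p2 _ b4; rewrite e1 ltnNge a4.
have sd m (f : simplex N m) : small 4 (dim f) -> small 4 (dim (dcomp (qabd n) f)).
apply: smq => a a4; first by apply: ord_inj; rewrite qabdE; case: ifP; lia.
by rewrite qabdE; case: ifP; lia.
have sz m (f : simplex N m) : small 4 (dim f) -> small 4 (dim (dcomp (qabz n) f)).
apply: smq => a a4; first by apply: ord_inj; rewrite qabzE; case: ifP; lia.
by rewrite qabzE; case: ifP; lia.
have sb m (f : simplex N m) : small 4 (dim f) -> small 4 (dim (dcomp (qbdz n) f)).
apply: smq => a a4; first by apply: ord_inj; rewrite qbdzE; do ?case: ifP; lia.
by rewrite qbdzE; do ?case: ifP; lia.
have cdz m (f : simplex N m) y y' : prel Gd f y -> prel Gz f y' -> y = y'.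
move=> [[a3 _] /= hy] [[a2 _] /= hy']; apply: (prel_fun hy).
rewrite (_ : dcomp _ f = dcomp (qabz n) f) //.
apply: deltaP => j; rewrite !dcE qabdE qabzE.
by have := avoidsP a3 j; have := avoidsP a2 j; do ?case: ifP; lia.
pose Gdz := pm_union cdz.
have cdb m (f : simplex N m) y y' : prel Gdz f y -> prel Gb f y' -> y = y'.
case=> [[[a3 sm] /= hy] [[a0 _] /= hy']|[[a2 _] /= hy] [[a0 _] /= hy']]; last first.
apply: (prel_fun hy); rewrite (_ : dcomp _ f = dcomp (qbdz n) f) //.
apply: deltaP => j; rewrite !dcE qbdzE qabzE.
by have := avoidsP a0 j; have := avoidsP a2 j; do ?case: ifP; lia.
have hpd : exists y, prel hp (dcomp (pB n) (dcomp (qabd n) f)) y.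
have sp : small 2 (dim (dcomp (dcomp (pB n) (qabd n)) f)).
apply: (small_map (s := fun a => inord (a - 2))) sm => [a a4|a b a4 /(f_equal (@nat_of_ord _))].
by rewrite inordK; have := ltn_ord a; lia.
rewrite dcE pBE qabdE inordK; last by have := ltn_ord a; lia.
by move=> e'; apply: ord_inj; move: e'; do ?case: ifP; lia.
have [r lr nr] := sp.
have r0 : r <> ord0 by move=> e'; move: lr; rewrite e'.
by exists (h m (exist _ _ (hornP r0 nr))), (hornP r0 nr).
have [y0 hy0] := hpd.
have UBd : UB (dim (dcomp (qabd n) f)).
split; last exact: sd.
split; apply: avoidsI => j; rewrite dcE qabdE;
by have := avoidsP a0 j; have := avoidsP a3 j; do ?case: ifP; lia.
have UBb : UB (dim (dcomp (qbdz n) f)).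
split; last exact: sb.
split; apply: avoidsI => j; rewrite dcE qbdzE;
by have := avoidsP a0 j; have := avoidsP a3 j; do ?case: ifP; lia.
rewrite (prel_fun hy (GB _ _ _ UBd hy0)); apply/esym/(prel_fun hy').
apply: GB UBb _; rewrite (_ : dcomp _ _ = dcomp (pB n) (dcomp (qabd n) f)) //.
apply: deltaP => j; rewrite !dcE !pBE qabdE qbdzE.
by have := avoidsP a0 j; have := avoidsP a3 j; do ?case: ifP; lia.
pose G := pm_union cdb.
have dG m (f : simplex N m) : pdom G f <-> [\/ V 3 (dim f), V 2 (dim f) | V 0 (dim f)].
split; first by case=> y [[[u _]|[u _]]|[u _]]; [constructor 1|constructor 2|constructor 3].
case=> u.
- by have [y hy] := (dG1 _ _).2 (sd _ _ u.2); exists y; left; left.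
- by have [y hy] := (dG1 _ _).2 (sz _ _ u.2); exists y; left; right.
- by have [y hy] := (dG1 _ _).2 (sb _ _ u.2); exists y; right.
pose o1 : 'I_N.+1 := @Ordinal N.+1 1 isT.
have [|||G2 [p2 dG2]] := @toggle X N G o1 (fun S => [\/ V 3 S, V 2 S | V 0 S])
(@small 4 N) qX dG.
- by move=> S [[]|[]|[]].
- exact: small_d.
- move=> S sm nU.
have [|r3 r3E r3S] := mem_av (a := 3) (S := S); first by move=> a1; apply: nU; constructor 1.
have [|r2 r2E r2S] := mem_av (a := 2) (S := S); first by move=> a1; apply: nU; constructor 2.
have [|r0 r0E r0S] := mem_av (a := 0) (S := S); first by move=> a1; apply: nU; constructor 3.
split.
+ exact: smU.
+ case=> u.
* by have /negP := u.1 r3 r3E; apply; apply: memD; rewrite //= r3E.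
* by have /negP := u.1 r2 r2E; apply; apply: memD; rewrite //= r2E.
* by have /negP := u.1 r0 r0E; apply; apply: memD; rewrite //= r0E.
+ by exists r0; rewrite ?r0E.
+ by exists r2; rewrite ?r2E.
exists G2; split=> // m f y a1 a2 sm hy; apply: p2.
- left; right; split=> //; apply: GA hy; split; last exact: sz.
by apply: avoidsI => j; rewrite dcE qabzE; have := avoidsP a1 j; case: ifP; lia.
- left; left; split=> //; apply: GA hy; split; last exact: sd.
by apply: avoidsI => j; rewrite dcE qabdE; have := avoidsP a1 j; case: ifP; lia.
Qed.

(** Drop b. The face omitting d is now known completely: it is the face of the horn opposite 1 with
    its first vertex repeated. Toggling z fills everything by inner horns, and the face omitting z
    is the required filler. *)
Lemma special_stage3 :
 exists x : X n.+2, forall m (f : @horn n.+2 ord0 m), act (sval f) x = h m f.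
Proof.
have [G2 [dG2 Gz Gd]] := special_stage2.
pose o1 : 'I_n.+4.+1 := @Ordinal n.+4.+1 1 isT.
pose i1 : delta n.+3 n.+4 := dfc o1.
have i1E a : i1 a = (if a < 1 then a : nat else a.+1) :> nat by apply: dfE.
have dA1 : dimclosed (@avoids n.+3 1) by apply: avoids_d.
pose Gs := pm_on (pm_pre (dpost i1) G2) (@small_d 3 n.+3).
pose Ga := pm_on (pm_pre (dpost (paz n)) hp) dA1.
have sm1 m (f : simplex n.+3 m) : small 3 (dim f) -> small 4 (dim (dcomp i1 f)).
apply: (small_map (s := fun a => i1 a)) => [a a3|a b _ /lift_inj //].
by rewrite i1E; case: ifP; lia.
have c m (f : simplex n.+3 m) y y' : prel Gs f y -> prel Ga f y' -> y = y'.
move=> [sm /= hy] [av /= hy']; apply: (prel_fun hy); apply: Gz.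
- by apply: avoidsI => j; rewrite dcE i1E; case: ltnP; lia.
- by apply: avoidsI => j; rewrite dcE i1E; have := avoidsP av j; case: ltnP; lia.
- exact: sm1.
rewrite (_ : dcomp _ _ = dcomp (paz n) f) //.
apply: deltaP => j; rewrite !dcE pAE qabzE i1E pazE.
by have := avoidsP av j; case: (ltnP (f j) 1) => ?; do ?case: ifP; lia.
pose G := pm_union c.
have dG m (f : simplex n.+3 m) : pdom G f <-> small 3 (dim f) \/ avoids 1 (dim f).
split; first by case=> y [[u _]|[u _]]; [left|right].
case=> u; first by have [y hy] := (dG2 _ _).2 (sm1 _ _ u); exists y; left.
have nr : (inord 1 : 'I_n.+3) \notin dim (dcomp (paz n) f).
apply/negP => /dimP[j /(f_equal (@nat_of_ord _))]; rewrite inordK // dcE pazE.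
by have := avoidsP u j; case: ltnP; lia.
have r0 : (inord 1 : 'I_n.+3) <> ord0 by move=> /(f_equal val) /=; rewrite inordK.
by exists (h m (exist _ _ (hornP r0 nr))); right; split=> //; exists (hornP r0 nr).
pose o2 : 'I_n.+4 := @Ordinal n.+4 2 isT.
have [|||G3 [p3 dG3]] := @toggle X n.+3 G o2 (fun S => small 3 S \/ avoids 1 S)
(fun _ => True) qX dG.
- by [].
- by [].
- move=> S _ nU.
have [|r1 r1E r1S] := mem_av (a := 1) (S := S); first by move=> a1; apply: nU; right.
have big (r : 'I_n.+4) : 3 <= r -> r \in S.
by move=> r3; apply: contrapT => /negP nr; apply: nU; left; exists r.
split=> //.
+ case=> [[r r3]|u].
rewrite in_setD1 big // andbT negbK => /eqP e'; move: r3; rewrite e' /=; lia.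
by have /negP := u r1 r1E; apply; apply: memD; rewrite //= r1E.
+ by exists r1; rewrite ?r1E.
+ by exists ord_max; [apply: big|].
have [H3 G3H] := (dG3 _ (did n.+3)).2 I.
pose i2 : delta n.+2 n.+3 := dfc o2.
have i2E a : i2 a = (if a < 2 then a : nat else a.+1) :> nat by apply: dfE.
exists (act i2 H3) => m f.
rewrite -actM; apply: (prel_fun (p := G3) (x := dcomp i2 (sval f))).
exact: (prel_act (dcomp i2 (sval f)) G3H).
have hf : prel hp (sval f) (h m f).
by exists (svalP f); congr (h m _); apply: sigE.
apply: p3; have [i [i0 fi]] := svalP f.
have i0' : i <> 0 :> nat by move=> e'; apply: i0; apply: ord_inj.
have fi' j : sval f j <> i :> nat by move=> /ord_inj; apply: fi.
have [i_1|i_1] := eqVneq (i : nat) 1.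
right; split.
by apply: avoidsI => j; rewrite dcE i2E; have := fi' j; case: ltnP; lia.
change (prel hp (dcomp (paz n) (dcomp i2 (sval f))) (h m f)).
rewrite (_ : dcomp _ _ = sval f) //.
apply: deltaP => j; rewrite !dcE pazE i2E; have := fi' j.
by case: (ltnP (sval f j) 2) => ?; do ?case: ifP; lia.
have sm : small 3 (dim (dcomp i2 (sval f))).
exists (i2 i); first by rewrite i2E; case: ifP; lia.
by apply/negP => /dimP[j /lift_inj]; apply: fi.
left; split=> //; apply: Gd; last 1 first.
- rewrite (_ : dcomp _ _ = sval f) //.
apply: deltaP => j; rewrite !dcE pAE qabdE i1E i2E.
by move: (nat_of_ord (sval f j)) => [|[|a]] //=; lia.
- by apply: avoidsI => j; rewrite !dcE i1E; case: ltnP; lia.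
- apply: avoidsI => j; rewrite !dcE i1E i2E.
by case: (ltnP (sval f j) 2) => ?; case: ltnP => ?; lia.
- exact: sm1.
Qed.
End Special.

Theorem joyal_special (X : sset) : quasicategory X -> special_filling X.
Proof. by move=> qX n h f1 f1E eq1; apply: special_stage3 qX f1E eq1. Qed.

(** * Products of a horn with a simplicial set *)

Lemma degen_surj (V : sset) n (x : V n) : ~ nondeg x ->
 exists m (f : delta n m) (y : V m), [/\ m < n, dsurj f & x = act f y].
Proof.
move=> nd.
have ex : exists m, m < n /\ exists (f : delta n m) y, x = act f y.
apply: contrapT => ne; apply: nd => m f y e; rewrite leqNgt; apply/negP => lt.
by apply: ne; exists m; split=> //; exists f, y.
have [m [[mn [f [y e]]] mmin]] := nat_min ex.
exists m, f, y; split=> //; apply: contrapT => /dsurjN[i fi].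
have [l [y' [g [ln e']]]] := act_factor y fi.
apply: (mmin l ln); split; first exact: ltn_trans ln mn.
by exists g, y'; rewrite e.
Qed.
Lemma dg_lt (V : sset) m n (f : delta n m) (y : V m) : m < n -> ~ nondeg (act f y).
Proof. by move=> mn /(_ _ _ _ erefl); rewrite leqNgt mn. Qed.

Notation wd v := (widen_ord (leqnSn _) v).

Lemma ddeg_wd n (v : 'I_n.+1) : ddeg v (wd v) = v.
Proof. by apply: ord_inj; rewrite dgE /= leqnn. Qed.
Lemma ddeg_face n (v : 'I_n.+1) j : ddeg v (dfc (wd v) j) = j.
Proof. by apply: ord_inj; rewrite dgE dfE /=; case: ltnP => ?; case: ifP; lia. Qed.

Section HornProduct.
Variables (X B : sset) (n : nat) (k : 'I_n.+2) (A : forall m, B m -> Prop).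
Hypotheses (qX : quasicategory X)
 (Aact : forall m l (f : delta m l) b, A b -> A (act f b))
 (kn : k < n.+1).
Notation V := (sprod (simplex n.+1) B).

Let U m (x : V m) := (exists j, j <> k /\ forall i, x.1 i <> j) \/ A x.2.

(** [v] is the first position whose entry exceeds [k]. The partner of [x] gets an entry [k] inserted
    just before it, with the second component repeated. *)
Let fb m (x : V m) (v : 'I_m.+1) :=
 (forall j : 'I_m.+1, j < v -> x.1 j <= k) /\
 (forall j : 'I_m.+1, v <= j -> k < x.1 j).

Let Ins m (x : V m) (z : V m.+1) (v : 'I_m.+1) :=
 [/\ fb x v, dcomp z.1 (dfc (wd v)) = x.1, z.1 (wd v) = k &
   z.2 = act (ddeg v) x.2].

Lemma fb_ex m (x : V m) j : k < x.1 j -> exists v, fb x v.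
Proof.
move=> kj; have [v [[i <- ki] vmin]] := nat_min
(ex_intro (fun v => exists2 i : 'I_m.+1, i = v :> nat & k < x.1 i) _
(ex_intro2 _ _ j erefl kj)).
exists i; split=> [l li|l il].
by rewrite leqNgt; apply/negP => kl; apply: (vmin l li); exists l.
have h : x.1 i <= x.1 l by apply: (dmono x.1).
exact: (leq_trans ki h).
Qed.

Lemma fb_fun m (x : V m) v v' : fb x v -> fb x v' -> v = v'.
Proof.
move=> [h1 h2] [h1' h2']; apply: ord_inj; apply/eqP; rewrite eqn_leq.
by apply/andP; split; rewrite leqNgt; apply/negP => lt; [have := h2' _ (leqnn _); rewrite ltnNge (h1 _ lt)|have := h2 _ (leqnn _); rewrite ltnNge (h1' _ lt)].
Qed.

Let Ins_ex m (x : V m) v : fb x v -> exists z, Ins x z v.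
Proof.
move=> [h1 h2].
have h2' (j : 'I_m.+1) : wd v <= j -> k <= x.1 j by move=> /h2/ltnW.
exists (dins (v := wd v) h1 h2', act (ddeg v) x.2); split=> //.
exact: dins_face.
exact: dins_at.
Qed.

Let Ins_fun m (x : V m) z z' v v' : Ins x z v -> Ins x z' v' -> z = z' /\ v = v'.
Proof.
move=> [fx e1 e2 e3] [fx' e1' e2' e3']; have vv := fb_fun fx fx'; subst v'.
split=> //; case: z z' e1 e2 e3 e1' e2' e3' => [a b] [a' b'] /= e1 e2 -> e1' e2' ->.
congr pair; apply: delta_eq => j.
have [<-|ne] := eqVneq (wd v) j; first by rewrite e2 e2'.
have [j' -> _] := unlift_some ne.
by have := f_equal (fun u : delta m n.+1 => u j') e1; rewrite -e1'.
Qed.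

Let Ins_act m l (x : V m) z v (q : delta l.+1 m.+1) (t : delta l m) (v' : 'I_l.+1) :
 Ins x z v -> q (wd v') = wd v -> (forall j, q (dfc (wd v') j) = dfc (wd v) (t j)) ->
 t v' = v -> (forall j : 'I_l.+1, j < v' -> t j < v) ->
 Ins (act t x) (act q z) v'.
Proof.
move=> [[h1 h2] e1 e2 e3] qv qt tv tlt; split.
- split=> j jv; first by apply: h1; apply: tlt.
by apply: h2; rewrite -tv; apply: (dmono t).
- apply: delta_eq => j; rewrite /= -/(dfc (wd v') j) qt.
exact: (f_equal (fun u : delta m n.+1 => u (t j)) e1).
- by rewrite /= qv.
rewrite /= e3 -!actM; congr (act _ _); apply: delta_eq => j.
have [<-|ne] := eqVneq (wd v') j; first by rewrite !dcE qv !ddeg_wd tv.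
have [j' -> _] := unlift_some ne.
by rewrite !dcE -!/(dfc _ _) qt !ddeg_face.
Qed.

(** Insertion commutes with degeneracies, so a simplex with nondegenerate partner is itself
    nondegenerate. *)
Let Ins_surj m l (x : V m) z v (t : delta l m) w v' : dsurj t ->
 Ins x z v -> Ins (act t x) w v' -> exists q : delta l.+1 m.+1, w = act q z.
Proof.
move=> st Ixz Iw; have [[h1 h2] _ _ _] := Ixz; have [[h1' h2'] _ _ _] := Iw.
have tv : t v' = v.
apply: (@fb_fun _ x); last by split.
split=> j jv.
have [i ij] := st j; subst j; apply: h1'; rewrite ltnNge; apply/negP => vi.
by have := dmono t vi; rewrite leqNgt jv.
exact: leq_trans (h2' _ (leqnn _)) (dmono x.1 jv).
have tlt (j : 'I_l.+1) : j < v' -> t j < v.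
move=> jv; rewrite ltnNge; apply/negP => /h2.
by have := h1' _ jv; rewrite /= leqNgt => /negP.
have g1 (j : 'I_l.+1) : j < wd v' -> dcomp (dfc (wd v)) t j <= wd v.
by move=> /tlt h; rewrite dcE dfE /= h ltnW.
have g2 (j : 'I_l.+1) : wd v' <= j -> wd v <= dcomp (dfc (wd v)) t j.
move=> /(dmono t); rewrite tv => h; rewrite dcE dfE /=.
by case: ltnP => // _; apply: leqW.
exists (dins g1 g2).
have := Ins_act (q := dins g1 g2) (t := t) Ixz (dins_at g1 g2) _ tv tlt.
move=> H; have {}H := H (fun j => f_equal (fun u : delta _ _ => u j) (dins_face g1 g2)).
by have [-> _] := Ins_fun Iw H.
Qed.

Let U_Ins m (x : V m) z v : Ins x z v -> U x -> U z.
Proof.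
case=> _ e1 e2 e3 [[j [jk xj]]|Ax]; [left|right]; last by rewrite e3; apply: Aact.
exists j; split=> // i; have [<-|ne] := eqVneq (wd v) i.
by rewrite e2 => /esym.
have [i' -> _] := unlift_some ne; move: (xj i'); rewrite -e1 //.
Qed.

Inductive horn_typeI : forall m, V m -> Prop :=
| Horn_typeI m (x : V m) z v : Ins x z v -> horn_typeI z.

(** A second insertion puts another [k] next to the first and repeats the same second component,
    which is a degeneracy. *)
Let typeI_degen m (y : V m) w v' : horn_typeI y -> Ins y w v' -> ~ nondeg w.
Proof.
move=> ty; case: ty w v' => {m y} m x y v [[h1 h2] e1 e2 e3] w v' [[g1 g2] f1 f2 f3].
have vE (j : 'I_m.+1) : v <= j -> k < y.1 (lift ord0 j).
move=> vj; have := h2 _ vj; rewrite -e1 /=.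
by rewrite (_ : lift (wd v) j = lift ord0 j) //; apply: ord_inj; rewrite /= /bump /= vj.
have vv : v' = v.+1 :> nat.
apply/eqP; rewrite eqn_leq; apply/andP; split; rewrite leqNgt; apply/negP => lt.
by have := g1 (lift ord0 v) lt; rewrite leqNgt vE.
have := g2 (wd v); rewrite /= -ltnS lt e2 ltnn => /(_ isT) //.
suff -> : w = act (ddeg (wd v)) y by apply: dg_lt.
case: w f1 f2 f3 => [a b] /= f1 f2 f3; congr pair.
apply: delta_eq => j; have [<-|ne] := eqVneq (wd v') j.
rewrite f2 -e2 dcE; congr (y.1 _); apply: ord_inj.
by rewrite dgE /= vv; case: ifP; lia.
have [j' -> _] := unlift_some ne.
have /(f_equal (fun u : delta _ _ => u j')) := f1; rewrite dcE => ->.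
rewrite dcE; congr (y.1 _); apply: ord_inj.
rewrite dgE -[lift _ _]/(dfc (wd v') j') dfE /= vv.
by case: ltnP => ?; case: ifP => ?; lia.
rewrite f3 e3 -!actM; congr (act _ _); apply: deltaP => j.
rewrite !dcE !dgE vv /=.
by case: (leqP j v.+1) => ?; case: (leqP j v) => ?; do ?case: ifP => ?; lia.
Qed.

Variable G0 : partmap V X.
Hypotheses (dG0 : forall m (x : V m), pdom G0 x <-> U x)
 (spec : 0 < k \/ (k = ord0 /\ forall b : B 0, exists e,
 G0 1 (edge01 n, act (dconst 1 ord0) b) e /\ is_equivalence e)).

(** Simplices outside the product of the horn with [B] and of the simplex with [A] are matched by
    insertion of [k]. The horns are inner, except for insertions at position 0 when [k = 0]; there
    the first edge goes to an equivalence by assumption. *)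
Lemma horn_prod : exists h : smap V X, forall m x y, G0 m x y -> h m x = y.
Proof.
pose Pair m (x : V m) (z : V m.+1) (w : 'I_m.+2) := exists v,
[/\ nondeg x, ~ U x, ~ horn_typeI x, Ins x z v & w = wd v].
(* The face of [z] omitting the entry just after the inserted [k] amounts to lowering one entry of
   [x] from [k+1] to [k]; all other faces are prescribed, degenerate or insertions themselves. *)
pose mu m (x : V m) := #|[set j | x.1 j == k.+1 :> nat]|.
have nU_fb m (x : V m) : ~ U x -> exists v, fb x v /\ x.1 v = k.+1 :> nat.
move=> nU; have [j jE] : exists j, x.1 j = inord k.+1.
apply: contrapT => ne; apply: nU; left; exists (inord k.+1); split.
by move=> /(f_equal val) /=; rewrite inordK; lia.
by move=> i e; apply: ne; exists i.
have {}jE : x.1 j = k.+1 :> nat by rewrite jE inordK; lia.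
have [v [h1 h2]] : exists v, fb x v by apply: (@fb_ex _ x j); rewrite jE.
exists v; split=> //; apply/eqP; rewrite eqn_leq (h2 _ (leqnn _)) andbT.
rewrite -jE; apply: (dmono x.1); rewrite leqNgt; apply/negP => /h1.
by rewrite jE ltnn.
have key m (y : V m) w v : Ins y w v -> nondeg w -> ~ U w -> paired Pair w.
move=> Iyw ndw nUw; apply: (@Paired _ _ _ y w (wd v)); exists v; split=> //.
- apply: contrapT => /degen_surj[l [f [y0 [lm sf yE]]]].
subst y; have [[_ h2] _ _ _] := Iyw.
have [v0 fb0] : exists v0, fb y0 v0 by apply: (@fb_ex _ y0 (f v)); apply: h2.
have [z0 I0] := Ins_ex fb0.
have [q wE] := Ins_surj sf I0 Iyw.
by move: ndw; rewrite wE; apply: dg_lt.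
- by move=> Uy; apply: nUw; apply: U_Ins Iyw Uy.
- by move=> ty; apply: (typeI_degen ty Iyw).
apply: (@pair_ext V X G0 Pair mu qX).
- move=> m x z w [v [_ _ _ [_ e1 _ e3] ->]]; case: x e1 e3 => [a b] /= e1 e3.
congr pair => //; rewrite e3 -actM (_ : dcomp _ _ = did m) ?act1 //.
by apply: delta_eq => j; rewrite dcE ddeg_face.
- by move=> m x z z' w w' [v [_ _ _ I1 _]] [v' [_ _ _ I2 _]]; case: (Ins_fun I1 I2).
- by move=> m x z w [v []].
- by move=> m x z w [v [_ nU _ _ _]] /dG0.
- move=> m x z w z' w' [v [_ _ _ I1 _]] [v' [_ _ ni _ _]]; apply: ni.
exact: Horn_typeI I1.
move=> m x nd /dG0 nU.
have [tI|ntI] := pselect (horn_typeI x).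
by left; case: tI nd nU => {m x} m y x v /key.
right; have [v [fbv xv]] := nU_fb _ _ nU.
have [z Iz] := Ins_ex fbv; have [_ z1 z2 z3] := Iz.
exists z, (wd v); split.
- by exists v; split.
- have [k0|[k0 spe]] := spec.
left; apply/andP; split; last exact: (ltn_ord v).
rewrite lt0n; apply/eqP => /= v0.
apply: nU; left; exists ord0; split; first by move=> k00; rewrite -k00 in k0.
by move=> i e; have := fbv.2 i; rewrite v0 e /= => /(_ isT).
(* At position 0 the horn is outer. Its first edge goes from the inserted entry 0 to an entry 1 and
   is constant in the second component, so it is one of the edges controlled by [spe]. *)
have [v0|v0] := posnP v; last by left; apply/andP; split=> //; apply: (ltn_ord v).
right; have m0 : 0 < m.
rewrite lt0n; apply/eqP => m0; have vI (i : 'I_m.+1) : i = v.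
by apply: ord_inj; have := ltn_ord i; have := ltn_ord v; lia.
have [e [Ge _]] := spe (act (dconst 0 ord0) x.2); apply: nU.
have /dG0[[j [jk xj]]|Ab] : pdom G0 ((edge01 n, act (dconst 1 ord0) (act (dconst 0 ord0) x.2)) : V 1) by exists e.
left; exists j; split=> // i; rewrite (vI i) => xvj; apply: (xj ord_max); rewrite -xvj.
by apply: ord_inj; rewrite xv k0.
right; have /= := Aact (dconst m ord0) Ab; rewrite -!actM (_ : dcomp _ _ = did m) ?act1 //.
by apply: delta_eq => i; rewrite (vI i) !dcE /=; apply: vI.
split=> //; [exact: joyal_special|by apply: ord_inj; rewrite /= v0|].
have [e [Ge eqe]] := spe (act (dconst 0 ord0) x.2); exists e; split=> //.
suff -> : act (edge01 m) z = ((edge01 n, act (dconst 1 ord0) (act (dconst 0 ord0) x.2)) : V 1) by [].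
have w0 : wd v = ord0 by apply: ord_inj; rewrite /= v0.
have w1 : Ordinal (isT : 1 < m.+2) = dfc (wd v) v.
by apply: ord_inj; rewrite dfE /= ltnn v0.
case: z z1 z2 z3 {Iz} => [a b] /= z1 z2 ->; congr pair.
apply: delta_eq => j; rewrite dcE /=.
have [_|j1] := eqVneq j ord0; first by rewrite -w0 z2.
rewrite w1; have := f_equal (fun u : delta _ _ => u v) z1; rewrite dcE => ->.
by apply: ord_inj; rewrite xv k0.
rewrite -!actM; congr (act _ _); apply: deltaP => j; rewrite !dcE dgE /= v0.
by case: eqP.
move=> i iv; set y := act (dfc i) z.
have [iv1|iv1] := eqVneq (nat_of_ord i) v.+1.
constructor 4; apply: proper_card; apply/properP; split.
apply/fintype.subsetP => j; rewrite !inE => /eqP yj; apply/eqP; rewrite -yj -z1 /=.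
have [jv|jv] := eqVneq j v.
move: yj; rewrite /y jv /= -/(dfc i v) (_ : dfc i v = wd v).
by rewrite z2; lia.
by apply: ord_inj; rewrite dfE iv1 /= ltnS leqnn.
congr (nat_of_ord (z.1 _)); apply: ord_inj; rewrite -!/(dfc _ _) !dfE /= iv1.
have {}jv : j <> v :> nat by move/ord_inj/eqP; rewrite (negbTE jv).
by case: ltnP => ?; case: ltnP => ?; lia.
exists v; rewrite !inE ?xv //; apply/eqP; rewrite /y /= -/(dfc i v).
rewrite (_ : dfc i v = wd v) ?z2; first by lia.
by apply: ord_inj; rewrite dfE iv1 /= ltnS leqnn.
have {}iv : i <> v :> nat by move=> e; apply: iv; apply: ord_inj.
case: m x nd nU ntI v fbv xv z Iz z1 z2 z3 i @y iv iv1 => [|m] x nd nU ntI v fbv xv z Iz z1 z2 z3 i y iv iv1.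
by move/eqP in iv1; have := ltn_ord i; have := ltn_ord v; lia.
move/eqP in iv1.
have i'P : (if i < v then i : nat else i.-1) < m.+2.
by have := ltn_ord i; have := ltn_ord v; case: ifP; lia.
have v'P : (if i < v then v.-1 else v : nat) < m.+1.
by have := ltn_ord i; have := ltn_ord v; case: ifP; lia.
have Iy : Ins (act (dfc (Ordinal i'P)) x) y (Ordinal v'P).
apply: (Ins_act Iz).
- apply: ord_inj; rewrite dfE /=; case: (ltnP i v) => h; case: ifP; lia.
- move=> j; apply: ord_inj; rewrite !dfE /=.
case: (ltnP i v) => h; [case: (ltnP j v.-1) => h1; case: (ltnP j i) => h2|case: (ltnP j v) => h1; case: (ltnP j i.-1) => h2]; do ?case: ifP => ?; lia.
- by apply: ord_inj; rewrite dfE /=; case: (ltnP i v) => h; case: ifP => ?; lia.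
- move=> j; rewrite dfE /=; case: (ltnP i v) => h; case: ifP => ?; lia.
have [Uy|nUy] := pselect (U y); first by constructor 1; apply/dG0.
have [ndy|] := pselect (nondeg y); last by constructor 2.
by constructor 3; apply: key Iy ndy nUy.
Qed.
End HornProduct.

(** By currying, a horn in the function complex is a map on the product of the horn with [K]; this
    is [horn_prod] with [A] empty. *)
Lemma quasi_fun (K X : sset) : quasicategory X -> quasicategory (sFun K X).
Proof.
move=> qX [|n] k /andP[k0 kn] h; first by case: k k0 kn h => [[|]].
pose V := sprod (simplex n.+1) K.
pose hs m (f : horn k m) (b : K m) := h m f m (b, did m).
have hs_act m l (t : delta l m) (f : horn k m) b : hs l (act t f) (act t b) = act t (hs m f b).
by rewrite /hs smapP /= -(smapP (h m f) t (b, did m)).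
have G0 : {G0 : partmap V X | forall m (x : V m) y, G0 m x y <->
exists p, hs m (exist _ x.1 p) x.2 = y}.
unshelve eexists.
refine (@Partmap V X (fun m x y => exists p, hs m (exist _ x.1 p) x.2 = y) _ _).
- move=> m l f x y [p <-]; have p' := svalP (act f (exist _ x.1 p : horn k l)).
exists p'; rewrite -hs_act; congr (hs m _ _); exact: sigE.
- by move=> m x y y' [p <-] [p' <-]; rewrite (pirr p p').
by [].
case: G0 => G0 G0E.
have [||||g gE] := @horn_prod X K n k (fun _ _ => False) qX _ _ G0; try by [].
- move=> m x; split.
by case=> y /G0E[[j [jk xj]] _]; left; exists j.
by case=> // [[j [jk xj]]]; eexists; apply/G0E; unshelve eexists; first by exists j.
- by left.
exists (@Smap (sprod K (simplex n.+1)) X (fun m x => g m (x.2, x.1))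
(fun m l t x => smapP g t (x.2, x.1))).
move=> m f; apply: smap_eq => l [b t] /=.
have := svalP (act t f); rewrite /= => p.
have -> : g l (dcomp (sval f) t, b) = hs l (act t f) b.
apply: gE; apply/G0E; exists p; congr (hs l _ b); exact: sigE.
by rewrite /hs smapP /=; congr (h m f l (b, _)); apply: delta_eq.
Qed.

(** * Equivalences, homotopy extension and pointwise equivalences *)

Lemma edge01_did : edge01 0 = did 1.
Proof. by apply: deltaP; case=> [[|[|]]]. Qed.
Definition edge_id (X : sset) (x : X 0) : X 1 := degenerate 1 x.

Lemma source_id (X : sset) (x : X 0) : source (edge_id x) = x.
Proof.
by rewrite /source /edge_id /degenerate -actM dconst_comp (_ : dconst 0 ord0 = did 0) ?act1 //;
apply: delta_eq => i; rewrite [LHS]ord1 [RHS]ord1.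
Qed.

Lemma target_id (X : sset) (x : X 0) : target (edge_id x) = x.
Proof.
by rewrite /target /edge_id /degenerate -actM dconst_comp (_ : dconst 0 ord0 = did 0) ?act1 //;
apply: delta_eq => i; rewrite [LHS]ord1 [RHS]ord1.
Qed.

Lemma edge_id_eqv (X : sset) (x : X 0) : is_equivalence (edge_id x).
Proof.
exists (edge_id x), (degenerate 2 x), (degenerate 2 x); rewrite source_id target_id.
by split; split; rewrite /edge_id /degenerate -actM; congr (act _ _); apply: delta_eq.
Qed.

Lemma smap_eqv (X Y : sset) (f : smap X Y) (e : X 1) :
 is_equivalence e -> is_equivalence (f 1 e).
Proof.
have ms s a b c : composite s a b c -> composite (f 2 s) (f 1 a) (f 1 b) (f 1 c).
by case=> <- <- <-; split; rewrite smapP.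
case=> [g [s [t [/ms c1 /ms c2]]]]; exists (f 1 g), (f 2 s), (f 2 t).
by move: c1 c2; rewrite /degenerate /source /target -!smapP.
Qed.

Section Triangles.
Variable X : sset.
Hypothesis qX : quasicategory X.

Definition tri (a b c : X 1) := exists s, composite s a b c.

(** Associativity of composition up to homotopy: the new triangle is the missing face of an inner
    3-horn, at 1 here and at 2 in [tri_assoc2]. *)
Lemma tri_assoc1 a b c ab bc abc :
 tri a b ab -> tri b c bc -> tri a bc abc -> tri ab c abc.
Proof.
move=> [t3 [h1 h2 h3]] [t0 [k1 k2 k3]] [t2 [l1 l2 l3]].
have [|||x [x0 x2 x3]] := @horn3_1 X t0 t2 t3 qX.
- by rewrite -d02E -d12E k3 l2.
- by rewrite -d01E -d12E k1 h2.
- by rewrite -d01E l1 h1.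
exists (act (dfc o1_4) x); split.
- by rewrite -h3 -x3 -!actM; congr (act _ _); apply: deltaP; case=> [[|[|]]].
- by rewrite -k2 -x0 -!actM; congr (act _ _); apply: deltaP; case=> [[|[|]]].
- by rewrite -l3 -x2 -!actM; congr (act _ _); apply: deltaP; case=> [[|[|]]].
Qed.

Lemma tri_assoc2 a b c ab bc abc :
 tri a b ab -> tri b c bc -> tri ab c abc -> tri a bc abc.
Proof.
move=> [t3 [h1 h2 h3]] [t0 [k1 k2 k3]] [t1 [l1 l2 l3]].
have [|||x [x0 x1 x3]] := @horn3_2 X t0 t1 t3 qX.
- by rewrite -d12E k2 l2.
- by rewrite -d01E -d12E k1 h2.
- by rewrite -d01E -d02E l1 h3.
exists (act (dfc o2_4) x); split.
- by rewrite -h1 -x3 -!actM; congr (act _ _); apply: deltaP; case=> [[|[|]]].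
- by rewrite -k3 -x0 -!actM; congr (act _ _); apply: deltaP; case=> [[|[|]]].
- by rewrite -l3 -x1 -!actM; congr (act _ _); apply: deltaP; case=> [[|[|]]].
Qed.

Lemma tri_1m (a : X 1) : tri (edge_id (source a)) a a.
Proof.
exists (act (ddeg ord0) a); split.
- by rewrite /edge_id /degenerate /source -!actM; congr (act _ _); apply: deltaP;
case=> [[|[|]]] // ?; rewrite !dcE dgE.
- by rewrite -[RHS]act1 -!actM; congr (act _ _); apply: deltaP;
case=> [[|[|]]] // ?; rewrite !dcE dgE.
- by rewrite -[RHS]act1 -!actM; congr (act _ _); apply: deltaP;
case=> [[|[|]]] // ?; rewrite !dcE dgE.
Qed.

Lemma tri_m1 (a : X 1) : tri a (edge_id (target a)) a.
Proof.
exists (act (ddeg ord_max) a); split.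
- by rewrite -[RHS]act1 -!actM; congr (act _ _); apply: deltaP;
case=> [[|[|]]] // ?; rewrite !dcE dgE.
- by rewrite /edge_id /degenerate /target -!actM; congr (act _ _); apply: deltaP;
case=> [[|[|]]] // ?; rewrite !dcE dgE.
- by rewrite -[RHS]act1 -!actM; congr (act _ _); apply: deltaP;
case=> [[|[|]]] // ?; rewrite !dcE dgE.
Qed.

Lemma tri_ends a b c : tri a b c ->
 [/\ source c = source a, target c = target b & target a = source b].
Proof.
by case=> s [<- <- <-]; rewrite /source /target -!actM; split; congr (act _ _);
apply: deltaP; case=> [[|]].
Qed.

Lemma is_eqvP (f : X 1) : is_equivalence f <->
 exists g, tri f g (edge_id (source f)) /\ tri g f (edge_id (target f)).
Proof.
split=> [[g [s [t [c1 c2]]]]|[g [[s c1] [t c2]]]]; last by exists g, s, t.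
by exists g; split; [exists s|exists t].
Qed.

(* A left inverse [g] and a right inverse [e'] of [e] are homotopic, and both
  are two-sided inverses. *)
Lemma tri_inv e g e' : tri e g (edge_id (source e)) ->
 tri e' e (edge_id (target e)) ->
 tri e e' (edge_id (source e)) /\ tri g e (edge_id (target e)).
Proof.
move=> eg e'e; have [_ tg se] := tri_ends eg; have [sf te _] := tri_ends e'e.
have [_ _ te'] := tri_ends e'e.
rewrite source_id in sf; rewrite target_id in tg.
have h1 : tri (edge_id (target e)) g e'.
by apply: (tri_assoc1 e'e eg); rewrite -te'; apply: tri_m1.
split; first by apply: (tri_assoc2 (tri_m1 e) h1 eg).
have gid : tri g (edge_id (source e)) e'.
apply: (tri_assoc1 _ _ h1); first by rewrite se; apply: tri_1m.
by rewrite tg; apply: tri_m1.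
exact: (tri_assoc2 gid (tri_1m e) e'e).
Qed.
End Triangles.

Lemma degenerate0 (X : sset) n (x : X 0) : act (dconst 0 ord0) (degenerate n x) = x.
Proof.
by rewrite /degenerate -actM dconst_comp (_ : dconst 0 ord0 = did 0) ?act1 //;
apply: delta_eq => i; rewrite [LHS]ord1 [RHS]ord1.
Qed.
Lemma act_deg (X : sset) m n (f : delta m n) (x : X 0) :
 act f (degenerate n x) = degenerate m x.
Proof. by rewrite /degenerate -actM dconst_comp. Qed.
Lemma smap_deg (X Y : sset) (f : smap X Y) n (x : X 0) :
 f n (degenerate n x) = degenerate n (f 0 x).
Proof. by rewrite /degenerate smapP. Qed.

Section HEP.
Variables (B X : sset) (A : forall m, B m -> Prop) (u : smap B X).
Hypotheses (qX : quasicategory X)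
 (Aact : forall m l (f : delta m l) b, A b -> A (act f b)).
Notation V := (sprod (simplex 1) B).
Variable H : partmap V X.
Hypotheses (dH : forall m (x : V m), pdom H x <-> A x.2)
 (H0 : forall m b y, H m (dconst m ord0, b) y -> y = u m b)
 (Heq : forall b : B 0, A b ->
 exists e, H 1 (did 1, degenerate 1 b) e /\ is_equivalence e).

(* Vertices outside [A] are moved along identities. *)
Lemma hep : exists h : smap V X,
 [/\ forall m x y, H m x y -> h m x = y,
   forall m b, h m (dconst m ord0, b) = u m b &
   forall b : B 0, is_equivalence (h 1 (did 1, degenerate 1 b))].
Proof.
pose A' m (b : B m) := A b \/ exists b0, ~ A b0 /\ b = degenerate m b0.
have A'act m l (f : delta m l) b : A' l b -> A' m (act f b).
case=> [/Aact h|[b0 [nb ->]]]; [by left|right].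
by exists b0; rewrite act_deg.
pose R m (x : V m) y := [\/ x.1 = dconst m ord0 /\ y = u m x.2, H m x y |
exists b0, [/\ ~ A b0, x.2 = degenerate m b0 & y = degenerate m (u 0 b0)]].
have R12 m (x : V m) y y' : x.1 = dconst m ord0 -> H m x y' -> y = u m x.2 -> y = y'.
by case: x => a b /= -> /H0 ->.
have R13 m (x : V m) y b0 y' : y = u m x.2 -> x.2 = degenerate m b0 -> y' = degenerate m (u 0 b0) -> y = y'.
by move=> -> -> ->; apply: smap_deg.
have R23 m (x : V m) y b0 : H m x y -> x.2 = degenerate m b0 -> A b0.
move=> h e; have /dH : pdom H x by exists y.
by rewrite e => /(Aact (dconst 0 ord0)); rewrite degenerate0.
have [G0 G0E] : {G0 : partmap V X | forall m x y, G0 m x y <-> R m x y}.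
unshelve eexists; first refine (@Partmap V X R _ _); last by [].
- move=> m n f x y [[h1 h2]|h|[b0 [h1 h2 h3]]].
+ by constructor 1; split; [rewrite /= h1; exact: delta_eq|rewrite h2 smapP].
+ by constructor 2; apply: prel_act.
+ by constructor 3; exists b0; rewrite /= h2 h3 !act_deg.
- move=> m x y y' [[h1 h2]|h|[b0 [h1 h2 h3]]] [[k1 k2]|k|[b1 [k1 k2 k3]]].
+ by rewrite h2 k2.
+ exact: R12 h1 k h2.
+ exact: R13 h2 k2 k3.
+ exact/esym/(R12 _ _ _ _ k1 h k2).
+ exact: prel_fun h k.
+ by case: k1; apply: R23 h k2.
+ exact/esym/(R13 _ _ _ _ _ k2 h2 h3).
+ by case: h1; apply: R23 k h2.
+ by rewrite h3 k3 -(degenerate0 m b0) -(degenerate0 m b1) -h2 -k2.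
have [|||h hE] := @horn_prod X B 0 ord0 A' qX A'act _ G0.
- by [].
- move=> m x; split.
case=> y /G0E[[h1 h2]|h|[b0 [h1 h2 h3]]].
+ by left; exists ord_max; split=> // i; rewrite h1.
+ by right; left; apply/dH; exists y.
+ by right; right; exists b0.
case=> [[j [j0 xj]]|[/dH[y h]|[b0 [h1 h2]]]].
+ exists (u m x.2); apply/G0E; constructor 1; split=> //; apply: delta_eq => i.
apply: ord_inj; have := xj i; have := ltn_ord (x.1 i); have := ltn_ord j.
have {}j0 : j <> 0 :> nat by move=> e; apply: j0; apply: ord_inj.
move=> l1 l2 ne; have {}ne : x.1 i <> j :> nat by move/ord_inj.
move: l1 l2 ne j0; rewrite /=; move: (nat_of_ord (x.1 i)) (nat_of_ord j) => a c.
by move: a c => [|[|?]] [|[|?]].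
+ by exists y; apply/G0E; constructor 2.
+ by exists (degenerate m (u 0 b0)); apply/G0E; constructor 3; exists b0.
- right; split=> // b; have [/Heq[e [h1 h2]]|nb] := pselect (A b).
by exists e; split=> //; apply/G0E; constructor 2; rewrite edge01_did.
exists (degenerate 1 (u 0 b)); split; last exact: edge_id_eqv.
by apply/G0E; constructor 3; exists b.
exists h; split=> [m x y h1|m b|b].
- by apply: hE; apply/G0E; constructor 2.
- by apply: hE; apply/G0E; constructor 1.
have [/Heq[e [h1 h2]]|nb] := pselect (A b).
by rewrite (hE 1 (did 1, degenerate 1 b) e) //; apply/G0E; constructor 2.
rewrite (hE 1 (did 1, degenerate 1 b) (degenerate 1 (u 0 b))); first exact: edge_id_eqv.
by apply/G0E; constructor 3; exists b.
Qed.
End HEP.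

Definition seval (B X : sset) (b : B 0) : smap (sFun B X) X.
Proof.
refine (@Smap (sFun B X) X (fun n (s : smap (sprod B (simplex n)) X) =>
s n (degenerate n b, did n)) _).
move=> m n f s /=; rewrite -smapP /= act_deg; congr (s m (_, _)); exact: delta_eq.
Defined.
Lemma smap_tri (X Y : sset) (f : smap X Y) a b c :
 tri a b c -> tri (f 1 a) (f 1 b) (f 1 c).
Proof. by case=> s [<- <- <-]; exists (f 2 s); split; rewrite smapP. Qed.
Lemma smap_source (X Y : sset) (f : smap X Y) e : source (f 1 e) = f 0 (source e).
Proof. by rewrite /source smapP. Qed.
Lemma smap_target (X Y : sset) (f : smap X Y) e : target (f 1 e) = f 0 (target e).
Proof. by rewrite /target smapP. Qed.

Section Pointwise.
Variables (B X : sset).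
Hypothesis qX : quasicategory X.

Definition pw_eqv (e : sFun B X 1) := forall b : B 0, is_equivalence (seval X b 1 e).

(** Over all of [B] at once, fill the outer horn with [e] on the edge 01 and an identity on 02; at
    each vertex of [B] its first edge is an equivalence. *)
Lemma pw_left_inv (e : sFun B X 1) : pw_eqv e ->
 exists g, tri e g (edge_id (source e)).
Proof.
(* [p] sends 0, 1, 2 to 0, 1, 1, so that [e] pulled back along it restricts to [e] on the edge
   01. *)
move=> pw; pose p : delta 2 1 := ddeg ord_max; pose V := sprod (simplex 2) B.
have pE (i : 'I_3) : p i = (if i <= 1 then i : nat else i.-1) :> nat by rewrite dgE.
pose R m (x : V m) y := ((forall i, x.1 i <> ord_max) /\ y = e m (x.2, dcomp p x.1)) \/
((forall i, x.1 i <> o1_3) /\ y = e m (x.2, dconst m ord0)).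
have R12 m (x : V m) : (forall i, x.1 i <> ord_max) -> (forall i, x.1 i <> o1_3) ->
dcomp p x.1 = dconst m ord0.
move=> h1 h2; apply: deltaP => i; rewrite dcE pE /=.
have h3 : x.1 i <> 2 :> nat by move=> h; apply: (h1 i); apply: ord_inj.
have h4 : x.1 i <> 1 :> nat by move=> h; apply: (h2 i); apply: ord_inj.
have := ltn_ord (x.1 i); move: h3 h4; move: (nat_of_ord (x.1 i)) => a.
by move: a => [|[|[|?]]].
have [G0 G0E] : {G0 : partmap V X | forall m x y, G0 m x y <-> R m x y}.
unshelve eexists; first refine (@Partmap V X R _ _); last by [].
- move=> m n f x y [[h1 ->]|[h1 ->]]; [left|right].
+ by split=> [i|]; [apply: h1|rewrite -smapP].
+ by split=> [i|]; [apply: h1|rewrite -smapP /= dconst_comp].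
- move=> m x y y' [[h1 ->]|[h1 ->]] [[k1 ->]|[k1 ->]] //; first by rewrite R12.
by rewrite R12.
have [||||h hE] := @horn_prod X B 1 ord0 (fun _ _ => False) qX _ _ G0; try by [].
- move=> m x; split.
case=> y /G0E[[h1 _]|[h1 _]]; left; first by exists ord_max.
by exists o1_3.
case=> // [[j [j0 xj]]]; move: j j0 xj; apply: ord3P => // _ xj.
by eexists; apply/G0E; right.
by eexists; apply/G0E; left.
- right; split=> // b; exists (e 1 (degenerate 1 b, did 1)); split; last exact: pw.
apply/G0E; left; split; first by case=> [[|[|]]].
by congr (e 1 (_, _)); apply: deltaP; case=> [[|[|]]] // i; rewrite dcE pE.
pose s : sFun B X 2 := @Smap (sprod B (simplex 2)) X (fun m x => h m (x.2, x.1))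
(fun m l t x => smapP h t (x.2, x.1)).
exists (act d12 s), s; split=> //.
- apply: smap_eq => m [b t] /=; apply: hE; apply/G0E; left; split.
by move=> i; rewrite /=; case: ifP.
congr (e m (b, _)); apply: deltaP => i; rewrite !dcE pE /=.
by case: (t i) => [[|[|]]].
apply: smap_eq => m [b t] /=; apply: hE; apply/G0E; right; split.
by move=> i; rewrite /=; case: ifP.
by congr (e m (b, _)); apply: deltaP.
Qed.

(** The left inverse [g] is again pointwise invertible and so has a left inverse too; having
    inverses on both sides, [g] is inverse to [e]. *)
Lemma pw_is_eqv (e : sFun B X 1) : pw_eqv e -> is_equivalence e.
Proof.
move=> pw; have qF := @quasi_fun B X qX.
have [g eg] := pw_left_inv pw; have [s1 t1 se] := tri_ends eg.
have [|h gh] := @pw_left_inv g.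
move=> b; have [e' [h1 h2]] := (is_eqvP _).1 (pw b).
have := smap_tri (seval X b) eg.
rewrite (smap_deg (seval X b)) -(smap_source (seval X b)) -/(edge_id _) => h3.
have [_ k2] := tri_inv qX h3 h2; have [l1 l2 l3] := tri_ends h3.
apply/is_eqvP; exists (seval X b 1 e); split; first by rewrite -l3.
by rewrite -l2 target_id.
have [_ t2 sg] := tri_ends gh.
apply/is_eqvP; exists g; split=> //.
by rewrite se; apply: (tri_inv qF gh _).1; rewrite -t1 target_id.
Qed.
End Pointwise.

Lemma eqv_inv (X : sset) (e : X 1) : is_equivalence e ->
 exists g : X 1, [/\ is_equivalence g, source g = target e & target g = source e].
Proof.
case=> [g [s [t [c1 c2]]]].
have [_ h1 h2] := tri_ends (ex_intro _ s c1).
have h1' : target g = source e by rewrite -h1 target_id.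
exists g; split=> //; exists e, t, s; rewrite -h2 h1'; split=> //.
Qed.

(** * Order proofs in SProp and isomorphisms in pre-additive categories *)

Inductive sbox (S : SProp) : Type := SBox of S.

(* [unbox (SBox h)] and [h] are convertible, so functions out of a strict
  proposition inherit extensionality from [sbox]. *)
Lemma sfunext (S : SProp) (X : S -> Type) (f g : forall h, X h) :
 (forall h, f h = g h) -> f = g.
Proof.
move=> e; pose un (t : sbox S) : S := match t with SBox h => h end.
have E : (fun t => f (un t)) = (fun t => g (un t)).
by apply: dfext => t; apply: e.
exact: (f_equal (fun F : (forall t, X (un t)) => fun h : S => F (SBox h)) E).
Qed.
(** Proofs of a strict proposition are convertible. With the order taken in SProp, the action on
    pseudofunctors is functorial by computation, and the simplicial identities of [D2] hold by
    reflexivity. *)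
Definition sle (i j : nat) : SProp := if i <= j then sUnit else sEmpty.

Definition sle_of i j (h : i <= j) : sle i j :=
 match esym h in _ = c return (if c then sUnit else sEmpty) with erefl => stt end.

Lemma of_sle i j : sle i j -> i <= j.
Proof. by rewrite /sle; case: leqP => // _ []. Qed.
Definition smono m n (f : delta m n) (i j : 'I_m.+1) (h : sle i j) : sle (f i) (f j) :=
 sle_of (dmono f (of_sle h)).

Section Isos.
Variable A : preadd.

(** The comparison isomorphism carried by an equality of objects; strictly functorial composites
    enter pseudofunctors through it. *)
Definition idc (x y : A) (e : x = y) : phom x y :=
 match e with erefl => pid x end.

Lemma idc_id (x : A) (e : x = x) : idc e = pid x.
Proof. by rewrite (pirr e erefl). Qed.
Lemma idc_cmp (x y z : A) (e : x = y) (e' : y = z) (e'' : x = z) :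
 pcmp (idc e') (idc e) = idc e''.
Proof. by subst y z; rewrite !idc_id pcmp1m. Qed.

Lemma p_iso_epi (x y z : A) (f : phom x y) (g h : phom y z) : p_iso f ->
 pcmp g f = pcmp h f -> g = h.
Proof.
by case=> f' [_ e] E; rewrite -(pcmpm1 g) -(pcmpm1 h) -e !pcmpA E.
Qed.

Lemma iso_mono (x y z : A) (f : phom y z) (g h : phom x y) : p_iso f ->
 pcmp f g = pcmp f h -> g = h.
Proof.
by case=> f' [e _] E; rewrite -(pcmp1m g) -(pcmp1m h) -e -!pcmpA E.
Qed.
Definition pinv (x y : A) (f : phom x y) (h : p_iso f) : phom y x := sval (cid h).

Lemma pinvP (x y : A) (f : phom x y) (h : p_iso f) : p_inverse f (pinv h).
Proof. exact: svalP (cid h). Qed.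
Lemma pinv_l (x y : A) (f : phom x y) (h : p_iso f) : pcmp (pinv h) f = pid x.
Proof. by case: (pinvP h). Qed.
Lemma pinv_r (x y : A) (f : phom x y) (h : p_iso f) : pcmp f (pinv h) = pid y.
Proof. by case: (pinvP h). Qed.
End Isos.

Lemma pfmor_idc (A B : preadd) (F : pfunctor A B) (x y : A) (e : x = y) (e' : F x = F y) :
 pfmor F (idc e) = idc e'.
Proof. by subst y; rewrite !idc_id pfmor1. Qed.
Lemma pfmor_inv (A B : preadd) (F : pfunctor A B) (x y : A) (f : phom x y) g :
 p_inverse f g -> p_inverse (pfmor F f) (pfmor F g).
Proof. by case=> h1 h2; split; rewrite -pfmorM ?h1 ?h2 pfmor1. Qed.
Lemma pfmor_iso (A B : preadd) (F : pfunctor A B) (x y : A) (f : phom x y) :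
 p_iso f -> p_iso (pfmor F f).
Proof. by case=> g /(pfmor_inv F) h; exists (pfmor F g). Qed.
Lemma p_iso_id (A : preadd) (x : A) : p_iso (pid x).
Proof. by exists (pid x); split; rewrite pcmp1m. Qed.

Lemma p_iso_cmp (A : preadd) (x y z : A) (g : phom y z) (f : phom x y) :
 p_iso g -> p_iso f -> p_iso (pcmp g f).
Proof.
case=> g' [a b] [f' [c d]]; exists (pcmp f' g'); split.
by rewrite -pcmpA (pcmpA g') a pcmp1m.
by rewrite -pcmpA (pcmpA f) d pcmp1m.
Qed.
Lemma p_iso_inv (A : preadd) (x y : A) (f : phom x y) g : p_inverse f g -> p_iso g.
Proof. by case=> a b; exists f. Qed.
Lemma marked_idc (A : mpreadd) (x y : A) (e : x = y) : marked (idc e).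
Proof. by subst y; apply: marked_id. Qed.
Lemma mk_pinv (A : mpreadd) (x y : A) (f : phom x y) (h : p_iso f) :
 marked f -> marked (pinv h).
Proof. by move=> m; apply: marked_inv m (pinvP h). Qed.

(* [cob false] and [cob true] stand for marked pre-additive categories and for
  pre-additive categories, the latter carrying the maximal marking. *)
Record cob (b : bool) := Cob {
 cm :> mpreadd;
 cob_all : b -> forall (x y : cm) (f : phom x y), p_iso f -> marked f }.

Definition Cb (b : bool) : category.
Proof.
refine (@Category (cob b) (fun A B => mpfunctor A B) (fun A => mpfunctor_id A)
(fun A B C F H => mpfunctor_comp F H) _ _ _).
- by move=> *; apply: mpfunctor_eq; apply: pfunctor_eq.
- by move=> *; apply: mpfunctor_eq; apply: pfunctor_eq.
- by move=> *; apply: mpfunctor_eq; apply: pfunctor_eq.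
Defined.

(** * The simplicial set of pseudofunctors *)

Section Duskin.
Variable b : bool.
Notation cob := (cob b).

(* Normalized pseudofunctors from [n] to the (2,1)-category of (marked)
  pre-additive categories, functors and (marked) natural isomorphisms. *)
Record d2 (n : nat) := D2s {
 dA : 'I_n.+1 -> cob;
 dF : forall i j : 'I_n.+1, sle i j -> mpfunctor (dA i) (dA j);
 dphi : forall (i j k : 'I_n.+1) (ij : sle i j) (jk : sle j k) (ik : sle i k)
  (a : dA i), phom (dF jk (dF ij a)) (dF ik a);
 dphi_marked : forall (i j k : 'I_n.+1) (ij : sle i j) (jk : sle j k) (ik : sle i k) a,
  marked (dphi ij jk ik a);
 dphi_nat : forall (i j k : 'I_n.+1) (ij : sle i j) (jk : sle j k) (ik : sle i k) a a'
  (f : phom a a'),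
  pcmp (dphi ij jk ik a') (pfmor (dF jk) (pfmor (dF ij) f)) =
  pcmp (pfmor (dF ik) f) (dphi ij jk ik a);
 dF1 : forall (i : 'I_n.+1) (ii : sle i i), dF ii = mpfunctor_id (dA i);
 dphi1l : forall (i k : 'I_n.+1) (ii : sle i i) (ik : sle i k) a (e : dF ik (dF ii a) = dF ik a),
  dphi ii ik ik a = idc e;
 dphi1r : forall (i k : 'I_n.+1) (kk : sle k k) (ik : sle i k) a (e : dF kk (dF ik a) = dF ik a),
  dphi ik kk ik a = idc e;
 dcoc : forall (i j k l : 'I_n.+1) (ij : sle i j) (jk : sle j k) (kl : sle k l) (ik : sle i k)
  (jl : sle j l) (il : sle i l) a,
  pcmp (dphi ik kl il a) (pfmor (dF kl) (dphi ij jk ik a)) =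
  pcmp (dphi ij jl il a) (dphi jk kl jl (dF ij a)) }.

Arguments dA {n}.
Arguments dF {n} x {i j} ij : rename.
Arguments dphi {n} x {i j k} ij jk ik a : rename.
Arguments dphi_marked {n} x {i j k} ij jk ik a : rename.
Arguments dphi_nat {n} x {i j k} ij jk ik {a a'} f : rename.
Arguments dF1 {n} x {i} ii : rename.
Arguments dphi1l {n} x {i k} ii ik {a} e : rename.
Arguments dphi1r {n} x {i k} kk ik {a} e : rename.
Arguments dcoc {n} x {i j k l} ij jk kl ik jl il a : rename.

Definition d2_act m n (f : delta m n) (x : d2 n) : d2 m :=
 @D2s m (fun i => dA x (f i)) (fun i j h => dF x (smono f h))
  (fun i j k ij jk ik a => dphi x (smono f ij) (smono f jk) (smono f ik) a)
  (fun i j k ij jk ik a => dphi_marked x _ _ _ a)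
  (fun i j k ij jk ik a a' g => dphi_nat x _ _ _ g)
  (fun i ii => dF1 x _)
  (fun i k ii ik a e => dphi1l x _ _ e)
  (fun i k kk ik a e => dphi1r x _ _ e)
  (fun i j k l ij jk kl ik jl il a => dcoc x _ _ _ _ _ _ a).

Definition D2 : sset :=
 @SSet d2 d2_act (fun _ _ => erefl) (fun _ _ _ _ _ _ => erefl).

(** Functors and 2-cells are bundled with their categories, so that data of two simplices can be
    compared by plain equality, without transport along equalities of categories. *)
Record arr := Arr { aS : cob; aT : cob; aF : mpfunctor aS aT }.
Definition arr1 (A : cob) : arr := Arr (mpfunctor_id A : mpfunctor A A).

Record cell := Cell { cS : cob; cM : cob; cT : cob;
 cF : mpfunctor cS cM; cG : mpfunctor cM cT; cH : mpfunctor cS cT;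
 cphi : forall a : cS, phom (cG (cF a)) (cH a) }.

Arguments cphi : clear implicits.

Definition goodc (c : cell) :=
 (forall a, marked (cphi c a)) /\
 (forall a a' (f : phom a a'), pcmp (cphi c a') (pfmor (cG c) (pfmor (cF c) f)) =
   pcmp (pfmor (cH c) f) (cphi c a)).

Definition cell_bd (c : cell) (f g h : arr) :=
 [/\ Arr (cF c) = f, Arr (cG c) = g & Arr (cH c) = h].

(** The cocycle condition of a tetrahedron as a relation between bundled cells: it can be rewritten
    along equalities of cells, and the matching of their boundaries is built into the
    constructor. *)
Inductive tet : cell -> cell -> cell -> cell -> Prop :=
| Tet (A0 A1 A2 A3 : cob) (F01 : mpfunctor A0 A1) (F12 : mpfunctor A1 A2)
  (F23 : mpfunctor A2 A3) (F02 : mpfunctor A0 A2) (F13 : mpfunctor A1 A3)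
  (F03 : mpfunctor A0 A3)
  (p012 : forall a, phom (F12 (F01 a)) (F02 a))
  (p023 : forall a, phom (F23 (F02 a)) (F03 a))
  (p013 : forall a, phom (F13 (F01 a)) (F03 a))
  (p123 : forall a, phom (F23 (F12 a)) (F13 a)) :
 (forall a, pcmp (p023 a) (pfmor F23 (p012 a)) = pcmp (p013 a) (p123 (F01 a))) ->
 tet (Cell p012) (Cell p023) (Cell p013) (Cell p123).

Lemma arr_inj (A B : cob) (F G : mpfunctor A B) : Arr F = Arr G -> F = G.
Proof. by move=> e; injection e => E; do 2 apply inj_pair2 in E. Qed.

Lemma cell_inj (A B C : cob) (F : mpfunctor A B) (G : mpfunctor B C) (H : mpfunctor A C)
 (p q : forall a : A, phom (G (F a)) (H a)) : Cell p = Cell q -> p = q.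
Proof.
by move=> e; injection e => E; do 6 apply inj_pair2 in E.
Qed.
Definition farr n (x : d2 n) (i j : 'I_n.+1) (h : sle i j) : arr := Arr (dF x h).
Definition fcell n (x : d2 n) (i j k : 'I_n.+1) (ij : sle i j) (jk : sle j k) (ik : sle i k) :
 cell := Cell (dphi x ij jk ik).

Lemma d2_extF n (x y : d2 n) : (forall i, dA x i = dA y i) ->
 (forall (i j : 'I_n.+1) (h : sle i j), farr x h = farr y h) ->
 (forall (i j k : 'I_n.+1) (ij : sle i j) (jk : sle j k) (ik : sle i k),
   fcell x ij jk ik = fcell y ij jk ik) -> x = y.
Proof.
case: x => A F p p1 p2 p3 p4 p5 p6; case: y => A' F' p' q1 q2 q3 q4 q5 q6.
rewrite /farr /fcell /= => eA eF ep.
have E : A = A' by apply: fext.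
subst A'; have E : F = F'.
apply: dfext => i; apply: dfext => j.
by apply: sfunext => h; apply: arr_inj.
subst F'; have E : p = p'.
do 3 (apply: dfext => ?).
by do 3 (apply: sfunext => ?); apply: cell_inj.
by subst p'; f_equal; apply: proof_irrelevance.
Qed.
Definition idcl (f : arr) : cell :=
 @Cell (aS f) (aS f) (aT f) (mpfunctor_id (aS f)) (aF f) (aF f) (fun a => pid (aF f a)).
Definition idcr (f : arr) : cell :=
 @Cell (aS f) (aT f) (aT f) (aF f) (mpfunctor_id (aT f)) (aF f) (fun a => pid (aF f a)).

Lemma fcell_l n (x : d2 n) (i k : 'I_n.+1) (ii : sle i i) (ik : sle i k) :
 fcell x ii ik ik = idcl (farr x ik).
Proof.
have : forall F : mpfunctor (dA x i) (dA x i), F = mpfunctor_id (dA x i) ->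
forall p : (forall a, phom (dF x ik (F a)) (dF x ik a)),
(forall a (e : dF x ik (F a) = dF x ik a), p a = idc e) ->
Cell p = idcl (farr x ik).
move=> F -> p h; rewrite /idcl /=; congr Cell.
by apply: dfext => a; rewrite (h a erefl).
move=> /(_ _ (dF1 x ii)); apply=> a e; exact: dphi1l.
Qed.

Lemma fcell_r n (x : d2 n) (i k : 'I_n.+1) (kk : sle k k) (ik : sle i k) :
 fcell x ik kk ik = idcr (farr x ik).
Proof.
have : forall F : mpfunctor (dA x k) (dA x k), F = mpfunctor_id (dA x k) ->
forall p : (forall a, phom (F (dF x ik a)) (dF x ik a)),
(forall a (e : F (dF x ik a) = dF x ik a), p a = idc e) ->
Cell p = idcr (farr x ik).
move=> F -> p h; rewrite /idcr /=; congr Cell.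
by apply: dfext => a; rewrite (h a erefl).
move=> /(_ _ (dF1 x kk)); apply=> a e; exact: dphi1r.
Qed.
Lemma farr_id n (x : d2 n) (i : 'I_n.+1) (ii : sle i i) : farr x ii = arr1 (dA x i).
Proof. by rewrite /farr dF1. Qed.
Lemma fcell_good n (x : d2 n) (i j k : 'I_n.+1) (ij : sle i j) (jk : sle j k) (ik : sle i k) :
 goodc (fcell x ij jk ik).
Proof. by split=> [a|a a' f]; [apply: dphi_marked|apply: dphi_nat]. Qed.

Lemma ftet n (x : d2 n) (i j k l : 'I_n.+1) (ij : sle i j) (jk : sle j k) (kl : sle k l)
  (ik : sle i k) (jl : sle j l) (il : sle i l) :
 tet (fcell x ij jk ik) (fcell x ik kl il) (fcell x ij jl il) (fcell x jk kl jl).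
Proof. by constructor=> a; apply: dcoc. Qed.

(* Only strictly increasing chains of vertices matter. *)
Lemma d2_ext n (x y : d2 n) : (forall i, dA x i = dA y i) ->
 (forall (i j : 'I_n.+1) (h : sle i j), i < j -> farr x h = farr y h) ->
 (forall (i j k : 'I_n.+1) (ij : sle i j) (jk : sle j k) (ik : sle i k), i < j < k ->
   fcell x ij jk ik = fcell y ij jk ik) -> x = y.
Proof.
move=> eA eF ep.
have eF' (i j : 'I_n.+1) (h : sle i j) : farr x h = farr y h.
have := of_sle h; rewrite leq_eqVlt => /orP[/eqP/ord_inj ij|]; last exact: eF.
by subst j; rewrite !farr_id eA.
apply: d2_extF => // i j k ij jk ik.
have := of_sle ij; rewrite leq_eqVlt => /orP[/eqP/ord_inj e|lij].
by subst j; rewrite !fcell_l eF'.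
have := of_sle jk; rewrite leq_eqVlt => /orP[/eqP/ord_inj e|ljk].
by subst k; rewrite !fcell_r eF'.
by apply: ep; rewrite lij.
Qed.
End Duskin.
Arguments dA {b n}.
Arguments dF {b n} x {i j} ij : rename.
Arguments dphi {b n} x {i j k} ij jk ik a : rename.
Arguments dphi_marked {b n} x {i j k} ij jk ik a : rename.
Arguments dphi_nat {b n} x {i j k} ij jk ik {a a'} f : rename.
Arguments dF1 {b n} x {i} ii : rename.
Arguments dphi1l {b n} x {i k} ii ik {a} e : rename.
Arguments dphi1r {b n} x {i k} kk ik {a} e : rename.
Arguments dcoc {b n} x {i j k l} ij jk kl ik jl il a : rename.
Arguments cphi {b} c a : rename.

(** * Simplices of [D2] and maps into it from low-dimensional data *)

Section DuskinBuild.
Variable b : bool.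
Notation cob := (cob b).
Notation arr := (arr b).
Notation cell := (cell b).
Notation d2 := (d2 b).

Definition castF (f : arr) (A B : cob) (p : aS f = A) (q : aT f = B) : mpfunctor A B :=
 match p in _ = A', q in _ = B' return mpfunctor A' B' with erefl, erefl => aF f end.

Lemma castFE (f : arr) (A B : cob) (p : aS f = A) (q : aT f = B) : Arr (castF p q) = f.
Proof. by subst A B. Qed.

Lemma cellP (A B C : cob) (F : mpfunctor A B) (G : mpfunctor B C) (H : mpfunctor A C) c :
 cell_bd c (Arr F) (Arr G) (Arr H) -> exists p : (forall a, phom (G (F a)) (H a)), Cell p = c.
Proof.
case: c => A' B' C' F' G' H' p [/= eF eG eH].
injection eF => _ eB eA; injection eG => _ eC _; subst A' B' C'.
by move: eF eG eH => /arr_inj eF /arr_inj eG /arr_inj eH; subst F' G' H'; exists p.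
Qed.

(** Inverts the bundled relation: once the categories and functors are fixed, equal bundled cells
    have equal components, by injectivity of dependent pairs. *)
Lemma tet_inv (A0 A1 A2 A3 : cob) (F01 : mpfunctor A0 A1) (F12 : mpfunctor A1 A2)
  (F23 : mpfunctor A2 A3) (F02 : mpfunctor A0 A2) (F13 : mpfunctor A1 A3)
  (F03 : mpfunctor A0 A3)
  (p012 : forall a, phom (F12 (F01 a)) (F02 a))
  (p023 : forall a, phom (F23 (F02 a)) (F03 a))
  (p013 : forall a, phom (F13 (F01 a)) (F03 a))
  (p123 : forall a, phom (F23 (F12 a)) (F13 a)) :
 tet (Cell p012) (Cell p023) (Cell p013) (Cell p123) ->
 forall a, pcmp (p023 a) (pfmor F23 (p012 a)) = pcmp (p013 a) (p123 (F01 a)).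
Proof.
move: {-1}(Cell p012) {-1}(Cell p023) {-1}(Cell p013) {-1}(Cell p123)
(erefl (Cell p012)) (erefl (Cell p023)) (erefl (Cell p013)) (erefl (Cell p123)).
move=> c0 c1 c2 c3 e0 e1 e2 e3 t.
case: t e0 e1 e2 e3 => B0 B1 B2 B3 G01 G12 G23 G02 G13 G03 q012 q023 q013 q123 h.
move=> e0 e1 e2 e3.
have a01 := f_equal (fun c => Arr (cF c)) e0; have a12 := f_equal (fun c => Arr (cG c)) e0.
have a02 := f_equal (fun c => Arr (cH c)) e0; have a23 := f_equal (fun c => Arr (cG c)) e1.
have a03 := f_equal (fun c => Arr (cH c)) e1; have a13 := f_equal (fun c => Arr (cG c)) e2.
move: a01 a12 a02 a23 a03 a13 => /= a01 a12 a02 a23 a03 a13.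
injection a01 => _ x1 x0; injection a23 => _ x3 x2; subst B0 B1 B2 B3.
move: a01 a12 a02 a23 a03 a13 => /arr_inj a01 /arr_inj a12 /arr_inj a02 /arr_inj a23 /arr_inj a03 /arr_inj a13.
subst G01 G12 G02 G23 G03 G13.
move: e0 e1 e2 e3 => /cell_inj e0 /cell_inj e1 /cell_inj e2 /cell_inj e3.
by subst q012 q023 q013 q123.
Qed.

Lemma id_cell_l_inv (A C : cob) (F : mpfunctor A A) (H : mpfunctor A C)
 (p : forall a, phom (H (F a)) (H a)) : F = mpfunctor_id A ->
 Cell p = idcl (Arr H) -> forall a (e : H (F a) = H a), p a = idc e.
Proof. by move=> eF; subst F => /cell_inj -> a e; rewrite idc_id. Qed.

Lemma id_cell_r_inv (A C : cob) (F : mpfunctor C C) (H : mpfunctor A C)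
 (p : forall a, phom (F (H a)) (H a)) : F = mpfunctor_id C ->
 Cell p = idcr (Arr H) -> forall a (e : F (H a) = H a), p a = idc e.
Proof. by move=> eF; subst F => /cell_inj -> a e; rewrite idc_id. Qed.

(** The bundled data are unpacked by casts, and boolean order proofs are turned into strict ones;
    proof irrelevance makes both changes harmless. *)
Lemma d2_build n (ob : 'I_n.+1 -> cob)
 (ar : forall i j : 'I_n.+1, i <= j -> arr)
 (ce : forall i j k : 'I_n.+1, i <= j -> j <= k -> cell) :
 (forall (i : 'I_n.+1) (h : i <= i), ar i i h = arr1 (ob i)) ->
 (forall (i j : 'I_n.+1) (h : i <= j), aS (ar i j h) = ob i /\ aT (ar i j h) = ob j) ->
 (forall (i j k : 'I_n.+1) (ij : i <= j) (jk : j <= k) (ik : i <= k),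
   goodc (ce i j k ij jk) /\ cell_bd (ce i j k ij jk) (ar i j ij) (ar j k jk) (ar i k ik)) ->
 (forall (i k : 'I_n.+1) (ii : i <= i) (ik : i <= k), ce i i k ii ik = idcl (ar i k ik)) ->
 (forall (i k : 'I_n.+1) (ik : i <= k) (kk : k <= k), ce i k k ik kk = idcr (ar i k ik)) ->
 (forall (i j k l : 'I_n.+1) (ij : i <= j) (jk : j <= k) (kl : k <= l) (ik : i <= k) (jl : j <= l),
   tet (ce i j k ij jk) (ce i k l ik kl) (ce i j l ij jl) (ce j k l jk kl)) ->
 exists x : d2 n, [/\ forall i, dA x i = ob i,
  forall (i j : 'I_n.+1) (h : i <= j), farr x (sle_of h) = ar i j h &
  forall (i j k : 'I_n.+1) (ij : i <= j) (jk : j <= k) (ik : i <= k),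
   fcell x (sle_of ij) (sle_of jk) (sle_of ik) = ce i j k ij jk].
Proof.
move=> h1 h2 h3 h4 h5 h6.
pose F (i j : 'I_n.+1) (h : sle i j) : mpfunctor (ob i) (ob j) :=
castF (h2 i j (of_sle h)).1 (h2 i j (of_sle h)).2.
have FE (i j : 'I_n.+1) (h : sle i j) : Arr (F i j h) = ar i j (of_sle h) by apply: castFE.
have pE (i j k : 'I_n.+1) (ij : sle i j) (jk : sle j k) (ik : sle i k) :
exists p : (forall a, phom (F j k jk (F i j ij a)) (F i k ik a)),
Cell p = ce i j k (of_sle ij) (of_sle jk).
by apply: cellP; rewrite !FE; case: (h3 i j k (of_sle ij) (of_sle jk) (of_sle ik)).
pose p i j k ij jk ik := sval (cid (pE i j k ij jk ik)).
have pE' (i j k : 'I_n.+1) (ij : sle i j) (jk : sle j k) (ik : sle i k) :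
Cell (p i j k ij jk ik) = ce i j k (of_sle ij) (of_sle jk).
exact: svalP (cid (pE i j k ij jk ik)).
have good i j k ij jk ik : goodc (Cell (p i j k ij jk ik)).
by rewrite pE'; case: (h3 i j k (of_sle ij) (of_sle jk) (of_sle ik)).
have F1 i ii : F i i ii = mpfunctor_id (ob i) by apply: arr_inj; rewrite FE h1.
unshelve eexists.
apply: (@D2s b n ob F p).
- by move=> i j k ij jk ik; case: (good i j k ij jk ik).
- by move=> i j k ij jk ik; case: (good i j k ij jk ik).
- exact: F1.
- by move=> i k ii ik; apply: id_cell_l_inv => //; rewrite pE' FE h4.
- by move=> i k ii ik; apply: id_cell_r_inv => //; rewrite pE' FE h5.
- by move=> i j k l ij jk kl ik jl il; apply: tet_inv; rewrite !pE'.
split=> //.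
- move=> i j h; rewrite /farr /= FE; congr ar; exact: pirr.
- move=> i j k ij jk ik; rewrite /fcell /= pE'; congr ce; exact: pirr.
Qed.

Definition dtri n (i j k : 'I_n.+1) (ij : i <= j) (jk : j <= k) : delta 2 n.
Proof.
refine (@Delta 2 n (fun c => match val c with 0 => i | 1 => j | _ => k end) _).
by case=> [[|[|c]] hc] [[|[|d]] hd] //= _; apply: leq_trans ij jk.
Defined.
Definition ob_of (y : d2 0) : cob := dA y ord0.
Definition ar_of (y : d2 1) : arr := @farr b 1 y ord0 ord_max stt.
Definition ce_of (y : d2 2) : cell := @fcell b 2 y ord0 o1_3 ord_max stt stt stt.

Lemma ob_ofE n (x : D2 b n) i : ob_of (act (dconst 0 i) x) = dA x i.
Proof. by []. Qed.
Lemma farr_eq n (x : d2 n) (i j i' j' : 'I_n.+1) (h : sle i j) (h' : sle i' j') :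
 i = i' -> j = j' -> farr x h = farr x h'.
Proof. by move=> ? ?; subst. Qed.

Lemma fcell_eq n (x : d2 n) (i j k i' j' k' : 'I_n.+1) (ij : sle i j) (jk : sle j k)
  (ik : sle i k) (ij' : sle i' j') (jk' : sle j' k') (ik' : sle i' k') :
 i = i' -> j = j' -> k = k' -> fcell x ij jk ik = fcell x ij' jk' ik'.
Proof. by move=> ? ? ?; subst. Qed.
Lemma ar_ofE n (x : D2 b n) (f : delta 1 n) (i j : 'I_n.+1) (h : sle i j) :
 f ord0 = i -> f ord_max = j -> ar_of (act f x) = farr x h.
Proof. by move=> e e'; apply: (@farr_eq n x). Qed.
Lemma ce_ofE n (x : D2 b n) (f : delta 2 n) (i j k : 'I_n.+1) (ij : sle i j) (jk : sle j k) (ik : sle i k) :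
 f ord0 = i -> f o1_3 = j -> f ord_max = k -> ce_of (act f x) = fcell x ij jk ik.
Proof. by move=> e e' e''; apply: (@fcell_eq n x). Qed.

Lemma d2_ext_low n (x y : D2 b n) :
 (forall f : delta 0 n, ob_of (act f x) = ob_of (act f y)) ->
 (forall f : delta 1 n, injective f -> ar_of (act f x) = ar_of (act f y)) ->
 (forall f : delta 2 n, injective f -> ce_of (act f x) = ce_of (act f y)) -> x = y.
Proof.
move=> h0 h1 h2; apply: d2_ext.
- by move=> i; apply: (h0 (dconst 0 i)).
- move=> i j h ij.
rewrite -(@ar_ofE _ x (dedge (ltnW ij)) _ _ h) // -(@ar_ofE _ y (dedge (ltnW ij)) _ _ h) //.
apply: h1; move=> [[|[|c]] hc] [[|[|d]] hd] //= e; apply: ord_inj => //=.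
by move: ij; rewrite e ltnn.
by move: ij; rewrite e ltnn.
- move=> i j k hij hjk hik /andP[ij jk].
rewrite -(@ce_ofE _ x (dtri (ltnW ij) (ltnW jk)) _ _ _ hij hjk hik) //.
rewrite -(@ce_ofE _ y (dtri (ltnW ij) (ltnW jk)) _ _ _ hij hjk hik) //.
have ik := ltn_trans ij jk.
apply: h2; move=> [[|[|[|c]]] hc] [[|[|[|d]]] hd] //= e; apply: ord_inj => //=;
by move: ij jk ik; rewrite e ?ltnn.
Qed.

(** A pseudofunctor consists of objects, functors and 2-cells, with equations on at most four
    vertices. So a map into [D2] is a choice in dimensions 0, 1, 2 subject to conditions up to
    dimension 3. *)
Lemma d2_smap_build (V : sset) (ob : V 0 -> cob) (ar : V 1 -> arr) (ce : V 2 -> cell) :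
 (forall v, ar (degenerate 1 v) = arr1 (ob v)) ->
 (forall e, aS (ar e) = ob (source e) /\ aT (ar e) = ob (target e)) ->
 (forall s, goodc (ce s) /\
   cell_bd (ce s) (ar (act d01 s)) (ar (act d12 s)) (ar (act d02 s))) ->
 (forall e, ce (act (ddeg ord0) e) = idcl (ar e)) ->
 (forall e, ce (act (ddeg ord_max) e) = idcr (ar e)) ->
 (forall t : V 3, tet (ce (act (dfc ord_max) t)) (ce (act (dfc o1_4) t))
   (ce (act (dfc o2_4) t)) (ce (act (dfc ord0) t))) ->
 exists h : smap V (D2 b), [/\ forall v, ob_of (h 0 v) = ob v,
  forall e, ar_of (h 1 e) = ar e & forall s, ce_of (h 2 s) = ce s].
Proof.
move=> h1 h2 h3 h4 h5 h6.
have ex n (x : V n) : exists y : d2 n, [/\ forall f : delta 0 n, ob_of (act f (y : D2 b n)) = ob (act f x),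
forall f : delta 1 n, ar_of (act f (y : D2 b n)) = ar (act f x) &
forall f : delta 2 n, ce_of (act f (y : D2 b n)) = ce (act f x)].
have [||||||y [y1 y2 y3]] := @d2_build n (fun i => ob (act (dconst 0 i) x))
(fun i j ij => ar (act (dedge ij) x)) (fun i j k ij jk => ce (act (dtri ij jk) x)).
- move=> i h; rewrite -h1 /degenerate -actM; congr (ar (act _ x)); apply: delta_eq => c /=.
by case: ifP.
- move=> i j h; have [-> ->] := h2 (act (dedge h) x).
by rewrite /source /target -!actM; split; congr (ob (act _ x)); apply: delta_eq.
- move=> i j k ij jk ik; have [g] := h3 (act (dtri ij jk) x); split=> //.
suff [<- <- <-] : [/\ act d01 (act (dtri ij jk) x) = act (dedge ij) x,
act d12 (act (dtri ij jk) x) = act (dedge jk) x &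
act d02 (act (dtri ij jk) x) = act (dedge ik) x] by [].
by rewrite -!actM; split; congr (act _ x); apply: delta_eq; case=> [[|[|]]].
- move=> i k ii ik; rewrite -h4 -actM; congr (ce (act _ x)).
by apply: delta_eq; apply: ord3P; rewrite /= -val_eqE /= inordK.
- move=> i k ii ik; rewrite -h5 -actM; congr (ce (act _ x)).
by apply: delta_eq; apply: ord3P; rewrite /= -val_eqE /= inordK.
- move=> i j k l ij jk kl ik jl.
have q : {q : delta 3 n | [/\ q ord0 = i, q o1_4 = j, q o2_4 = k & q ord_max = l]}.
unshelve eexists; first refine (@Delta 3 n
(fun c => match val c with 0 => i | 1 => j | 2 => k | _ => l end) _); last by [].
by case=> [[|[|[|c]]] hc] [[|[|[|d]]] hd] //= _;
rewrite ?ij ?jk ?ik ?kl ?jl //; apply: leq_trans ij jl.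
case: q => q [q0 q1 q2 q3]; have := h6 (act q x); rewrite -!actM.
suff [-> -> -> ->] : [/\ dcomp q (dfc ord_max) = dtri ij jk,
dcomp q (dfc o1_4) = dtri ik kl, dcomp q (dfc o2_4) = dtri ij jl &
dcomp q (dfc ord0) = dtri jk kl] by [].
by split; apply: delta_eq; apply: ord3P; rewrite dcE /dtri /= -?q0 -?q1 -?q2 -?q3;
congr (q _); apply: ord_inj.
- exists y; split=> f.
+ by rewrite -[f](_ : dconst 0 (f ord0) = f) ?ob_ofE ?y1 //; apply: delta_eq => c; rewrite ord1.
+ have ff : f ord0 <= f ord_max by apply: dmono.
rewrite (@ar_ofE _ y f _ _ (sle_of ff)) // y2; congr (ar (act _ x)); apply: delta_eq.
by case=> [[|[|]]] // c; congr (f _); apply: ord_inj.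
+ have f1 : f ord0 <= f o1_3 by apply: dmono.
have f2 : f o1_3 <= f ord_max by apply: dmono.
have f3 : f ord0 <= f ord_max by apply: dmono.
rewrite (@ce_ofE _ y f _ _ _ (sle_of f1) (sle_of f2) (sle_of f3)) // y3.
congr (ce (act _ x)); apply: delta_eq.
by apply: ord3P.
pose h n x : D2 b n := sval (cid (ex n x)).
have hE n x := svalP (cid (ex n x)).
have hP m n (f : delta m n) (x : V n) : h m (act f x) = act f (h n x).
apply: d2_ext_low => g; rewrite -actM.
- have [-> _ _] := hE m (act f x); have [-> _ _] := hE n x; by rewrite actM.
- have [_ -> _] := hE m (act f x); have [_ -> _] := hE n x; by rewrite actM.
- have [_ _ ->] := hE m (act f x); have [_ _ ->] := hE n x; by rewrite actM.
exists (@Smap V (D2 b) h hP); split=> v /=.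
- by have [/(_ (did 0))] := hE 0 v; rewrite !act1.
- by have [_ /(_ (did 1))] := hE 1 v; rewrite !act1.
- by have [_ _ /(_ (did 2))] := hE 2 v; rewrite !act1.
Qed.
End DuskinBuild.

Lemma not_nondeg (V : sset) n (x : V n.+1) : ~ nondeg x ->
 exists i (y : V n), x = act (ddeg i) y.
Proof.
move=> /degen_surj[m [f [y [mn _ ->]]]].
have ni : ~ injective f by move/inj_leq; rewrite leqNgt mn.
have [a [c [ac e]]] : exists a c : 'I_n.+2, a < c /\ f a = f c.
apply: contrapT => ne; apply: ni => a c e; apply: contrapT => ac.
by have [lt|lt|/val_inj//] := ltngtP a c; apply: ne; [exists a, c|exists c, a].
by have [i ->] := delta_degen ac e; exists i, (act (dcomp f (dfc c)) y); rewrite -actM.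
Qed.

Lemma ord2P (P : 'I_2 -> Prop) : P ord0 -> P ord_max -> forall i, P i.
Proof.
by move=> h0 h1 [[|[|]]] // h; [rewrite (_ : Ordinal h = ord0)|rewrite (_ : Ordinal h = ord_max)] => //;
apply: ord_inj.
Qed.

Section DuskinExtend.
Variable b : bool.
Notation cob := (cob b).
Notation arr := (arr b).
Notation cell := (cell b).
Notation d2 := (d2 b).

(** The three degenerate tetrahedra on a cell, with the repeated vertex first, in the middle and
    last, satisfy the cocycle condition by the unit laws. *)
Lemma tet_l (c : cell) : tet (idcl (Arr (cF c))) c (idcl (Arr (cH c))) c.
Proof.
case: c => A B C F G H p; apply: (@Tet b A A B C (mpfunctor_id A) F G F H H) => a.
by rewrite /= pfmor1 pcmp1m pcmpm1.
Qed.

Lemma tet_m (c : cell) : tet (idcr (Arr (cF c))) c c (idcl (Arr (cG c))).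
Proof.
case: c => A B C F G H p; apply: (@Tet b A B B C F (mpfunctor_id B) G F G H) => a.
by rewrite /= pfmor1.
Qed.

Lemma tet_r (c : cell) : tet c (idcr (Arr (cH c))) c (idcr (Arr (cG c))).
Proof.
case: c => A B C F G H p; apply: (@Tet b A B C C F G (mpfunctor_id C) H G H) => a.
by rewrite /= pcmp1m pcmpm1.
Qed.
Lemma id_cell_l_good (f : arr) : goodc (idcl f).
Proof. by split=> [a|a a' g]; [apply: marked_id|rewrite /= pcmp1m pcmpm1]. Qed.
Lemma id_cell_r_good (f : arr) : goodc (idcr f).
Proof. by split=> [a|a a' g]; [apply: marked_id|rewrite /= pcmp1m pcmpm1]. Qed.
Lemma ce_of_bd (s : D2 b 2) : cell_bd (ce_of s) (ar_of (act d01 s)) (ar_of (act d12 s)) (ar_of (act d02 s)).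
Proof. by split; symmetry; apply: (@ar_ofE b 2 s). Qed.

Lemma dtetE (t : D2 b 3) : tet (ce_of (act (dfc ord_max) t)) (ce_of (act (dfc o1_4) t))
   (ce_of (act (dfc o2_4) t)) (ce_of (act (dfc ord0) t)).
Proof.
have E i (f : delta 2 3) (i0 i1 i2 : 'I_4) (h01 : sle i0 i1) (h12 : sle i1 i2) (h02 : sle i0 i2) :
f = dfc i -> f ord0 = i0 -> f o1_3 = i1 -> f ord_max = i2 ->
ce_of (act (dfc i) t) = fcell t h01 h12 h02.
by move=> <-; apply: ce_ofE.
rewrite (E ord_max (dfc ord_max) ord0 o1_4 o2_4 stt stt stt) //; try exact: ord_inj.
rewrite (E o1_4 (dfc o1_4) ord0 o2_4 ord_max stt stt stt) //; try exact: ord_inj.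
rewrite (E o2_4 (dfc o2_4) ord0 o1_4 ord_max stt stt stt) //; try exact: ord_inj.
rewrite (E ord0 (dfc ord0) o1_4 o2_4 ord_max stt stt stt) //; try exact: ord_inj.
exact: ftet.
Qed.

Section Extend.
Variables (V : sset) (G : partmap V (D2 b)) (ar : V 1 -> arr) (ce : V 2 -> cell).
Hypotheses (V0 : forall v : V 0, pdom G v)
 (m1 : forall e y, G 1 e y -> ar e = ar_of y)
 (m2 : forall s y, G 2 s y -> ce s = ce_of y)
 (n1 : forall e y y', ~ pdom G e -> G 0 (source e) y -> G 0 (target e) y' ->
 aS (ar e) = ob_of y /\ aT (ar e) = ob_of y')
 (n2 : forall s, ~ pdom G s -> nondeg s -> goodc (ce s) /\
 cell_bd (ce s) (ar (act d01 s)) (ar (act d12 s)) (ar (act d02 s)))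
 (n2l : forall e, ~ pdom G e -> ce (act (ddeg ord0) e) = idcl (ar e))
 (n2r : forall e, ~ pdom G e -> ce (act (ddeg ord_max) e) = idcr (ar e))
 (n3 : forall t : V 3, ~ pdom G t -> nondeg t ->
 tet (ce (act (dfc ord_max) t)) (ce (act (dfc o1_4) t))
   (ce (act (dfc o2_4) t)) (ce (act (dfc ord0) t))).

Ltac fe3 := apply: ord3P; rewrite !dcE /= ?dgE ?dfE -?val_eqE /= ?inordK.

(** Normalization forces the values on degenerate simplices and makes their cocycle conditions
    automatic, so that new cells and equations need checking on nondegenerate simplices only. *)
Lemma d2_extend : exists h : smap V (D2 b), [/\ forall n x y, G n x y -> h n x = y,
 forall e, ar_of (h 1 e) = ar e & forall s, ce_of (h 2 s) = ce s].
Proof.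
pose ob v := ob_of (sval (cid (V0 v))).
have obE v y : G 0 v y -> ob v = ob_of y.
by rewrite /ob; case: cid => y' h /= h'; rewrite (prel_fun h h').
have h4 e : ce (act (ddeg ord0) e) = idcl (ar e).
have [[y h]|nd] := pselect (pdom G e); last exact: n2l.
rewrite (m1 h) (m2 (prel_act (ddeg ord0) h)) ; apply: etrans (@fcell_l b 1 y ord0 ord_max stt stt).
by apply: (@ce_ofE b 1 y) => //; apply: ord_inj; rewrite dgE.
have h5 e : ce (act (ddeg ord_max) e) = idcr (ar e).
have [[y h]|nd] := pselect (pdom G e); last exact: n2r.
rewrite (m1 h) (m2 (prel_act (ddeg ord_max) h)); apply: etrans (@fcell_r b 1 y ord0 ord_max stt stt).
by apply: (@ce_ofE b 1 y) => //; apply: ord_inj; rewrite dgE.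
have fE l (f g : delta 1 l) (x : V l) : (forall i, f i = g i :> nat) -> act f x = act g x.
by move=> h; congr (act _ x); apply: deltaP.
have h2 e : aS (ar e) = ob (source e) /\ aT (ar e) = ob (target e).
have [[y h]|nd] := pselect (pdom G e).
by rewrite (m1 h) (obE _ _ (prel_act (dconst 0 ord0) h)) (obE _ _ (prel_act (dconst 0 ord_max) h)).
have [y h] := V0 (source e); have [y' h'] := V0 (target e).
by rewrite (obE _ _ h) (obE _ _ h'); apply: n1.
have h1 v : ar (degenerate 1 v) = arr1 (ob v).
have [y h] := V0 v; rewrite (m1 (prel_act (dconst 1 ord0) h)) (obE _ _ h).
exact: (@farr_id b 0 y ord0 stt).
have h3 s : goodc (ce s) /\ cell_bd (ce s) (ar (act d01 s)) (ar (act d12 s)) (ar (act d02 s)).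
have [[y h]|nd] := pselect (pdom G s).
rewrite (m2 h) (m1 (prel_act d01 h)) (m1 (prel_act d12 h)) (m1 (prel_act d02 h)).
by split; [apply: fcell_good|apply: ce_of_bd].
have [/n2|/not_nondeg[i [e ->]]] := pselect (nondeg s); first exact.
have [e1 e2] := h2 e.
move: i; apply: ord2P.
rewrite h4; split; first exact: id_cell_l_good.
have -> : act d01 (act (ddeg ord0) e) = degenerate 1 (source e).
by rewrite /degenerate /source -!actM; apply: fE; case=> [[|[|]]] // ?; rewrite !dcE dgE.
have -> : act d12 (act (ddeg ord0) e) = e.
by rewrite -[RHS]act1 -!actM; apply: fE; case=> [[|[|]]] // ?; rewrite !dcE dgE.
have -> : act d02 (act (ddeg ord0) e) = e.
by rewrite -[RHS]act1 -!actM; apply: fE; case=> [[|[|]]] // ?; rewrite !dcE dgE.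
by rewrite h1 -e1.
rewrite h5; split; first exact: id_cell_r_good.
have -> : act d01 (act (ddeg ord_max) e) = e.
by rewrite -[RHS]act1 -!actM; apply: fE; case=> [[|[|]]] // ?; rewrite !dcE dgE.
have -> : act d12 (act (ddeg ord_max) e) = degenerate 1 (target e).
by rewrite /degenerate /target -!actM; apply: fE; case=> [[|[|]]] // ?; rewrite !dcE dgE.
have -> : act d02 (act (ddeg ord_max) e) = e.
by rewrite -[RHS]act1 -!actM; apply: fE; case=> [[|[|]]] // ?; rewrite !dcE dgE.
by rewrite h1 -e2.
have fE2 l (f g : delta 2 l) (x : V l) : (forall i, f i = g i :> nat) -> act f x = act g x.
by move=> h; congr (act _ x); apply: deltaP.
have h6 (t : V 3) : tet (ce (act (dfc ord_max) t)) (ce (act (dfc o1_4) t))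
(ce (act (dfc o2_4) t)) (ce (act (dfc ord0) t)).
have [[y h]|nd] := pselect (pdom G t).
rewrite (m2 (prel_act (dfc ord_max) h)) (m2 (prel_act (dfc o1_4) h)).
by rewrite (m2 (prel_act (dfc o2_4) h)) (m2 (prel_act (dfc ord0) h)); apply: dtetE.
have [/n3|/not_nondeg[i [s ->]]] := pselect (nondeg t); first exact.
have [_ [e1 e2 e3]] := h3 s; rewrite -!actM.
have face2 (i0 : 'I_3) (k : 'I_4) : (forall j, ddeg i0 (dfc k j) = j :> nat) ->
act (dcomp (ddeg i0) (dfc k)) s = s.
by move=> h; rewrite -[RHS]act1; apply: fE2.
move: i; apply: ord3P.
- have -> : act (dcomp (ddeg ord0) (dfc ord_max)) s = act (ddeg ord0) (act d01 s).
by rewrite -actM; apply: fE2; fe3.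
have -> : act (dcomp (ddeg ord0) (dfc o2_4)) s = act (ddeg ord0) (act d02 s).
by rewrite -actM; apply: fE2; fe3.
rewrite !face2; [|by apply: ord3P; rewrite dgE dfE..].
by rewrite !h4 -e1 -e3; apply: tet_l.
- have -> : act (dcomp (ddeg o1_3) (dfc ord_max)) s = act (ddeg ord_max) (act d01 s).
by rewrite -actM; apply: fE2; fe3.
have -> : act (dcomp (ddeg o1_3) (dfc ord0)) s = act (ddeg ord0) (act d12 s).
by rewrite -actM; apply: fE2; fe3.
rewrite !face2; [|by apply: ord3P; rewrite dgE dfE..].
by rewrite h4 h5 -e1 -e2; apply: tet_m.
- have -> : act (dcomp (ddeg ord_max) (dfc o1_4)) s = act (ddeg ord_max) (act d02 s).
by rewrite -actM; apply: fE2; fe3.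
have -> : act (dcomp (ddeg ord_max) (dfc ord0)) s = act (ddeg ord_max) (act d12 s).
by rewrite -actM; apply: fE2; fe3.
rewrite !face2; [|by apply: ord3P; rewrite dgE dfE..].
by rewrite !h5 -e2 -e3; apply: tet_r.
have [h [H0 H1 H2]] := d2_smap_build h1 h2 h3 h4 h5 h6.
exists h; split=> // n x y hxy; apply: d2_ext_low => f.
- by rewrite -smapP H0; apply: obE; apply: prel_act.
- by rewrite -smapP H1 => _; apply: m1; apply: prel_act.
- by rewrite -smapP H2 => _; apply: m2; apply: prel_act.
Qed.
End Extend.
End DuskinExtend.

(** * Inner horns in [D2] *)

Section DuskinHorns.
Variable b : bool.
Notation cob := (cob b).
Notation arr := (arr b).
Notation cell := (cell b).
Notation d2 := (d2 b).

Lemma arr_typed (A B : cob) (f : arr) : aS f = A -> aT f = B ->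
 exists F : mpfunctor A B, Arr F = f.
Proof. by move=> p q; exists (castF p q); apply: castFE. Qed.
Lemma arr_comp (A B C : cob) (F : mpfunctor A B) (G : mpfunctor B C) :
 goodc (@Cell b A B C F G (mpfunctor_comp G F) (fun a => pid (G (F a)))).
Proof. by split=> [a|a a' g]; [apply: marked_id|rewrite /= pcmp1m pcmpm1]. Qed.

Section Three.
Variables (A0 A1 A2 A3 : cob) (F01 : mpfunctor A0 A1) (F12 : mpfunctor A1 A2)
  (F23 : mpfunctor A2 A3) (F02 : mpfunctor A0 A2) (F13 : mpfunctor A1 A3)
  (F03 : mpfunctor A0 A3)
  (p012 : forall a, phom (F12 (F01 a)) (F02 a))
  (p023 : forall a, phom (F23 (F02 a)) (F03 a))
  (p013 : forall a, phom (F13 (F01 a)) (F03 a))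
  (p123 : forall a, phom (F23 (F12 a)) (F13 a)).

Lemma good_iso (c : cell) : goodc c -> forall a, p_iso (cphi c a).
Proof. by case=> m _ a; apply: marked_iso. Qed.

(** All cells are invertible, so the cocycle equation can be solved for the face opposite 1;
    naturality of the solution follows by cancelling the inverted cell. *)
Lemma fill3_1 : goodc (Cell p012) -> goodc (Cell p013) -> goodc (Cell p123) ->
 exists q : (forall a, phom (F23 (F02 a)) (F03 a)), goodc (Cell q) /\
  tet (Cell p012) (Cell q) (Cell p013) (Cell p123).
Proof.
move=> g012 g013 g123.
have i012 a : p_iso (pfmor F23 (p012 a)) by apply: pfmor_iso; apply: (good_iso g012).
pose q a := pcmp (pcmp (p013 a) (p123 (F01 a))) (pinv (i012 a)).
exists q; split; last first.
by constructor=> a; rewrite /q -pcmpA pinv_l pcmpm1.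
split=> [a|a a' f] /=.
apply: marked_cmp; first by apply: marked_cmp; [apply: g013.1|apply: g123.1].
by apply: mk_pinv; apply: mpf_marked; apply: g012.1.
apply: (p_iso_epi (i012 a)).
have := g012.2 a a' f; have := g013.2 a a' f; have := g123.2 _ _ (pfmor F01 f) => /= n123 n013 n012.
rewrite /q -!pcmpA pinv_l pcmpm1 -pfmorM -n012 pfmorM (pcmpA (pinv (i012 a'))) pinv_l pcmp1m.
by rewrite n123 !pcmpA n013.
Qed.

Lemma fill3_2 : goodc (Cell p012) -> goodc (Cell p023) -> goodc (Cell p123) ->
 exists q : (forall a, phom (F13 (F01 a)) (F03 a)), goodc (Cell q) /\
  tet (Cell p012) (Cell p023) (Cell q) (Cell p123).
Proof.
move=> g012 g023 g123.
have i123 a : p_iso (p123 a) by apply: (good_iso g123).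
pose q a := pcmp (pcmp (p023 a) (pfmor F23 (p012 a))) (pinv (i123 (F01 a))).
exists q; split; last first.
by constructor=> a; rewrite /q -[in RHS]pcmpA pinv_l pcmpm1.
split=> [a|a a' f] /=.
apply: marked_cmp; last by apply: mk_pinv; apply: g123.1.
by apply: marked_cmp; [apply: g023.1|apply: mpf_marked; apply: g012.1].
apply: (p_iso_epi (i123 (F01 a))).
have := g012.2 a a' f; have := g023.2 a a' f; have := g123.2 _ _ (pfmor F01 f) => /= n123 n023 n012.
rewrite /q -!pcmpA pinv_l pcmpm1 -n123 (pcmpA (pinv _)) pinv_l pcmp1m.
by rewrite -pfmorM n012 pfmorM !pcmpA n023.
Qed.
End Three.

(** In a 4-simplex the pasted 2-cells from the spine to the long edge are related by five
    tetrahedra. Any inner one follows from the other four after composing with an invertible cell: a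
    whiskering of [p012] for 1, of [p123] for 2, and [p234] for 3. *)
Lemma four_faces (A0 A1 A2 A3 A4 : cob)
  (F01 : mpfunctor A0 A1) (F12 : mpfunctor A1 A2) (F23 : mpfunctor A2 A3)
  (F34 : mpfunctor A3 A4) (F02 : mpfunctor A0 A2) (F13 : mpfunctor A1 A3)
  (F24 : mpfunctor A2 A4) (F03 : mpfunctor A0 A3) (F14 : mpfunctor A1 A4)
  (F04 : mpfunctor A0 A4)
  (p012 : forall a, phom (F12 (F01 a)) (F02 a))
  (p013 : forall a, phom (F13 (F01 a)) (F03 a))
  (p014 : forall a, phom (F14 (F01 a)) (F04 a))
  (p023 : forall a, phom (F23 (F02 a)) (F03 a))
  (p024 : forall a, phom (F24 (F02 a)) (F04 a))
  (p034 : forall a, phom (F34 (F03 a)) (F04 a))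
  (p123 : forall a, phom (F23 (F12 a)) (F13 a))
  (p124 : forall a, phom (F24 (F12 a)) (F14 a))
  (p134 : forall a, phom (F34 (F13 a)) (F14 a))
  (p234 : forall a, phom (F34 (F23 a)) (F24 a)) (k : nat) :
 goodc (Cell p012) -> goodc (Cell p123) -> goodc (Cell p234) -> 0 < k < 4 ->
 (k <> 4 -> tet (Cell p012) (Cell p023) (Cell p013) (Cell p123)) ->
 (k <> 3 -> tet (Cell p012) (Cell p024) (Cell p014) (Cell p124)) ->
 (k <> 2 -> tet (Cell p013) (Cell p034) (Cell p014) (Cell p134)) ->
 (k <> 1 -> tet (Cell p023) (Cell p034) (Cell p024) (Cell p234)) ->
 (k <> 0 -> tet (Cell p123) (Cell p134) (Cell p124) (Cell p234)) ->
 [/\ tet (Cell p012) (Cell p024) (Cell p014) (Cell p124),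
   tet (Cell p013) (Cell p034) (Cell p014) (Cell p134) &
   tet (Cell p023) (Cell p034) (Cell p024) (Cell p234)].
Proof.
move=> g012 g123 g234 k14 t4 t3 t2 t1 t0.
have {t4} /tet_inv e4 : tet (Cell p012) (Cell p023) (Cell p013) (Cell p123) by apply: t4 => k4; rewrite k4 in k14.
have {t0} /tet_inv e0 : tet (Cell p123) (Cell p134) (Cell p124) (Cell p234) by apply: t0 => k0; rewrite k0 in k14.
have n234 a a' f := g234.2 a a' f; rewrite /= in n234.
have i012 a : p_iso (pfmor F34 (pfmor F23 (p012 a))).
by do 2 apply: pfmor_iso; apply: (good_iso g012).
have i123 a : p_iso (pfmor F34 (p123 a)) by apply: pfmor_iso; apply: (good_iso g123).
have i234 a : p_iso (p234 a) by apply: (good_iso g234).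
have [k1|k1] := pselect (k = 1).
have t2' : tet (Cell p013) (Cell p034) (Cell p014) (Cell p134) by apply: t2; rewrite k1.
have t3' : tet (Cell p012) (Cell p024) (Cell p014) (Cell p124) by apply: t3; rewrite k1.
have e2 := tet_inv t2'; have e3 := tet_inv t3'.
split=> //; constructor=> a; apply: (p_iso_epi (i012 a)).
rewrite -!pcmpA -pfmorM e4 pfmorM pcmpA e2 -!pcmpA n234 e0.
by rewrite !pcmpA e3 -!pcmpA.
have t1' := t1 k1; have e1 := tet_inv t1'.
have [k2|k2] := pselect (k = 2).
have t3' : tet (Cell p012) (Cell p024) (Cell p014) (Cell p124) by apply: t3; rewrite k2.
have e3 := tet_inv t3'.
split=> //; constructor=> a; apply: (p_iso_epi (i123 (F01 a))).
rewrite -!pcmpA -pfmorM -e4 e0 pfmorM pcmpA e1 -!pcmpA n234.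
by rewrite !pcmpA e3.
have t2' := t2 k2; have e2 := tet_inv t2'.
split=> //; constructor=> a; apply: (p_iso_epi (i234 _)).
rewrite -!pcmpA -n234 pcmpA -e1 -pcmpA -pfmorM e4 pfmorM pcmpA e2.
by rewrite -!pcmpA e0.
Qed.

(** The at most [m+1] vertices of the simplex together with [k] do not exhaust the [n+1] vertices
    available. *)
Lemma horn_dom n (k : 'I_n.+1) m (f : delta m n) : m.+1 < n ->
 exists i, i <> k /\ forall j, f j <> i.
Proof.
move=> mn; apply: contrapT => ne.
have : #|[set: 'I_n.+1]| <= #|k |: dim f|.
apply: subset_leq_card; apply/fintype.subsetP => i _; rewrite in_setU1.
have [//|ik] := eqVneq i k; apply/dimP; apply: contrapT => nj; apply: ne; exists i; split.
by move=> e; rewrite e eqxx in ik.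
by move=> j e; apply: nj; exists j.
rewrite cardsT card_ord cardsU1; have : #|dim f| <= m.+1.
by have := leq_imset_card f 'I_m.+1; rewrite card_ord.
move: (leq_b1 (k \notin dim f)); move: (nat_of_bool _) => z z1 c1 c2.
by move: (leq_trans c2 (leq_add z1 c1)); rewrite ltnS leqNgt mn.
Qed.

Lemma nondeg_injS n m (f : simplex n m) : nondeg f -> injective f.
Proof.
move=> nd; apply: (@nondeg_inj (simplex n) m n f (did n)).
by rewrite (_ : act _ _ = f) //; apply: delta_eq.
Qed.

Lemma horn_last n (k : 'I_n.+2) (f : delta n n.+1) : injective f ->
 ~ (exists i, i <> k /\ forall j, f j <> i) -> f = dfc k.
Proof.
move=> inj ne.
have [i fi] : exists i, forall j, f j <> i.
have : #|dim f| < #|[set: 'I_n.+2]|.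
rewrite cardsT card_ord; have := leq_imset_card f 'I_n.+1; rewrite card_ord ltnS; exact.
move=> lt; apply: contrapT => na; move: lt; rewrite ltnNge => /negP; apply.
apply: subset_leq_card; apply/fintype.subsetP => i _; apply/dimP.
by apply: contrapT => nj; apply: na; exists i => j e; apply: nj; exists j.
have ik : i = k by apply: contrapT => ik; apply: ne; exists i.
have [f' fE] := dfactor fi.
suff f'1 : f' = did n by rewrite fE ik f'1; apply: delta_eq.
by apply: dinj_endo => a c e; apply: inj; rewrite fE /= e.
Qed.

(** The composite functor with an identity 2-cell fills the horn. *)
Lemma quasi_D2_2 (h : smap (@horn 2 o1_3) (D2 b)) :
 exists x : D2 b 2, forall m (f : @horn 2 o1_3 m), act (sval f) x = h m f.
Proof.
pose G : partmap (simplex 2) (D2 b) := pm_sub h.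
have dG m (f : simplex 2 m) : pdom G f <-> exists i, i <> o1_3 /\ forall j, f j <> i.
by split=> [[y [p _]]//|p]; exists (h m (exist _ f p)), p.
have V0 (v : simplex 2 0) : pdom G v by apply/dG; apply: (@horn_dom 2 o1_3 0 v isT).
have [y01 h01] : pdom G d01 by apply/dG; exists ord_max; split=> //; apply: ord2P.
have [y12 h12] : pdom G d12 by apply/dG; exists ord0; split=> //; apply: ord2P.
have e1 : target (y01 : D2 b 1) = source y12.
apply: (prel_fun (prel_act (dconst 0 ord_max) h01)).
have := prel_act (dconst 0 ord0) h12; rewrite (_ : act (dconst 0 ord0) (d12 : simplex 2 1) = act (dconst 0 ord_max) (d01 : simplex 2 1)) //.
have [F12 F12E] := @arr_typed (aT (ar_of y01)) (aT (ar_of y12)) (ar_of y12) (esym (f_equal (@ob_of b) e1)) erefl.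
pose F01 := aF (ar_of y01); pose c := @Cell b _ _ _ F01 F12 (mpfunctor_comp F12 F01) (fun a => pid (F12 (F01 a))).
pose ar e := if pselect (pdom G e) is left h then ar_of (sval (cid h)) else Arr (cH c).
(* Outside the horn a triangle is the nondegenerate one or a degeneracy of the edge 02; which
   degeneracy is read off its first two vertices. *)
pose ce (s : simplex 2 2) := if pselect (pdom G s) is left h then ce_of (sval (cid h)) else
if pselect (nondeg s) then c else if s ord0 == s o1_3 then idcl (Arr (cH c)) else idcr (Arr (cH c)).
have arE e y : G 1 e y -> ar e = ar_of y.
rewrite /ar; case: pselect => [p|np] hy; last by case: np; exists y.
by case: cid => y' /= hy'; rewrite (prel_fun hy hy').
have arN e : ~ pdom G e -> ar e = Arr (cH c) by rewrite /ar; case: pselect.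
have eN (e : simplex 2 1) : ~ pdom G e -> e = d02.
move=> /dG ne; have ee : e ord0 <= e ord_max by apply: dmono.
have m0 : e ord0 = ord0.
apply: contrapT => n0; apply: ne; exists ord0; split=> //; apply: ord2P => // e'.
by apply: n0; apply: ord_inj; move: ee; rewrite e' leqn0 => /eqP.
have m1 : e ord_max = ord_max.
apply: contrapT => n0; apply: ne; exists ord_max; split=> //; apply: ord2P => // e'.
by rewrite m0 in e'.
by apply: delta_eq; apply: ord2P.
have degN (i : 'I_2) (e : simplex 2 1) : ~ pdom G e -> ~ pdom G (act (ddeg i) e : simplex 2 2).
move=> ne h1; apply: ne; have := pdom_act (dfc (wd i)) h1.
by rewrite -actM (_ : dcomp _ _ = did 1) ?act1 //; apply: delta_eq => j; rewrite dcE ddeg_face.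
have degnd i (e : simplex 2 1) : ~ nondeg (act (ddeg i) e) by apply: dg_lt.
have [||||||g [gE _ _]] := @d2_extend b _ G ar ce V0 arE.
- move=> s y hs; rewrite /ce; case: pselect => [p|np]; last by case: np; exists y.
by case: cid => y' /= hy'; rewrite (prel_fun hs hy').
- move=> e y y' ne; rewrite arN // (eN e ne) => h0 h1.
have -> : y = source (y01 : D2 b 1).
apply: (prel_fun h0); have := prel_act (dconst 0 ord0) h01.
by rewrite (_ : act _ (d01 : simplex 2 1) = source (d02 : simplex 2 1)).
have -> : y' = target (y12 : D2 b 1).
apply: (prel_fun h1); have := prel_act (dconst 0 ord_max) h12.
by rewrite (_ : act _ (d12 : simplex 2 1) = target (d02 : simplex 2 1)).
by [].
- move=> s ns nd; have sE : s = did 2 := dinj_endo (nondeg_injS nd).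
have -> : ce s = c.
rewrite /ce; case: (pselect (pdom G s)) => [/ns//|_]; by case: (pselect (nondeg s)) => [p|/(_ nd)//].
split; first exact: arr_comp.
rewrite sE; split.
+ rewrite (arE _ y01) //; rewrite (_ : act _ _ = d01) //; exact: delta_eq.
+ rewrite F12E (arE _ y12) //; rewrite (_ : act _ _ = d12) //; exact: delta_eq.
+ rewrite arN //; move/dG => [i [ii]]; move: i ii; apply: ord3P => // _.
by move=> /(_ ord0).
by move=> /(_ ord_max).
- move=> e ne; rewrite /ce; case: pselect => [p|_]; first by case: (degN ord0 e ne).
case: (pselect (nondeg (act (ddeg ord0) e : simplex 2 2))) => [p|nn]; first by case: (degnd ord0 e p).
rewrite (_ : _ == _ = true) ?arN //; apply/eqP.
by rewrite !dcE; congr (e _); apply: ord_inj; rewrite !dgE.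
- move=> e ne; rewrite /ce; case: pselect => [p|_]; first by case: (degN ord_max e ne).
case: (pselect (nondeg (act (ddeg ord_max) e : simplex 2 2))) => [p|nn]; first by case: (degnd ord_max e p).
rewrite (_ : _ == _ = false) ?arN //; apply/eqP; rewrite (eN e ne) /= -val_eqE /= inordK //.
by rewrite -val_eqE /= inordK.
- by move=> t _ /nondeg_injS/inj_leq.
exists (g 2 (did 2)) => m [f p]; rewrite -smapP; apply: gE; exists p; congr (h m _).
Qed.

Section HighHorn.
Variables (n : nat) (k : 'I_n.+4) (h : smap (@horn n.+3 k) (D2 b)).
Let G : partmap (simplex n.+3) (D2 b) := pm_sub h.

Lemma hdomP m (f : simplex n.+3 m) : pdom G f <-> exists i, i <> k /\ forall j, f j <> i.
Proof. by split=> [[y [p _]]//|p]; exists (h m (exist _ f p)), p. Qed.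
Lemma horn_V0 (v : simplex n.+3 0) : pdom G v.
Proof. by apply/hdomP; apply: horn_dom. Qed.
Lemma horn_V1 (e : simplex n.+3 1) : pdom G e.
Proof. by apply/hdomP; apply: horn_dom. Qed.
Definition hob v := ob_of (sval (cid (horn_V0 v))).
Definition har e := ar_of (sval (cid (horn_V1 e))).

Lemma hobE v y : G 0 v y -> hob v = ob_of y.
Proof. by move=> hy; rewrite /hob; case: cid => y' /= h'; rewrite (prel_fun hy h'). Qed.
Lemma harE e y : G 1 e y -> har e = ar_of y.
Proof. by move=> hy; rewrite /har; case: cid => y' /= h'; rewrite (prel_fun hy h'). Qed.

Lemma har_typed (e : simplex n.+3 1) : exists F : mpfunctor (hob (source e)) (hob (target e)), Arr F = har e.
Proof.
have [y hy] := horn_V1 e; rewrite (harE hy).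
rewrite (hobE (prel_act (dconst 0 ord0) hy)) (hobE (prel_act (dconst 0 ord_max) hy)).
exact: arr_typed.
Qed.
Lemma har_typed' (e : simplex n.+3 1) v w : source e = v -> target e = w ->
 exists F : mpfunctor (hob v) (hob w), Arr F = har e.
Proof. by move=> <- <-; apply: har_typed. Qed.

Lemma hceE s y : G 2 s y -> goodc (ce_of y) /\
 cell_bd (ce_of y) (har (act d01 s)) (har (act d12 s)) (har (act d02 s)).
Proof.
move=> hy; split; first exact: fcell_good.
rewrite (harE (prel_act d01 hy)) (harE (prel_act d12 hy)) (harE (prel_act d02 hy)).
exact: ce_of_bd.
Qed.

(** From dimension 3 on, vertices and edges already lie in the horn; only cells and equations remain
    to be supplied. *)
Lemma horn_fill (ce : simplex n.+3 2 -> cell) :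
 (forall s y, G 2 s y -> ce s = ce_of y) ->
 (forall s, ~ pdom G s -> nondeg s -> goodc (ce s) /\
  cell_bd (ce s) (har (act d01 s)) (har (act d12 s)) (har (act d02 s))) ->
 (forall t : simplex n.+3 3, ~ pdom G t -> nondeg t ->
  tet (ce (act (dfc ord_max) t)) (ce (act (dfc o1_4) t))
   (ce (act (dfc o2_4) t)) (ce (act (dfc ord0) t))) ->
 exists x : D2 b n.+3, forall m (f : @horn n.+3 k m), act (sval f) x = h m f.
Proof.
move=> m2 n2 n3.
have [| | |g [gE _ _]] := @d2_extend b _ G har ce horn_V0 harE m2 _ n2 _ _ n3.
- by move=> e y y' /(_ (horn_V1 e)).
- by move=> e /(_ (horn_V1 e)).
- by move=> e /(_ (horn_V1 e)).
exists (g _ (did n.+3)) => m [f p]; rewrite -smapP; apply: gE; exists p; congr (h m _).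
Qed.
End HighHorn.

Lemma quasi_D2_3 (k : 'I_4) (h : smap (@horn 3 k) (D2 b)) : 0 < k < 3 ->
 exists x : D2 b 3, forall m (f : @horn 3 k m), act (sval f) x = h m f.
Proof.
move=> k03; have k12 : k = o1_4 \/ k = o2_4.
by move: k h k03; apply: ord4P => // *; [left|right].
pose e01 : simplex 3 1 := @dedge 3 ord0 o1_4 isT.
pose e02 : simplex 3 1 := @dedge 3 ord0 o2_4 isT.
pose e03 : simplex 3 1 := @dedge 3 ord0 ord_max isT.
pose e12 : simplex 3 1 := @dedge 3 o1_4 o2_4 isT.
pose e13 : simplex 3 1 := @dedge 3 o1_4 ord_max isT.
pose e23 : simplex 3 1 := @dedge 3 o2_4 ord_max isT.
pose v i : simplex 3 0 := dconst 0 i.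
have st (e : simplex 3 1) i j : e ord0 = i -> e ord_max = j -> source e = v i /\ target e = v j.
by move=> <- <-; split; apply: delta_eq.
have ht (e : simplex 3 1) i j : e ord0 = i -> e ord_max = j ->
exists F : mpfunctor (hob h (v i)) (hob h (v j)), Arr F = har h e.
by move=> h1 h2; have [s t] := st e i j h1 h2; apply: har_typed'.
have [F01 E01] := ht e01 ord0 o1_4 erefl erefl.
have [F02 E02] := ht e02 ord0 o2_4 erefl erefl.
have [F03 E03] := ht e03 ord0 ord_max erefl erefl.
have [F12 E12] := ht e12 o1_4 o2_4 erefl erefl.
have [F13 E13] := ht e13 o1_4 ord_max erefl erefl.
have [F23 E23] := ht e23 o2_4 ord_max erefl erefl.
pose G : partmap (simplex 3) (D2 b) := pm_sub h.
have dG i : i <> k -> pdom G (dfc i : simplex 3 2).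
by move=> ik; apply/hdomP; exists i; split=> // j; apply: dfN.
have bE (s e e' e'' : _) : act d01 s = e -> act d12 s = e' -> act d02 s = e'' ->
forall y, G 2 s y -> goodc (ce_of y) /\ cell_bd (ce_of y) (har h e) (har h e') (har h e'').
by move=> <- <- <- y hy; apply: hceE.
have f3 : [/\ act d01 (dfc ord_max : simplex 3 2) = e01, act d12 (dfc ord_max : simplex 3 2) = e12 &
act d02 (dfc ord_max : simplex 3 2) = e02].
by split; apply: deltaP; case=> [[|[|]]].
have f2 : [/\ act d01 (dfc o2_4 : simplex 3 2) = e01, act d12 (dfc o2_4 : simplex 3 2) = e13 &
act d02 (dfc o2_4 : simplex 3 2) = e03].
by split; apply: deltaP; case=> [[|[|]]].
have f1 : [/\ act d01 (dfc o1_4 : simplex 3 2) = e02, act d12 (dfc o1_4 : simplex 3 2) = e23 &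
act d02 (dfc o1_4 : simplex 3 2) = e03].
by split; apply: deltaP; case=> [[|[|]]].
have f0 : [/\ act d01 (dfc ord0 : simplex 3 2) = e12, act d12 (dfc ord0 : simplex 3 2) = e23 &
act d02 (dfc ord0 : simplex 3 2) = e13].
by split; apply: deltaP; case=> [[|[|]]].
have [y3 h3] : pdom G (dfc ord_max : simplex 3 2) by apply: dG; case: k12 => ->.
have [y0 h0] : pdom G (dfc ord0 : simplex 3 2) by apply: dG; case: k12 => ->.
have [g3 b3] : goodc (ce_of y3) /\ cell_bd (ce_of y3) (har h e01) (har h e12) (har h e02).
by case: f3 => a1 a2 a3; apply: (bE _ _ _ _ a1 a2 a3).
have [g0 b0] : goodc (ce_of y0) /\ cell_bd (ce_of y0) (har h e12) (har h e23) (har h e13).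
by case: f0 => a1 a2 a3; apply: (bE _ _ _ _ a1 a2 a3).
rewrite -E01 -E12 -E02 in b3; rewrite -E12 -E23 -E13 in b0.
have [p012 P012] := cellP b3; have [p123 P123] := cellP b0.
suff [c [gc bc tc]] : exists c, [/\ goodc c,
cell_bd c (har h (act d01 (dfc k : simplex 3 2))) (har h (act d12 (dfc k : simplex 3 2)))
(har h (act d02 (dfc k : simplex 3 2))) &
forall ce : simplex 3 2 -> cell, (forall s y, G 2 s y -> ce s = ce_of y) -> ce (dfc k) = c ->
tet (ce (dfc ord_max)) (ce (dfc o1_4)) (ce (dfc o2_4)) (ce (dfc ord0))].
pose ce (s : simplex 3 2) := if pselect (pdom G s) is left p then ce_of (sval (cid p)) else c.
have ceE s y : G 2 s y -> ce s = ce_of y.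
rewrite /ce; case: pselect => [p|np] hy; last by case: np; exists y.
by case: cid => y' /= hy'; rewrite (prel_fun hy hy').
have ceN s : ~ pdom G s -> ce s = c by rewrite /ce; case: pselect.
apply: (horn_fill (ce := ce)) => //.
- move=> s ns nd; rewrite ceN //.
have -> : s = dfc k; last by [].
by apply: horn_last; [apply: nondeg_injS|move/hdomP].
- move=> t nt nd; have -> : t = did 3 by apply: dinj_endo (nondeg_injS nd).
have E i : act (dfc i) (did 3 : simplex 3 3) = dfc i by apply: delta_eq.
rewrite !E; apply: tc => //; apply: ceN; case/hdomP=> i [ik].
have ik' : k != i by apply/eqP => e; apply: ik.
by have [j -> _] := unlift_some ik' => /(_ j).
case: k12 => kE.
- have [y2 h2] : pdom G (dfc o2_4 : simplex 3 2) by apply: dG; rewrite kE.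
have [g2 b2] : goodc (ce_of y2) /\ cell_bd (ce_of y2) (har h e01) (har h e13) (har h e03).
by case: f2 => a1 a2 a3; apply: (bE _ _ _ _ a1 a2 a3).
rewrite -E01 -E13 -E03 in b2; have [p013 P013] := cellP b2.
rewrite -P012 in g3; rewrite -P123 in g0; rewrite -P013 in g2.
have [q [gq tq]] := @fill3_1 _ _ _ _ F01 F12 F23 F02 F13 F03 p012 p013 p123 g3 g2 g0.
exists (Cell q); split=> //; first by rewrite -kE in f1; case: f1 => -> -> ->; rewrite -E02 -E23 -E03.
move=> ce ceE ck; have {}ck : ce (dfc o1_4) = Cell q by rewrite -ck; congr (ce (dfc _)).
by rewrite ck (ceE _ _ h3) (ceE _ _ h2) (ceE _ _ h0) -P012 -P013 -P123.
- have [y1 h1] : pdom G (dfc o1_4 : simplex 3 2) by apply: dG; rewrite kE.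
have [g1 b1] : goodc (ce_of y1) /\ cell_bd (ce_of y1) (har h e02) (har h e23) (har h e03).
by case: f1 => a1 a2 a3; apply: (bE _ _ _ _ a1 a2 a3).
rewrite -E02 -E23 -E03 in b1; have [p023 P023] := cellP b1.
rewrite -P012 in g3; rewrite -P123 in g0; rewrite -P023 in g1.
have [q [gq tq]] := @fill3_2 _ _ _ _ F01 F12 F23 F02 F13 F03 p012 p023 p123 g3 g1 g0.
exists (Cell q); split=> //; first by rewrite -kE in f2; case: f2 => -> -> ->; rewrite -E01 -E13 -E03.
move=> ce ceE ck; have {}ck : ce (dfc o2_4) = Cell q by rewrite -ck; congr (ce (dfc _)).
by rewrite ck (ceE _ _ h3) (ceE _ _ h1) (ceE _ _ h0) -P012 -P023 -P123.
Qed.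

Ltac dn2 := apply: deltaP; apply: ord2P.

(** All triangles of a 4-simplex lie in the horn. What is missing is the equation of a single
    tetrahedron, and [four_faces] provides it. *)
Lemma horn4_tet (k : 'I_5) (h : smap (@horn 4 k) (D2 b)) (ce : simplex 4 2 -> cell) :
 0 < k < 4 -> (forall s y, prel (pm_sub h) s y -> ce s = ce_of y) ->
 tet (ce (act (dfc ord_max) (dfc k : simplex 4 3))) (ce (act (dfc o1_4) (dfc k : simplex 4 3)))
   (ce (act (dfc o2_4) (dfc k : simplex 4 3))) (ce (act (dfc ord0) (dfc k : simplex 4 3))).
Proof.
move=> k04 m2; pose G : partmap (simplex 4) (D2 b) := pm_sub h.
pose v i : simplex 4 0 := dconst 0 i.
have st (e : simplex 4 1) i j : e ord0 = i -> e ord_max = j -> source e = v i /\ target e = v j.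
by move=> <- <-; split; apply: delta_eq.
have ht (e : simplex 4 1) i j : e ord0 = i -> e ord_max = j ->
exists F : mpfunctor (@hob 1 k h (v i)) (@hob 1 k h (v j)), Arr F = @har 1 k h e.
by move=> h1 h2; have [s t] := st e i j h1 h2; apply: har_typed'.
have hc (s : simplex 4 2) : goodc (ce s) /\
cell_bd (ce s) (@har 1 k h (act d01 s)) (@har 1 k h (act d12 s)) (@har 1 k h (act d02 s)).
have [y hy] : pdom G s by apply/(@hdomP 1); exact: (@horn_dom 4 k 2 s isT).
by rewrite (m2 _ _ hy); apply: hceE.
have hc' (s : simplex 4 2) e e' e'' : act d01 s = e -> act d12 s = e' -> act d02 s = e'' ->
goodc (ce s) /\ cell_bd (ce s) (@har 1 k h e) (@har 1 k h e') (@har 1 k h e'').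
by move=> <- <- <-; apply: hc.
have htet (t : simplex 4 3) (a c d e : simplex 4 2) : pdom G t ->
act (dfc ord_max) t = a -> act (dfc o1_4) t = c -> act (dfc o2_4) t = d ->
act (dfc ord0) t = e -> tet (ce a) (ce c) (ce d) (ce e).
case=> y hy <- <- <- <-; rewrite (m2 _ _ (prel_act (dfc ord_max) hy)) (m2 _ _ (prel_act (dfc o1_4) hy)).
by rewrite (m2 _ _ (prel_act (dfc o2_4) hy)) (m2 _ _ (prel_act (dfc ord0) hy)); apply: dtetE.
have dG i : i <> k -> pdom G (dfc i : simplex 4 3).
by move=> ik; apply/(@hdomP 1); exists i; split=> // j; apply: dfN.
pose e01 : simplex 4 1 := @dedge 4 (@Ordinal 5 0 isT) (@Ordinal 5 1 isT) isT.
pose e02 : simplex 4 1 := @dedge 4 (@Ordinal 5 0 isT) (@Ordinal 5 2 isT) isT.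
pose e03 : simplex 4 1 := @dedge 4 (@Ordinal 5 0 isT) (@Ordinal 5 3 isT) isT.
pose e04 : simplex 4 1 := @dedge 4 (@Ordinal 5 0 isT) (@Ordinal 5 4 isT) isT.
pose e12 : simplex 4 1 := @dedge 4 (@Ordinal 5 1 isT) (@Ordinal 5 2 isT) isT.
pose e13 : simplex 4 1 := @dedge 4 (@Ordinal 5 1 isT) (@Ordinal 5 3 isT) isT.
pose e14 : simplex 4 1 := @dedge 4 (@Ordinal 5 1 isT) (@Ordinal 5 4 isT) isT.
pose e23 : simplex 4 1 := @dedge 4 (@Ordinal 5 2 isT) (@Ordinal 5 3 isT) isT.
pose e24 : simplex 4 1 := @dedge 4 (@Ordinal 5 2 isT) (@Ordinal 5 4 isT) isT.
pose e34 : simplex 4 1 := @dedge 4 (@Ordinal 5 3 isT) (@Ordinal 5 4 isT) isT.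
pose t012 : simplex 4 2 := @dtri 4 (@Ordinal 5 0 isT) (@Ordinal 5 1 isT) (@Ordinal 5 2 isT) isT isT.
pose t013 : simplex 4 2 := @dtri 4 (@Ordinal 5 0 isT) (@Ordinal 5 1 isT) (@Ordinal 5 3 isT) isT isT.
pose t014 : simplex 4 2 := @dtri 4 (@Ordinal 5 0 isT) (@Ordinal 5 1 isT) (@Ordinal 5 4 isT) isT isT.
pose t023 : simplex 4 2 := @dtri 4 (@Ordinal 5 0 isT) (@Ordinal 5 2 isT) (@Ordinal 5 3 isT) isT isT.
pose t024 : simplex 4 2 := @dtri 4 (@Ordinal 5 0 isT) (@Ordinal 5 2 isT) (@Ordinal 5 4 isT) isT isT.
pose t034 : simplex 4 2 := @dtri 4 (@Ordinal 5 0 isT) (@Ordinal 5 3 isT) (@Ordinal 5 4 isT) isT isT.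
pose t123 : simplex 4 2 := @dtri 4 (@Ordinal 5 1 isT) (@Ordinal 5 2 isT) (@Ordinal 5 3 isT) isT isT.
pose t124 : simplex 4 2 := @dtri 4 (@Ordinal 5 1 isT) (@Ordinal 5 2 isT) (@Ordinal 5 4 isT) isT isT.
pose t134 : simplex 4 2 := @dtri 4 (@Ordinal 5 1 isT) (@Ordinal 5 3 isT) (@Ordinal 5 4 isT) isT isT.
pose t234 : simplex 4 2 := @dtri 4 (@Ordinal 5 2 isT) (@Ordinal 5 3 isT) (@Ordinal 5 4 isT) isT isT.
have [F01 E01] := ht e01 (@Ordinal 5 0 isT) (@Ordinal 5 1 isT) erefl erefl.
have [F02 E02] := ht e02 (@Ordinal 5 0 isT) (@Ordinal 5 2 isT) erefl erefl.
have [F03 E03] := ht e03 (@Ordinal 5 0 isT) (@Ordinal 5 3 isT) erefl erefl.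
have [F04 E04] := ht e04 (@Ordinal 5 0 isT) (@Ordinal 5 4 isT) erefl erefl.
have [F12 E12] := ht e12 (@Ordinal 5 1 isT) (@Ordinal 5 2 isT) erefl erefl.
have [F13 E13] := ht e13 (@Ordinal 5 1 isT) (@Ordinal 5 3 isT) erefl erefl.
have [F14 E14] := ht e14 (@Ordinal 5 1 isT) (@Ordinal 5 4 isT) erefl erefl.
have [F23 E23] := ht e23 (@Ordinal 5 2 isT) (@Ordinal 5 3 isT) erefl erefl.
have [F24 E24] := ht e24 (@Ordinal 5 2 isT) (@Ordinal 5 4 isT) erefl erefl.
have [F34 E34] := ht e34 (@Ordinal 5 3 isT) (@Ordinal 5 4 isT) erefl erefl.
have [g012 b012] : goodc (ce t012) /\ cell_bd (ce t012) (@har 1 k h e01) (@har 1 k h e12) (@har 1 k h e02).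
by apply: hc'; dn2.
rewrite -E01 -E12 -E02 in b012; have [p012 P012] := cellP b012.
have [g013 b013] : goodc (ce t013) /\ cell_bd (ce t013) (@har 1 k h e01) (@har 1 k h e13) (@har 1 k h e03).
by apply: hc'; dn2.
rewrite -E01 -E13 -E03 in b013; have [p013 P013] := cellP b013.
have [g014 b014] : goodc (ce t014) /\ cell_bd (ce t014) (@har 1 k h e01) (@har 1 k h e14) (@har 1 k h e04).
by apply: hc'; dn2.
rewrite -E01 -E14 -E04 in b014; have [p014 P014] := cellP b014.
have [g023 b023] : goodc (ce t023) /\ cell_bd (ce t023) (@har 1 k h e02) (@har 1 k h e23) (@har 1 k h e03).
by apply: hc'; dn2.
rewrite -E02 -E23 -E03 in b023; have [p023 P023] := cellP b023.
have [g024 b024] : goodc (ce t024) /\ cell_bd (ce t024) (@har 1 k h e02) (@har 1 k h e24) (@har 1 k h e04).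
by apply: hc'; dn2.
rewrite -E02 -E24 -E04 in b024; have [p024 P024] := cellP b024.
have [g034 b034] : goodc (ce t034) /\ cell_bd (ce t034) (@har 1 k h e03) (@har 1 k h e34) (@har 1 k h e04).
by apply: hc'; dn2.
rewrite -E03 -E34 -E04 in b034; have [p034 P034] := cellP b034.
have [g123 b123] : goodc (ce t123) /\ cell_bd (ce t123) (@har 1 k h e12) (@har 1 k h e23) (@har 1 k h e13).
by apply: hc'; dn2.
rewrite -E12 -E23 -E13 in b123; have [p123 P123] := cellP b123.
have [g124 b124] : goodc (ce t124) /\ cell_bd (ce t124) (@har 1 k h e12) (@har 1 k h e24) (@har 1 k h e14).
by apply: hc'; dn2.
rewrite -E12 -E24 -E14 in b124; have [p124 P124] := cellP b124.
have [g134 b134] : goodc (ce t134) /\ cell_bd (ce t134) (@har 1 k h e13) (@har 1 k h e34) (@har 1 k h e14).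
by apply: hc'; dn2.
rewrite -E13 -E34 -E14 in b134; have [p134 P134] := cellP b134.
have [g234 b234] : goodc (ce t234) /\ cell_bd (ce t234) (@har 1 k h e23) (@har 1 k h e34) (@har 1 k h e24).
by apply: hc'; dn2.
rewrite -E23 -E34 -E24 in b234; have [p234 P234] := cellP b234.
have T0 : (@Ordinal 5 0 isT) <> k -> tet (Cell p123) (Cell p134) (Cell p124) (Cell p234).
move=> /dG dt; rewrite P123 P134 P124 P234; apply: (htet _ _ _ _ _ dt); by apply: deltaP; apply: ord3P.
have T1 : (@Ordinal 5 1 isT) <> k -> tet (Cell p023) (Cell p034) (Cell p024) (Cell p234).
move=> /dG dt; rewrite P023 P034 P024 P234; apply: (htet _ _ _ _ _ dt); by apply: deltaP; apply: ord3P.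
have T2 : (@Ordinal 5 2 isT) <> k -> tet (Cell p013) (Cell p034) (Cell p014) (Cell p134).
move=> /dG dt; rewrite P013 P034 P014 P134; apply: (htet _ _ _ _ _ dt); by apply: deltaP; apply: ord3P.
have T3 : (@Ordinal 5 3 isT) <> k -> tet (Cell p012) (Cell p024) (Cell p014) (Cell p124).
move=> /dG dt; rewrite P012 P024 P014 P124; apply: (htet _ _ _ _ _ dt); by apply: deltaP; apply: ord3P.
have T4 : (@Ordinal 5 4 isT) <> k -> tet (Cell p012) (Cell p023) (Cell p013) (Cell p123).
move=> /dG dt; rewrite P012 P023 P013 P123; apply: (htet _ _ _ _ _ dt); by apply: deltaP; apply: ord3P.
rewrite -P012 in g012; rewrite -P123 in g123; rewrite -P234 in g234.
have nk (i : nat) (i5 : i < 5) : nat_of_ord k <> i -> Ordinal i5 <> k by move=> ki e; apply: ki; rewrite -e.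
have [R3 R2 R1] := @four_faces _ _ _ _ _ F01 F12 F23 F34 F02 F13 F24 F03 F14 F04 p012 p013 p014 p023 p024 p034 p123 p124 p134 p234 k g012 g123 g234 k04
(fun z => T4 (nk 4 isT z)) (fun z => T3 (nk 3 isT z)) (fun z => T2 (nk 2 isT z)) (fun z => T1 (nk 1 isT z)) (fun z => T0 (nk 0 isT z)).
have key (t : simplex 4 3) (a c d e : simplex 4 2) : (forall x, t x = dfc k x :> nat) ->
act (dfc ord_max) t = a -> act (dfc o1_4) t = c -> act (dfc o2_4) t = d ->
act (dfc ord0) t = e -> tet (ce a) (ce c) (ce d) (ce e) ->
tet (ce (act (dfc ord_max) (dfc k : simplex 4 3))) (ce (act (dfc o1_4) (dfc k : simplex 4 3)))
(ce (act (dfc o2_4) (dfc k : simplex 4 3))) (ce (act (dfc ord0) (dfc k : simplex 4 3))).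
by move=> tk <- <- <- <-; rewrite (deltaP tk).
have [k1|[k2|k3]] : nat_of_ord k = 1 \/ nat_of_ord k = 2 \/ nat_of_ord k = 3.
by move: (nat_of_ord k) k04 => [|[|[|[|?]]]] //; auto.
- apply: (key (dfc (@Ordinal 5 1 isT)) t023 t034 t024 t234); try by apply: deltaP; apply: ord3P.
by move=> x; rewrite !dfE k1.
by rewrite -P023 -P034 -P024 -P234.
- apply: (key (dfc (@Ordinal 5 2 isT)) t013 t034 t014 t134); try by apply: deltaP; apply: ord3P.
by move=> x; rewrite !dfE k2.
by rewrite -P013 -P034 -P014 -P134.
- apply: (key (dfc (@Ordinal 5 3 isT)) t012 t024 t014 t124); try by apply: deltaP; apply: ord3P.
by move=> x; rewrite !dfE k3.
by rewrite -P012 -P024 -P014 -P124.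
Qed.

(** In dimension 5 and above the horn contains every tetrahedron, so nothing is left to check. *)
Lemma quasi_D2 : quasicategory (D2 b).
Proof.
move=> [|[|[|n]]] k kn h; try by move: kn; rewrite ?andbF //; case: (nat_of_ord k) => [|[|?]].
have k1 : k = o1_3 by apply: ord_inj; move: kn; case: (nat_of_ord k) => [|[|?]].
by subst k; apply: quasi_D2_2.
case: n k kn h => [|n] k kn h; first exact: quasi_D2_3.
have V2 (s : simplex n.+4 2) : pdom (pm_sub h) s.
by apply/(@hdomP n.+1); exact: (@horn_dom n.+4 k 2 s isT).
pose ce s := ce_of (sval (cid (V2 s))).
have ceE s y : prel (pm_sub h) s y -> ce s = ce_of y.
by move=> hy; rewrite /ce; case: cid => y' /= h'; rewrite (prel_fun hy h').
apply: (@horn_fill n.+1 k h ce) => //.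
move=> t nt nd; case: n k kn h V2 ce ceE t nt nd => [|n] k kn h V2 ce ceE t nt nd; last first.
by case: nt; apply/(@hdomP n.+2); exact: (@horn_dom n.+4.+1 k 3 t isT).
have tk : t = dfc k; last by rewrite tk; exact: (@horn4_tet k h ce kn ceE).
by apply: horn_last; [apply: nondeg_injS|move/(@hdomP 1)].
Qed.
End DuskinHorns.

(** * Use of the universal property of the localization *)

Definition eqve (X : sset) (x y : X 0) :=
 exists e : X 1, [/\ is_equivalence e, source e = x & target e = y].

Lemma eqv_edge_sym (X : sset) (x y : X 0) : eqve x y -> eqve y x.
Proof. by case=> e [/eqv_inv[g [h s t]] <- <-]; exists g. Qed.

Lemma smap_eqe (X Y : sset) (f : smap X Y) (x y : X 0) :
 eqve x y -> eqve (f 0 x) (f 0 y).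
Proof.
case=> e [h <- <-]; exists (f 1 e); split; [exact: smap_eqv|exact: smap_source|exact: smap_target].
Qed.

Definition of_vertex (X Y : sset) (r : sFun X Y 0) : smap X Y.
Proof.
refine (@Smap X Y (fun n x => (r : smap _ _) n (x, dconst n ord0)) _).
by move=> m n f x; rewrite -smapP /= dconst_comp.
Defined.

Lemma of_vertexK (X Y : sset) (r : sFun X Y 0) : sFun_vertex (of_vertex r) = r.
Proof.
apply: smap_eq => n [x f] /=; congr (r n (x, _)); apply: delta_eq => i.
by rewrite [LHS]ord1 [RHS]ord1.
Qed.
Definition full_incl (X : sset) (P : X 0 -> Prop) : smap (full_ssub P) X :=
 @Smap (full_ssub P) X (fun n x => sval x) (fun _ _ _ _ => erefl).

Lemma vertex2 (n : nat) (i : 'I_3) : exists (f : delta 1 2) (j : 'I_2),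
 (f = d01 \/ f = d12) /\ dconst n i = dcomp f (dconst n j).
Proof.
move: i; apply: ord3P.
- by exists d01, ord0; split; [left|apply: delta_eq].
- by exists d01, ord_max; split; [left|apply: deltaP].
- by exists d12, ord_max; split; [right|apply: deltaP].
Qed.

Lemma full_composite (X : sset) (P : X 0 -> Prop) (s : X 2) (f g e : full_ssub P 1) :
 composite s (sval f) (sval g) (sval e) -> exists s' : full_ssub P 2, composite s' f g e.
Proof.
move=> [h1 h2 h3]; have Ps : forall i, P (act (dconst 0 i) s).
move=> i; have [d [j [[->|->] ->]]] := vertex2 0 i; rewrite actM.
by rewrite h1; apply: (svalP f).
by rewrite h2; apply: (svalP g).
by exists (exist _ s Ps); split; apply: sigE.
Qed.

(** An inverse of [e] has the same two end points, so it lies in the full subcomplex together with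
    the witnessing triangles. *)
Lemma full_eqv (X : sset) (P : X 0 -> Prop) (e : full_ssub P 1) :
 is_equivalence (sval e) -> is_equivalence e.
Proof.
case=> g [s [t [c1 c2]]]; have [_ a1 a2] := tri_ends (ex_intro _ s c1).
have Pg : forall i, P (act (dconst 0 i) g).
have P0 : P (source g) by rewrite -a2; apply: (svalP e ord_max).
have P1 : P (target g) by rewrite -a1 target_id; apply: (svalP e ord0).
by case=> [[|[|]]] // h; [have := P0|have := P1]; rewrite /source /target;
congr (P (act (dconst 0 _) g)); apply: ord_inj.
pose g' : full_ssub P 1 := exist _ g Pg.
have [s' c1'] := @full_composite X P s e g' (degenerate 1 (source e)) c1.
have [t' c2'] := @full_composite X P t g' e (degenerate 1 (target e)) c2.
by exists g', s', t'.
Qed.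

Lemma nat_eqv_at (X Y : sset) (f g : smap X Y) (x : X 0) :
 naturally_equivalent f g -> eqve (f 0 x) (g 0 x).
Proof.
case=> e [h s t]; have := smap_eqe (seval Y x) (ex_intro _ e (And3 h s t)).
have d0 : degenerate 0 x = x.
rewrite /degenerate (_ : dconst 0 ord0 = did 0) ?act1 //.
by apply: delta_eq => i; rewrite [LHS]ord1 [RHS]ord1.
by rewrite /= d0.
Qed.

Section Localization.
Variables (X : sset) (W : X 1 -> Prop) (L : sset) (ell : smap X L).
Hypothesis loc : is_localization W ell.

Lemma loc_quasi : quasicategory L. Proof. by case: loc. Qed.

Lemma inv_vertexP (D : sset) (F : smap X D) :
 (forall e, W e -> is_equivalence (F 1 e)) ->
 forall i, forall e, W e ->
  is_equivalence ((act (dconst 0 i) (sFun_vertex F : sFun X D 0) : smap _ _) 1 (e, dconst 1 ord0)).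
Proof. by move=> h i e /h. Qed.

(** Essential surjectivity of restriction along [ell], read at one vertex. *)
Lemma loc_ex (D : sset) (F : smap X D) : quasicategory D ->
 (forall e, W e -> is_equivalence (F 1 e)) ->
 exists r : smap L D, eqve (sFun_vertex (scomp r ell) : sFun X D 0) (sFun_vertex F).
Proof.
move=> qD iF; have [_ /(_ D qD)[R [RE [g [_ Rg]]]]] := loc.
pose Fv : sFun_inverting W D 0 := exist _ (sFun_vertex F : sFun X D 0) (inv_vertexP iF).
exists (of_vertex (g 0 Fv)).
have := smap_eqe (full_incl _) (nat_eqv_at Fv Rg).
rewrite /= RE; congr eqve; apply: smap_eq => n [x f] /=.
by congr ((g 0 Fv : smap _ _) n (_, _)); apply: delta_eq => i; rewrite [LHS]ord1 [RHS]ord1.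
Qed.

Lemma loc_inv e : W e -> is_equivalence (ell 1 e).
Proof.
move=> We; have [_ /(_ L loc_quasi)[R [RE _]]] := loc.
have := svalP (R 0 (sFun_vertex (sid L))) ord0 e We.
by rewrite RE.
Qed.

(** An equivalence after restriction lies in the full subcomplex of inverting functors, and the
    inverse [g] of restriction carries it back. The outcome is left as a chain of three equivalences
    instead of being composed. *)
Lemma loc_un (phi : smap L L) :
 eqve (sFun_vertex (scomp phi ell) : sFun X L 0) (sFun_vertex ell) ->
 exists u v : smap L L, [/\ eqve (sFun_vertex phi : sFun L L 0) (sFun_vertex u),
  eqve (sFun_vertex u : sFun L L 0) (sFun_vertex v) &
  eqve (sFun_vertex v : sFun L L 0) (sFun_vertex (sid L))].
Proof.
case=> e [eqe se te]; have [_ /(_ L loc_quasi)[R [RE [g [gR _]]]]] := loc.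
pose pv : sFun L L 0 := sFun_vertex phi; pose iv : sFun L L 0 := sFun_vertex (sid L).
have Rp : sval (R 0 pv) = source e by rewrite RE se; apply: smap_eq.
have Ri : sval (R 0 iv) = target e by rewrite RE te; apply: smap_eq.
have Pe : forall i, forall e', W e' -> is_equivalence ((act (dconst 0 i) e : smap _ _) 1 (e', dconst 1 ord0)).
apply: ord2P.
change (act (dconst 0 ord0) e) with (source e); rewrite -Rp => e' We; exact: (svalP (R 0 pv) ord0 e' We).
change (act (dconst 0 ord_max) e) with (target e); rewrite -Ri => e' We; exact: (svalP (R 0 iv) ord0 e' We).
pose e' : sFun_inverting W L 1 := exist _ e Pe.
have E : eqve (R 0 pv) (R 0 iv).
exists e'; split; first exact: full_eqv.
by apply: sigE; rewrite Rp.
by apply: sigE; rewrite Ri.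
exists (of_vertex (g 0 (R 0 pv))), (of_vertex (g 0 (R 0 iv))); rewrite !of_vertexK; split.
- exact/eqv_edge_sym/(nat_eqv_at pv gR).
- exact: smap_eqe.
- exact: (nat_eqv_at iv gR).
Qed.
End Localization.

(** * Strict functors as pseudofunctors *)

Definition cweq (b : bool) (A B : Cb b) (F : hom A B) : Prop :=
 exists H : hom B A,
  nat_iso (@marked A) (mpf (cmp H F)) (mpf (idm A)) /\
  nat_iso (@marked B) (mpf (cmp F H)) (mpf (idm B)).

Section Strict.
Variable b : bool.
Notation cob := (cob b).

Lemma idc_nat (A B : cob) (F G : mpfunctor A B) (E : F = G) (a a' : A) (f : phom a a')
 (e : F a = G a) (e' : F a' = G a') :
 pcmp (idc e') (pfmor F f) = pcmp (pfmor G f) (idc e).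
Proof. by subst G; rewrite !idc_id pcmp1m pcmpm1. Qed.

Section StrictSimp.
Variables (n : nat) (x : nerve (Cb b) n).

Definition sF (i j : 'I_n.+1) (h : sle i j) : mpfunctor (nob x i) (nob x j) :=
 nmor x (of_sle h).

Lemma sFE (i j k : 'I_n.+1) (ij : sle i j) (jk : sle j k) (ik : sle i k) :
 mpfunctor_comp (sF jk) (sF ij) = sF ik.
Proof. by rewrite /sF (nmorM x (of_sle ij) (of_sle jk) (of_sle ik)). Qed.
Definition sphi (i j k : 'I_n.+1) (ij : sle i j) (jk : sle j k) (ik : sle i k) (a : nob x i) :
  phom (sF jk (sF ij a)) (sF ik a) :=
 idc (f_equal (fun F : mpfunctor _ _ => F a) (sFE ij jk ik)).

Definition strict_simp : d2 b n.
Proof.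
refine (@D2s b n (nob x) sF sphi _ _ _ _ _ _).
- by move=> *; apply: marked_idc.
- by move=> i j k ij jk ik a a' f; apply: (idc_nat (sFE ij jk ik)).
- by move=> i ii; apply: (nmor1 x (of_sle ii)).
- by move=> i k ii ik a e; rewrite /sphi; congr idc; apply: pirr.
- by move=> i k ii ik a e; rewrite /sphi; congr idc; apply: pirr.
- move=> i j k l ij jk kl ik jl il a; rewrite /sphi.
rewrite (pfmor_idc (F := sF kl) _ (f_equal (sF kl) (f_equal (fun F : mpfunctor _ _ => F a) (sFE ij jk ik)))).
rewrite !(idc_cmp _ _ (etrans (f_equal (sF kl) (f_equal (fun F : mpfunctor _ _ => F a) (sFE ij jk ik))) (f_equal (fun F : mpfunctor _ _ => F a) (sFE ik kl il)))).
by [].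
Defined.
End StrictSimp.

Definition comp_cell (A B C : cob) (F : mpfunctor A B) (G : mpfunctor B C) (H : mpfunctor A C)
  (E : mpfunctor_comp G F = H) : cell b :=
 @Cell b A B C F G H (fun a => idc (f_equal (fun F : mpfunctor A C => F a) E)).

Lemma comp_cell_eq (A B C : cob) (F F' : mpfunctor A B) (G G' : mpfunctor B C)
  (H H' : mpfunctor A C) (E : mpfunctor_comp G F = H) (E' : mpfunctor_comp G' F' = H') :
 F = F' -> G = G' -> comp_cell E = comp_cell E'.
Proof.
move=> eF eG; by case: _ / eF E' => E'; case: _ / eG E' => E'; case: _ / E; case: _ / E'.
Qed.

Definition strict : smap (nerve (Cb b)) (D2 b).
Proof.
refine (@Smap (nerve (Cb b)) (D2 b) strict_simp _).
have sm m n (f : delta m n) x (i j : 'I_m.+1) (h : sle i j) :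
sF (act f x : nerve (Cb b) m) h = sF x (smono f h).
exact: (f_equal (@nmor _ _ x (f i) (f j)) (pirr _ _)).
move=> m n f x; apply: d2_extF => //.
- by move=> i j h; apply: (f_equal (@Arr b _ _) (sm _ _ f x i j h)).
- move=> i j k ij jk ik.
exact: (@comp_cell_eq _ _ _ _ _ _ _ _ _ (sFE (act f x : nerve (Cb b) m) ij jk ik) (sFE x (smono f ij) (smono f jk) (smono f ik)) (sm _ _ f x i j ij) (sm _ _ f x j k jk)).
Defined.

(** Needed for the canonical lifts of strict simplices to form a single-valued partial map. *)
Lemma strict_inj n (x y : nerve (Cb b) n) : strict n x = strict n y -> x = y.
Proof.
case: x => A F h1 h2; case: y => A' F' h1' h2' e.
have eA : A = A' by apply: fext => i; apply: (f_equal (fun z : d2 b n => dA z i) e).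
subst A'; have eF : F = F'.
apply: dfext => i; apply: dfext => j.
apply: fext => h.
have := f_equal (fun z : d2 b n => farr z (sle_of h)) e; rewrite /farr /= => /arr_inj.
by rewrite /sF /= (pirr (of_sle (sle_of h)) h).
by subst F'; f_equal; apply: proof_irrelevance.
Qed.

Lemma strict_onto0 (y : D2 b 0) : exists x, strict 0 x = y.
Proof.
unshelve eexists.
apply: (@NerveSimp (Cb b) 0 (fun _ => dA y ord0) (fun _ _ _ => idm (dA y ord0 : Cb b))).
- by [].
- by move=> *; rewrite cmp1m.
apply: d2_ext => //.
- by move=> i; rewrite /= [i]ord1.
- by move=> i j h ij; exfalso; move: ij; rewrite [i]ord1 [j]ord1.
- by move=> i j k ij jk ik h; exfalso; move: h; rewrite [i]ord1 [j]ord1.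
Qed.

Lemma d2_1_ext (x y : D2 b 1) : ar_of x = ar_of y -> x = y.
Proof.
move=> e; apply: d2_ext.
- by apply: ord2P; [exact: (f_equal (@aS b) e)|exact: (f_equal (@aT b) e)].
- move=> i j h; have := h; move: i j h; apply: ord2P; apply: ord2P => // h _ _; exact: e.
- move=> i j k ij jk ik; move: i j k ij jk ik; do 3 apply: ord2P => //.
Qed.

(** The three constant vertices are extended over the 2-simplex by [d2_extend], with the given cell
    on the nondegenerate triangle. *)
Lemma d2_tri (A B C : cob) (F : mpfunctor A B) (G : mpfunctor B C) (H : mpfunctor A C)
 (p : forall a, phom (G (F a)) (H a)) : goodc (Cell p) ->
 exists s : D2 b 2, [/\ ar_of (act d01 s) = Arr F, ar_of (act d12 s) = Arr G,
  ar_of (act d02 s) = Arr H & ce_of s = Cell p].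
Proof.
move=> gp; pose ob (i : 'I_3) := match val i with 0 => A | 1 => B | _ => C end.
pose pt (i : 'I_3) : D2 b 0 := strict 0 (@NerveSimp (Cb b) 0 (fun _ => ob i)
(fun _ _ _ => idm (ob i : Cb b)) (fun _ _ => erefl) (fun _ _ _ _ _ _ => esym (cmp1m _))).
have [G0 G0E] : {G0 : partmap (simplex 2) (D2 b) | forall m f y, prel G0 f y <->
exists i, f = dconst m i /\ y = degenerate m (pt i)}.
unshelve eexists; first refine (@Partmap (simplex 2) (D2 b) (fun m f y =>
exists i, f = dconst m i /\ y = degenerate m (pt i)) _ _); last by [].
- by move=> m l f x y [i [-> ->]]; exists i; rewrite act_deg; split=> //; apply: delta_eq.
- move=> m x y y' [i [-> ->]] [i' [e ->]].
by have -> : i = i' := f_equal (fun f : delta _ _ => f ord0) e.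
have V0 (v : simplex 2 0) : pdom G0 v.
exists (degenerate 0 (pt (v ord0))); apply/G0E; exists (v ord0); split=> //.
by apply: delta_eq => i; rewrite [i]ord1.
pose ar (e : simplex 2 1) : arr b := if e ord0 == e ord_max then arr1 (ob (e ord0)) else
if e ord0 == ord0 then (if e ord_max == o1_3 then Arr F else Arr H) else Arr G.
pose ce (s : simplex 2 2) : cell b := if pselect (s = did 2) then Cell p else
if s ord0 == s o1_3 then idcl (ar (act d02 s)) else idcr (ar (act d02 s)).
have obpt i : ob_of (pt i) = ob i by [].
have G0c m i : prel G0 (dconst m i : simplex 2 m) (degenerate m (pt i)) by apply/G0E; exists i.
have vob (v : simplex 2 0) y : prel G0 v y -> ob_of y = ob (v ord0).
by case/G0E=> i [-> ->].
have arT (e : simplex 2 1) : [/\ aS (ar e) = ob (e ord0) & aT (ar e) = ob (e ord_max)].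
have le : e ord0 <= e ord_max by apply: dmono.
rewrite /ar; by move: (e ord0) (e ord_max) le => [[|[|[|//]]] h] [[|[|[|//]]] h'].
have inj2 (e : simplex 2 1) : ~ pdom G0 e -> e ord0 <> e ord_max.
move=> ne e01; apply: ne; exists (degenerate 1 (pt (e ord0))); apply/G0E; exists (e ord0); split=> //.
by apply: delta_eq; apply: ord2P.
have degE i (e : simplex 2 1) : (act (ddeg i) e : simplex 2 2) = did 2 -> False.
have key (u v : 'I_3) : ddeg i u = ddeg i v -> (act (ddeg i) e : simplex 2 2) = did 2 -> u = v.
by move=> uv E; rewrite -[u]/(did 2 u) -[v]/(did 2 v) -E !dcE uv.
move: i key; apply: ord2P => key E.
have e1 : ddeg ord0 ord0 = ddeg ord0 o1_3 :> 'I_2 by apply: ord_inj; rewrite !dgE.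
by have := key _ _ e1 E.
have e1 : ddeg ord_max o1_3 = ddeg ord_max ord_max :> 'I_2 by apply: ord_inj; rewrite !dgE.
by have := key _ _ e1 E.
have ceN (s : simplex 2 2) : s <> did 2 -> ce s = if s ord0 == s o1_3 then idcl (ar (act d02 s)) else idcr (ar (act d02 s)).
by rewrite /ce; case: pselect.
have ce1 : ce (did 2) = Cell p by rewrite /ce; case: pselect.
have d02deg i (e : simplex 2 1) : act d02 (act (ddeg i) e) = e.
rewrite -actM (_ : dcomp _ _ = did 1) ?act1 //; apply: deltaP => j; rewrite dcE dgE.
by move: i j; do 2 apply: ord2P.
have constG m (f : simplex 2 m) y : prel G0 f y -> forall i, f i = f ord0.
by case/G0E=> i [-> _].
have [|||||||g [gE gar gce]] := @d2_extend b _ G0 ar ce V0.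
- move=> e y /G0E[i [-> ->]]; rewrite /ar eqxx; symmetry; exact: (@farr_id b 0 (pt i) ord0 stt).
- move=> s y /G0E[i [-> ->]]; rewrite ceN; last by move=> /(f_equal (fun f : delta _ _ => (f ord0, f ord_max))) [-> ].
rewrite eqxx /ar eqxx; symmetry.
apply: etrans (@fcell_l b 0 (pt i) ord0 ord0 stt stt) _.
by congr idcl; apply: (@farr_id b 0 (pt i) ord0 stt).
- by move=> e y y' ne /vob -> /vob ->; apply: arT.
- move=> s ns nd; have -> : s = did 2 := dinj_endo (nondeg_injS nd).
by rewrite ce1; split=> //; split; rewrite /ar.
- move=> e ne; rewrite ceN; last exact: degE.
by rewrite (_ : _ == _ = true) ?d02deg //; apply/eqP; rewrite !dcE; congr (e _); apply: ord_inj; rewrite !dgE.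
- move=> e ne; rewrite ceN; last exact: degE.
rewrite (_ : _ == _ = false) ?d02deg //; apply/eqP; rewrite !dcE.
rewrite (_ : ddeg _ _ = ord0); last by apply: ord_inj; rewrite dgE.
rewrite (_ : ddeg _ o1_3 = ord_max); last by apply: ord_inj; rewrite dgE.
exact: inj2.
- by move=> t _ /nondeg_injS/inj_leq.
exists (g 2 (did 2)); rewrite -!smapP !gar gce ce1.
by split=> //; rewrite /ar.
Qed.
Lemma ar_of_degenerate (x : D2 b 0) : ar_of (degenerate 1 x) = arr1 (ob_of x).
Proof. exact: (@farr_id b 0 x ord0 stt). Qed.
Lemma ar_of_src (e : D2 b 1) : ob_of (source e) = aS (ar_of e). Proof. by []. Qed.
Lemma ar_of_tgt (e : D2 b 1) : ob_of (target e) = aT (ar_of e). Proof. by []. Qed.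

Lemma d2_equivalence (A B : cob) (F : mpfunctor A B) (H : mpfunctor B A) (e : D2 b 1) :
 ar_of e = Arr F ->
 nat_iso (@marked A) (pfunctor_comp H F) (pfunctor_id A) ->
 nat_iso (@marked B) (pfunctor_comp F H) (pfunctor_id B) -> is_equivalence e.
Proof.
move=> eF [eta [eta1 eta2]] [eps [eps1 eps2]].
have g1 : goodc (@Cell b A B A F H (mpfunctor_id A) eta).
by split=> [a|a a' f]; [case: (eta1 a)|apply: eta2].
have g2 : goodc (@Cell b B A B H F (mpfunctor_id B) eps).
by split=> [a|a a' f]; [case: (eps1 a)|apply: eps2].
have [s [s1 s2 s3 _]] := d2_tri g1; have [t [t1 t2 t3 _]] := d2_tri g2.
exists (act d12 s), s, t; split; split=> //.
- by apply: d2_1_ext; rewrite s1 eF.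
- by apply: d2_1_ext; rewrite s3 ar_of_degenerate ar_of_src eF.
- by apply: d2_1_ext; rewrite t1 s2.
- by apply: d2_1_ext; rewrite t2 eF.
- by apply: d2_1_ext; rewrite t3 ar_of_degenerate ar_of_tgt eF.
Qed.

Lemma strict_inv (e : nerve (Cb b) 1) : nerve_class (@cweq b) e -> is_equivalence (strict 1 e).
Proof.
case=> H [h1 h2]; apply: (@d2_equivalence _ _ _ H) h1 h2.
by rewrite /ar_of /farr /=; congr Arr; congr (nmor e); apply: pirr.
Qed.
End Strict.

(** * Both cases as instances of one category [Cb b] *)

Definition maxmk (A : preadd) : mpreadd.
Proof.
refine (@Mpreadd A (@p_iso A) _ _ _ _).
- by [].
- exact: p_iso_id.
- by move=> *; apply: p_iso_cmp.
- by move=> x y f g _ /p_iso_inv.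
Defined.

Section SharpC.
Variables (b : bool) (Gamma : groupoid).

Definition smk (A : mpreadd) (X Y : sharp Gamma A) (f : phom X Y) : Prop :=
 if b then p_iso f else @sharp_marked Gamma A X Y f.

(** The proofs are selected by matching on [b], so that at [false] the result is convertible to
    [msharp] and at [true] to the maximal marking. *)
Definition msharpC (A : mpreadd) : mpreadd :=
 @Mpreadd (sharp Gamma A) (@smk A)
  (match b as b0 return (forall X Y (f : @phom (sharp Gamma A) X Y),
    (if b0 then p_iso f else @sharp_marked Gamma A X Y f) -> p_iso f)
   with true => @marked_iso (maxmk (sharp Gamma A))
   | false => @marked_iso (msharp Gamma A) end)
  (match b as b0 return (forall X,
    (if b0 then p_iso (@pid (sharp Gamma A) X) else @sharp_marked Gamma A X X (pid X)))
   with true => @marked_id (maxmk (sharp Gamma A))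
   | false => @marked_id (msharp Gamma A) end)
  (match b as b0 return (forall X Y Z (g : @phom (sharp Gamma A) Y Z) (f : @phom (sharp Gamma A) X Y),
    (if b0 then p_iso g else @sharp_marked Gamma A Y Z g) ->
    (if b0 then p_iso f else @sharp_marked Gamma A X Y f) ->
    (if b0 then p_iso (pcmp g f) else @sharp_marked Gamma A X Z (pcmp g f)))
   with true => @marked_cmp (maxmk (sharp Gamma A))
   | false => @marked_cmp (msharp Gamma A) end)
  (match b as b0 return (forall X Y (f : @phom (sharp Gamma A) X Y) (g : @phom (sharp Gamma A) Y X),
    (if b0 then p_iso f else @sharp_marked Gamma A X Y f) -> p_inverse f g ->
    (if b0 then p_iso g else @sharp_marked Gamma A Y X g))
   with true => @marked_inv (maxmk (sharp Gamma A))
   | false => @marked_inv (msharp Gamma A) end).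

Lemma smk_tens (A : mpreadd) (X Y : sharp Gamma A) (a : phom (sh1 X) (sh1 Y))
 (g : ghom (sh2 X) (sh2 Y)) : marked a -> @marked (msharpC A) X Y (tens a g).
Proof.
move=> ma; rewrite /msharpC /= /smk; case: b; last by exists a, g.
have [a' aa] := marked_iso ma; exists (tens a' (ginv g)); exact: sharp_inverse.
Qed.
Lemma msharpC_all (A : cob b) : b -> forall (x y : msharpC A) (f : phom x y), p_iso f -> marked f.
Proof. by rewrite /msharpC /= /smk; case: b. Qed.
Definition sho (A : cob b) : cob b := Cob (@msharpC_all A).

Definition shm (A B : cob b) (F : mpfunctor A B) : mpfunctor (sho A) (sho B).
Proof.
refine (@Mpfunctor (sho A) (sho B) (sharp_map Gamma F) _).
rewrite /= /smk; case: b => [x y f|]; first exact: (pfmor_iso (sharp_map Gamma F)).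
exact: (mpf_marked (msharp_map Gamma F)).
Defined.

Definition sharpC : functor (Cb b) (Cb b).
Proof.
refine (@Functor (Cb b) (Cb b) sho shm _ _).
- by move=> A; apply: mpfunctor_eq; apply: sharp_map_id.
- by move=> A B C G F; apply: mpfunctor_eq; apply: sharp_map_comp.
Defined.
End SharpC.

Lemma nerve_eq (C : category) n (A : 'I_n.+1 -> C)
  (F F' : forall i j : 'I_n.+1, i <= j -> hom (A i) (A j)) h1 h2 h1' h2' :
 F = F' -> @NerveSimp C n A F h1 h2 = @NerveSimp C n A F' h1' h2'.
Proof. by move=> e; subst F'; f_equal; apply: proof_irrelevance. Qed.

(** Comparing simplices of nerves over different objects would need transports. Surjectivity
    together with a left inverse gives the inverse on the other side without them. *)
Lemma nerve_full_surj (C0 C1 : category) (Phi : functor C0 C1) :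
 (forall A : C1, exists A0, A = Phi A0) ->
 (forall (A B : C0) (f : hom (Phi A) (Phi B)), exists f0 : hom A B, f = fmor Phi f0) ->
 (forall (A B : C0) (f g : hom A B), fmor Phi f = fmor Phi g -> f = g) ->
 forall n (x : nerve C1 n), exists y, nerve_map Phi n y = x.
Proof.
move=> so sf inj n [A F h1 h2].
have [A0 AE] : exists A0, A = (fun i => Phi (A0 i)).
exists (fun i => sval (cid (so (A i)))); apply: fext => i.
exact: svalP (cid (so (A i))).
subst A; pose F0 (i j : 'I_n.+1) (h : i <= j) := sval (cid (sf _ _ (F i j h))).
have FE i j h : F i j h = fmor Phi (F0 i j h) := svalP (cid (sf _ _ (F i j h))).
have k1 i h : F0 i i h = idm (A0 i) by apply: inj; rewrite -FE h1 fmor1.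
have k2 i j k hij hjk hik : F0 i k hik = cmp (F0 j k hjk) (F0 i j hij).
by apply: inj; rewrite fmorM -!FE; apply: h2.
exists (@NerveSimp C0 n A0 F0 k1 k2).
have E : F = (fun i j h => fmor Phi (F0 i j h)).
apply: dfext => i; apply: dfext => j.
by apply: fext => h; apply: FE.
exact: nerve_eq.
Qed.

Lemma nerve_map_id' (C0 C1 : category) (Phi : functor C0 C1) (U : functor C1 C0) :
 (forall n (x : nerve C0 n), nerve_map U n (nerve_map Phi n x) = x) ->
 (forall n (x : nerve C1 n), exists y, nerve_map Phi n y = x) ->
 forall n (x : nerve C1 n), nerve_map Phi n (nerve_map U n x) = x.
Proof. by move=> h s n x; have [y <-] := s n x; rewrite h. Qed.

Definition PhiT : functor preAdd (Cb true).
Proof.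
refine (@Functor preAdd (Cb true) (fun A => @Cob true (maxmk A) (fun _ _ _ _ h => h))
(fun A B F => @Mpfunctor (maxmk A) (maxmk B) F (fun x y f h => pfmor_iso F h)) _ _).
- by move=> A; apply: mpfunctor_eq.
- by move=> A B C G F; apply: mpfunctor_eq.
Defined.

Definition UT : functor (Cb true) preAdd.
Proof.
refine (@Functor (Cb true) preAdd (fun A => mp (cm A)) (fun A B F => mpf F) _ _).
- by [].
- by [].
Defined.

Definition PhiF : functor preAddplus (Cb false).
Proof.
refine (@Functor preAddplus (Cb false) (fun A => @Cob false A (fun h => match notF h with end))
(fun A B F => F) _ _).
- by [].
- by [].
Defined.

Definition UF : functor (Cb false) preAddplus.
Proof.
refine (@Functor (Cb false) preAddplus (fun A => cm A) (fun A B F => F) _ _).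
- by [].
- by [].
Defined.
Lemma UPhiT n (x : nerve preAdd n) : nerve_map UT n (nerve_map PhiT n x) = x.
Proof. by case: x => A F h1 h2; rewrite /= /nerve_map_simp /=; f_equal; apply: proof_irrelevance. Qed.
Lemma UPhiF n (x : nerve preAddplus n) : nerve_map UF n (nerve_map PhiF n x) = x.
Proof. by case: x => A F h1 h2; rewrite /= /nerve_map_simp /=; f_equal; apply: proof_irrelevance. Qed.
Lemma sharpT (G : groupoid) n (x : nerve preAdd n) :
 nerve_map UT n (nerve_map (sharpC true G) n (nerve_map PhiT n x)) = nerve_map (sharp_functor G) n x.
Proof. by rewrite /= /nerve_map_simp /=; f_equal; apply: proof_irrelevance. Qed.

Lemma sharpF (G : groupoid) n (x : nerve preAddplus n) :
 nerve_map UF n (nerve_map (sharpC false G) n (nerve_map PhiF n x)) = nerve_map (msharp_functor G) n x.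
Proof.
have E (A : mpreadd) : cm (sho G (PhiF A : cob false)) = msharp G A by [].
case: x => A F h1 h2; rewrite /= /nerve_map_simp /=.
have EM (A1 B : mpreadd) (f : mpfunctor A1 B) :
shm G (f : mpfunctor (PhiF A1 : cob false) (PhiF B : cob false)) = msharp_map G f :> mpfunctor (msharp G A1) (msharp G B).
exact: mpfunctor_eq.
have E2 : (fun (i j : 'I_n.+1) (h : i <= j) => shm G (F i j h : mpfunctor (PhiF (A i) : cob false) (PhiF (A j) : cob false)) : mpfunctor (msharp G (A i)) (msharp G (A j)))
= (fun (i j : 'I_n.+1) (h : i <= j) => msharp_map G (F i j h)).
do 2 (apply: dfext => ?); apply: fext => ?; exact: EM.
exact: (@nerve_eq preAddplus n (fun i => msharp G (A i)) _ _ _ _ _ _ E2).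
Qed.
Lemma cob_eq (b : bool) (A B : mpreadd) h h' : A = B -> @Cob b A h = @Cob b B h'.
Proof. by move=> e; subst B; f_equal; apply: proof_irrelevance. Qed.

Lemma PhiUT n (x : nerve (Cb true) n) : nerve_map PhiT n (nerve_map UT n x) = x.
Proof.
apply: nerve_map_id'; first exact: UPhiT.
apply: nerve_full_surj.
- move=> [[A mk h1 h2 h3 h4] ha]; exists A.
(* An object of [Cb true] marks all isomorphisms, and a marking never contains anything else, so it
   is the maximal one by propositional extensionality. *)
have E : mk = @p_iso A.
do 3 (apply: dfext => ?); apply: propext; split; first exact: h1.
exact: (ha isT).
by subst mk; apply: cob_eq; rewrite /maxmk; f_equal; apply: proof_irrelevance.
- by move=> A B f; exists (mpf f); apply: mpfunctor_eq.
- by move=> A B f g /(f_equal (fun h : mpfunctor _ _ => mpf h)).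
Qed.

Lemma PhiUF n (x : nerve (Cb false) n) : nerve_map PhiF n (nerve_map UF n x) = x.
Proof.
apply: nerve_map_id'; first exact: UPhiF.
apply: nerve_full_surj.
- by move=> [A ha]; exists A; apply: cob_eq.
- by move=> A B f; exists f.
- by [].
Qed.

Section Transfer.
Variables (K X0 X1 L : sset) (P : smap X0 X1) (U : smap X1 X0) (ell : smap X0 L)
 (F0 : smap X0 L) (F1 : smap X1 L).
Hypotheses (UP : forall n x, U n (P n x) = x)
 (F10 : forall n x, F1 n (P n x) = F0 n x).

(** The natural cocone is pulled back along [P]; diagrams and apexes agree because [U] is a left
    inverse of [P]. *)
Lemma natural_colimit_transfer :
 natural_colimit (scomp (postcomp K (scomp ell U)) (const_diagram K X1)) F1 ->
 natural_colimit (scomp (postcomp K ell) (const_diagram K X0)) F0.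
Proof.
case=> T [T0 T1 T2].
have D01 n x : scomp (postcomp K (scomp ell U)) (const_diagram K X1) n (P n x) =
scomp (postcomp K ell) (const_diagram K X0) n x.
by apply: smap_eq => m [k f] /=; rewrite -smapP UP.
pose T' : smap (sprod X0 (simplex 1)) (sFun K L) := @Smap (sprod X0 (simplex 1)) (sFun K L)
(fun n x => T n (P n x.1, x.2))
(fun m n f x => etrans (f_equal (fun z => T m (z, _)) (smapP P f x.1)) (smapP T f (P n x.1, x.2))).
exists T'; split.
- by move=> n s; rewrite /= T0 D01.
- by move=> n s; rewrite /= T1 F10.
move=> i; have := T2 (P 0 i); rewrite D01 F10.
rewrite (_ : at_vertex T (P 0 i) = at_vertex T' i) //.
by apply: smap_eq => n t /=; rewrite smap_deg.
Qed.
End Transfer.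

(** * Strictification by conjugation with marked isomorphisms *)

Section Pull.
Variable b : bool.
Notation cob := (cob b).

(* The category with set of objects [X] and the morphisms of [B] between the
  images under [g].  For [g] the identity it is convertible to [B]. *)
Definition pull_preadd (B : preadd) (X : Type) (g : X -> B) : preadd :=
 @Preadd X (fun x y => phom (g x) (g y)) (fun x => pid (g x)) (fun x y z h f => pcmp h f)
  (fun w x y z h k f => @pcmpA B (g w) (g x) (g y) (g z) h k f)
  (fun x y f => @pcmp1m B (g x) (g y) f) (fun x y f => @pcmpm1 B (g x) (g y) f)
  (fun x y z h h' f => @pcmpDl B (g x) (g y) (g z) h h' f)
  (fun x y z h f f' => @pcmpDr B (g x) (g y) (g z) h f f').

Definition pull_mpreadd (B : mpreadd) (X : Type) (g : X -> B) : mpreadd :=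
 @Mpreadd (pull_preadd g) (fun x y f => @marked B (g x) (g y) f)
  (fun x y f m => @marked_iso B (g x) (g y) f m) (fun x => @marked_id B (g x))
  (fun x y z h f mh mf => @marked_cmp B (g x) (g y) (g z) h f mh mf)
  (fun x y f h m i => @marked_inv B (g x) (g y) f h m i).

Definition pull (B : cob) (X : Type) (g : X -> B) : cob :=
 @Cob b (pull_mpreadd g) (fun bt x y f i => @cob_all b B bt (g x) (g y) f i).

Section PullMap.
Variables (B B' : cob) (X X' : Type) (g : X -> B) (g' : X' -> B').

(** The freedom used for strictification: the image of an object is only required to be isomorphic,
    by a marked isomorphism, to the one that [K] prescribes. *)
Definition pdat (K : mpfunctor B B') (x : X) :=
 {y : X' & {f : phom (K (g x)) (g' y) | marked f}}.

Definition pd_inv K x (t : pdat K x) : phom (g' (projT1 t)) (K (g x)) :=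
 pinv (marked_iso (svalP (projT2 t))).

Section Mor.
Variables (K : mpfunctor B B') (th : forall x, pdat K x).

Definition pm_mor x y (f : phom (g x) (g y)) :
  phom (g' (projT1 (th x))) (g' (projT1 (th y))) :=
 pcmp (pcmp (sval (projT2 (th y))) (pfmor K f)) (pd_inv (th x)).

Lemma pm_mor1 x : pm_mor (pid (g x)) = pid (g' (projT1 (th x))).
Proof. by rewrite /pm_mor pfmor1 pcmpm1 pinv_r. Qed.

Lemma pm_morM x y z (h : phom (g y) (g z)) (f : phom (g x) (g y)) :
 pm_mor (pcmp h f) = pcmp (pm_mor h) (pm_mor f).
Proof.
rewrite /pm_mor pfmorM -!pcmpA; congr pcmp; congr pcmp.
by rewrite [in RHS]pcmpA pinv_l pcmp1m.
Qed.
Lemma pm_morD x y (f f' : phom (g x) (g y)) : pm_mor (f + f')%R = (pm_mor f + pm_mor f')%R.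
Proof. by rewrite /pm_mor pfmorD pcmpDr pcmpDl. Qed.

Lemma pm_mor_marked x y (f : phom (g x) (g y)) : marked f -> marked (pm_mor f).
Proof.
move=> mf; apply: marked_cmp; first apply: marked_cmp.
- exact: svalP (projT2 (th y)).
- exact: mpf_marked.
- by apply: mk_pinv; apply: svalP (projT2 (th x)).
Qed.
Definition pull_map : mpfunctor (pull g) (pull g') :=
 @Mpfunctor (pull g) (pull g') (@Pfunctor (pull g) (pull g') (fun x => projT1 (th x))
  pm_mor pm_mor1 pm_morM pm_morD) pm_mor_marked.
End Mor.

Lemma pull_map_ext (K : mpfunctor B B') (th th' : forall x, pdat K x) :
 (forall x, th x = th' x) -> pull_map th = pull_map th'.
Proof. by move=> e; congr pull_map; apply: dfext. Qed.
Lemma pinv_uniq (A : preadd) (x y : A) (f : phom x y) (h : p_iso f) k :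
 pcmp f k = pid y -> k = pinv h.
Proof. by move=> e; apply: (iso_mono h); rewrite e pinv_r. Qed.

Definition pd_pre (K K' : mpfunctor B B') (p : forall x, phom (K x) (K' x))
  (mp : forall x, marked (p x)) x (t : pdat K' x) : pdat K x :=
 existT _ (projT1 t) (exist _ (pcmp (sval (projT2 t)) (p (g x)))
  (marked_cmp (svalP (projT2 t)) (mp (g x)))).

(** An isomorphism between [K] and [K'] can be absorbed in the chosen data without changing the
    resulting functor. This turns the coherence cells of a pseudofunctor into equalities of
    functors. *)
Lemma pull_map_conj (K K' : mpfunctor B B') (p : forall x, phom (K x) (K' x))
  (mp : forall x, marked (p x)) (th : forall x, pdat K' x) :
 (forall x y (f : phom x y), pcmp (p y) (pfmor K f) = pcmp (pfmor K' f) (p x)) ->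
 pull_map th = pull_map (fun x => pd_pre mp (th x)).
Proof.
move=> nat; apply: mpfunctor_eq; apply: pfunctor_eq.
apply: dfext => x; apply: dfext => y.
apply: fext => f.
change (pcmp (pcmp (sval (projT2 (th y))) (pfmor K' f)) (pd_inv (th x)) =
pcmp (pcmp (pcmp (sval (projT2 (th y))) (p (g y))) (pfmor K f)) (pd_inv (pd_pre mp (th x)))).
rewrite -!pcmpA; congr pcmp; rewrite pcmpA nat -pcmpA; congr pcmp.
by symmetry; apply: pinv_uniq; rewrite pcmpA; apply: pinv_r.
Qed.
End PullMap.

Definition pd_id (B : cob) (X : Type) (g : X -> B) (x : X) : pdat g g (mpfunctor_id B) x :=
 existT _ x (exist _ (pid (g x)) (marked_id (g x))).

Lemma pull_map_id (B : cob) (X : Type) (g : X -> B) : pull_map (pd_id g) = mpfunctor_id (pull g).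
Proof.
apply: mpfunctor_eq; apply: pfunctor_eq.
apply: dfext => x; apply: dfext => y.
apply: fext => f; change (pm_mor (pd_id g) f = f).
have -> : pm_mor (pd_id g) f = pcmp (pcmp (pid (g y)) f) (pd_inv (pd_id g x)) by [].
rewrite pcmp1m -[RHS]pcmpm1; congr pcmp; symmetry; apply: pinv_uniq; exact: pcmp1m.
Qed.

Section PullComp.
Variables (B0 B1 B2 : cob) (X0 X1 X2 : Type) (g0 : X0 -> B0) (g1 : X1 -> B1) (g2 : X2 -> B2).
Variables (K : mpfunctor B0 B1) (K' : mpfunctor B1 B2).
Variables (th : forall x, pdat g0 g1 K x) (th' : forall x, pdat g1 g2 K' x).

Definition pd_comp x : pdat g0 g2 (mpfunctor_comp K' K) x :=
 existT _ (projT1 (th' (projT1 (th x))))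
  (exist _ (pcmp (sval (projT2 (th' (projT1 (th x))))) (pfmor K' (sval (projT2 (th x)))))
   (marked_cmp (svalP (projT2 (th' (projT1 (th x))))) (mpf_marked K' (svalP (projT2 (th x)))))).

Lemma pull_map_comp : mpfunctor_comp (pull_map th') (pull_map th) = pull_map pd_comp.
Proof.
apply: mpfunctor_eq; apply: pfunctor_eq.
apply: dfext => x; apply: dfext => y.
apply: fext => f.
set fy := sval (projT2 (th y)); set fx := projT2 (th x).
change (pcmp (pcmp (sval (projT2 (th' (projT1 (th y)))))
(pfmor K' (pcmp (pcmp fy (pfmor K f)) (pd_inv (th x))))) (pd_inv (th' (projT1 (th x)))) =
pcmp (pcmp (pcmp (sval (projT2 (th' (projT1 (th y))))) (pfmor K' fy)) (pfmor K' (pfmor K f)))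
(pd_inv (pd_comp x))).
rewrite !pfmorM -!pcmpA; do 3 congr pcmp.
apply: pinv_uniq; set i1 := pd_inv (th x); set i2 := pd_inv _.
change (pcmp (pcmp (sval (projT2 (th' (projT1 (th x))))) (pfmor K' (sval (projT2 (th x)))))
(pcmp (pfmor K' i1) i2) = pid (g2 (projT1 (th' (projT1 (th x)))))).
by rewrite -pcmpA (pcmpA (pfmor K' (sval _))) -pfmorM pinv_r pfmor1 pcmp1m pinv_r.
Qed.
End PullComp.

(** Morphisms on both sides are those of [B], so the functor is fully faithful by construction, and
    the hypothesis supplies essential surjectivity. *)
Lemma pull_weq (B : cob) (X X' : Type) (g : X -> B) (g' : X' -> B)
  (th : forall x, pdat g g' (mpfunctor_id B) x) :
 (forall y : X', {x : X & {f : phom (g' y) (g x) | marked f}}) ->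
 @cweq b (pull g) (pull g') (pull_map th).
Proof.
move=> si; pose th' y : pdat g' g (mpfunctor_id B) y := si y.
exists (pull_map th'); split.
pose e x := pcmp (sval (projT2 (th' (projT1 (th x))))) (sval (projT2 (th x))).
have me x : marked (e x).
by apply: marked_cmp; [apply: svalP (projT2 (th' _))|apply: svalP (projT2 (th x))].
exists (fun x => pinv (marked_iso (me x))); split.
move=> x; have m : marked (pinv (marked_iso (me x))) by apply: mk_pinv.
by split=> //; have [h hh] := marked_iso m; exists h.
move=> x y f; apply: (iso_mono (marked_iso (me y))).
set f0 := (f : phom (g x) (g y)).
have E : pcmp (pcmp (sval (projT2 (th' (projT1 (th y))))) (pcmp (pcmp (sval (projT2 (th y))) f0) (pd_inv (th x))))
(pd_inv (th' (projT1 (th x)))) = pcmp (pcmp (e y) f0) (pinv (marked_iso (me x))).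
rewrite /e -!pcmpA; do 3 congr pcmp; apply: pinv_uniq.
by rewrite -pcmpA (pcmpA (sval (projT2 (th x)))) pinv_r pcmp1m pinv_r.
change (pcmp (e y) (pcmp (pinv (marked_iso (me y))) (pcmp (pcmp (sval (projT2 (th' (projT1 (th y))))) (pcmp (pcmp (sval (projT2 (th y))) f0) (pd_inv (th x))))
(pd_inv (th' (projT1 (th x)))))) = pcmp (e y) (pcmp f0 (pinv (marked_iso (me x))))).
by rewrite E !pcmpA pinv_r pcmp1m.
pose e y := pcmp (sval (projT2 (th (projT1 (th' y))))) (sval (projT2 (th' y))).
have me y : marked (e y).
by apply: marked_cmp; [apply: svalP (projT2 (th _))|apply: svalP (projT2 (th' y))].
exists (fun x => pinv (marked_iso (me x))); split.
move=> x; have m : marked (pinv (marked_iso (me x))) by apply: mk_pinv.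
by split=> //; have [h hh] := marked_iso m; exists h.
move=> x y f; apply: (iso_mono (marked_iso (me y))).
set f0 := (f : phom (g' x) (g' y)).
have E : pcmp (pcmp (sval (projT2 (th (projT1 (th' y))))) (pcmp (pcmp (sval (projT2 (th' y))) f0) (pd_inv (th' x))))
(pd_inv (th (projT1 (th' x)))) = pcmp (pcmp (e y) f0) (pinv (marked_iso (me x))).
rewrite /e -!pcmpA; do 3 congr pcmp; apply: pinv_uniq.
by rewrite -pcmpA (pcmpA (sval (projT2 (th' x)))) pinv_r pcmp1m pinv_r.
change (pcmp (e y) (pcmp (pinv (marked_iso (me y))) (pcmp (pcmp (sval (projT2 (th (projT1 (th' y))))) (pcmp (pcmp (sval (projT2 (th' y))) f0) (pd_inv (th' x))))
(pd_inv (th (projT1 (th' x)))))) = pcmp (e y) (pcmp f0 (pinv (marked_iso (me x))))).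
by rewrite E !pcmpA pinv_r pcmp1m.
Qed.
End Pull.

(* A family of labels [t] with [km t], each placed at a vertex [kD t] of [n]
  below the vertex [klv]. *)
Record knode (n : nat) := KN {
 kD : nat -> 'I_n.+1;
 km : nat -> bool;
 klv : 'I_n.+1;
 kle : forall t, km t -> kD t <= klv;
 kj : forall t, ~~ km t -> kD t = klv }.

Lemma knode_eq n (k k' : knode n) : kD k = kD k' -> km k = km k' -> klv k = klv k' -> k = k'.
Proof.
case: k => D m l h hj; case: k' => D' m' l' h' hj' /= e1 e2 e3; subst D' m' l'.
by f_equal; apply: proof_irrelevance.
Qed.
Definition kact m n (f : delta m n) (k : knode m) : knode n :=
 @KN n (fun t => f (kD k t)) (km k) (f (klv k)) (fun t h => dmono f (kle h))
  (fun t h => f_equal f (kj h)).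

Definition numk n (j : 'I_n.+1) : knode n := @KN n (fun _ => j) (fun _ => false) j
 (fun t (h : false) => match notF h with end) (fun _ _ => erefl).

(* Chains in the cograph of [klv]: a chain of maps of labelled families,
  followed by vertices of [n] (the positions with [cb i]). *)
Record csimp (n m : nat) := CS {
 cb : 'I_m.+1 -> bool;
 cn : 'I_m.+1 -> knode n;
 cu : 'I_m.+1 -> 'I_m.+1 -> nat -> nat;
 cbm : forall i j : 'I_m.+1, i <= j -> cb i -> cb j;
 cnum : forall i, cb i -> cn i = numk (klv (cn i));
 catt : forall i, ~~ cb i -> exists2 t, km (cn i) t & kD (cn i) t = klv (cn i);
 clv : forall i j : 'I_m.+1, i <= j -> klv (cn i) <= klv (cn j);
 cum : forall (i j : 'I_m.+1) t, i <= j -> ~~ cb j -> km (cn i) t -> km (cn j) (cu i j t);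
 cuD : forall (i j : 'I_m.+1) t, i <= j -> ~~ cb j -> km (cn i) t ->
  kD (cn j) (cu i j t) = kD (cn i) t;
 cu1 : forall i t, km (cn i) t -> cu i i t = t;
 cuM : forall (i j l : 'I_m.+1) t, i <= j -> j <= l -> ~~ cb l -> km (cn i) t ->
  cu i l t = cu j l (cu i j t);
 cu0 : forall (i j : 'I_m.+1) t, ~~ [&& i <= j, ~~ cb j & km (cn i) t] -> cu i j t = 0 }.

(** The value 0 imposed by [cu0] outside the meaningful range makes equality of chains
    extensional. *)
Lemma csimp_eq n m (x y : csimp n m) : (forall i, cb x i = cb y i) ->
 (forall i, cn x i = cn y i) ->
 (forall (i j : 'I_m.+1) t, i <= j -> ~~ cb x j -> km (cn x i) t -> cu x i j t = cu y i j t) -> x = y.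
Proof.
case: x => xb xn xu h1 h2 h0 h3 h4 h5 h6 h7 h8; case: y => yb yn yu g1 g2 g0 g3 g4 g5 g6 g7 g8 /= e1 e2 e3.
have E1 : xb = yb by apply: fext.
have E2 : xn = yn by apply: fext.
subst yb yn; have E3 : xu = yu.
apply: fext => i; apply: fext => j.
apply: fext => t.
case: (boolP [&& i <= j, ~~ xb j & km (xn i) t]) => [/and3P[]|n0]; first exact: e3.
by rewrite h8 // g8.
by subst yu; f_equal; apply: proof_irrelevance.
Qed.

Definition csimp_act n m m' (a : delta m' m) (x : csimp n m) : csimp n m'.
Proof.
refine (@CS n m' (fun i => cb x (a i)) (fun i => cn x (a i))
(fun i j t => if i <= j then cu x (a i) (a j) t else 0) _ _ _ _ _ _ _ _ _).
- by move=> i j ij; apply: cbm; apply: dmono.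
- by move=> i; apply: cnum.
- by move=> i; apply: catt.
- by move=> i j ij; apply: clv; apply: dmono.
- by move=> i j t ij; rewrite ij; apply: cum; apply: dmono.
- by move=> i j t ij; rewrite ij; apply: cuD; apply: dmono.
- by move=> i t h; rewrite leqnn; apply: cu1.
- by move=> i j l t ij jl; rewrite ij jl (leq_trans ij jl); apply: cuM; apply: dmono.
- move=> i j t; case: ifP => // ij h; apply: cu0; rewrite (dmono a ij); exact: h.
Defined.

Definition Cyl (n : nat) : sset.
Proof.
refine (@SSet (csimp n) (fun m' m a x => csimp_act a x) _ _).
- by move=> m x; apply: csimp_eq => //= i j t ->.
- move=> k m l f g x; apply: csimp_eq => //= i j t ij _ _.
by rewrite ij (dmono g ij).
Defined.

Definition Cyl_map_simp n n' (f : delta n n') m (x : csimp n m) : csimp n' m.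
Proof.
refine (@CS n' m (cb x) (fun i => kact f (cn x i)) (cu x) _ _ _ _ _ _ _ _ _).
- exact: cbm.
- move=> i h; have /= E := cnum h; apply: knode_eq; rewrite E //.
- by move=> i /catt[t mt e]; exists t; rewrite /= ?e.
- by move=> i j ij; apply: (dmono f); apply: clv.
- exact: cum.
- by move=> i j t ij h1 h2; rewrite /= (cuD ij h1 h2).
- exact: cu1.
- exact: cuM.
- exact: cu0.
Defined.

Definition Cyl_map n n' (f : delta n n') : smap (Cyl n) (Cyl n').
Proof.
refine (@Smap (Cyl n) (Cyl n') (@Cyl_map_simp n n' f) _).
by move=> m l g x; apply: csimp_eq.
Defined.
Lemma Cyl_map_id n m (x : Cyl n m) : Cyl_map (did n) m x = x.
Proof. by apply: csimp_eq => // i; apply: knode_eq. Qed.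
Lemma Cyl_map_comp n n' n'' (g : delta n' n'') (f : delta n n') m (x : Cyl n m) :
 Cyl_map (dcomp g f) m x = Cyl_map g m (Cyl_map f m x).
Proof. by apply: csimp_eq => // i; apply: knode_eq. Qed.

(** * Strict replacements of a pseudofunctor *)

Record qobj (M : nat -> bool) (B : nat -> Type) := Qobj { qt : nat; qa : B qt; qm : M qt }.

Section QMap.
Variables (b : bool) (n : nat) (s : d2 b n).
Notation A := (dA s).

Definition castA (i j : 'I_n.+1) (e : i = j) (a : A i) : A j :=
 match e in _ = j' return A j' with erefl => a end.

(** A coherence cell whose target is read at [j] instead of [i]: a relabelling preserves the vertex
    of a label only up to a propositional equality. *)
Definition qpf (i l l' : 'I_n.+1) (il : sle i l) (ll : sle l l') (il' : sle i l') (j : 'I_n.+1)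
  (e : i = j) (a : A i) : forall jl : sle j l', phom (dF s ll (dF s il a)) (dF s jl (castA e a)) :=
 match e as e0 in _ = j' return (forall jl : sle j' l',
  phom (dF s ll (dF s il a)) (dF s jl (castA e0 a)))
 with erefl => fun jl => dphi s il ll il' a end.

Lemma qpf_marked i l l' il ll il' j (e : i = j) a jl : marked (@qpf i l l' il ll il' j e a jl).
Proof. by subst j; apply: dphi_marked. Qed.
Definition nX (bn : bool) (k : knode n) : Type :=
 match bn return Type with true => A (klv k) | false => qobj (km k) (fun t => A (kD k t)) end.

Definition nG (bn : bool) (k : knode n) : nX bn k -> A (klv k) :=
 match bn as b0 return (nX b0 k -> A (klv k)) with
 | true => fun a => a
 | false => fun x => dF s (sle_of (kle (qm x))) (qa x)
 end.
Arguments nG : clear implicits.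

(** For a family, objects are labelled objects of the various fibres and morphisms are computed
    after pushing both to the fibre over [klv]; for a number it is that fibre. *)
Definition qnode (bn : bool) (k : knode n) : cob b := pull (nG bn k).

Definition mkpd (k1 k2 : knode n) b1 b2 (K : mpfunctor (A (klv k1)) (A (klv k2))) x y
 (f : phom (K (nG b1 k1 x)) (nG b2 k2 y)) (mf : marked f) : pdat (nG b1 k1) (nG b2 k2) K x :=
 existT _ y (exist _ f mf).

Definition thKK (k1 k2 : knode n) (hl : klv k1 <= klv k2) (x : nX false k1) (t2 : nat)
  (m2 : km k2 t2) (e : kD k2 t2 = kD k1 (qt x)) :
  pdat (nG false k1) (nG false k2) (dF s (sle_of hl)) x :=
 @mkpd k1 k2 false false (dF s (sle_of hl)) x (Qobj (castA (esym e) (qa x)) m2)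
  (qpf (sle_of (kle (qm x))) (sle_of hl) (sle_of (leq_trans (kle (qm x)) hl)) (esym e) (qa x) (sle_of (kle m2)))
  (qpf_marked _ _ _ _ _ _).

Lemma thKK_eq k1 k2 hl x t2 t2' m2 m2' e e' : t2 = t2' ->
 @thKK k1 k2 hl x t2 m2 e = @thKK k1 k2 hl x t2' m2' e'.
Proof. by move=> E; subst t2'; rewrite (pirr m2 m2') (pirr e e'). Qed.

Definition thKN (k1 k2 : knode n) (hl : klv k1 <= klv k2) (x : nX false k1) :
  pdat (nG false k1) (nG true k2) (dF s (sle_of hl)) x :=
 @mkpd k1 k2 false true (dF s (sle_of hl)) x (dF s (sle_of (leq_trans (kle (qm x)) hl)) (qa x))
  (dphi s (sle_of (kle (qm x))) (sle_of hl) (sle_of (leq_trans (kle (qm x)) hl)) (qa x))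
  (dphi_marked s _ _ _ _).

Definition thNN (k1 k2 : knode n) (hl : klv k1 <= klv k2) (x : nX true k1) :
  pdat (nG true k1) (nG true k2) (dF s (sle_of hl)) x :=
 @mkpd k1 k2 true true (dF s (sle_of hl)) x (dF s (sle_of hl) x) (pid _) (marked_id _).

(** From family to family an object is relabelled but not moved, from family to number it is pushed
    forward, and between numbers the functor of [s] is applied. Steps from a number back to a family
    do not occur. *)
Definition qth (b1 : bool) (k1 : knode n) (b2 : bool) (k2 : knode n) (u : nat -> nat) (hb : b1 -> b2) (hl : klv k1 <= klv k2)
 (hm : forall t, ~~ b2 -> km k1 t -> km k2 (u t))
 (hD : forall t, ~~ b2 -> km k1 t -> kD k2 (u t) = kD k1 t) :
 forall x : nX b1 k1, pdat (nG b1 k1) (nG b2 k2) (dF s (sle_of hl)) x :=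
 match b1 as c1, b2 as c2 return (c1 -> c2) -> (forall t, ~~ c2 -> km k1 t -> km k2 (u t)) ->
  (forall t, ~~ c2 -> km k1 t -> kD k2 (u t) = kD k1 t) ->
  forall x : nX c1 k1, pdat (nG c1 k1) (nG c2 k2) (dF s (sle_of hl)) x
 with
 | true, true => fun _ _ _ => thNN hl
 | true, false => fun h _ _ _ => match notF (h isT) with end
 | false, true => fun _ _ _ => thKN hl
 | false, false => fun _ hm' hD' x => thKK hl (hm' (qt x) isT (qm x)) (hD' (qt x) isT (qm x))
 end hb hm hD.

Definition qmap b1 k1 b2 k2 u hb hl hm hD : mpfunctor (qnode b1 k1) (qnode b2 k2) :=
 pull_map (@qth b1 k1 b2 k2 u hb hl hm hD).

Lemma qmap_ext b1 k1 b2 k2 u u' hb hb' hl hl' hm hm' hD hD' :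
 (forall t, ~~ b2 -> km k1 t -> u t = u' t) ->
 @qmap b1 k1 b2 k2 u hb hl hm hD = @qmap b1 k1 b2 k2 u' hb' hl' hm' hD'.
Proof.
move=> E; rewrite (pirr hl' hl); apply: pull_map_ext.
case: b1 hb hb'; case: b2 hm hm' hD hD' E => // hm hm' hD hD' E hb hb' x.
- by have := hb isT.
- by apply: thKK_eq; apply: E => //; apply: qm.
Qed.

Lemma mkpd_idc (k1 k2 : knode n) b1 (K : mpfunctor (A (klv k1)) (A (klv k2))) x (y y' : A (klv k2))
 (f : phom (K (nG b1 k1 x)) y) (f' : phom (K (nG b1 k1 x)) y') mf mf' (e : y = y') :
 f' = pcmp (idc e) f ->
 @mkpd k1 k2 b1 true K x y f mf = @mkpd k1 k2 b1 true K x y' f' mf'.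
Proof.
subst y' => E; rewrite /= pcmp1m in E; subst f'.
by rewrite (pirr mf mf').
Qed.
Lemma dF1e (i : 'I_n.+1) (ii : sle i i) (a : A i) : a = dF s ii a.
Proof. by rewrite dF1. Qed.
Lemma dF1_nat (i : 'I_n.+1) (ii : sle i i) (a a' : A i) (f : phom a a') :
 pcmp (idc (dF1e ii a')) f = pcmp (pfmor (dF s ii) f) (idc (dF1e ii a)).
Proof. by apply: (idc_nat (F := mpfunctor_id (A i)) (esym (dF1 s ii))). Qed.

Lemma qmap_id b1 k u hb hl hm hD : (forall t, km k t -> u t = t) ->
 @qmap b1 k b1 k u hb hl hm hD = mpfunctor_id (qnode b1 k).
Proof.
move=> E; rewrite /qmap (@pull_map_conj b _ _ _ _ _ _ (mpfunctor_id (A (klv k))) _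
(fun a => idc (dF1e (sle_of hl) a)) (fun a => marked_idc _)); last first.
by move=> x y f; apply: dF1_nat.
apply: etrans _ (pull_map_id (nG b1 k)); apply: pull_map_ext => x.
case: b1 hb hm hD x => hb hm hD x /=.
rewrite /pd_pre /pd_id /=.
apply: (@mkpd_idc k k true (mpfunctor_id _) x _ _ _ _ _ _ (esym (dF1e (sle_of hl) x))).
by rewrite pcmp1m (idc_cmp _ _ erefl).
rewrite (thKK_eq (t2' := qt x) hl _ (qm x) _ erefl); last by apply: E; apply: qm.
case: x => t a m; rewrite /pd_pre /thKK /pd_id /=.
apply: (f_equal (fun w => existT _ (Qobj a m) w)); apply: sigE => /=.
have e0 : dF s (sle_of hl) (dF s (sle_of (kle m)) a) = dF s (sle_of (kle m)) a by rewrite dF1.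
rewrite (dphi1r s (sle_of hl) (sle_of (kle m)) e0) -[RHS]/(idc erefl).
exact: idc_cmp.
Qed.
Definition dstrict := forall (i j k : 'I_n.+1) (ij : sle i j) (jk : sle j k) (ik : sle i k) a,
 exists e : dF s jk (dF s ij a) = dF s ik a, dphi s ij jk ik a = idc e.

Lemma KKK_core (i l l' l'' j J : 'I_n.+1) (il : sle i l) (ll : sle l l') (l2 : sle l' l'')
  (l3 : sle l l'') (il' : sle i l') (il'' : sle i l'') (jl : sle j l') (jl'' : sle j l'') (Jl : sle J l'')
  (e : i = j) (e' : j = J) (e'' : i = J) (a : A i) mf mf' :
  existT (fun a2 => {f : phom (dF s l2 (dF s ll (dF s il a))) (dF s Jl a2) | marked f})
   (castA e' (castA e a))
   (exist _ (pcmp (qpf jl l2 jl'' e' (castA e a) Jl) (pfmor (dF s l2) (qpf il ll il' e a jl))) mf) =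
  existT _ (castA e'' a)
   (exist _ (pcmp (qpf il l3 il'' e'' a Jl) (dphi s ll l2 l3 (dF s il a))) mf').
Proof.
subst j J; rewrite (pirr e'' erefl) in mf' *.
apply: (f_equal (existT _ a)); apply: sigE => /=; exact: dcoc.
Qed.

(** Both sides are conjugated from the same functor, and the chosen isomorphisms agree by the
    cocycle condition. With a number in the middle even the objects agree only when coherence cells
    are identities, whence the alternative [dstrict]. *)
Lemma qmap_comp b1 k1 b2 k2 b3 k3 u u' u'' hb hl hm hD hb' hl' hm' hD' hb'' hl'' hm'' hD'' :
 (forall t, ~~ b3 -> km k1 t -> u'' t = u' (u t)) -> ~~ b2 \/ dstrict ->
 mpfunctor_comp (@qmap b2 k2 b3 k3 u' hb' hl' hm' hD') (@qmap b1 k1 b2 k2 u hb hl hm hD) =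
 @qmap b1 k1 b3 k3 u'' hb'' hl'' hm'' hD''.
Proof.
move=> E str; rewrite /qmap pull_map_comp.
rewrite (@pull_map_conj b _ _ _ _ _ _ (mpfunctor_comp (dF s (sle_of hl')) (dF s (sle_of hl))) _
(fun a => dphi s (sle_of hl) (sle_of hl') (sle_of hl'') a) (fun a => dphi_marked s _ _ _ _)); last first.
by move=> x y f; apply: dphi_nat.
apply: pull_map_ext => x.
case: b1 hb hb'' hm hD hm'' hD'' x => hb hb'' hm hD hm'' hD'' x.
case: b2 hb hm hD hb' hm' hD' str => hb hm hD hb' hm' hD' str; last by have := hb isT.
case: b3 hb' hm' hD' hb'' hm'' hD'' E => hb' hm' hD' hb'' hm'' hD'' E; last by have := hb' isT.
case: str => // /(_ _ _ _ (sle_of hl) (sle_of hl') (sle_of hl'') x)[e eE].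
rewrite /pd_comp /pd_pre /=.
apply: (@mkpd_idc k1 k3 true (mpfunctor_comp (dF s (sle_of hl')) (dF s (sle_of hl))) x _ _ _ _ _ _ e).
by rewrite pcmp1m eE pfmor1 pcmp1m pcmpm1.
case: b2 hb hm hD hb' hm' hD' str => hb hm hD hb' hm' hD' str.
case: b3 hb' hm' hD' hb'' hm'' hD'' E => hb' hm' hD' hb'' hm'' hD'' E; last by have := hb' isT.
case: str => // str; case: x => t a m.
have [e eE] := str _ _ _ (sle_of (leq_trans (kle m) hl)) (sle_of hl') (sle_of (leq_trans (kle m) hl'')) a.
rewrite /pd_comp /pd_pre /=.
apply: (@mkpd_idc k1 k3 false (mpfunctor_comp (dF s (sle_of hl')) (dF s (sle_of hl))) _ _ _ _ _ _ _ e).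
by rewrite -eE pcmp1m; symmetry; apply: dcoc.
case: b3 hb' hm' hD' hb'' hm'' hD'' E => hb' hm' hD' hb'' hm'' hD'' E.
case: x => t a m; rewrite /pd_comp /pd_pre /=.
have gen : forall (j : 'I_n.+1) (e : kD k1 t = j) (jl : sle j (klv k2)) (jl3 : sle j (klv k3)) mf mf',
existT (fun y => {f : phom (dF s (sle_of hl') (dF s (sle_of hl) (dF s (sle_of (kle m)) a))) y | marked f})
(dF s jl3 (castA e a)) (exist _ (pcmp (dphi s jl (sle_of hl') jl3 (castA e a))
(pfmor (dF s (sle_of hl')) (qpf (sle_of (kle m)) (sle_of hl) (sle_of (leq_trans (kle m) hl)) e a jl))) mf) =
existT _ (dF s (sle_of (leq_trans (kle m) hl'')) a) (exist _ (pcmp (dphi s (sle_of (kle m)) (sle_of hl'') (sle_of (leq_trans (kle m) hl'')) a)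
(dphi s (sle_of hl) (sle_of hl') (sle_of hl'') (dF s (sle_of (kle m)) a))) mf').
move=> j e jl jl3 mf mf'; subst j; apply: (f_equal (existT _ _)); apply: sigE => /=.
exact: dcoc.
exact: gen.
rewrite /qth (thKK_eq (t2' := u' (u (qt x))) hl'' _ (hm' _ isT (hm _ isT (qm x))) _
(etrans (hD' _ isT (hm _ isT (qm x))) (hD _ isT (qm x)))); last by apply: E => //; apply: qm.
case: x => t a m; rewrite /pd_comp /pd_pre /thKK /=.
set m3 := hm' _ _ _; set e2 := hD' _ _ _; set e1 := hD _ _ _; set e3 := etrans _ _.
have G : forall w w' : {a2 : A (kD k3 (u' (u t))) & {f : phom (dF s (sle_of hl') (dF s (sle_of hl) (dF s (sle_of (kle m)) a)))
(dF s (sle_of (kle m3)) a2) | marked f}}, w = w' ->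
existT (fun y : nX false k3 => {f : phom (mpfunctor_comp (dF s (sle_of hl')) (dF s (sle_of hl)) (nG false k1 (Qobj a m : nX false k1))) (nG false k3 y) | marked f})
(Qobj (projT1 w) m3) (projT2 w) = existT _ (Qobj (projT1 w') m3) (projT2 w').
by move=> w w' ->.
apply: (G (existT _ _ _) (existT _ _ _)); exact: KKK_core.
Qed.
End QMap.

Section Rectify.
Variable b : bool.
Notation N := (nerve (Cb b)).

(** The two situations where the replacement is strictly functorial: chains of families over any
    [s], and arbitrary chains over a strict [s]. *)
Definition qok n (s : d2 b n) m (x : csimp n m) := (forall i, cb x i = false) \/ dstrict s.

Definition Qhat n (s : d2 b n) m (x : csimp n m) (ok : qok s x) : N m.
Proof.
refine (@NerveSimp (Cb b) m (fun i => qnode s (cb x i) (cn x i))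
(fun i j h => @qmap b n s (cb x i) (cn x i) (cb x j) (cn x j) (cu x i j) (cbm h) (clv x h)
(fun t => @cum n m x i j t h) (fun t => @cuD n m x i j t h)) _ _).
- by move=> i h; apply: qmap_id => t; apply: cu1.
- move=> i j k ij jk ik; symmetry; apply: qmap_comp.
by move=> t; apply: cuM.
by case: ok => [->|]; [left|right].
Defined.
Lemma Qhat_ok n (s : d2 b n) m (x : csimp n m) (ok ok' : qok s x) : Qhat ok = Qhat ok'.
Proof. exact: nerve_eq. Qed.

Lemma Qhat_act n (s : d2 b n) m m' (a : delta m' m) (x : Cyl n m) (ok : qok s x)
 (ok' : qok s (act a x : Cyl n m')) : Qhat ok' = act a (Qhat ok : N m).
Proof.
apply: nerve_eq.
apply: dfext => i; apply: dfext => j.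
by apply: fext => h; apply: qmap_ext => t _ _; rewrite /= h.
Qed.

Lemma qmap_act m n (f : delta m n) (s : D2 b n) b1 k1 b2 k2 u hb hl hm hD hl' hm' hD' :
 @qmap b m (act f s : D2 b m) b1 k1 b2 k2 u hb hl hm hD =
 @qmap b n s b1 (kact f k1) b2 (kact f k2) u hb hl' hm' hD'.
Proof.
rewrite (pirr hl' (dmono f hl)).
apply: (@pull_map_ext b _ _ _ _ _ _ (dF s (sle_of (dmono f hl)))
(@qth b m (act f s : D2 b m) b1 k1 b2 k2 u hb hl hm hD)
(@qth b n s b1 (kact f k1) b2 (kact f k2) u hb (dmono f hl) hm' hD')).
case: b1 hb hm hD hm' hD' => hb hm hD hm' hD' x; case: b2 hb hm hD hm' hD' => hb hm hD hm' hD' //.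
have E : hm' = hm by apply: pirr.
subst hm'; case: x => t a mt; set m2' := hm t isT mt; set e' := hD' t isT mt; set e := hD t isT mt.
have gen (j : 'I_m.+1) (e1 : kD k1 t = j) (e2 : f (kD k1 t) = f j)
(jl0 : sle j (klv k2)) (jl : sle (f j) (f (klv k2))) mf mf' :
existT (fun y => {g : phom (dF s (sle_of (dmono f hl)) (dF s (sle_of (dmono f (kle mt))) a)) (dF s jl y) | marked g})
(@castA b m (act f s : D2 b m) _ _ e1 a)
(exist _ (@qpf b m (act f s : D2 b m) _ _ _ (sle_of (kle mt)) (sle_of hl) (sle_of (leq_trans (kle mt) hl)) _ e1 a jl0) mf) =
existT _ (@castA b n s _ _ e2 a)
(exist _ (@qpf b n s _ _ _ (sle_of (dmono f (kle mt))) (sle_of (dmono f hl)) (sle_of (leq_trans (dmono f (kle mt)) (dmono f hl))) _ e2 a jl) mf').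
subst j; rewrite (pirr e2 erefl) in mf' *; apply: (f_equal (existT _ _)); exact: sigE.
pose mk (w : {a2 : dA s (f (kD k2 (u t))) & {g : phom (dF s (sle_of (dmono f hl)) (dF s (sle_of (dmono f (kle mt))) a))
(dF s (sle_of (dmono f (kle m2'))) a2) | marked g}}) :=
existT (fun y : qobj (km k2) (fun t => dA s (f (kD k2 t))) => {g : phom (dF s (sle_of (dmono f hl)) (dF s (sle_of (dmono f (kle mt))) a))
(dF s (sle_of (dmono f (kle (qm y)))) (qa y)) | marked g}) (Qobj (projT1 w) m2') (projT2 w).
exact: (f_equal mk (gen _ (esym e) (esym e') _ _ _ _)).
Qed.

Lemma Qhat_map m n (f : delta m n) (s : D2 b n) l (x : Cyl m l) (ok : qok (act f s : D2 b m) x)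
 (ok' : qok (s : d2 b n) (Cyl_map f l x)) : Qhat ok = Qhat ok'.
Proof.
apply: (@nerve_eq (Cb b) l (fun i => qnode (s : d2 b n) (cb x i) (kact f (cn x i)))).
apply: dfext => i; apply: dfext => j.
by apply: fext => h; apply: qmap_act.
Qed.

Definition KC (n : nat) : sset.
Proof.
refine (@ssub (Cyl n) (fun m (x : csimp n m) => forall i, cb x i = false) _).
by move=> m l f x h i; apply: h.
Defined.

Definition Qmap n (s : d2 b n) : smap (KC n) N.
Proof.
refine (@Smap (KC n) N (fun m x => Qhat (or_introl (svalP x) : qok s (sval x))) _).
by move=> m l f x; apply: Qhat_act.
Defined.
Lemma strict_dstrict n (x : N n) : dstrict (strict b n x : d2 b n).
Proof. by move=> i j k ij jk ik a; eexists; reflexivity. Qed.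

(** Over a strict simplex the whole cylinder maps to the nerve; its end formed by the numbers is the
    simplex itself, by [Hcan_num]. *)
Definition Hcan n (x : N n) : smap (Cyl n) N.
Proof.
refine (@Smap (Cyl n) N (fun m y => Qhat (or_intror (@strict_dstrict n x) : qok (strict b n x : d2 b n) y)) _).
by move=> m l f y; apply: Qhat_act.
Defined.

Definition numC n m (a : delta m n) : Cyl n m.
Proof.
refine (@CS n m (fun _ => true) (fun i => numk (a i)) (fun _ _ _ => 0) _ _ _ _ _ _ _ _ _) => //.
by move=> i j ij; apply: dmono.
Defined.

Lemma qmap_NN n (s : d2 b n) k1 k2 u hb hl hm hD :
 (@qmap b n s true k1 true k2 u hb hl hm hD : mpfunctor (dA s (klv k1)) (dA s (klv k2))) =
 dF s (sle_of hl).
Proof.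
apply: mpfunctor_eq; apply: pfunctor_eq.
apply: dfext => y; apply: dfext => y'.
apply: fext => f.
change (pcmp (pcmp (pid (dF s (sle_of hl) y')) (pfmor (dF s (sle_of hl)) f))
(pd_inv (@thNN b n s k1 k2 hl y)) = pfmor (dF s (sle_of hl)) f).
rewrite pcmp1m -[RHS]pcmpm1; congr pcmp; symmetry; apply: pinv_uniq; exact: pcmp1m.
Qed.

Lemma Hcan_num n (x : N n) m (a : delta m n) : Hcan x m (numC a) = act a x.
Proof.
apply: (@nerve_eq (Cb b) m (fun i => nob x (a i))).
apply: dfext => i; apply: dfext => j.
apply: fext => h.
transitivity (dF (strict b n x : d2 b n) (@sle_of (a i) (a j) (clv (numC a) h))).
exact: (@qmap_NN n (strict b n x : d2 b n) (numk (a i)) (numk (a j)) (fun _ => 0) (cbm (c := numC a) h)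
(clv (numC a) h) (fun t => @cum n m (numC a) i j t h) (fun t => @cuD n m (numC a) i j t h)).
exact: (f_equal (@nmor _ _ x (a i) (a j)) (pirr _ _)).
Qed.

(** Both nodes compute morphisms in the fibre over the same vertex, so only essential surjectivity
    is at stake; the label [t0] sitting at that vertex provides it. *)
Lemma qmap_weq n (s : d2 b n) k1 b2 k2 u hb hl hm hD t0 : klv k1 = klv k2 ->
 km k1 t0 -> kD k1 t0 = klv k1 ->
 @cweq b (qnode s false k1) (qnode s b2 k2) (@qmap b n s false k1 b2 k2 u hb hl hm hD).
Proof.
case: k1 hl hm hD => D1 m1 l1 h1 j1; case: k2 => D2 m2 l2 h2 j2 hl hm hD /= e12 mt Dt.
subst l2; set k1 := KN h1 j1; set k2 := KN h2 j2.
rewrite /qmap (@pull_map_conj b _ _ _ _ _ _ (mpfunctor_id (dA s l1)) _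
(fun a => idc (@dF1e b n s l1 (@sle_of l1 l1 hl) a)) (fun a => marked_idc _)); last first.
by move=> x y f; apply: dF1_nat.
apply: pull_weq => y; pose a := @nG b n s b2 k2 y.
have key : forall (j : 'I_n.+1) (e : l1 = j) (h : sle j l1), a = dF s h (castA (s := s) e a).
by move=> j e h; subst j; apply: dF1e.
exists (@Qobj m1 (fun t => dA s (D1 t)) t0 (castA (esym Dt) a) mt).
exists (idc (key _ (esym Dt) (sle_of (h1 _ mt)))); exact: marked_idc.
Qed.

(* The terminal labelled family among those supported in [S] and below [j]. *)
Definition tn n (j : 'I_n.+1) (S : {set 'I_n.+1}) : knode n.
Proof.
refine (@KN n (fun t => if [&& t < n.+1, inord t \in S & (inord t : 'I_n.+1) <= j] then inord t else j)
(fun t => [&& t < n.+1, inord t \in S & (inord t : 'I_n.+1) <= j]) j _ _).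
- by move=> t h; rewrite h; case/and3P: h.
- by move=> t /negbTE ->.
Defined.
(** A supply of edges over a single vertex that must become equivalences: the outer horns met in the
    cylinder start with such an edge when it ends in a number. *)
Definition is_vedge n (e : csimp n 1) :=
 [/\ cb e ord0 = false, klv (cn e ord0) = klv (cn e ord_max) &
   forall t, km (cn e ord0) t -> kD (cn e ord0) t = klv (cn e ord0)].

Lemma vedge_weq n (s : d2 b n) (e : csimp n 1) (ok : qok s e) :
 is_vedge e -> nerve_class (@cweq b) (Qhat ok).
Proof.
move=> [e0 e1 e2]; have [|t mt Dt] := @catt _ _ e ord0; first by rewrite e0.
rewrite /nerve_class /Qhat /=; move: (cbm _) (fun t => _) (fun t => _); rewrite e0 => hb hm hD.
exact: qmap_weq e1 mt Dt.
Qed.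

Section Esset.
Variables (L : sset) (ell : smap N L).

(** A simplex of [D2] together with a map on its cylinder that starts from its strict replacement. A
    section of the projection to [D2], evaluated on the numbers, is the desired map from [D2] to
    [L]. *)
Record esimp (n : nat) := ES {
 es : d2 b n;
 eh : smap (Cyl n) L;
 eK : forall m (x : KC n m), eh m (sval x) = ell m (Qmap es m x);
 eE : forall e : Cyl n 1, is_vedge e -> is_equivalence (eh 1 e) }.

Lemma esimp_eq n (x y : esimp n) : es x = es y -> (forall m z, eh x m z = eh y m z) -> x = y.
Proof.
case: x => s h k q; case: y => s' h' k' q' /= e1 e2; have {}e2 := @smap_eq (Cyl n) L h h' e2; subst s' h'.
by f_equal; apply: proof_irrelevance.
Qed.
Definition KC_map m n (f : delta m n) l (x : KC m l) : KC n l :=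
 exist _ (Cyl_map f l (sval x)) (svalP x).

Lemma Qmap_map m n (f : delta m n) (s : D2 b n) l (x : KC m l) :
 Qmap (act f s : D2 b m) l x = Qmap (s : d2 b n) l (KC_map f x).
Proof. exact: Qhat_map. Qed.

Definition esimp_act m n (f : delta m n) (x : esimp n) : esimp m.
Proof.
refine (@ES m (act f (es x : D2 b n)) (scomp (eh x) (Cyl_map f)) _ _).
- by move=> l z; rewrite Qmap_map -eK.
- move=> e [h1 h2 h3]; apply: (@eE _ x (Cyl_map f 1 e)); split=> //=.
by rewrite h2.
by move=> t /h3 ->.
Defined.

Definition Esset : sset.
Proof.
refine (@SSet esimp esimp_act _ _).
- move=> n x; apply: esimp_eq => // m z; exact: (f_equal (eh x m) (Cyl_map_id z)).
- by move=> k m n f g x; apply: esimp_eq => // l z; exact: (f_equal (eh x l) (Cyl_map_comp f g z)).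
Defined.

Hypothesis ellW : forall e, nerve_class (@cweq b) e -> is_equivalence (ell 1 e).

Definition ecan n (x : N n) : esimp n.
Proof.
refine (@ES n (strict b n x) (scomp ell (Hcan x)) _ _).
- by move=> m z; rewrite /=; congr (ell m _); apply: Qhat_ok.
- by move=> e he; apply: ellW; apply: vedge_weq.
Defined.

Lemma ecan_act m n (f : delta m n) (x : N n) : ecan (act f x) = esimp_act f (ecan x).
Proof.
apply: esimp_eq => [|l z]; first exact: (smapP (strict b) f x).
rewrite /=; congr (ell l _).
have okf : qok (act f (strict b n x : D2 b n) : D2 b m) z.
by right; rewrite -smapP; apply: strict_dstrict.
have gen s1 s2 (ok1 : qok s1 z) (ok2 : qok s2 z) : s1 = s2 -> Qhat ok1 = Qhat ok2.
by move=> E; subst s2; apply: Qhat_ok.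
apply: etrans (gen _ _ _ okf (smapP (strict b) f x)) _; exact: Qhat_map.
Qed.
End Esset.
End Rectify.

(** * Matching on the rectifying cylinder *)

Section Supports.
Variable N : nat.
Implicit Types (k : knode N) (j : 'I_N.+1) (S : {set 'I_N.+1}).

Definition supp k : {set 'I_N.+1} :=
 [set i | asbool (i = klv k \/ exists2 t, km k t & kD k t = i)].

Lemma suppP k i : i \in supp k <-> (i = klv k \/ exists2 t, km k t & kD k t = i).
Proof. by rewrite inE; split=> [/asboolP|h]; last apply/asboolP. Qed.
Lemma supp_lv k : klv k \in supp k. Proof. by apply/suppP; left. Qed.

Lemma supp_kD k t : kD k t \in supp k.
Proof.
apply/suppP; have [m|m] := boolP (km k t); first by right; exists t.
by left; apply: kj.
Qed.
Lemma supp_le k i : i \in supp k -> i <= klv k.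
Proof. by case/suppP=> [->//|[t m <-]]; apply: kle. Qed.

Lemma supp_tn j S : j \in S -> (forall i, i \in S -> i <= j) -> supp (tn j S) = S.
Proof.
move=> jS Sj; apply/setP => i; apply/idP/idP.
case/suppP=> [->//|[t /=]]; case: ifP => // /and3P[_ tS _] _ <-; exact: tS.
move=> iS; apply/suppP; right; exists i; rewrite /= inord_val ltn_ord iS Sj //.
Qed.
Definition isTn j k := k = tn j (supp k).

Lemma isT_lv j k : isTn j k -> klv k = j. Proof. by move=> ->. Qed.
Lemma isT_val j k t : isTn j k -> km k t -> kD k t = t :> nat.
Proof. by move=> E; rewrite E /= => m; rewrite m; case/and3P: m => h _ _; rewrite inordK. Qed.

Lemma isT_km j k i : isTn j k -> i \in supp k -> km k i.
Proof.
move=> E ik; have := supp_le ik; rewrite (isT_lv E) => ij.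
by rewrite E /= inord_val ltn_ord ik ij.
Qed.
Lemma isT_kD j k i : isTn j k -> i \in supp k -> kD k i = i.
Proof. by move=> E ik; apply: ord_inj; apply: (isT_val E); apply: isT_km E ik. Qed.
Lemma isT_tn j S : j \in S -> (forall i, i \in S -> i <= j) -> isTn j (tn j S).
Proof. by move=> jS Sj; rewrite /isTn supp_tn. Qed.
End Supports.

Section Chains.
Variable N : nat.

Section Access.
Variables (m : nat) (x : Cyl N m).

(** Entries are indexed by natural numbers, so that shifting positions past an inserted entry needs
    no casts. *)
Definition nd (p : nat) : knode N := cn x (inord p).
Definition bb (p : nat) : bool := cb x (inord p).

Lemma ndE (i : 'I_m.+1) : nd i = cn x i. Proof. by rewrite /nd inord_val. Qed.
Lemma bbE (i : 'I_m.+1) : bb i = cb x i. Proof. by rewrite /bb inord_val. Qed.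

Lemma supp_mono (i q : 'I_m.+1) : i <= q -> ~~ cb x q -> supp (cn x i) \subset supp (cn x q).
Proof.
move=> iq nq; have ni : ~~ cb x i by apply: contra nq; apply: cbm.
have key t : km (cn x i) t -> kD (cn x i) t \in supp (cn x q).
by move=> mt; rewrite -(cuD iq nq mt); apply: supp_kD.
apply/fintype.subsetP => a /suppP[->|[t mt <-]]; last exact: key.
by have [t mt <-] := catt ni; apply: key.
Qed.
Lemma nd_mono p q : p <= q -> q <= m -> ~~ bb q -> supp (nd p) \subset supp (nd q).
Proof. by move=> pq qm; apply: supp_mono; rewrite !inordK ?ltnS //; exact: leq_trans pq qm. Qed.
Lemma nd_lv p q : p <= q -> q <= m -> klv (nd p) <= klv (nd q).
Proof. by move=> pq qm; apply: clv; rewrite !inordK ?ltnS //; exact: leq_trans pq qm. Qed.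
Definition idstep (p : nat) := [/\ nd p = nd p.+1, bb p = bb p.+1 &
 forall t, km (nd p) t -> cu x (inord p) (inord p.+1) t = t].
End Access.

Lemma nd_face m (z : Cyl N m.+1) (k : 'I_m.+2) p : p <= m ->
 nd (act (dfc k) z) p = nd z (if p < k then p else p.+1).
Proof.
by move=> pm; rewrite /nd /=; congr cn; apply: ord_inj; rewrite -/(dfc k _) dfE !inordK //;
case: ifP => //; lia.
Qed.

Lemma bb_face m (z : Cyl N m.+1) (k : 'I_m.+2) p : p <= m ->
 bb (act (dfc k) z) p = bb z (if p < k then p else p.+1).
Proof.
by move=> pm; rewrite /bb /=; congr cb; apply: ord_inj; rewrite -/(dfc k _) dfE !inordK //;
case: ifP => //; lia.
Qed.

Lemma nondeg_idstep m (x : Cyl N m) p : nondeg x -> p < m -> ~ idstep x p.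
Proof.
case: m x => // m x ndx pm [h1 h2 h3].
pose i : 'I_m.+1 := Ordinal pm; pose i1 : 'I_m.+2 := Ordinal (pm : p.+1 < m.+2).
have i1E : inord p.+1 = i1 by apply: ord_inj; rewrite inordK.
have i0E : inord p = wd i :> 'I_m.+2 by apply: ord_inj; rewrite inordK //= ltnW.
rewrite /nd /bb i1E i0E in h1 h2 h3.
suff E : x = act (ddeg i) (act (dfc i1) x).
by move: ndx; rewrite E; apply: dg_lt.
pose r (q : 'I_m.+2) := dfc i1 (ddeg i q).
have rE q : q <> i1 -> r q = q.
move=> qi; apply: ord_inj; rewrite /r dfE dgE /=.
have {}qi : q <> p.+1 :> nat by move=> e; apply: qi; apply: ord_inj.
by case: (leqP q p) => ?; case: ifP; lia.
have rI : r i1 = wd i.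
by apply: ord_inj; rewrite /r dfE dgE /= ltnn /= ltnS leqnn.
apply: csimp_eq => [q|q|q q' t qq nq' kq] /=.
- change (cb x q = cb x (r q)); have [->|/eqP ne] := eqVneq q i1; last by rewrite rE.
by rewrite rI h2.
- change (cn x q = cn x (r q)); have [->|/eqP ne] := eqVneq q i1; last by rewrite rE.
by rewrite rI h1.
rewrite qq (dmono (ddeg i) qq); change (cu x q q' t = cu x (r q) (r q') t).
have wi : wd i <= i1 by rewrite /= leqnSn.
have [e|/eqP ne] := eqVneq q i1; have [e'|/eqP ne'] := eqVneq q' i1.
- subst q q'; rewrite rI (cu1 kq) cu1 //.
by rewrite h1.
- subst q; rewrite rI rE //; have kq' : km (cn x (wd i)) t by rewrite h1.
by rewrite (@cuM _ _ x (wd i) i1 q' t) // h3.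
- subst q'; rewrite rI (rE _ ne).
have qw : q <= wd i.
have : q <> p.+1 :> nat by move=> e; apply: ne; apply: ord_inj.
by move: qq => /=; lia.
rewrite (@cuM _ _ x q (wd i) i1 t) // h3 //.
by apply: cum => //; rewrite h2.
- by rewrite !rE.
Qed.

Lemma idstep_nondeg m (x : Cyl N m) : (forall p, p < m -> ~ idstep x p) -> nondeg x.
Proof.
case: m x => [|m] x h; first by move=> l f y _.
apply: contrapT => /not_nondeg[i [y E]]; apply: (h i (ltn_ord i)).
have d1 : ddeg i (inord i) = i by apply: ord_inj; rewrite dgE inordK ?leqnn //; apply: ltnW (ltn_ord i).
have d2 : ddeg i (inord i.+1) = i by apply: ord_inj; rewrite dgE inordK ?ltnn // ltnS ltn_ord.
rewrite E /idstep /nd /bb /= -!/(ddeg i _) d1 d2; split=> // t mt.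
have l1 : i < m.+2 by apply: leq_trans (ltn_ord i) _.
have l2 : i.+1 < m.+2 by apply: ltn_ord i.
by rewrite (inordK l1) (inordK l2) leqnSn; apply: cu1.
Qed.

(* Insertion of a terminal family before the tail of terminal families. *)
Section Insert.
Variables (m : nat) (x : Cyl N m) (k : 'I_m.+2) (J j : nat) (jo : 'I_N.+1) (T : knode N).
Hypotheses (kJ : k <= J)
 (Jm : J <= m)
 (bJ : forall i : 'I_m.+1, cb x i = (J <= i))
 (TT : isTn jo T)
 (lvJ : klv (nd x J) = jo)
 (Tlo : forall i : 'I_m.+1, i < k -> supp (cn x i) \subset supp T)
 (Thi : forall i : 'I_m.+1, k <= i -> i < J ->
 isTn jo (cn x i) /\ supp T \subset supp (cn x i)).

Let zn (p : 'I_m.+2) := if unlift k p is Some i then cn x i else T.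
Let zb (p : 'I_m.+2) := if unlift k p is Some i then cb x i else false.
Let zu0 (p q : 'I_m.+2) t := if unlift k p is Some i then
 (if unlift k q is Some i' then cu x i i' t else 0) else 0.
(** Into a terminal family a label can only go to the number of its own vertex; this prescribes all
    maps into the inserted entry and the tail. *)
Let zu (p q : 'I_m.+2) t := if [&& p <= q, ~~ zb q & km (zn p) t] then
 (if q < k then zu0 p q t else kD (zn p) t : nat) else 0.

Let dfk (i : 'I_m.+1) : dfc k i = (if i < k then i : nat else i.+1) :> nat.
Proof. exact: dfE. Qed.

Let splitk (P : 'I_m.+2 -> Prop) : P k -> (forall i, P (dfc k i)) -> forall p, P p.
Proof.
move=> h0 h1 p; have [<-//|ne] := eqVneq k p.
by have [i -> _] := unlift_some ne; apply: h1.
Qed.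
Let znk : zn k = T. Proof. by rewrite /zn unlift_none. Qed.
Let zbk : zb k = false. Proof. by rewrite /zb unlift_none. Qed.
Let znf i : zn (dfc k i) = cn x i. Proof. by rewrite /zn /= liftK. Qed.
Let zbf i : zb (dfc k i) = cb x i. Proof. by rewrite /zb /= liftK. Qed.
Let lek (i : 'I_m.+1) : (dfc k i <= k) = (i < k).
Proof. by rewrite dfk; case: ifP; lia. Qed.
Let kle' (i : 'I_m.+1) : (k <= dfc k i) = (k <= i).
Proof. by rewrite dfk; case: ifP; lia. Qed.
Let ltk (i : 'I_m.+1) : (dfc k i < k) = (i < k).
Proof. by rewrite dfk; case: ifP; lia. Qed.
Let leff (i i' : 'I_m.+1) : (dfc k i <= dfc k i') = (i <= i').
Proof. by rewrite !dfk; do 2 case: ifP; lia. Qed.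
Let lvT : klv T = jo. Proof. exact: isT_lv TT. Qed.
Let hi_isT : forall q : 'I_m.+2, k <= q -> ~~ zb q -> isTn jo (zn q).
Proof.
apply: splitk => [|i]; first by rewrite znk.
by rewrite kle' zbf znf bJ -ltnNge => ki iJ; case: (Thi ki iJ).
Qed.

Let z_supp : forall p q : 'I_m.+2, p <= q -> ~~ zb q -> supp (zn p) \subset supp (zn q).
Proof.
apply: splitk => [|i]; apply: splitk => [|i'].
- by [].
- by rewrite kle' zbf !znk znf bJ -ltnNge => ki iJ; case: (Thi ki iJ).
- by rewrite lek znk znf => /Tlo.
- by rewrite leff zbf !znf; apply: supp_mono.
Qed.

Let zcbm : forall p q : 'I_m.+2, p <= q -> zb p -> zb q.
Proof.
apply: splitk => [|i]; apply: splitk => [|i']; rewrite ?zbk //.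
- by rewrite lek zbf bJ => ik /(leq_trans kJ); rewrite leqNgt ik.
- by rewrite leff !zbf; apply: cbm.
Qed.

Let zclv : forall p q : 'I_m.+2, p <= q -> klv (zn p) <= klv (zn q).
Proof.
have hJ (i : 'I_m.+1) : i <= J -> klv (cn x i) <= jo.
by move=> iJ; rewrite -lvJ; apply: clv; rewrite inordK.
have hJ' (i : 'I_m.+1) : J <= i -> jo <= klv (cn x i).
by move=> iJ; rewrite -lvJ; apply: clv; rewrite inordK.
apply: splitk => [|i]; apply: splitk => [|i'] //.
- rewrite kle' znk znf lvT => ki; have [iJ|/hJ'//] := ltnP i' J.
by have [/isT_lv -> _] := Thi ki iJ.
- by rewrite lek znf znk lvT => ik; apply: hJ; apply: leq_trans (ltnW ik) kJ.
- by rewrite leff !znf; apply: clv.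
Qed.
Let zu_lo (i i' : 'I_m.+1) t : i' < k -> i <= i' -> ~~ cb x i' -> km (cn x i) t ->
 zu (dfc k i) (dfc k i') t = cu x i i' t.
Proof. by move=> ik ii nb mt; rewrite /zu leff zbf znf ltk ii nb mt ik /zu0 /= !liftK. Qed.
Let zu_hi (p q : 'I_m.+2) t : k <= q -> p <= q -> ~~ zb q -> km (zn p) t -> zu p q t = kD (zn p) t.
Proof. by move=> kq pq nq mt; rewrite /zu pq nq mt ltnNge kq. Qed.

Let zcum_D : forall (p q : 'I_m.+2) t, p <= q -> ~~ zb q -> km (zn p) t ->
 km (zn q) (zu p q t) /\ kD (zn q) (zu p q t) = kD (zn p) t.
Proof.
move=> p q t pq nq mt; have [qk|kq] := ltnP q k; last first.
rewrite zu_hi //; have iT := hi_isT kq nq.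
have ins : kD (zn p) t \in supp (zn q).
by apply: (fintype.subsetP (z_supp pq nq)); apply: supp_kD.
by split; [apply: isT_km iT ins|apply: isT_kD iT ins].
move: p q pq nq mt qk; apply: splitk => [q kq _ _ qk|i].
by move: (leq_trans qk kq); rewrite ltnn.
apply: splitk => [|i']; first by rewrite ltnn.
rewrite leff zbf !znf ltk => ii nb mt ik; rewrite zu_lo //.
by split; [apply: cum|apply: cuD].
Qed.

Lemma insert_exists : exists z : Cyl N m.+1,
 [/\ act (dfc k) z = x, cb z k = false & cn z k = T].
Proof.
unshelve eexists.
apply: (@CS N m.+1 zb zn zu zcbm _ _ zclv).
- by apply: splitk => [|i]; rewrite ?zbk // zbf znf; apply: cnum.
- apply: splitk => [_|i]; last by rewrite zbf znf; apply: catt.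
rewrite znk; exists jo; last by rewrite lvT; apply: (isT_kD TT); rewrite -lvT; apply: supp_lv.
by apply: (isT_km TT); rewrite -lvT; apply: supp_lv.
- by move=> p q t pq nq mt; have [] := zcum_D pq nq mt.
- by move=> p q t pq nq mt; have [] := zcum_D pq nq mt.
- move=> p t mt.
have nb : ~~ zb p.
move: p mt; apply: splitk => [|i]; first by rewrite zbk.
by rewrite zbf znf => mt; apply/negP => /cnum E; rewrite E in mt.
have [pk|kp] := ltnP p k; last by rewrite zu_hi //; apply: isT_val (hi_isT kp nb) mt.
move: p mt nb pk; apply: splitk => [|i]; first by rewrite ltnn.
by rewrite znf zbf ltk => mt nb ik; rewrite zu_lo // cu1.
- move=> p q r t pq qr nr mt.
have nq : ~~ zb q by apply: contra nr; apply: zcbm.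
have [m1 e1] := zcum_D pq nq mt.
have [rk|kr] := ltnP r k; last by rewrite (zu_hi kr (leq_trans pq qr) nr mt) (zu_hi kr qr nr m1) e1.
move: p q r pq qr nr mt nq m1 e1 rk; apply: splitk => [q r kq qr _ _ _ _ _ rk|i].
by move: (leq_trans rk (leq_trans kq qr)); rewrite ltnn.
apply: splitk => [r _ kr _ _ _ _ _ rk|i']; first by move: (leq_trans rk kr); rewrite ltnn.
apply: splitk => [|i'']; first by rewrite ltnn.
rewrite !leff !zbf !znf ltk => ii ii' nb mt nb' m1 e1 ik.
have ik' : i' < k by apply: leq_ltn_trans ik.
rewrite zu_lo //; last exact: leq_trans ii'.
rewrite (zu_lo _ ii) // in m1 *; rewrite zu_lo //.
exact: cuM.
- by move=> p q t h; rewrite /zu (negbTE h).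
split.
- apply: csimp_eq => [i|i|i i' t ii]; rewrite /= -?/(dfc k _); first exact: zbf.
exact: znf.
rewrite -!/(dfc k _) ii !zbf !znf => nb mt.
have [ik|ki] := ltnP i' k; first by rewrite zu_lo.
rewrite zu_hi ?zbf ?kle' ?leff ?znf //.
have iT : isTn jo (cn x i') by move: (nb); rewrite bJ -ltnNge => iJ; case: (Thi ki iJ).
by rewrite -(cuD ii nb mt); apply: (isT_val iT (cum ii nb mt)).
- exact: zbk.
- exact: znk.
Qed.
End Insert.
End Chains.

Section Cuts.
Variables (N m : nat) (x : Cyl N m).

Definition PS (j : 'I_N.+1) (c : nat) : {set 'I_N.+1} :=
 j |: (if c is c'.+1 then supp (nd x c') else set0).
(** A terminal family at [j] that is not the one an insertion at [p] would produce, [PS j p] being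
    the support of the latter. *)
Definition good (j : 'I_N.+1) (p : nat) := isTn j (nd x p) /\ supp (nd x p) <> PS j p.
Definition prof (J : nat) := J <= m /\ forall p, p <= m -> bb x p = (J <= p).
Definition jj (J : nat) := klv (nd x J).
(** [c] is where the maximal run of good families before the first number begins; this is the place
    of insertion. *)
Definition cut (J c : nat) := [/\ c <= J, forall p, c <= p -> p < J -> good (jj J) p &
 c = 0 \/ ~ good (jj J) c.-1].
(** The larger members of pairs: the entry preceding the good run is terminal without being good, so
    it is exactly what an insertion produces. *)
Definition typeI := exists J c, [/\ prof J, cut J c.+1 & isTn (jj J) (nd x c)].

Lemma prof_uniq J J' : prof J -> prof J' -> J = J'.
Proof.
move=> [h1 h2] [h1' h2']; apply/eqP; rewrite eqn_leq.
by rewrite -(h2 _ h1') h2' // -(h2' _ h1) h2 // !leqnn.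
Qed.

Lemma prof_ex : (exists i, cb x i) -> exists J, prof J.
Proof.
case=> i xi; have [J [[Jm xJ] Jmin]] := nat_min (ex_intro (fun p => p <= m /\ bb x p) (i : nat)
(conj (ltn_ord i : i <= m) (etrans (bbE x i) xi))).
exists J; split=> // p pm; have [Jp|pJ] := leqP J p.
by apply: (cbm (c := x) _ xJ); rewrite !inordK ?ltnS.
by apply/negP => xp; apply: (Jmin p pJ).
Qed.

Lemma cut_le J a : a <= J -> (forall p, a <= p -> p < J -> good (jj J) p) ->
 exists2 c, c <= a & cut J c.
Proof.
move=> aJ ha; have [c [[cJ hc] cmin]] := nat_min (ex_intro (fun c => c <= J /\
forall p, c <= p -> p < J -> good (jj J) p) a (conj aJ ha)).
have ca : c <= a by rewrite leqNgt; apply/negP => lt; apply: (cmin _ lt).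
exists c => //; split=> //; case: c cJ hc cmin ca => [|c] cJ hc cmin ca; [by left|right] => /= gc.
apply: (cmin c (ltnSn c)); split; first exact: ltnW.
move=> p; rewrite leq_eqVlt => /orP[/eqP <- //|]; exact: hc.
Qed.

Lemma cut_ex J : exists c, cut J c.
Proof.
have [|c _ h] := @cut_le J J (leqnn J); last by exists c.
by move=> p h1 h2; move: (leq_ltn_trans h1 h2); rewrite ltnn.
Qed.

Lemma cut_uniq J c c' : cut J c -> cut J c' -> c = c'.
Proof.
move=> [h1 h2 h3] [h1' h2' h3']; apply/eqP; rewrite eqn_leq; apply/andP; split; rewrite leqNgt; apply/negP => lt.
case: h3 => [e|]; first by rewrite e in lt.
by apply; apply: h2'; move: lt; case: (c) h1 => [|?] //= ? ?; lia.
case: h3' => [e|]; first by rewrite e in lt.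
by apply; apply: h2; move: lt; case: (c') h1' => [|?] //= ? ?; lia.
Qed.
Lemma PS_j j c : j \in PS j c. Proof. by rewrite setU11. Qed.

Lemma PS_le J c i : prof J -> c <= J -> i \in PS (jj J) c -> i <= jj J.
Proof.
move=> [Jm _] cJ; rewrite in_setU1 => /orP[/eqP->//|]; case: c cJ => [|c] cJ; first by rewrite inE.
by move=> /supp_le h; apply: leq_trans h _; apply: nd_lv => //; apply: ltnW.
Qed.
Lemma isT_j (j : 'I_N.+1) (k : knode N) : isTn j k -> j \in supp k.
Proof. by move=> /isT_lv <-; apply: supp_lv. Qed.

Lemma mk_typeI J c : prof J -> c < J -> isTn (jj J) (nd x c) ->
 supp (nd x c) = PS (jj J) c -> (forall p, c < p -> p < J -> good (jj J) p) -> typeI.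
Proof.
move=> pJ cJ h1 h2 h3; exists J, c; split=> //; split=> //; right=> /= [[_]]; exact.
Qed.
Lemma not_good J p : ~ good (jj J) p -> isTn (jj J) (nd x p) -> supp (nd x p) = PS (jj J) p.
Proof. by move=> ng iT; apply: contrapT => ne; apply: ng. Qed.
(** A lexicographic measure: fewer numbers first, then an earlier cut. The weight [m+2] suffices
    because the cut is at most [m]; chains without numbers get the junk value 0. *)
Definition mu : nat := if pselect (exists v J c, [/\ prof J, cut J c & v = (m.+1 - J) * m.+2 + c])
 is left h then sval (cid h) else 0.

Lemma muE J c : prof J -> cut J c -> mu = (m.+1 - J) * m.+2 + c.
Proof.
move=> pJ cc; rewrite /mu; case: pselect => [h|[]]; last by exists ((m.+1 - J) * m.+2 + c), J, c.
case: cid => v /= [J' [c' [pJ' cc' ->]]]; have e := prof_uniq pJ pJ'; subst J'.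
by rewrite (cut_uniq cc cc').
Qed.
End Cuts.

Section Inserted.
Variables (N m : nat) (x : Cyl N m) (z : Cyl N m.+1) (k : 'I_m.+2) (J : nat).
Hypotheses (face : act (dfc k) z = x)
 (pJ : prof x J)
 (cJ : cut x J k)
 (bk : cb z k = false).
Let j := jj x J.
Hypothesis nk : cn z k = tn j (PS x j k).

Let kJ : k <= J. Proof. by case: cJ. Qed.
Let Jm : J <= m. Proof. by case: pJ. Qed.
Let ltk (i : 'I_m.+2) p : p < i -> p <= m.
Proof. by move=> pk; rewrite -2!ltnS; apply: leq_ltn_trans pk (ltn_ord i). Qed.
Lemma nz_lo p : p < k -> nd z p = nd x p.
Proof. by move=> pk; rewrite -face nd_face ?pk // (ltk pk). Qed.
Lemma nz_hi p : k <= p -> p <= m -> nd z p.+1 = nd x p.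
Proof. by move=> kp pm; rewrite -face nd_face // ltnNge kp. Qed.
Lemma nz_k : nd z k = tn j (PS x j k). Proof. by rewrite ndE. Qed.
Lemma suppT : supp (nd z k) = PS x j k.
Proof. by rewrite nz_k supp_tn ?PS_j // => i; apply: PS_le. Qed.
Lemma isTz : isTn j (nd z k).
Proof. by rewrite nz_k; apply: isT_tn; rewrite ?PS_j // => i; apply: PS_le. Qed.

Lemma prof_z : prof z J.+1.
Proof.
have [_ bJ] := pJ; split=> // p pm; have [pk|] := ltnP p k.
have pm' := ltk pk.
have := bb_face z k pm'; rewrite face pk bJ // => <-.
by apply/idP/idP; move: kJ; lia.
rewrite leq_eqVlt => /orP[/eqP <-|]; first by rewrite bbE bk ltnNge kJ.
case: p pm => // p pm kp; rewrite ltnS in kp.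
by have := bb_face z k pm; rewrite face ltnNge kp bJ // => <-.
Qed.
Lemma jj_z : jj z J.+1 = j.
Proof. by rewrite /jj nz_hi. Qed.
Lemma PSz_lo p : p <= k -> PS z j p = PS x j p.
Proof. by case: p => // p pk; rewrite /PS nz_lo. Qed.

Lemma goodz p : k < p -> p <= J -> good z j p.
Proof.
case: p => // p; rewrite ltnS => kp pJ'; have pm := leq_trans (ltnW pJ') Jm.
have [_ gJ _] := cJ; have [iT ne] := gJ _ kp pJ'; split; rewrite nz_hi //.
suff -> : PS z j p.+1 = PS x j p by [].
move: kp; rewrite leq_eqVlt => /orP[/eqP <-|].
rewrite /PS -/(PS x j k) suppT; apply/setUidPr; rewrite sub1set; exact: PS_j.
by case: (p) pm => // q qm kq; rewrite /PS nz_hi // ltnW.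
Qed.

Lemma inserted_typeI : typeI z.
Proof.
apply: (@mk_typeI _ _ _ _ k prof_z); rewrite ?jj_z //; first exact: isTz.
- by rewrite suppT PSz_lo.
- by move=> p kp; rewrite ltnS; apply: goodz.
Qed.

Section Face.
Variable i : 'I_m.+2.
Let y := act (dfc i) z.
Lemma ndy_lo p : p < i -> nd y p = nd z p.
Proof. by move=> pk; rewrite nd_face ?pk // (ltk pk). Qed.
Lemma ndy_hi p : i <= p -> p <= m -> nd y p = nd z p.+1.
Proof. by move=> kp pm; rewrite nd_face // ltnNge kp. Qed.
Lemma PSy_lo p : p <= i -> PS y j p = PS z j p.
Proof. by case: p => // p pk; rewrite /PS ndy_lo. Qed.
Lemma PSy_hi p : i < p -> p <= m.+1 -> PS y j p = PS z j p.+1.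
Proof. by case: p => // p; rewrite ltnS => kp pm; rewrite /PS ndy_hi. Qed.
Lemma good_lo p : p < i -> good z j p -> good y j p.
Proof. by move=> pi [g1 g2]; split; rewrite ndy_lo // PSy_lo // ltnW. Qed.
Lemma good_hi p : i < p -> p <= m -> good z j p.+1 -> good y j p.
Proof.
by move=> ip pm [g1 g2]; split; rewrite ndy_hi ?(ltnW ip) // PSy_hi // leqW.
Qed.
Lemma prof_y : prof y (if i <= J then J else J.+1) \/ (J = m /\ forall p, cb y p = false).
Proof.
have [_ bz] := prof_z.
have bby p : p <= m -> bb y p = (J < (if p < i then p else p.+1)).
by move=> pm; rewrite bb_face // bz //; case: ifP => _ //; apply: leqW.
have [iJ|Ji] := leqP i J.
left; split=> // p pm; rewrite bby //; case: (ltnP p i) => // pi.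
have h := leq_trans pi iJ; apply/idP/idP => h2; move: h h2; clear; lia.
have [Jm'|mJ] := ltnP J m.
left; split=> // p pm; rewrite bby //; case: (ltnP p i) => // pi.
by rewrite ltnS (leq_trans (ltnW Ji) pi) (leq_trans Ji pi).
right; have JmE : J = m by apply/eqP; rewrite eqn_leq Jm mJ.
split=> // p; have pm : p <= m by rewrite -ltnS ltn_ord.
rewrite -bbE bby // JmE.
have im : i = m.+1 :> nat by apply/eqP; rewrite eqn_leq; apply/andP; split; [rewrite -ltnS; apply: ltn_ord|exact: leq_ltn_trans mJ Ji].
by rewrite im ltnS pm ltnNge pm.
Qed.

(** Deleting an entry behind the inserted family leaves it recognizable, except for the first
    number, whose deletion lowers [mu] or leaves no number. Deleting an entry before it either
    leaves it forced by its predecessor or makes it good, and then the cut comes earlier. *)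
Lemma face_cases : i <> k -> [\/ forall p, cb y p = false, typeI y | mu y < mu x].
Proof.
move=> /eqP ne; have {}ne : i != k :> nat by apply: contraNneq ne => /ord_inj ->.
case: prof_y => [py|[_ h]]; last by constructor 1.
have [ik|ki] := ltnP i k.
have iJ : i <= J by apply: leq_trans (ltnW ik) kJ.
rewrite iJ in py; have jy : jj y J = j by rewrite /jj ndy_hi // nz_hi.
have k0 : 0 < k by apply: leq_trans ik.
have ik1 : i <= k.-1 by rewrite -ltnS prednK.
have k1m : k.-1 <= m by have := ltn_ord k; move: k0; lia.
have nk1 : nd y k.-1 = nd z k by rewrite ndy_hi // prednK.
have k1J : k.-1 < J by rewrite prednK.
have gy p : k.-1 < p -> p < J -> good y j p.
rewrite prednK // => kp pJ'; have ip : i < p by apply: leq_trans kp.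
have pm : p <= m by apply: leq_trans (ltnW pJ') Jm.
by apply: good_hi => //; apply: goodz.
have iTk : isTn j (nd y k.-1) by rewrite nk1; apply: isTz.
have [e|e] := pselect (supp (nd y k.-1) = PS y j k.-1).
by constructor 2; apply: (@mk_typeI _ _ _ J k.-1); rewrite ?jy.
constructor 3; have [|c cle cy] := @cut_le _ _ y J k.-1 (ltnW k1J).
rewrite jy => p; rewrite leq_eqVlt => /orP[/eqP <- _|]; first by split.
exact: gy.
rewrite (muE py cy) (muE pJ cJ) ltn_add2l; apply: leq_ltn_trans cle _.
by rewrite prednK.
have {}ki : k < i by rewrite ltn_neqAle eq_sym ne.
have nyk : nd y k = nd z k by rewrite ndy_lo.
have gy p : k < p -> p < J -> i <> J.+1 :> nat -> good y j p.
move=> kp pJ' iJ; have pm : p <= m by apply: leq_trans (ltnW pJ') Jm.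
have [pi|] := ltnP p i.
by apply: good_lo => //; apply: goodz => //; apply: ltnW.
rewrite leq_eqVlt => /orP[/eqP ip|ip]; last first.
by apply: good_hi => //; apply: goodz => //; apply: leqW.
have [g1 g2] := @goodz p.+1 (leqW kp) pJ'; split; rewrite ndy_hi ?ip //.
rewrite PSy_lo ?ip // => E; apply: g2; apply/eqP; rewrite finset.eqEsubset; apply/andP; split.
rewrite E; case: (p) kp pm pJ' => // q kq qm qJ; rewrite /PS; apply: setUS.
apply: nd_mono => //; first exact: leqW.
by case: prof_z => _ ->; move: qm qJ; clear; lia.
rewrite /PS finset.subUset sub1set (isT_j g1) /=; apply: nd_mono => //.
by case: prof_z => _ ->; move: pm pJ'; clear; lia.
have [iJ|Ji] := leqP i J.
rewrite iJ in py; have jy : jj y J = j by rewrite /jj ndy_hi // nz_hi.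
constructor 2; apply: (@mk_typeI _ _ _ J k py); rewrite ?jy ?nyk.
- exact: leq_trans ki iJ.
- exact: isTz.
- by rewrite suppT PSy_lo 1?ltnW // PSz_lo.
- by move=> p kp pJ'; apply: gy => // e; rewrite e ltnn in iJ.
rewrite leqNgt Ji /= in py.
have [iE|iE] := eqVneq (i : nat) J.+1.
constructor 3; have [c cy] := cut_ex y J.+1.
rewrite (muE py cy) (muE pJ cJ); have [cle _ _] := cy; have [Jm' _] := py.
rewrite (_ : m.+1 - J = (m.+1 - J.+1).+1) ?subSS ?subSn // mulSn -addnA addnCA ltn_add2l.
by apply: leq_ltn_trans cle _; move: Jm'; generalize (nat_of_ord k); clear; lia.
have {iE}iE : J.+1 < i by rewrite ltn_neqAle eq_sym iE.
have jy : jj y J.+1 = j by rewrite /jj ndy_lo // nz_hi.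
constructor 2; apply: (@mk_typeI _ _ _ J.+1 k py); rewrite ?jy ?nyk //.
- exact: isTz.
- by rewrite suppT PSy_lo 1?ltnW // PSz_lo.
- move=> p kp; rewrite ltnS => pJ'; have pi : p < i by apply: leq_ltn_trans pJ' (ltnW iE).
by apply: good_lo => //; apply: goodz.
Qed.
End Face.
End Inserted.

Section Pairing.
Variables (N : nat) (L : sset) (GU : partmap (Cyl N) L) (kap : smap (KC N) L).
Hypotheses (qL : quasicategory L)
 (N0 : 0 < N)
 (dU : forall m (x : Cyl N m), pdom GU x <-> exists i, forall p, i \notin supp (cn x p))
 (compat : forall m (x : KC N m) y, prel GU (sval x) y -> y = kap m x)
 (eU : forall (e : Cyl N 1) y, is_vedge e -> prel GU e y -> is_equivalence y)
 (eKap : forall e : KC N 1, klv (cn (sval e) ord0) = klv (cn (sval e) ord_max) ->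
 is_equivalence (kap 1 e)).

Let G0 : partmap (Cyl N) L.
Proof.
apply: (@pm_union _ _ (pm_sub kap) GU).
by move=> m x y y' [p <-] h; symmetry; apply: (compat (x := exist _ x p)).
Defined.

Let dG0 m (x : Cyl N m) : ~ pdom G0 x <-> (exists i, cb x i) /\ forall i, exists p, i \in supp (cn x p).
Proof.
split=> [h|[[i xi] h]]; first split.
- apply: contrapT => ne; apply: h.
have p : forall i, cb x i = false by move=> i; apply/negbTE/negP => xi; apply: ne; exists i.
by exists (kap m (exist _ x p)); left; exists p.
- move=> i; apply: contrapT => ne; apply: h.
have [y hy] : pdom GU x by apply/dU; exists i => p; apply/negP => ip; apply: ne; exists p.
by exists y; right.
case=> y [[p _]|hy]; first by have := p i; rewrite xi.
have /dU[i' hi'] : pdom GU x by exists y.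
by have [p] := h i'; rewrite (negbTE (hi' p)).
Qed.
Definition CPair m (x : Cyl N m) (z : Cyl N m.+1) (k : 'I_m.+2) :=
 [/\ nondeg x, ~ pdom G0 x, ~ typeI x, act (dfc k) z = x &
  exists J, [/\ prof x J, cut x J k, cb z k = false & cn z k = tn (jj x J) (PS x (jj x J) k)]].

(** The smaller member is obtained by deleting the family at [c]; it has to be shown that this face
    is nondegenerate, not prescribed and not a larger member itself. *)
Lemma typeI_paired m (z : Cyl N m) : nondeg z -> ~ pdom G0 z -> typeI z -> paired CPair z.
Proof.
case: m z => [|m] z ndz outz [J [c [[Jm bJ] [cJ gJ ngc] iTc]]].
by move: (leq_trans cJ Jm).
case: ngc => //= /not_good/(_ iTc) sc; set j := jj z J in gJ iTc sc; have jE : j = jj z J by []; clearbody j.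
case: J Jm bJ cJ gJ jE iTc sc => // J Jm bJ cJ gJ jE iTc sc.
rewrite ltnS in cJ; rewrite ltnS in Jm.
pose k : 'I_m.+2 := inord c; have kE : k = c :> nat by rewrite inordK // ltnS (leq_trans cJ) // (leq_trans Jm).
pose y := act (dfc k) z.
have ndy p : p <= m -> nd y p = nd z (if p < c then p else p.+1) by move=> pm; rewrite nd_face // kE.
have bby p : p <= m -> bb y p = bb z (if p < c then p else p.+1) by move=> pm; rewrite bb_face // kE.
(* If the preceding family were terminal at [j] too, the two would have the same support and the
   step between them would be an identity, against nondegeneracy. *)
have A : 0 < c -> ~ isTn j (nd z c.-1).
case: (c) cJ sc iTc => // d dJ sd iTd _ iTd'.
have dm : d < m.+1 by rewrite ltnS (leq_trans (ltnW dJ)).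
have sE : supp (nd z d.+1) = supp (nd z d).
by rewrite sd /PS; apply/setUidPr; rewrite sub1set; apply: isT_j.
apply: (nondeg_idstep ndz dm); split.
- by rewrite iTd iTd' sE.
- by rewrite !bJ // ?(ltnW dm) //; apply/idP/idP; lia.
move=> t mt; have i1 : (inord d : 'I_m.+2) <= (inord d.+1 : 'I_m.+2) by rewrite (inordK (leqW dm : d < m.+2)) (inordK (dm : d.+1 < m.+2)).
have nb : ~~ cb z (inord d.+1) by rewrite -/(bb z _) bJ // -ltnNge ltnS.
exact: etrans (esym (isT_val iTd (cum i1 nb mt))) (etrans (f_equal (@nat_of_ord _) (cuD i1 nb mt)) (isT_val iTd' mt)).
have jy : jj y J = j by rewrite jE /jj ndy // ltnNge cJ.
have pJ : prof y J.
split=> // p pm; rewrite bby //; case: (ltnP p c) => pc; rewrite bJ //; last exact: leqW.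
by apply/idP/idP; lia.
have PSlo p : p <= c -> PS y j p = PS z j p.
case: p => // p pc; rewrite /PS ndy ?pc //.
by rewrite (leq_trans (ltnW pc)) // (leq_trans cJ).
have PShi p : c < p -> p <= m.+1 -> PS y j p = PS z j p.+1.
by case: p => // p pc pm; rewrite /PS ndy // ltnNge -ltnS pc.
have cutc : cut y J c.
split=> //.
move=> p cp pJ'; have pm : p <= m by rewrite (leq_trans (ltnW pJ')).
rewrite jy; have [iTp gp] := gJ p.+1 cp pJ'.
rewrite /good ndy // ltnNge cp /=; split=> //.
move: cp; rewrite leq_eqVlt => /orP[/eqP cp|cp]; last by rewrite PShi // leqW.
rewrite -cp PSlo // -sc; move: gp; rewrite -cp /PS.
by rewrite (_ : j |: supp (nd z c) = supp (nd z c)) //; apply/setUidPr; rewrite sub1set; apply: isT_j.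
have [c0|c0] := posnP c; first by left.
right=> [[iT _]]; apply: (A c0); move: iT; rewrite jy ndy.
by rewrite prednK ?leqnn.
by rewrite (leq_trans (leq_pred _)) // (leq_trans cJ).
apply: (@Paired _ _ _ y z k); split=> //.
- apply: idstep_nondeg => p pm [s1 s2 s3].
have pm' := ltnW pm; rewrite !ndy // in s1; rewrite !bby // in s2.
have st : (forall t, km (nd z (if p < c then p else p.+1)) t ->
cu z (inord (if p < c then p else p.+1)) (inord (if p.+1 < c then p.+1 else p.+2)) t = t).
move=> t mt; have := s3 t; rewrite ndy // => /(_ mt); rewrite /= !inordK ?ltnS // leqnSn.
suff E r : r <= m -> lift k (inord r : 'I_m.+1) = inord (if r < c then r else r.+1) by rewrite !E.
move=> rm; apply: ord_inj; rewrite -/(dfc k _) dfE kE inordK ?ltnS // inordK //.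
by case: ifP => _; rewrite ?ltnS //; apply: leqW.
have [pc|pc] := ltnP p.+1 c.
rewrite pc (ltnW pc) in s1 s2 st; apply: (nondeg_idstep ndz (leqW pm)); split=> //.
rewrite (ltnNge p.+1) pc /= in s1 s2 st.
have [pc'|pc'] := ltnP p c; last first.
rewrite ltnNge pc' /= in s1 s2 st; apply: (nondeg_idstep ndz (p := p.+1)) => //.
have cE : c = p.+1 by apply/eqP; rewrite eqn_leq pc pc'.
rewrite pc' in s1 s2 st; apply: A; rewrite cE //= s1.
have : ~~ bb z p.+2.
by rewrite -s2 bJ ?leqW // -ltnNge ltnS -ltnS -cE; apply: leqW.
rewrite bJ // -ltnNge => lt; have le : c < p.+2 by rewrite cE.
by have [] := gJ p.+2 le lt.
- have [_ full] := (dG0 z).1 outz; apply/dG0; split.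
by exists (inord J); rewrite -/(bb y J); case: pJ => _ ->.
move=> i; have [q iq] := full i.
have [|qc] := eqVneq (nat_of_ord q) c.
move=> qc; have {}iq : i \in PS z j c by rewrite -sc /nd -qc inord_val.
move: iq; rewrite in_setU1 => /orP[/eqP ->|].
by exists (inord J); rewrite -jy; apply: supp_lv.
case: (c) cJ ndy => [|d] dJ ndy; first by rewrite inE.
have dm : d <= m by rewrite (leq_trans (ltnW dJ)).
by move=> id; exists (inord d); rewrite -/(nd y d) ndy // ltnSn.
have kq : k != q by apply: contraNneq qc => <-; rewrite kE.
by have [q' qE _] := unlift_some kq; exists q'; rewrite /= -qE.
- move=> [J2 [c2 [p2 cut2 iT2]]]; have e := prof_uniq pJ p2; subst J2.
have e := cut_uniq cutc cut2; rewrite jy in iT2; apply: A; first by rewrite e.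
move: iT2; rewrite ndy; first by rewrite e /= ltnSn.
by have : c2 < J by [case: cut2]; move=> h; rewrite (leq_trans (ltnW h)).
exists J; rewrite kE; split=> //; rewrite ?jy ?PSlo // -?sc.
by rewrite -bbE kE bJ; [apply/negbTE|]; move: cJ Jm; clear; lia.
by rewrite -ndE kE.
Qed.

Lemma CPair_z m (x : Cyl N m) z (k k' : 'I_m.+2) :
 k = k' -> forall J, prof x J -> cut x J k -> act (dfc k) z = x -> cb z k = false ->
 cn z k = tn (jj x J) (PS x (jj x J) k) -> forall z', act (dfc k') z' = x -> cb z' k' = false ->
 cn z' k' = tn (jj x J) (PS x (jj x J) k') -> z = z'.
Proof.
move=> <- J pJ cJ fz bz nz z' fz' bz' nz'.
have spl (P : 'I_m.+2 -> Prop) : P k -> (forall i, P (dfc k i)) -> forall p, P p.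
move=> h0 h1 p; have [<-//|ne] := eqVneq k p.
by have [i -> _] := unlift_some ne; apply: h1.
have fE i : cn z (dfc k i) = cn x i by rewrite -fz.
have fE' i : cn z' (dfc k i) = cn x i by rewrite -fz'.
have gE i : cb z (dfc k i) = cb x i by rewrite -fz.
have gE' i : cb z' (dfc k i) = cb x i by rewrite -fz'.
have ebz : forall p, cb z p = cb z' p by apply: spl => [|i]; rewrite ?bz ?bz' ?gE ?gE'.
have enz : forall p, cn z p = cn z' p by apply: spl => [|i]; rewrite ?nz ?nz' ?fE ?fE'.
have isTh : forall q : 'I_m.+2, k <= q -> ~~ cb z q -> isTn (jj x J) (cn z q).
apply: spl => [|i]; first by move=> _ _; rewrite -ndE; apply: (isTz pJ cJ nz).
rewrite dfE gE fE; case: (pJ) => Jm bJ; rewrite -bbE bJ; last by rewrite -ltnS ltn_ord.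
rewrite -ltnNge => ki iJ; have {}ki : k <= i by move: ki; case: ifP; lia.
by have [_ g _] := cJ; have [] := g _ ki iJ; rewrite ndE.
apply: csimp_eq => //; move=> p q t pq nq mt.
have [qk|kq] := ltnP q k; last first.
have iT := isTh q kq nq; have iT' := iT; rewrite enz in iT'.
have mt' := mt; rewrite enz in mt'; have nq' := nq; rewrite ebz in nq'.
rewrite -(isT_val iT (cum pq nq mt)) -(isT_val iT' (cum pq nq' mt')).
by rewrite (cuD pq nq mt) (cuD pq nq' mt') enz.
move: p q pq nq mt qk; apply: (spl) => [q kq _ _ qk|i].
by move: (leq_trans qk kq); rewrite ltnn.
apply: spl => [|i']; first by rewrite ltnn.
rewrite !dfE gE fE => ii nb mt ik.
have {}ii : i <= i' by move: ii ik; do 2 case: ifP; lia.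
have := f_equal (fun w : Cyl N m => cu w i i' t) fz; rewrite /= ii -!/(dfc k _) => ->.
by have := f_equal (fun w : Cyl N m => cu w i i' t) fz'; rewrite /= ii -!/(dfc k _) => ->.
Qed.
Lemma CPair_inserted m (x : Cyl N m) z k : CPair x z k -> exists J, [/\ prof x J, cut x J k,
 act (dfc k) z = x, cb z k = false & cn z k = tn (jj x J) (PS x (jj x J) k)].
Proof. by case=> _ _ _ f [J [? ? ? ?]]; exists J. Qed.

(** Prescribed are the chains without numbers and those missing a vertex. Any other chain is matched
    with the insertion, at its cut, of the terminal family at its first number [j] supported on [j]
    and the preceding entry. *)
Theorem cyl_extend : exists H : smap (Cyl N) L, (forall m x y, prel GU x y -> H m x = y) /\
 forall m (x : KC N m), H m (sval x) = kap m x.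
Proof.
have [||||||H HE] := @pair_ext (Cyl N) L G0 CPair (@mu N) qL.
- by move=> n x z k [].
- move=> n x z z' k k' P P'; have [J [pJ cJ f b e]] := CPair_inserted P.
have [J' [pJ' cJ' f' b' e']] := CPair_inserted P'.
have E := prof_uniq pJ pJ'; subst J'.
have kk : k = k' := ord_inj (cut_uniq cJ cJ').
exact: (CPair_z kk pJ cJ f b e f' b' e').
- by move=> n x z k [].
- by move=> n x z k [].
- move=> n x z k z' k' P [_ _ []]; have [J [pJ cJ f b e]] := CPair_inserted P.
exact: inserted_typeI f pJ cJ b e.
- move=> n x ndx outx; have [tI|ntI] := pselect (typeI x); [left; exact: typeI_paired|right].
have [exn full] := (dG0 x).1 outx; have [J pJ] := prof_ex exn; have [c cc] := cut_ex x J.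
have [cJ gJ cmin] := cc; have [Jm bJ] := pJ.
pose k : 'I_n.+2 := inord c.
have kE : k = c :> nat by rewrite inordK // ltnS (leq_trans cJ) // leqW.
clearbody k.
pose j := jj x J.
have sT : supp (tn j (PS x j c)) = PS x j c.
by rewrite supp_tn ?PS_j // => i; apply: PS_le.
have bx i : cb x i = (J <= i) by rewrite -bbE bJ // -ltnS ltn_ord.
have [|||||||z [fz bz nz]] := @insert_exists N n x k J j (tn j (PS x j c)).
+ by rewrite kE.
+ exact: Jm.
+ exact: bx.
+ by apply: isT_tn; rewrite ?PS_j // => i; apply: PS_le.
+ by [].
+ move=> i; rewrite kE sT; case: (c) cJ => // d dJ id; rewrite /PS.
apply: fintype.subset_trans (finset.subsetUr _ _).
rewrite -ndE; apply: nd_mono => //; first by rewrite (leq_trans (ltnW dJ)).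
by rewrite bJ -?ltnNge // (leq_trans (ltnW dJ)).
+ move=> i ci iJ; rewrite kE in ci; have [iT _] := gJ _ ci iJ; rewrite ndE in iT; split=> //.
rewrite sT /PS finset.subUset sub1set (isT_j iT) /=; case: (c) ci => [|d] di; first exact: finset.sub0set.
have im : i <= n by rewrite -ltnS ltn_ord.
rewrite -ndE; apply: nd_mono => //; first exact: ltnW.
by rewrite bJ // -ltnNge.
exists z, k; have ck : cut x J k by rewrite kE.
have nz' : cn z k = tn (jj x J) (PS x (jj x J) k) by rewrite kE.
split.
+ by split=> //; exists J.
(* Insertion at position 0 gives an outer horn. Its first edge starts at the family supported at [j]
   alone and stays over [j]; it becomes an equivalence by [eKap] if it ends in a family and by [eU]
   if it ends in a number. *)
+ have [c0|c0] := posnP c; [right|left]; last by rewrite kE c0 ltnS (leq_trans cJ).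
subst c; have kE := c0; have k0 : k = ord0 by apply: ord_inj; rewrite kE.
(* A single number has a one-element support, so it misses a vertex because [N] is positive and is
   therefore prescribed. *)
have n0 : 0 < n.
rewrite lt0n; apply/negP => /eqP nE; subst n.
have J0 : J = 0 by move: Jm; rewrite leqn0 => /eqP.
have c1 : cb x ord0 by rewrite bx J0.
have [q ne] : exists q : 'I_N.+1, q <> klv (cn x ord0).
case: (eqVneq (klv (cn x ord0)) ord0) => [->|/eqP ne]; last by exists ord0 => /esym.
by exists ord_max => /(f_equal (@nat_of_ord _)) /= e; move: N0; rewrite e.
have [p] := full q; rewrite (ord1 p) (cnum c1) => /suppP[//|[t]]; by [].
split=> //; first exact: joyal_special.
pose e := act (edge01 n) z : Cyl N 1.
have z0 : cn z ord0 = tn j [set j].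
by rewrite -k0 nz' /PS kE /= finset.setU0.
have s0 : supp (tn j [set j]) = [set j].
by rewrite supp_tn ?inE // => i; rewrite inE => /eqP ->.
have e0 : cn e ord0 = tn j [set j] by rewrite -z0 /=; congr cn; apply: ord_inj; rewrite edge01E.
have be0 : cb e ord0 = false.
by rewrite -bz k0 /=; congr cb; apply: ord_inj; rewrite edge01E.
have o1 : edge01 n ord_max = dfc k ord0.
by apply: ord_inj; rewrite edge01E dfE kE.
have e1 : cn e ord_max = cn x ord0 by rewrite -fz; exact: (f_equal (@cn N _ z) o1).
have be1 : cb e ord_max = cb x ord0 by rewrite -fz; exact: (f_equal (@cb N _ z) o1).
have all2 (P : 'I_2 -> Prop) : P ord0 -> P ord_max -> forall i, P i by apply: ord2P.
have [J0|J0] := posnP J; last first.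
have Ke : forall i, cb e i = false.
by apply: all2 => //; rewrite be1 bx leqNgt J0.
exists (kap 1 (exist _ e Ke)); split; first by left; exists Ke.
apply: eKap; change (klv (cn e ord0) = klv (cn e ord_max)); rewrite e0 e1; symmetry; apply: (@isT_lv _ j).
by have [iT _] := gJ 0 (eq_leq kE) J0; rewrite -ndE.
have c1 : cb x ord0 by rewrite bx J0.
have l1 : klv (cn x ord0) = j by rewrite -(ndE x ord0) /j /jj J0.
have [y hy] : pdom GU e.
apply/dU; exists (if j == ord0 then ord_max else ord0).
have ij : (if j == ord0 then ord_max else ord0) != j.
case: (eqVneq j ord0) => [->|]; last by rewrite eq_sym.
by apply/eqP => /(f_equal (@nat_of_ord _)) /= E; move: N0; rewrite E.
apply: all2; first by rewrite e0 s0 inE.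
rewrite e1 (cnum c1) l1; apply/negP => /suppP[E|[t]] //.
by rewrite E eqxx in ij.
exists y; split; first by right.
apply: eU hy; split=> //; first by rewrite e0 e1 l1.
move=> t mt; rewrite e0 in mt *; have := supp_kD (tn j [set j]) t.
by rewrite s0 inE => /eqP ->.
+ move=> i ik; have [pd|npd] := pselect (pdom G0 (act (dfc i) z)); first by constructor 1.
have [ndy|nndy] := pselect (nondeg (act (dfc i) z)); last by constructor 2.
have [h|tI|lt] := face_cases fz pJ ck bz nz' ik.
* by have [[p]] := (dG0 _).1 npd; rewrite h.
* by constructor 3; apply: typeI_paired.
* by constructor 4.
exists H; split=> [m x y h|m [x p]]; apply: HE; first by right.
by left; exists p.
Qed.
End Pairing.

(** * The map from [D2] to the localization *)

Lemma retraction n (S : {set 'I_n.+1}) : S != set0 ->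
 exists r : delta n n, (forall i, r i \in S) /\ forall i, i \in S -> r i = i.
Proof.
case/set0Pn=> s1 s1S; pose s0 := [arg min_(s < s1 in S) nat_of_ord s].
have [s0S s0min] : s0 \in S /\ forall s, s \in S -> s0 <= s by rewrite /s0; case: arg_minnP.
pose P (i s : 'I_n.+1) := (s \in S) && (s <= maxn i s0).
have P0 i : P i s0 by rewrite /P s0S leq_maxr.
(* The retraction sends [i] to the largest element of [S] that is at most [i], and everything below
   [S] to its least element. *)
pose r i := [arg max_(s > s0 | P i s) nat_of_ord s].
have rP i : P i (r i) /\ forall s, P i s -> s <= r i by rewrite /r; case: arg_maxnP.
have rm (i i' : 'I_n.+1) : i <= i' -> r i <= r i'.
move=> ii; have [_ h] := rP i'; apply: h; have [/andP[h1 h2] _] := rP i.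
by rewrite /P h1 (leq_trans h2) // geq_max !leq_max ii leqnn orbT.
exists (Delta rm); split=> i /=; first by have [/andP[]] := rP i.
move=> iS; have [/andP[rS rle] h] := rP i; apply: ord_inj; apply/eqP; rewrite eqn_leq.
rewrite h ?andbT; last by rewrite /P iS leq_maxl.
by rewrite (maxn_idPl (s0min _ iS)) in rle.
Qed.
Definition csupp n m (x : Cyl n m) : {set 'I_n.+1} := \bigcup_i supp (cn x i).

Lemma csupp_neq0 n m (x : Cyl n m) : csupp x != set0.
Proof. by apply/set0Pn; exists (klv (cn x ord0)); apply/bigcupP; exists ord0 => //; apply: supp_lv. Qed.

Lemma Cyl_map_fix n m (x : Cyl n m) (e : delta n n) :
 (forall i, i \in csupp x -> e i = i) -> Cyl_map e m x = x.
Proof.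
move=> h; apply: csimp_eq => // i; apply: knode_eq => //=.
by apply: fext => t; apply: h; apply/bigcupP; exists i => //; apply: supp_kD.
by apply: h; apply/bigcupP; exists i => //; apply: supp_lv.
Qed.

Lemma Cyl_map_fixed n m (x : Cyl n m) (e : delta n n) i :
 Cyl_map e m x = x -> i \in csupp x -> e i = i.
Proof.
move=> E /bigcupP[p _]; have Ep : kact e (cn x p) = cn x p by apply: (f_equal (fun w : Cyl n m => cn w p) E).
case/suppP=> [->|[t _ <-]]; first exact: (f_equal (@klv n) Ep).
exact: (f_equal (fun k : knode n => kD k t) Ep).
Qed.

Section Sec.
Variables (b : bool) (L : sset) (ell : smap (nerve (Cb b)) L).
Hypotheses (qL : quasicategory L)
 (ellW : forall e, nerve_class (@cweq b) e -> is_equivalence (ell 1 e)).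
Notation E := (Esset ell).

Lemma lv_weq n (s : d2 b n) (e : csimp n 1) (ok : qok s e) : cb e ord0 = false ->
 klv (cn e ord0) = klv (cn e ord_max) -> nerve_class (@cweq b) (Qhat ok).
Proof.
move=> e0 e1; have [|t mt Dt] := @catt _ _ e ord0; first by rewrite e0.
rewrite /nerve_class /Qhat /=; move: (cbm _) (fun t => _) (fun t => _); rewrite e0 => hb hm hD.
exact: qmap_weq e1 mt Dt.
Qed.

Definition pcan : partmap (D2 b) E.
Proof.
refine (@Partmap (D2 b) E (fun n s e => exists x, strict b n x = s /\ ecan ellW x = e) _ _).
- by move=> m n f _ _ [x [<- <-]]; exists (act f x); rewrite smapP ecan_act.
- by move=> n s e e' [x [<- <-]] [x' [/strict_inj -> <-]].
Defined.

Section Step.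
Variables (G : partmap (D2 b) E) (n : nat) (s : D2 b n).
Hypotheses (GR : forall m t (e : E m), prel G t e -> es e = t)
 (bd : forall m (f : delta m n), ~ dsurj f -> pdom G (act f s))
 (n0 : 0 < n).

(** A chain whose support misses a vertex is fixed by a non-surjective [e], and its value comes from
    the simplex already constructed over [act e s]. Any two choices agree with the one given by the
    retraction onto the support. *)
Definition GUp : partmap (Cyl n) L.
Proof.
refine (@Partmap (Cyl n) L (fun m x y => exists (e : delta n n) (w : E n),
[/\ ~ dsurj e, Cyl_map e m x = x, prel G (act e s) w & eh w m x = y]) _ _).
- move=> m l f x y [e [w [h1 h2 h3 <-]]]; exists e, w; split=> //; last by rewrite smapP.
by rewrite smapP h2.
- move=> m x y y' [e [w [_ h2 h3 <-]]] [e' [w' [_ h2' h3' <-]]].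
have [r [rS rfix]] := retraction (csupp_neq0 x).
have er : dcomp e r = r by apply: delta_eq => i; apply: (Cyl_map_fixed h2 (rS i)).
have er' : dcomp e' r = r by apply: delta_eq => i; apply: (Cyl_map_fixed h2' (rS i)).
have rx := Cyl_map_fix rfix.
have := prel_act r h3; have := prel_act r h3'; rewrite -!actM er er' => g' g.
have := f_equal (fun v : E n => eh v m x) (prel_fun g g').
by rewrite /= -/(Cyl_map r m x) rx.
Defined.

Lemma GUp_dom m (x : Cyl n m) : pdom GUp x <-> exists i, forall p, i \notin supp (cn x p).
Proof.
split=> [[y [e [w [/dsurjN[i hi] h2 _ _]]]]|[i hi]].
exists i => p; apply/negP => ip; apply: (hi i); apply: Cyl_map_fixed h2 _.
by apply/bigcupP; exists p.
have [r [rS rfix]] := retraction (csupp_neq0 x).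
have nr : ~ dsurj r.
move=> /(_ i)[j ji]; have := rS j; rewrite ji => /bigcupP[p _]; exact/negP.
have [w hw] := bd nr.
by exists (eh w m x), r, w; split=> //; apply: Cyl_map_fix.
Qed.

Lemma GUp_compat m (x : KC n m) y : prel GUp (sval x) y -> y = ell m (Qmap (s : d2 b n) m x).
Proof.
case=> e [w [_ h2 h3 <-]]; rewrite (eK w x).
have -> : es w = (act e s : D2 b n) by apply: GR h3.
by rewrite Qmap_map; congr (ell m (Qmap _ _ _)); apply: sigE.
Qed.

(** [cyl_extend] over the cylinder of [s], with the strict replacement on the families and the
    earlier cells on the boundary. *)
Lemma cell_ex : exists w : E n, es w = s /\
 forall m (f : delta m n), ~ dsurj f -> prel G (act f s) (act f w).
Proof.
have eKap (e : KC n 1) : klv (cn (sval e) ord0) = klv (cn (sval e) ord_max) ->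
is_equivalence (scomp ell (Qmap (s : d2 b n)) 1 e).
by move=> h; apply: ellW; apply: lv_weq => //; apply: (svalP e).
have eU (e : Cyl n 1) y : is_vedge e -> prel GUp e y -> is_equivalence y.
by move=> ve [_ [w [_ _ _ <-]]]; apply: eE.
have [H [HU HK]] := cyl_extend (kap := scomp ell (Qmap (s : d2 b n))) qL n0 GUp_dom GUp_compat eU eKap.
have hE (e : Cyl n 1) : is_vedge e -> is_equivalence (H 1 e).
move=> ve; have [e0 e1 e2] := ve; case c1 : (cb e ord_max); last first.
have Ke : forall i, cb e i = false by apply: ord2P.
have := eKap (exist _ e Ke) e1; rewrite -HK; exact.
have [y hy] : pdom GUp e; last by rewrite (HU _ _ _ hy); apply: eU hy.
apply/GUp_dom; set j := klv (cn e ord0) in e1 e2.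
exists (if j == ord0 then ord_max else ord0).
have ij : (if j == ord0 then ord_max else ord0) != j.
case: (eqVneq j ord0) => [->|]; last by rewrite eq_sym.
by apply/eqP => /(f_equal (@nat_of_ord _)) /= E; move: n0; rewrite E.
apply: ord2P; apply/negP.
by case/suppP=> [E|[t mt E]]; [rewrite E eqxx in ij|rewrite -E e2 // eqxx in ij].
by rewrite (cnum c1) -e1 => /suppP[E|[t]] //; rewrite E eqxx in ij.
exists (@ES b L ell n s H HK hE); split=> // m f nf.
have [w' hw'] := bd nf; suff -> : act f (@ES b L ell n s H HK hE : E n) = w' by [].
pose S := dim f; have S0 : S != set0 by apply/set0Pn; exists (f ord0); apply/dimP; exists ord0.
have [r [rS rfix]] := retraction S0.
have nr : ~ dsurj r.
move=> sr; apply: nf => i; have [j ji] := sr i.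
by have := rS j; rewrite ji => /dimP.
have rf : dcomp r f = f by apply: delta_eq => i; apply: rfix; apply/dimP; exists i.
have [w hw] := bd nr; have := prel_act f hw; rewrite -actM rf => /(prel_fun hw') ->.
apply: esimp_eq => [|l z].
by change (act f s = act f (es w : D2 b n) :> D2 b m); rewrite (GR hw) -actM rf.
apply: HU; exists r, w; split=> //.
by rewrite -[RHS](f_equal (fun g => Cyl_map g l z) rf) Cyl_map_comp.
Qed.
End Step.

(** The canonical lifts of strict simplices are extended cell by cell to a section. Vertices of [D2]
    are strict, so each new cell has positive dimension, as [cell_ex] requires. *)
Theorem section_ex : exists s : smap (D2 b) L, forall n x, s n (strict b n x) = ell n x.
Proof.
have [||h [hG hR]] := @extend_total (D2 b) E (fun n s e => es e = s) (fun _ _ _ => False) pcan.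
- by split=> // n _ _ [x [<- <-]].
- move=> G G0 [GR _] ex; have [n [[s ns] nmin]] := nat_min ex.
have low m (t : D2 b m) : m < n -> pdom G t.
by move=> mn; apply: contrapT => nt; apply: (nmin _ mn); exists t.
have n0 : 0 < n.
case: n s ns nmin low => // s ns _ _; case: ns; have [x <-] := strict_onto0 s.
by exists (ecan ellW x); apply: G0; exists x.
have bd m (f : delta m n) : ~ dsurj f -> pdom G (act f s).
case: n s ns nmin low f n0 => // n s ns nmin low f _ /dsurjN[i /dfactor[f' ->]].
by rewrite actM; apply: pdom_act; apply: low.
have [w [ws hw]] := cell_ex GR bd n0.
have [G' [e1 e2 e3]] := attach_cell ns hw.
exists G', n, s; split=> //; last by exists w.
by split=> // m t y /e3[/GR//|[f [-> ->]]]; rewrite /= ws.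
(* The numbers form a copy of the simplex inside the cylinder, compatible with faces and
   degeneracies. *)
have num m n (f : delta m n) : Cyl_map f m (numC (did m)) = act f (numC (did n) : Cyl n n).
by apply: csimp_eq => // i; apply: knode_eq.
have sP m n (f : delta m n) (x : D2 b n) : eh (h m (act f x)) m (numC (did m)) =
act f (eh (h n x) n (numC (did n))).
rewrite smapP; exact: etrans (f_equal (eh (h n x) m) (num m n f)) (smapP (eh (h n x)) f _).
exists (Smap sP) => n x /=; have -> : h n (strict b n x) = ecan ellW x by apply: hG; exists x.
by rewrite /= -[in RHS](act1 x) -Hcan_num.
Qed.
End Sec.

(* A simplex of [D2] glued from simplices [X] and [Y] over the vertices outside
  and inside [tt]. *)
Section Glue.
Variables (b : bool) (n : nat) (X Y : d2 b n) (tt : 'I_n.+1 -> bool).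
Hypothesis ttm : forall i j : 'I_n.+1, sle i j -> tt i -> tt j.
Variable F : forall i j : 'I_n.+1, sle i j -> mpfunctor (dA X i) (dA Y j).
Variable e : forall (i j k : 'I_n.+1) (ij : sle i j) (jk : sle j k) (ik : sle i k) (a : dA X i),
 phom (F jk (dF X ij a)) (F ik a).
Variable c : forall (i j k : 'I_n.+1) (ij : sle i j) (jk : sle j k) (ik : sle i k) (a : dA X i),
 phom (dF Y jk (F ij a)) (F ik a).
Hypotheses (em : forall i j k ij jk ik a, marked (@e i j k ij jk ik a))
 (cmk : forall i j k ij jk ik a, marked (@c i j k ij jk ik a))
 (en : forall i j k ij jk ik a a' (f : phom a a'),
 pcmp (@e i j k ij jk ik a') (pfmor (F jk) (pfmor (dF X ij) f)) = pcmp (pfmor (F ik) f) (@e i j k ij jk ik a))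
 (cn' : forall i j k ij jk ik a a' (f : phom a a'),
 pcmp (@c i j k ij jk ik a') (pfmor (dF Y jk) (pfmor (F ij) f)) = pcmp (pfmor (F ik) f) (@c i j k ij jk ik a))
 (e1 : forall (i k : 'I_n.+1) (ii : sle i i) (ik : sle i k) a (E : F ik (dF X ii a) = F ik a),
 e ii ik ik a = idc E)
 (c1 : forall (i k : 'I_n.+1) (kk : sle k k) (ik : sle i k) a (E : dF Y kk (F ik a) = F ik a),
 c ik kk ik a = idc E)
 (T1 : forall (i j k l : 'I_n.+1) (ij : sle i j) (jk : sle j k) (kl : sle k l) (ik : sle i k)
  (jl : sle j l) (il : sle i l) a,
  pcmp (e ik kl il a) (pfmor (F kl) (dphi X ij jk ik a)) =
  pcmp (e ij jl il a) (e jk kl jl (dF X ij a)))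
 (T2 : forall (i j k l : 'I_n.+1) (ij : sle i j) (jk : sle j k) (kl : sle k l) (ik : sle i k)
  (jl : sle j l) (il : sle i l) a,
  pcmp (c ik kl il a) (pfmor (dF Y kl) (e ij jk ik a)) =
  pcmp (e ij jl il a) (c jk kl jl (dF X ij a)))
 (T3 : forall (i j k l : 'I_n.+1) (ij : sle i j) (jk : sle j k) (kl : sle k l) (ik : sle i k)
  (jl : sle j l) (il : sle i l) a,
  pcmp (c ik kl il a) (pfmor (dF Y kl) (c ij jk ik a)) =
  pcmp (c ij jl il a) (dphi Y jk kl jl (F ij a))).

Definition gA0 (t : bool) (i : 'I_n.+1) : cob b := if t then dA Y i else dA X i.
Definition gF0 (t u : bool) : forall (i j : 'I_n.+1) (h : sle i j), (t -> u) -> mpfunctor (gA0 t i) (gA0 u j) :=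
 match t, u return forall (i j : 'I_n.+1) (h : sle i j), (t -> u) -> mpfunctor (gA0 t i) (gA0 u j) with
 | true, true => fun i j h _ => dF Y h
 | false, true => fun i j h _ => F h
 | false, false => fun i j h _ => dF X h
 | true, false => fun i j h H => match notF (H isT) with end
 end.
Definition gp0 (t u v : bool) : forall (i j k : 'I_n.+1) (ij : sle i j) (jk : sle j k) (ik : sle i k)
  (h1 : t -> u) (h2 : u -> v) (h3 : t -> v) (a : gA0 t i),
  phom (gF0 jk h2 (gF0 ij h1 a)) (gF0 ik h3 a) :=
 match t, u, v return forall (i j k : 'I_n.+1) (ij : sle i j) (jk : sle j k) (ik : sle i k)
  (h1 : t -> u) (h2 : u -> v) (h3 : t -> v) (a : gA0 t i),
  phom (gF0 jk h2 (gF0 ij h1 a)) (gF0 ik h3 a) with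
 | true, true, true => fun i j k ij jk ik _ _ _ a => dphi Y ij jk ik a
 | false, true, true => fun i j k ij jk ik _ _ _ a => c ij jk ik a
 | false, false, true => fun i j k ij jk ik _ _ _ a => e ij jk ik a
 | false, false, false => fun i j k ij jk ik _ _ _ a => dphi X ij jk ik a
 | true, false, _ => fun i j k ij jk ik h1 _ _ => match notF (h1 isT) with end
 | _, true, false => fun i j k ij jk ik _ h2 _ => match notF (h2 isT) with end
 end.

Definition glue : d2 b n.
Proof.
refine (@D2s b n (fun i => gA0 (tt i) i) (fun i j h => gF0 h (ttm h))
(fun i j k ij jk ik a => gp0 ij jk ik (ttm ij) (ttm jk) (ttm ik) a) _ _ _ _ _ _).
- move=> i j k ij jk ik; move: (ttm ij) (ttm jk) (ttm ik).
case: (tt i) (tt j) (tt k) => [] [] [] h1 h2 h3 a //=; try (by case: (notF (h1 isT))); try (by case: (notF (h2 isT))).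
+ exact: dphi_marked.
+ exact: dphi_marked.
- move=> i j k ij jk ik; move: (ttm ij) (ttm jk) (ttm ik).
case: (tt i) (tt j) (tt k) => [] [] [] h1 h2 h3 a a' f; try (by case: (notF (h1 isT))); try (by case: (notF (h2 isT))).
+ exact: (dphi_nat Y).
+ exact: cn'.
+ exact: en.
+ exact: (dphi_nat X).
- move=> i ii; move: (ttm ii); case: (tt i) => h; exact: dF1.
- move=> i k ii ik; move: (ttm ii) (ttm ik); case: (tt i) (tt k) => [] [] h1 h2 a E; try (by case: (notF (h2 isT))).
+ exact: (dphi1l Y).
+ exact: e1.
+ exact: (dphi1l X).
- move=> i k ii ik; move: (ttm ii) (ttm ik); case: (tt i) (tt k) => [] [] h1 h2 a E; try (by case: (notF (h2 isT))).
+ exact: (dphi1r Y).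
+ exact: c1.
+ exact: (dphi1r X).
- move=> i j k l ij jk kl ik jl il; move: (ttm ij) (ttm jk) (ttm kl) (ttm ik) (ttm jl) (ttm il).
case: (tt i) (tt j) (tt k) (tt l) => [] [] [] [] h1 h2 h3 h4 h5 h6 a;
try (by case: (notF (h1 isT))); try (by case: (notF (h2 isT))); try (by case: (notF (h3 isT))).
+ exact: (dcoc Y).
+ exact: T3.
+ exact: T2.
+ exact: T1.
+ exact: (dcoc X).
Defined.
End Glue.

(** * The cocone on [A # BG], spread over a 2-simplex *)

Section Gamma.
Variables (b : bool) (G : groupType).
Notation cob := (cob b).
Notation N := (nerve (Cb b)).
Notation BGn := (nerve (BG G)).

Definition gk n (k : BGn n) (i j : 'I_n.+1) (h : sle i j) : G := nmor k (of_sle h).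

Lemma gkM n (k : BGn n) (i j l : 'I_n.+1) (ij : sle i j) (jl : sle j l) (il : sle i l) :
 gk k il = (gk k jl * gk k ij)%g.
Proof. exact: (nmorM k (of_sle ij) (of_sle jl) (of_sle il)). Qed.
Lemma gk1 n (k : BGn n) (i : 'I_n.+1) (ii : sle i i) : gk k ii = 1%g.
Proof. exact: (nmor1 k (of_sle ii)). Qed.
Lemma gk_act m n (f : delta m n) (k : BGn n) (i j : 'I_m.+1) (h : sle i j) :
 gk (act f k : BGn m) h = gk k (smono f h).
Proof. exact: (f_equal (@nmor _ _ k (f i) (f j)) (pirr _ _)). Qed.

Record gpr (A : Type) := GPr { g1 : A; g2 : G }.
(** At [false] this is [A] times the indiscrete category on [G]: equivalent to [A], but with a free
    action of [G] by left translation. *)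
Definition Pn (c : bool) (A : cob) : cob := if c then A else pull (@g1 A).
Definition gobj (c : bool) (A : cob) : Pn c A -> A :=
 match c return Pn c A -> A with true => fun a => a | false => fun a : gpr A => g1 a end.
Definition gkap (c : bool) (A : cob) : Pn c A -> G :=
 match c return Pn c A -> G with true => fun=> 1%g | false => fun a : gpr A => g2 a end.
Definition gmor (c : bool) (A : cob) : forall x y : Pn c A, phom x y -> phom (gobj x) (gobj y) :=
 match c return forall x y : Pn c A, phom x y -> phom (gobj x) (gobj y) with
 | true => fun x y f => f | false => fun x y f => f end.

Definition Pm00 (A B : cob) (F : mpfunctor A B) (s : G -> G) : mpfunctor (Pn false A) (Pn false B) :=
 @Mpfunctor (Pn false A) (Pn false B) (@Pfunctor (Pn false A) (Pn false B) (fun a : gpr A => GPr (F (g1 a)) (s (g2 a)))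
  (fun a a' f => pfmor F (f : phom (g1 a) (g1 a'))) (fun a => pfmor1 F (g1 a))
  (fun x y z g f => @pfmorM _ _ F (g1 x) (g1 y) (g1 z) g f) (fun x y f f' => @pfmorD _ _ F (g1 x) (g1 y) f f'))
  (fun x y f => @mpf_marked _ _ F (g1 x) (g1 y) f).
Definition Pm01 (A B : cob) (F : mpfunctor A B) : mpfunctor (Pn false A) B :=
 @Mpfunctor (Pn false A) B (@Pfunctor (Pn false A) B (fun a : gpr A => F (g1 a))
  (fun a a' f => pfmor F (f : phom (g1 a) (g1 a'))) (fun a => pfmor1 F (g1 a))
  (fun x y z g f => @pfmorM _ _ F (g1 x) (g1 y) (g1 z) g f) (fun x y f f' => @pfmorD _ _ F (g1 x) (g1 y) f f'))
  (fun x y f => @mpf_marked _ _ F (g1 x) (g1 y) f).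
Definition Pm (c c' : bool) (A B : cob) (F : mpfunctor A B) (s : G -> G) :
  (c -> c') -> mpfunctor (Pn c A) (Pn c' B) :=
 match c, c' return (c -> c') -> mpfunctor (Pn c A) (Pn c' B) with
 | true, true => fun=> F
 | false, true => fun=> Pm01 F
 | false, false => fun=> Pm00 F s
 | true, false => fun H => match notF (H isT) with end
 end.

Lemma Pm_id (c : bool) (A : cob) (s : G -> G) (h : c -> c) : (forall g, s g = g) ->
 Pm (mpfunctor_id A) s h = mpfunctor_id (Pn c A).
Proof.
move=> e; have -> : s = id by apply: fext.
by case: c h => h; apply: mpfunctor_eq; apply: pfunctor_eq.
Qed.

Lemma Pm_comp (c1 c2 c3 : bool) (A B C : cob) (F : mpfunctor A B) (F' : mpfunctor B C) (s s' s'' : G -> G) h1 h2 h3 :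
 (forall g, s'' g = s' (s g)) ->
 @Pm c1 c3 A C (mpfunctor_comp F' F) s'' h3 = mpfunctor_comp (@Pm c2 c3 B C F' s' h2) (@Pm c1 c2 A B F s h1).
Proof.
move=> e; have -> : s'' = (fun g => s' (s g)) by apply: fext.
case: c1 c2 c3 h1 h2 h3 => [] [] [] h1 h2 h3; try (by case: (notF (h1 isT)));
try (by case: (notF (h2 isT))); by apply: mpfunctor_eq; apply: pfunctor_eq.
Qed.

Lemma Pm_irr (c1 c2 : bool) (A B : cob) (F F' : mpfunctor A B) (s s' : G -> G) h h' :
 F = F' -> (forall g, s g = s' g) -> @Pm c1 c2 A B F s h = @Pm c1 c2 A B F' s' h'.
Proof.
move=> -> e; have -> : s = s' by apply: fext.
congr Pm; exact: pirr.
Qed.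

Section Low.
Variables (n : nat) (x : N n) (k : BGn n) (t : delta n 2).
(** The coordinate [t] selects the free replacement over 0, [A] over 1, where [lo] starts, and
    [A # BG] over 2, where [hi] starts. *)
Definition lo (i : 'I_n.+1) : bool := 0 < t i.
Definition hi (i : 'I_n.+1) : bool := 1 < t i.
Lemma lom (i j : 'I_n.+1) : i <= j -> lo i -> lo j.
Proof. by move=> /(dmono t) h1 h2; apply: leq_trans h2 h1. Qed.
Lemma him (i j : 'I_n.+1) : sle i j -> hi i -> hi j.
Proof. by move=> /of_sle/(dmono t) h1 h2; apply: leq_trans h2 h1. Qed.

Definition low : N n.
Proof.
refine (@NerveSimp (Cb b) n (fun i => Pn (lo i) (nob x i))
(fun i j h => Pm (nmor x h) (fun g => (nmor k h : G) * g)%g (lom h)) _ _).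
- move=> i h; rewrite (nmor1 x h) (nmor1 k h); apply: Pm_id => g; exact: mul1g.
- move=> i j l ij jl il; rewrite (nmorM x ij jl il) (nmorM k ij jl il).
apply: (@Pm_comp (lo i) (lo j) (lo l) _ _ _ (nmor x ij) (nmor x jl)) => g; symmetry; exact: mulgA.
Defined.
End Low.

Lemma low_act m n (f : delta m n) (x : N n) (k : BGn n) (t : delta n 2) :
 low (act f x : N m) (act f k : BGn m) (dcomp t f) = act f (low x k t : N n).
Proof.
refine (@nerve_eq (Cb b) m (fun i => Pn (lo t (f i)) (nob x (f i))) _ _ _ _ _ _ _).
apply: dfext => i; apply: dfext => j.
apply: fext => h; exact: Pm_irr.
Qed.

Notation Sh := (sharpC b (BG G)).
Notation So := (sho (BG G)).
Notation sob a := (@SharpOb _ (BG G) a Datatypes.tt).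

(** On the free replacement the label [h^-1 * g] is invariant under left translation, so the cocone
    is strict there. On [A] all labels are 1, and invariance holds only up to the 2-cell [coreE]. *)
Definition Eu (c : bool) (A : cob) : mpfunctor (Pn c A) (So A).
Proof.
unshelve refine (@Mpfunctor (Pn c A) (So A) (@Pfunctor (Pn c A) (So A)
(fun a => @SharpOb A (BG G) (gobj a) Datatypes.tt) (fun x y f => @tens (phom (gobj x) (gobj y)) G (gmor f) ((gkap y)^-1 * gkap x)%g) _ _ _) _).
- by move=> x; rewrite mulVg; case: c x.
- move=> x y z g f; rewrite /= sharp_cmpU /= !mulgA mulgK; congr tens; by case: c x y z g f.
- by move=> x y f f'; rewrite /= -tensDl; congr tens; case: c x y f f'.
- by move=> x y f m; apply: smk_tens; case: c x y f m.
Defined.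

Section Core.
Variables (c c' : bool) (h : c -> c') (A B C : cob) (K : mpfunctor A B) (H : mpfunctor B C) (H'' : mpfunctor A C).
Variable g : G.
Notation KK := (@Pm c c' A B K (fun u => g * u)%g h).
Hypothesis HK : mpfunctor_comp H K = H''.

Lemma Pm_gobj (a : Pn c A) : gobj (KK a) = K (gobj a).
Proof. by case: c c' h a => [] [] h' a //; case: (notF (h' isT)). Qed.
Lemma core_eq (a : Pn c A) : H (gobj (KK a)) = H'' (gobj a).
Proof. by rewrite Pm_gobj -HK. Qed.
(** The label is 1 between two copies of the free replacement and [g^-1] between two copies of [A]:
    this is the 2-cell of the leg attached to a group element. *)
Definition coreE (a : Pn c A) : phom (shm (BG G) H (Eu c' B (KK a))) (shm (BG G) H'' (Eu c A a)) :=
 @tens (phom (H (gobj (KK a))) (H'' (gobj a))) G (idc (core_eq a)) ((gkap a)^-1 * g^-1 * gkap (KK a))%g.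

Lemma coreE_nat (a a' : Pn c A) (f : phom a a') :
 pcmp (coreE a') (pfmor (shm (BG G) H) (pfmor (Eu c' B) (pfmor KK f))) =
 pcmp (pfmor (shm (BG G) H'') (pfmor (Eu c A) f)) (coreE a).
Proof.
rewrite /coreE /= !sharp_fmorU !sharp_cmpU; congr tens; last by rewrite /= !mulgA !mulgK.
have [e1 e2] := (core_eq a, core_eq a'); rewrite (pirr (core_eq a) e1) (pirr (core_eq a') e2).
case: c c' h a a' f e1 e2 => [] [] h' a a' f e1 e2; try (by case: (notF (h' isT)));
exact: (idc_nat HK).
Qed.
Lemma coreE_marked a : marked (coreE a).
Proof. by apply: smk_tens; apply: marked_idc. Qed.
End Core.

Section Gam.
Variables (n : nat) (x : N n) (k : BGn n) (t : delta n 2).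
Notation X := (low x k t).
Notation Y := (nerve_map Sh n x : N n).
Notation Xs := (strict b n X).
Notation Ys := (strict b n Y).

Definition GF (i j : 'I_n.+1) (h : sle i j) : mpfunctor (dA Xs i) (dA Ys j) :=
 mpfunctor_comp (dF Ys h) (Eu (lo t i) (nob x i)).

Definition Ge (i j l : 'I_n.+1) (ij : sle i j) (jl : sle j l) (il : sle i l) (a : dA Xs i) :
  phom (GF jl (dF Xs ij a)) (GF il a) :=
 @coreE (lo t i) (lo t j) (@lom n t i j (of_sle ij)) _ _ _ (sF x ij) (sF x jl) (sF x il) (gk k ij) (sFE x ij jl il) a.

Definition Gc (i j l : 'I_n.+1) (ij : sle i j) (jl : sle j l) (il : sle i l) (a : dA Xs i) :
 phom (dF Ys jl (GF ij a)) (GF il a) := dphi Ys ij jl il (Eu (lo t i) (nob x i) a).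

Lemma dphi_strict (w : N n) (i j l : 'I_n.+1) (ij : sle i j) (jl : sle j l) (il : sle i l) a
 (e : dF (strict b n w) jl (dF (strict b n w) ij a) = dF (strict b n w) il a) :
 dphi (strict b n w) ij jl il a = idc e.
Proof. exact: (f_equal (@idc _ _ _) (pirr _ _)). Qed.
Lemma sidc (A : cob) (u v : A) (E : sob u = sob v :> sharp (BG G) A) (e : u = v) :
 idc E = @tens (phom u v) G (idc e) 1%g :> phom (sob u : So A) (sob v).
Proof. by subst v; rewrite idc_id. Qed.

Lemma tcmp (A : cob) (u v w : A) (e : v = w) (e' : u = v) (e'' : u = w) (g g' g'' : G) : g'' = (g * g')%g ->
 pcmp (@tens (phom v w) G (idc e) g : phom (sob v : So A) (sob w))
  (@tens (phom u v) G (idc e') g' : phom (sob u : So A) (sob v)) = @tens (phom u w) G (idc e'') g''.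
Proof. by move=> ->; rewrite /= sharp_cmpU /=; congr tens; apply: idc_cmp. Qed.
Lemma teq (A : cob) (u v : A) (e e' : u = v) (g g' : G) : g = g' ->
 @tens (phom u v) G (idc e) g = @tens (phom u v) G (idc e') g'.
Proof. by move=> ->; rewrite (pirr e e'). Qed.
Lemma Xs1 (i : 'I_n.+1) (ii : sle i i) (a : dA Xs i) : dF Xs ii a = a.
Proof. by rewrite (dF1 Xs). Qed.
Lemma Xs2 (i j l : 'I_n.+1) (ij : sle i j) (jl : sle j l) (il : sle i l) (a : dA Xs i) :
 dF Xs jl (dF Xs ij a) = dF Xs il a.
Proof. exact: (f_equal (fun K : mpfunctor _ _ => K a) (sFE X ij jl il)). Qed.

Lemma Ge1 (i l : 'I_n.+1) (ii : sle i i) (il : sle i l) a (E : GF il (dF Xs ii a) = GF il a) :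
 Ge ii il il a = idc E.
Proof.
rewrite (sidc E (core_eq (@lom n t i i (of_sle ii)) (gk k ii) (sFE x ii il il) a)).
apply: teq; apply: etrans (f_equal (fun z => (gkap (a : Pn (lo t i) (nob x i)))^-1 * (gk k ii)^-1 * z)%g
(f_equal (@gkap (lo t i) (nob x i)) (Xs1 ii a))) _.
by rewrite gk1 invg1 mulg1 mulVg.
Qed.

Lemma GeT1 (i j l m : 'I_n.+1) (ij : sle i j) (jl : sle j l) (lm : sle l m) (il : sle i l)
  (jm : sle j m) (im : sle i m) a :
 pcmp (Ge il lm im a) (pfmor (GF lm) (dphi Xs ij jl il a)) =
 pcmp (Ge ij jm im a) (Ge jl lm jm (dF Xs ij a)).
Proof.
rewrite (dphi_strict (Xs2 ij jl il a)).
have e1 : GF lm (dF Xs jl (dF Xs ij a)) = GF lm (dF Xs il a) by rewrite (Xs2 ij jl il a).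
have e2 : sF x lm (gobj (dF Xs jl (dF Xs ij a) : Pn (lo t l) (nob x l))) = sF x lm (gobj (dF Xs il a : Pn (lo t l) (nob x l))) by rewrite (Xs2 ij jl il a).
rewrite (pfmor_idc (F := GF lm) _ e1) (sidc e1 e2).
have e3 : sF x lm (gobj (dF Xs jl (dF Xs ij a) : Pn (lo t l) (nob x l))) = sF x im (gobj (a : Pn (lo t i) (nob x i))).
by rewrite e2; apply: core_eq (sFE x il lm im) a.
rewrite (tcmp _ _ e3 erefl) (tcmp _ _ e3 erefl); congr tens.
have E : gkap (dF Xs jl (dF Xs ij a) : Pn (lo t l) (nob x l)) = gkap (dF Xs il a : Pn (lo t l) (nob x l)) by rewrite (Xs2 ij jl il a).
rewrite mulg1 (gkM k ij jl il) invgM !mulgA; congr (_ * _)%g; first by rewrite mulgK.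
rewrite -(gkM k ij jl il); exact: (esym (f_equal (@gkap (lo t l) (nob x l)) (Xs2 ij jl il a))).
Qed.

Lemma GeT2 (i j l m : 'I_n.+1) (ij : sle i j) (jl : sle j l) (lm : sle l m) (il : sle i l)
  (jm : sle j m) (im : sle i m) a :
 pcmp (Gc il lm im a) (pfmor (dF Ys lm) (Ge ij jl il a)) =
 pcmp (Ge ij jm im a) (Gc jl lm jm (dF Xs ij a)).
Proof.
have e1 : sF x lm (sF x il (gobj (a : Pn (lo t i) (nob x i)))) = sF x im (gobj (a : Pn (lo t i) (nob x i))).
by rewrite -(sFE x il lm im).
have e2 : sF x lm (sF x jl (gobj (dF Xs ij a : Pn (lo t j) (nob x j)))) = sF x jm (gobj (dF Xs ij a : Pn (lo t j) (nob x j))).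
by rewrite -(sFE x jl lm jm).
have E1 : dF Ys lm (dF Ys il (Eu (lo t i) (nob x i) a)) = dF Ys im (Eu (lo t i) (nob x i) a).
exact: (f_equal (fun u => sob u : sharp (BG G) (nob x m)) e1).
have E2 : dF Ys lm (dF Ys jl (Eu (lo t j) (nob x j) (dF Xs ij a))) = dF Ys jm (Eu (lo t j) (nob x j) (dF Xs ij a)).
exact: (f_equal (fun u => sob u : sharp (BG G) (nob x m)) e2).
rewrite /Gc (dphi_strict E1) (dphi_strict E2) (sidc E1 e1) (sidc E2 e2).
have e3 := f_equal (sF x lm) (core_eq (@lom n t i j (of_sle ij)) (gk k ij) (sFE x ij jl il) a).
rewrite [pfmor _ _]sharp_fmorU (pfmor_idc _ e3).
rewrite (tcmp e1 e3 (etrans e3 e1) erefl) (tcmp _ e2 (etrans e3 e1) erefl); congr tens.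
by rewrite mul1g mulg1.
Qed.

Definition gam : d2 b n :=
 @glue b n Xs Ys (hi t) (@him _ t) GF Ge Gc
  (fun i j l ij jl il a => coreE_marked _ _ _ _)
  (fun i j l ij jl il a => dphi_marked Ys _ _ _ _)
  (fun i j l ij jl il a a' f => coreE_nat _ _ _ _)
  (fun i j l ij jl il a a' f => dphi_nat Ys _ _ _ _)
  Ge1 (fun i l ll il a E => dphi1r Ys _ _ E) GeT1 GeT2
  (fun i j l m ij jl lm il jm im a => dcoc Ys _ _ _ _ _ _ _).
End Gam.

Lemma coreE_cell (c c' : bool) (h h' : c -> c') (A B C : cob) (K K1 : mpfunctor A B) (H H1 : mpfunctor B C)
  (H2 H3 : mpfunctor A C) (g g' : G) (HK : mpfunctor_comp H K = H2) (HK1 : mpfunctor_comp H1 K1 = H3) :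
 K = K1 -> H = H1 -> g = g' ->
 @Cell b (Pn c A) (Pn c' B) (So C) (Pm K (fun u => g * u)%g h) (mpfunctor_comp (shm (BG G) H) (Eu c' B))
  (mpfunctor_comp (shm (BG G) H2) (Eu c A)) (coreE h g HK) =
 @Cell b (Pn c A) (Pn c' B) (So C) (Pm K1 (fun u => g' * u)%g h') (mpfunctor_comp (shm (BG G) H1) (Eu c' B))
  (mpfunctor_comp (shm (BG G) H3) (Eu c A)) (coreE h' g' HK1).
Proof.
move=> e1 e2 e3; subst K1 H1 g'; rewrite (pirr h' h).
by subst H2 H3.
Qed.

Lemma sF_whisker (A : cob) n (w : N n) (i j l : 'I_n.+1) (ij : sle i j) (jl : sle j l) (il : sle i l)
 (K' : mpfunctor A (nob w i)) :
 mpfunctor_comp (sF w jl) (mpfunctor_comp (sF w ij) K') = mpfunctor_comp (sF w il) K'.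
Proof. by rewrite -(sFE w ij jl il); apply: mpfunctor_eq; apply: pfunctor_eq. Qed.

Lemma sphi_whisker (A' : cob) n (w : N n) (i j l : 'I_n.+1) (ij : sle i j) (jl : sle j l) (il : sle i l)
 (K : mpfunctor A' (nob w i)) :
 Cell (fun a => dphi (strict b n w) ij jl il (K a) : phom (sF w jl (mpfunctor_comp (sF w ij) K a)) (mpfunctor_comp (sF w il) K a)) =
 comp_cell (sF_whisker ij jl il K).
Proof.
congr Cell; apply: dfext => a; exact: (f_equal (@idc _ _ _) (pirr _ _)).
Qed.

Definition Gam : smap (sprod (sprod N BGn) (simplex 2)) (D2 b).
Proof.
refine (@Smap (sprod (sprod N BGn) (simplex 2)) (D2 b) (fun n p => gam p.1.1 p.1.2 p.2) _).
move=> m n f [[x k] t]; apply: d2_extF => /=.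
- by [].
- move=> i j h; have eX : farr (strict b m (low (act f x : N m) (act f k : BGn m) (dcomp t f))) h =
farr (strict b n (low x k t)) (smono f h).
by rewrite (low_act f x k t) smapP.
have eY : farr (strict b m (nerve_map Sh m (act f x : N m))) h = farr (strict b n (nerve_map Sh n x)) (smono f h).
by rewrite !smapP.
change (Arr (gF0 (@GF m (act f x : N m) (act f k : BGn m) (dcomp t f)) h (@him m (dcomp t f) i j h)) =
Arr (gF0 (@GF n x k t) (smono f h) (@him n t (f i) (f j) (smono f h)))).
rewrite (pirr (@him n t (f i) (f j) (smono f h)) (@him m (dcomp t f) i j h)).
move: (@him m (dcomp t f) i j h); change (hi (dcomp t f) i) with (hi t (f i)); change (hi (dcomp t f) j) with (hi t (f j)).
case: (hi t (f i)) (hi t (f j)) => [] [] hh.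
+ exact: eY.
+ by case: (notF (hh isT)).
+ exact: (f_equal (fun K : mpfunctor _ _ => Arr (mpfunctor_comp K (Eu (lo t (f i)) (nob x (f i))))) (arr_inj eY)).
+ exact: eX.
- move=> i j l ij jl il; have eX : fcell (strict b m (low (act f x : N m) (act f k : BGn m) (dcomp t f))) ij jl il =
fcell (strict b n (low x k t)) (smono f ij) (smono f jl) (smono f il).
by rewrite (low_act f x k t) smapP.
have eY : fcell (strict b m (nerve_map Sh m (act f x : N m))) ij jl il =
fcell (strict b n (nerve_map Sh n x)) (smono f ij) (smono f jl) (smono f il).
by rewrite !smapP.
have aY (p q : 'I_m.+1) (pq : sle p q) : sF (nerve_map Sh m (act f x : N m)) pq =
sF (nerve_map Sh n x) (smono f pq).
apply: arr_inj; change (farr (strict b m (nerve_map Sh m (act f x : N m))) pq =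
farr (strict b n (nerve_map Sh n x)) (smono f pq)); by rewrite !smapP.
have aX (p q : 'I_m.+1) (pq : sle p q) : sF (act f x : N m) pq = sF x (smono f pq).
apply: arr_inj; change (farr (strict b m (act f x : N m)) pq = farr (strict b n x) (smono f pq)).
by rewrite smapP.
change (Cell (gp0 (@Ge m (act f x : N m) (act f k : BGn m) (dcomp t f)) (@Gc m (act f x : N m) (act f k : BGn m) (dcomp t f))
ij jl il (@him m (dcomp t f) i j ij) (@him m (dcomp t f) j l jl) (@him m (dcomp t f) i l il)) =
Cell (gp0 (@Ge n x k t) (@Gc n x k t) (smono f ij) (smono f jl) (smono f il)
(@him n t (f i) (f j) (smono f ij)) (@him n t (f j) (f l) (smono f jl)) (@him n t (f i) (f l) (smono f il)))).
rewrite (pirr (@him n t (f i) (f j) (smono f ij)) (@him m (dcomp t f) i j ij)).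
rewrite (pirr (@him n t (f j) (f l) (smono f jl)) (@him m (dcomp t f) j l jl)).
rewrite (pirr (@him n t (f i) (f l) (smono f il)) (@him m (dcomp t f) i l il)).
move: (@him m (dcomp t f) i j ij) (@him m (dcomp t f) j l jl) (@him m (dcomp t f) i l il).
change (hi (dcomp t f) i) with (hi t (f i)); change (hi (dcomp t f) j) with (hi t (f j)).
change (hi (dcomp t f) l) with (hi t (f l)).
case: (hi t (f i)) (hi t (f j)) (hi t (f l)) => [] [] [] h1 h2 h3; try (by case: (notF (h1 isT)));
try (by case: (notF (h2 isT))).
+ exact: eY.
+ pose K := Eu (lo t (f i)) (nob x (f i)).
apply: etrans (@sphi_whisker _ m (nerve_map Sh m (act f x : N m)) i j l ij jl il K) _.
apply: etrans _ (esym (@sphi_whisker _ n (nerve_map Sh n x) (f i) (f j) (f l) (smono f ij) (smono f jl) (smono f il) K)).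
apply: (@comp_cell_eq b); last exact: aY.
exact: (f_equal (fun H : mpfunctor _ _ => mpfunctor_comp H K) (aY i j ij)).
+ apply: (@coreE_cell (lo t (f i)) (lo t (f j))); [exact: aX|exact: aX|exact: gk_act].
+ exact: eX.
Defined.

Lemma Gam0 n (x : N n) (k : BGn n) : Gam n ((x, k), dconst n (@Ordinal 3 1 isT)) = strict b n x.
Proof.
apply: d2_extF => //.
move=> i j l ij jl il; apply: etrans (_ : comp_cell (sFE (low x k (dconst n (@Ordinal 3 1 isT))) ij jl il) = _) _ => //.
exact: (@comp_cell_eq b).
Qed.
Lemma Gam1 n (x : N n) (k : BGn n) : Gam n ((x, k), dconst n ord_max) = strict b n (nerve_map Sh n x).
Proof. exact: d2_extF. Qed.

(* The restriction to the horn: [Gam] is strict away from the edge 12. *)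
Lemma Gam_low n (x : N n) (k : BGn n) (t : delta n 2) : (forall i, t i < 2) ->
 Gam n ((x, k), t) = strict b n (low x k t).
Proof.
move=> h; have h' i : hi t i = false by apply/negbTE; rewrite -leqNgt -ltnS.
apply: d2_extF.
- by move=> i; rewrite /= /gA0 h'.
- move=> i j ij; rewrite /farr /= /gF0; move: (@him n t i j ij); rewrite /gA0; move: (h' i) (h' j).
by case: (hi t i) (hi t j) => [] [].
- move=> i j l ij jl il; rewrite /fcell /=; move: (@him n t i j ij) (@him n t j l jl) (@him n t i l il).
by move: (h' i) (h' j) (h' l); case: (hi t i) (hi t j) (hi t l) => [] [] [].
Qed.
End Gamma.

(** * Comparison of [Gam] with its image under [r] and [s] *)

Section DStrict.
Variable b : bool.

Lemma functor_ext_idc (A B : cob b) (F H : mpfunctor A B) (e : forall a, F a = H a) :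
 (forall a a' (f : phom a a'), pcmp (idc (e a')) (pfmor F f) = pcmp (pfmor H f) (idc (e a))) -> F = H.
Proof.
move: F H e => [[o m m1 mM mD] mm] [[o' m' m1' mM' mD'] mm'] /= e nat.
have E : o = o' by apply: fext.
subst o'; apply: mpfunctor_eq; apply: pfunctor_eq.
do 2 (apply: dfext => ?); apply: fext => f.
by have := nat _ _ f; rewrite !idc_id pcmp1m pcmpm1.
Qed.

(** Naturality of identity coherence cells upgrades equality of composites on objects to equality of
    functors. *)
Lemma dstrict_strict n (s : d2 b n) : dstrict s -> exists w, strict b n w = s.
Proof.
move=> ds; have FE (i j k : 'I_n.+1) (ij : sle i j) (jk : sle j k) (ik : sle i k) :
mpfunctor_comp (dF s jk) (dF s ij) = dF s ik.
have e a : dF s jk (dF s ij a) = dF s ik a by have [] := ds i j k ij jk ik a.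
refine (@functor_ext_idc (dA s i) (dA s k) (mpfunctor_comp (dF s jk) (dF s ij)) (dF s ik) e _) => a a' f.
have [e1 E1] := ds i j k ij jk ik a; have [e2 E2] := ds i j k ij jk ik a'.
by rewrite (pirr (e a) e1) (pirr (e a') e2) -E1 -E2; apply: dphi_nat.
unshelve eexists.
apply: (@NerveSimp (Cb b) n (dA s) (fun i j h => dF s (sle_of h))).
- by move=> i h; apply: dF1.
- by move=> i j k ij jk ik; rewrite /= (FE i j k _ _ (sle_of ik)).
apply: d2_extF => // i j k ij jk ik; congr Cell; apply: dfext => a.
have [e ->] := ds i j k ij jk ik a; exact: (f_equal (@idc _ _ _) (pirr _ _)).
Qed.
End DStrict.

Section Theta.
Variables (b : bool) (G : groupType).
Notation cob := (cob b).
Notation N := (nerve (Cb b)).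
Notation BGn := (nerve (BG G)).
Notation D := (D2 b).
Notation o1 := (@Ordinal 3 1 isT).

(** Away from the vertex 1 the source of each remaining 2-cell is the free replacement, where its
    label cancels to 1. *)
Lemma gam_dstrict n (x : N n) (k : BGn n) (t : delta n 2) : (forall i, t i <> o1) -> dstrict (gam x k t).
Proof.
move=> h; have hl i : hi t i = false -> lo t i = false.
move=> /negbT; rewrite /hi /lo -leqNgt => le; apply/negbTE; rewrite -leqNgt leqn0.
have : t i <> 1 :> nat by move=> e; apply: (h i); apply: ord_inj.
by move: le; case: (nat_of_ord (t i)) => [|[|]].
move=> i j l ij jl il; move: (hl i) (hl j).
change (hi t i = false -> lo t i = false) with (hi t i = false -> lo t i = false).
move=> li lj; rewrite /gam /glue /=.
move: (@him n t i j ij) (@him n t j l jl) (@him n t i l il).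
have key (ci cj : bool) (hc : ci -> cj) (A B C : cob) (K : mpfunctor A B) (H : mpfunctor B C) (H2 : mpfunctor A C)
(g : G) (HK : mpfunctor_comp H K = H2) (a : Pn G ci A) : ci = false -> cj = false ->
exists e : mpfunctor_comp (shm (BG G) H) (Eu G cj B) (Pm K (fun u => g * u)%g hc a) =
mpfunctor_comp (shm (BG G) H2) (Eu G ci A) a, coreE hc g HK a = idc e.
move=> e1 e2; subst ci cj; exists (f_equal (fun u => @SharpOb C (BG G) u Datatypes.tt : sharp (BG G) C) (core_eq hc g HK a)).
rewrite (sidc _ (core_eq hc g HK a)); apply: teq => /=.
by rewrite mulgA -(mulgA (_^-1)%g) mulVg mulg1 mulVg.
have st (w : N n) a : exists e : dF (strict b n w) jl (dF (strict b n w) ij a) = dF (strict b n w) il a,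
dphi (strict b n w) ij jl il a = idc e by apply: strict_dstrict.
rewrite /gA0 /gF0 /gp0; move: li lj; case: (hi t i) (hi t j) (hi t l) => [] [] [] li lj h1 h2 h3 a;
try (by exfalso; exact: (notF (h1 isT))); try (by exfalso; exact: (notF (h2 isT))).
- exact: st.
- have [e E] := st (nerve_map (sharpC b (BG G)) n x) (Eu G (lo t i) (nob x i) a); exists e; exact: E.
- exact: (key (lo t i) (lo t j) _ _ _ _ _ _ _ _ _ a (li erefl) (lj erefl)).
- exact: (st (low x k t) a).
Qed.

(** [Gam] is strict on the faces 01 and 02, that is, on the outer horn at 0. *)
Lemma gam_strict n (x : N n) (k : BGn n) (t : delta n 2) : (exists j, j <> ord0 /\ forall i, t i <> j) ->
 exists w, strict b n w = gam x k t.
Proof.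
case=> j [j0 tj]; have [j1|j1] := eqVneq j o1.
by subst j; apply: dstrict_strict; apply: gam_dstrict.
exists (low x k t); symmetry; apply: (Gam_low x k) => i.
have j2 : j = ord_max.
by move: j j0 j1 tj; apply: ord3P => // /eqP.
move: (ltn_ord (t i)); rewrite ltnS leq_eqVlt => /orP[/eqP e|//].
by case: (tj i); rewrite j2; apply: ord_inj.
Qed.

Definition Pin (A : cob) : mpfunctor A (Pn G false A).
Proof.
by unshelve refine (@Mpfunctor A (Pn G false A) (@Pfunctor A (Pn G false A)
(fun a => GPr a 1%g) (fun a a' f => f) _ _ _) _).
Defined.

(** The edge 01 is the projection from the free replacement, with inverse up to isomorphism [a] to
    [(a, 1)]; a group element only translates what the projection forgets. *)
Lemma low_weq (A : N 0) (k : BGn 1) : nerve_class (@cweq b) (low (degenerate 1 A) k (edge01 1)).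
Proof.
have F1 : nmor (degenerate 1 A : N 1) (isT : ord0 <= ord_max) = idm (nob A ord0) by apply: nmor1.
pose P := @Pm01 b G (nob A ord0) (nob A ord0) (mpfunctor_id (nob A ord0)).
apply: (eq_ind _ (fun F => @cweq b (Pn G false (nob A ord0)) (nob A ord0) F) _ _
(esym (f_equal (@Pm01 b G (nob A ord0) (nob A ord0)) F1))).
exists (Pin (nob A ord0)); split; rewrite /nat_iso /=.
exists (fun a : gpr G (nob A ord0) => pid (g1 a)); split.
by move=> a; split; [apply: (@p_iso_id (nob A ord0))|apply: (@marked_id (nob A ord0))].
by move=> a a' f; rewrite /= (@pcmp1m (nob A ord0)) (@pcmpm1 (nob A ord0)).
exists (fun a => pid a); split.
by move=> a; split; [apply: p_iso_id|apply: marked_id].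
by move=> a a' f; rewrite /= pcmp1m pcmpm1.
Qed.

Variables (L : sset) (ell : smap N L) (s : smap D L) (r : smap L D) (A : N 0).
Hypotheses (ellW : forall e, nerve_class (@cweq b) e -> is_equivalence (ell 1 e))
 (sE : forall n x, s n (strict b n x) = ell n x)
 (rE : eqve (sFun_vertex (scomp r ell) : sFun N D 0) (sFun_vertex (strict b))).

Notation gA k t := (gam (degenerate _ A) k t).

Lemma rhtpy : exists h0 : smap (sprod N (simplex 1)) D,
 [/\ forall n w, h0 n (w, dconst n ord0) = r n (ell n w), forall n w, h0 n (w, dconst n ord_max) = strict b n w &
  forall w : N 0, is_equivalence (h0 1 (degenerate 1 w, did 1))].
Proof.
have [e [eq se te]] := rE; exists e; split.
- move=> n w; have := f_equal (fun z : smap (sprod N (simplex 0)) D => z n (w, dconst n ord0)) se.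
by rewrite /= => <-; congr (e n (w, _)); apply: delta_eq.
- move=> n w; have := f_equal (fun z : smap (sprod N (simplex 0)) D => z n (w, dconst n ord0)) te.
by rewrite /= => <-; congr (e n (w, _)); apply: delta_eq.
by move=> w; apply: (smap_eqv (seval D w) eq).
Qed.

(** [rE] compares [r] and [strict] on strict simplices only. Since [Gam] is strict on the outer horn
    at 0 and its edge 01 is a weak equivalence, the comparison extends over the 2-simplex, and its
    face 12 is kept. The last clause says that the ends of that face ignore the simplex of BG. *)
Theorem Theta_ex : quasicategory D -> exists Th : smap (sprod (simplex 1) (sprod BGn (simplex 1))) D,
 [/\ forall n (k : BGn n) (t : delta n 1), Th n (dconst n ord0, (k, t)) = r n (s n (gA k (dcomp d12 t))),
   forall n (k : BGn n) (t : delta n 1), Th n (dconst n ord_max, (k, t)) = gA k (dcomp d12 t),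
   forall (k : BGn 0) (t : delta 0 1), is_equivalence (Th 1 (did 1, degenerate 1 ((k, t) : sprod BGn (simplex 1) 0))) &
   forall n u (k k' : BGn n) (t : delta n 1), (t = dconst n ord0 \/ t = dconst n ord_max) ->
     Th n (u, (k, t)) = Th n (u, (k', t))].
Proof.
move=> qD; have [h0 [h00 h01 h0e]] := rhtpy.
pose Hn n (t : delta n 2) := exists j, j <> ord0 /\ forall i, t i <> j.
pose B := sprod BGn (simplex 1); pose V := sprod (simplex 2) B.
(* Three prescriptions: the homotopy [h0] on the horn, and at the two ends of the homotopy the whole
   of [r (s Gam)] and of [Gam]. The equation [sE] makes them agree. *)
pose R n (x : V n) y := [\/ Hn n x.1 /\ exists w, strict b n w = gA x.2.1 x.1 /\ y = h0 n (w, x.2.2),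
x.2.2 = dconst n ord0 /\ y = r n (s n (gA x.2.1 x.1)) | x.2.2 = dconst n ord_max /\ y = gA x.2.1 x.1].
have gact m n (f : delta m n) (k : BGn n) (t : delta n 2) : gA (act f k : BGn m) (dcomp t f) = act f (gA k t : D n).
by rewrite -(act_deg f); exact: (smapP (Gam b G) f ((degenerate n A, k), t)).
have Ra m n (f : delta m n) (x : V n) y : R n x y -> R m (act f x) (act f y).
case: x => t [k u] [[[j [j0 hj]] [w [ww ->]]]|[/= -> ->]|[/= -> ->]].
- constructor 1; split; first by exists j; split=> // i; apply: hj.
exists (act f w); split; last by symmetry; exact: (smapP h0 f (w, u)).
by rewrite (smapP (strict b) f w) ww -gact.
- by constructor 2; rewrite /= dconst_comp gact !smapP.
- by constructor 3; rewrite /= dconst_comp gact.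
have c01 n : dconst n (ord0 : 'I_2) <> dconst n ord_max by move/(f_equal (fun g : delta n 1 => g ord0)).
have R12 n (x : V n) y y' w : strict b n w = gA x.2.1 x.1 -> y = h0 n (w, x.2.2) -> R n x y' -> y = y'.
case: x => t [k u] /= ww ->; case=> /= [[_ [w' [ww' ->]]]|[-> ->]|[-> ->]].
- by rewrite -ww' in ww; rewrite (strict_inj ww).
- by rewrite h00 -ww sE.
- by rewrite h01.
have Rf n (x : V n) y y' : R n x y -> R n x y' -> y = y'.
move=> h h'; case: (h) => [[_ [w [ww e]]]|[e ey]|[e ey]]; first exact: R12 ww e h'.
case: h' => [[_ [w [ww e']]]|[_ ->] //|[e' _]]; first by symmetry; apply: R12 ww e' h.
by case: (@c01 n); rewrite -e -e'.
case: h' => [[_ [w [ww e']]]|[e' _]|[_ ->] //]; first by symmetry; apply: R12 ww e' h.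
by case: (@c01 n); rewrite -e -e'.
pose Ac m (x : B m) := x.2 = dconst m ord0 \/ x.2 = dconst m ord_max.
have [||||h hE] := @horn_prod D B 1 ord0 Ac qD _ _ (@Partmap V D R Ra Rf).
- by move=> m l f [k u] [/= ->|/= ->]; [left|right]; rewrite /= dconst_comp.
- by [].
- move=> m [t [k u]]; split=> /=.
by case=> y [[h _]|[/= -> _]|[/= -> _]]; [left; exact: h|right; left|right; right].
case=> [h|[/= e|/= e]].
- by have [w ww] := gam_strict (degenerate m A) k h; exists (h0 m (w, u)); constructor 1; split=> //; exists w.
- by exists (r m (s m (gA k t))); constructor 2.
- by exists (gA k t); constructor 3.
- right; split=> // -[k u]; pose w := low (degenerate 1 A) (act (dconst 1 ord0) k : BGn 1) (edge01 1).
have a2 (i : 'I_2) : edge01 1 i < 2 by move: i; apply: ord2P.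
have Hw : strict b 1 w = gA (act (dconst 1 ord0) k : BGn 1) (edge01 1).
by symmetry; apply: (Gam_low (degenerate 1 A) _ a2).
have We := low_weq A (act (dconst 1 ord0) k : BGn 1).
exists (h0 1 (w, dcomp u (dconst 1 ord0))); split.
constructor 1; split; last by exists w.
by exists ord_max; split=> // i e; have := a2 i; rewrite e.
have [->|->] : dcomp u (dconst 1 ord0) = dconst 1 ord0 \/ dcomp u (dconst 1 ord0) = dconst 1 ord_max.
by rewrite dcomp_const; move: (u ord0); apply: ord2P; [left|right].
+ by rewrite h00; apply: smap_eqv; apply: ellW.
+ by rewrite h01; apply: strict_inv.
have ThP m n (f : delta m n) (p : sprod (simplex 1) (sprod BGn (simplex 1)) n) :
h m (dcomp d12 (act f p).2.2, ((act f p).2.1, (act f p).1)) = act f (h n (dcomp d12 p.2.2, (p.2.1, p.1))).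
by rewrite -smapP.
pose Th : smap (sprod (simplex 1) (sprod BGn (simplex 1))) D := Smap ThP.
have ThS n u (k : BGn n) (t : delta n 1) (v : N 0) : Hn n (dcomp d12 t) -> gA k (dcomp d12 t) = strict b n (degenerate n v) ->
Th n (u, (k, t)) = h0 n (degenerate n v, u).
by move=> Hd e; apply: hE; constructor 1; split=> //; exists (degenerate n v).
have end0 n (k : BGn n) : Hn n (dcomp d12 (dconst n ord0)) /\ gA k (dcomp d12 (dconst n ord0)) = strict b n (degenerate n A).
rewrite dcomp_const; split; first by exists ord_max; split=> // i /(f_equal (@nat_of_ord _)).
exact: (Gam0 (degenerate n A) k).
have end1 n (k : BGn n) : Hn n (dcomp d12 (dconst n ord_max)) /\
gA k (dcomp d12 (dconst n ord_max)) = strict b n (degenerate n (nerve_map (sharpC b (BG G)) 0 A : N 0)).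
rewrite dcomp_const; split; first by exists o1; split=> // i /(f_equal (@nat_of_ord _)).
rewrite -smap_deg; exact: (Gam1 (degenerate n A) k).
exists Th; split.
- by move=> n k t; apply: hE; constructor 2.
- by move=> n k t; apply: hE; constructor 3.
- move=> k t; have [tE|tE] : t = dconst 0 ord0 \/ t = dconst 0 ord_max.
have E : t = dconst 0 (t ord0) by apply: delta_eq => i; rewrite [i]ord1.
by rewrite E; move: (t ord0); apply: ord2P; [left|right].
+ have -> : degenerate 1 ((k, t) : sprod BGn (simplex 1) 0) = (degenerate 1 k, dconst 1 ord0) by rewrite tE.
by have [e1 e2] := end0 1 (degenerate 1 k); rewrite (ThS _ _ _ _ A e1 e2).
+ have -> : degenerate 1 ((k, t) : sprod BGn (simplex 1) 0) = (degenerate 1 k, dconst 1 ord_max) by rewrite tE.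
by have [e1 e2] := end1 1 (degenerate 1 k); rewrite (ThS _ _ _ _ _ e1 e2).
- move=> n u k k' t [->|->].
+ by have [e1 e2] := end0 n k; have [e1' e2'] := end0 n k'; rewrite (ThS _ _ _ _ A e1 e2) (ThS _ _ _ _ A e1' e2').
+ by have [e1 e2] := end1 n k; have [e1' e2'] := end1 n k'; rewrite (ThS _ _ _ _ _ e1 e2) (ThS _ _ _ _ _ e1' e2').
Qed.
End Theta.

(** * A simplicial set representing simplices of cocones *)

Section SNorm.
Variables (B : sset) (nf : forall n, B n -> B n).
Hypothesis nfI : forall m n (f : delta m n) (x : B n), nf (act f (nf x)) = nf (act f x).

Lemma nf_idem n (x : B n) : nf (nf x) = nf x.
Proof. by have := nfI (did n) x; rewrite !act1. Qed.

(** A quotient of [B] presented by its normal forms, with renormalization after each action, instead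
    of by equivalence classes. *)
Definition snorm : sset.
Proof.
refine (@SSet (fun n => {x : B n | nf x = x})
(fun m n f x => exist _ (nf (act f (sval x))) (nf_idem _)) _ _).
- by move=> n [x nx]; apply: sigE; rewrite /= act1.
- by move=> k m n f g [x nx]; apply: sigE; rewrite /= nfI actM.
Defined.

Definition squot : smap B snorm.
Proof.
refine (@Smap B snorm (fun n x => exist _ (nf x) (nf_idem x)) _).
by move=> m n f x; apply: sigE; rewrite /= nfI.
Defined.
Lemma squotK n (x : snorm n) : squot n (sval x) = x.
Proof. by apply: sigE => /=; apply: (svalP x). Qed.
End SNorm.

Section ZCone.
Variables (G : groupType) (M : nat).
Notation BGn := (nerve (BG G)).

(** Drops the order proof from the arguments; out of order the junk value is 1. *)
Definition kv n (k : BGn n) (i j : 'I_n.+1) : G :=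
 if pselect (i <= j) is left h then nmor k h else 1%g.

Lemma kvE n (k : BGn n) (i j : 'I_n.+1) (h : i <= j) : kv k i j = nmor k h.
Proof. by rewrite /kv; case: pselect => [h'|[]//]; congr (nmor k _); apply: pirr. Qed.
Lemma kvM n (k : BGn n) (i j l : 'I_n.+1) : i <= j -> j <= l -> kv k i l = (kv k j l * kv k i j)%g.
Proof. by move=> h1 h2; rewrite (kvE k h1) (kvE k h2) (kvE k (leq_trans h1 h2)); exact: (nmorM k h1 h2). Qed.
Lemma kv1 n (k : BGn n) (i : 'I_n.+1) : kv k i i = 1%g.
Proof. by rewrite (kvE k (leqnn i)); apply: (nmor1 k (leqnn i)). Qed.
Lemma kv_act m n (f : delta m n) (k : BGn n) (i j : 'I_m.+1) : i <= j ->
 kv (act f k : BGn m) i j = kv k (f i) (f j).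
Proof. by move=> h; rewrite (kvE _ h) (kvE k (dmono f h)). Qed.

Lemma BG_ext n (k k' : BGn n) : (forall i j : 'I_n.+1, i <= j -> kv k i j = kv k' i j) -> k = k'.
Proof.
case: k => o m h1 h2; case: k' => o' m' h1' h2' e.
have E : o = o' by apply: fext => i; case: (o i); case: (o' i).
subst o'; apply: (@nerve_eq (BG G)).
do 2 (apply: dfext => ?); apply: fext => h.
by have := e _ _ h; rewrite !(kvE _ h).
Qed.
Definition BG1 n : BGn n.
Proof. by refine (@NerveSimp (BG G) n (fun _ => Datatypes.tt) (fun _ _ _ => 1%g) _ _) => //= *; rewrite mulg1. Defined.
Lemma kvBG1 n (i j : 'I_n.+1) : kv (BG1 n) i j = 1%g.
Proof. by rewrite /kv; case: pselect. Qed.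
Lemma BG1_act m n (f : delta m n) : act f (BG1 n) = BG1 m.
Proof. by apply: BG_ext => i j h; rewrite kv_act // !kvBG1. Qed.

Notation B := (sprod (simplex 1) (sprod (simplex M) BGn)).
(** Over the end 0 of the interval both the M-simplex and BG are collapsed, over the end 1 only BG.
    A map out of the quotient is an M-simplex of cocones under the constant diagram on a fixed
    object. *)
Definition znf n (x : B n) : B n :=
 if x.1 ord_max == ord0 then (x.1, (dconst n ord0, BG1 n))
 else if x.1 ord0 == ord_max then (x.1, (x.2.1, BG1 n)) else x.

Lemma I2 (i : 'I_2) : i = ord0 \/ i = ord_max.
Proof. by move: i; apply: ord2P; [left|right]. Qed.
Lemma d1_0 n (e : delta n 1) i : e ord_max = ord0 -> e i = ord0.
Proof.
by move=> E; case: (I2 (e i)) => // h; have := dmono e (leq_ord i : i <= ord_max); rewrite h E.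
Qed.
Lemma d1_1 n (e : delta n 1) i : e ord0 = ord_max -> e i = ord_max.
Proof. by move=> E; case: (I2 (e i)) => // h; have := dmono e (leq0n i : ord0 <= i); rewrite h E. Qed.

Lemma znfI m n (f : delta m n) (x : B n) : znf (act f (znf x)) = znf (act f x).
Proof.
case: x => e [f0 k]; rewrite /znf /=; case: (e ord_max =P ord0) => [e0|_] /=.
by rewrite (d1_0 _ e0) eqxx.
case: (e ord0 =P ord_max) => [e1|//] /=; case: eqP => // _.
by rewrite (d1_1 _ e1) eqxx.
Qed.
Definition Z : sset := snorm znfI.
Definition zq : smap B Z := squot znfI.

Definition ze n (x : Z n) : delta n 1 := (sval x).1.
Definition zf n (x : Z n) : delta n M := (sval x).2.1.
Definition zk n (x : Z n) : BGn n := (sval x).2.2.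

Lemma ze_act m n (f : delta m n) (x : Z n) : ze (act f x) = dcomp (ze x) f.
Proof. by rewrite /ze /= /znf /=; case: eqP => // _; case: eqP. Qed.
Lemma ze_q n e f k : ze (zq n (e, (f, k))) = e.
Proof. by rewrite /ze /= /znf /=; case: eqP => // _; case: eqP. Qed.
Lemma zf_act m n (f : delta m n) (x : Z n) : ze x (f ord_max) <> ord0 -> zf (act f x) = dcomp (zf x) f.
Proof. by rewrite /ze /zf /= /znf /=; case: eqP => // _ _; case: eqP. Qed.
Lemma zf_act0 m n (f : delta m n) (x : Z n) : ze x (f ord_max) = ord0 -> zf (act f x) = dconst m ord0.
Proof. by rewrite /ze /zf /= /znf /=; case: eqP. Qed.

Lemma z_ext n (x y : Z n) : ze x = ze y -> zf x = zf y -> zk x = zk y -> x = y.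
Proof.
case: x => [[e [f k]] h]; case: y => [[e' [f' k']] h']; rewrite /ze /zf /zk /= => e1 e2 e3.
by apply: sigE => /=; rewrite e1 e2 e3.
Qed.
Definition zmixed n (x : Z n) := ze x ord0 = ord0 /\ ze x ord_max = ord_max.

Lemma zq_mixed n (e : delta n 1) f k : e ord0 = ord0 -> e ord_max = ord_max -> sval (zq n (e, (f, k))) = (e, (f, k)).
Proof. by move=> h0 h1; rewrite /= /znf /= h0 h1. Qed.
Lemma zk_mixed m n (f : delta m n) (x : Z n) : zmixed (act f x) -> zk (act f x) = act f (zk x).
Proof. by rewrite /zmixed ze_act /= /zk /= /znf /= => -[h0 h1]; rewrite h1 /= h0. Qed.

Lemma zone n (x : Z n) : ze x ord0 = ord_max -> zk x = BG1 n.
Proof.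
case: x => [[e [f k]] h] /=; rewrite /ze /zk /= => e1.
have e2 : e ord_max = ord_max by apply: d1_1.
by move: h; rewrite /znf /= e1 e2 /= => /(f_equal (fun z => z.2.2)).
Qed.

Lemma zzero n (x : Z n) : ze x ord_max = ord0 -> zf x = dconst n ord0 /\ zk x = BG1 n.
Proof.
case: x => [[e [f k]] h] /=; rewrite /ze /zk /zf /= => e1.
by move: h; rewrite /znf /= e1 /= => h; split; [have := f_equal (fun z => z.2.1) h|have := f_equal (fun z => z.2.2) h].
Qed.
End ZCone.

(** * First stage: extension over the cone by inner horns *)

Section Stage1.
Variables (G : groupType) (M : nat) (X : sset).
Hypotheses (M0 : 0 < M)
 (qX : quasicategory X).
Notation BGn := (nerve (BG G)).
Notation Z := (Z G M).

Definition Zb n (x : Z n) := exists j, forall i, zf x i <> j.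
(** The boundary together with the simplices that do not meet the vertex 0 of the M-simplex over the
    end 1. Only beyond this part is the universal property of [A # BG] called for. *)
Definition S1p n (x : Z n) := (forall i, ze x i = ord_max -> zf x i <> ord0) \/ Zb x.

Lemma M1 : (ord_max : 'I_M.+1) <> ord0.
Proof. by move/(f_equal (@nat_of_ord _)) => /= E; move: M0; rewrite E. Qed.
Lemma Zb_0 n (x : Z n) : ze x ord_max = ord0 -> Zb x.
Proof. by move=> /zzero[e _]; exists ord_max => i; rewrite e => /esym/M1. Qed.

Lemma Zb_act m n (f : delta m n) (x : Z n) : Zb x -> Zb (act f x).
Proof.
case=> j hj; have [h|h] := I2 (ze x (f ord_max)); first by apply: Zb_0; rewrite ze_act.
by exists j => i; rewrite zf_act ?h // dcE; apply: hj.
Qed.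

Lemma S1_act m n (f : delta m n) (x : Z n) : S1p x -> S1p (act f x).
Proof.
case=> [h|/(Zb_act f)]; last by right.
have [h0|h1] := I2 (ze x (f ord_max)); first by right; apply: Zb_0; rewrite ze_act.
by left=> i; rewrite ze_act zf_act ?h1 // !dcE; apply: h.
Qed.
Definition ZB : sset := @ssub Z Zb Zb_act.
Definition ZS : sset := @ssub Z S1p S1_act.
Variable kap : smap ZB X.

Definition zc n (x : Z n) (c : nat) := c <= n /\ forall i, (ze x i == ord_max) = (c <= i).
Definition adj n (x : Z n) (p : nat) := zf x (inord p) = zf x (inord p.+1) /\
 kv (zk x) (inord p) (inord p.+1) = 1%g.
Definition ztypeI n (x : ZS n) := exists c, zc (sval x) c.+1 /\ adj (sval x) c.

Lemma zc_uniq n (x : Z n) c c' : zc x c -> zc x c' -> c = c'.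
Proof.
move=> [h1 h2] [h1' h2']; apply/eqP; rewrite eqn_leq.
have := h2 (inord c'); rewrite h2' inordK // leqnn => <-.
by have := h2' (inord c); rewrite h2 inordK // leqnn => <-.
Qed.

Lemma zc_ext n (x y : Z n) c : zc x c -> zc y c -> ze x = ze y.
Proof.
move=> [_ h] [_ h']; apply: delta_eq => i; have := h i; rewrite -h'.
by case: (I2 (ze x i)) (I2 (ze y i)) => -> [] ->.
Qed.

Lemma zc_ex n (x : Z n) : ze x ord_max = ord_max -> exists c, zc x c.
Proof.
move=> h; have [c [[cn hc] cmin]] := nat_min (ex_intro (fun p => p <= n /\ ze x (inord p) = ord_max) n
(conj (leqnn n) (etrans (f_equal (ze x) (ord_inj (inordK (ltnSn n) : _ = ord_max :> nat))) h))).
exists c; split=> // i; have [ci|ic] := leqP c i.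
have := dmono (ze x) (_ : (inord c : 'I_n.+1) <= i); rewrite inordK // => /(_ ci).
by rewrite hc; case: (I2 (ze x i)) => ->.
apply/negP => /eqP e; apply: (cmin _ ic); split; last by rewrite inord_val.
by rewrite -ltnS.
Qed.

Lemma S1_mixed n (x : ZS n) : ~ Zb (sval x) -> [/\ zmixed (sval x), zf (sval x) ord0 = ord0 &
 forall i, ze (sval x) i = ord_max -> zf (sval x) i <> ord0].
Proof.
case: x => x hx /= nb; case: (hx) => // h; split=> //.
split; first by case: (I2 (ze x ord0)) => // e; case: nb; exists ord0 => i; apply: h; apply: d1_1.
by case: (I2 (ze x ord_max)) => // /Zb_0.
apply: contrapT => ne; apply: nb; exists ord0 => i e; apply: ne; apply: ord_inj.
by apply/eqP; rewrite -leqn0 -[X in _ <= X]/(nat_of_ord (ord0 : 'I_M.+1)) -e; apply: (dmono (zf x)).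
Qed.

Lemma nondeg_adj n (x : ZS n.+1) p : nondeg x -> zmixed (sval x) -> p < n.+1 -> adj (sval x) p ->
 ze (sval x) (inord p) = ze (sval x) (inord p.+1) -> False.
Proof.
move=> ndx mx pn [a1 a2] a3; pose i : 'I_n.+1 := Ordinal pn; pose i1 : 'I_n.+2 := Ordinal (pn : p.+1 < n.+2).
have i1E : inord p.+1 = i1 by apply: ord_inj; rewrite inordK.
have i0E : inord p = wd i :> 'I_n.+2 by apply: ord_inj; rewrite inordK //= ltnW.
rewrite i1E i0E in a1 a2 a3.
suff E : x = act (ddeg i) (act (dfc i1) x) by move: ndx; rewrite E; apply: dg_lt.
rewrite -actM; set r := dcomp _ _.
have rE q : q <> i1 -> r q = q.
move=> qi; apply: ord_inj; rewrite /r dcE dfE dgE /=.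
have {}qi : q <> p.+1 :> nat by move=> e; apply: qi; apply: ord_inj.
by case: (leqP q p) => ?; case: ifP; lia.
have rI : r i1 = wd i by apply: ord_inj; rewrite /r dcE dfE dgE /= ltnn /= ltnS leqnn.
have er q : ze (sval x) (r q) = ze (sval x) q.
by have [->|/eqP ne] := eqVneq q i1; [rewrite rI|rewrite rE].
have eE : ze (act r (sval x)) = ze (sval x) by rewrite ze_act; apply: delta_eq => q; exact: er.
have wi : wd i <= i1 by rewrite /= leqnSn.
apply: sigE; change (sval x = act r (sval x)); apply: z_ext => //.
rewrite zf_act; last by rewrite er; case: mx => _ ->.
apply: delta_eq => q; rewrite dcE.
by have [->|/eqP ne] := eqVneq q i1; [rewrite rI|rewrite rE].
rewrite zk_mixed /zmixed ?eE //; apply: BG_ext => q q' qq; rewrite kv_act //.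
have [e|/eqP ne] := eqVneq q i1; have [e'|/eqP ne'] := eqVneq q' i1.
- by subst q q'; rewrite rI !kv1.
- subst q; rewrite rI rE //; rewrite (kvM (zk (sval x)) wi qq) a2.
by rewrite mulg1.
- subst q'; rewrite rI (rE _ ne).
have qw : q <= wd i.
have : q <> p.+1 :> nat by move=> e; apply: ne; apply: ord_inj.
by move: qq => /=; lia.
by rewrite (kvM (zk (sval x)) qw wi) a2 mul1g.
- by rewrite !rE.
Qed.

Lemma adj_nondeg n (x : ZS n) : zmixed (sval x) ->
 (forall p, p < n -> adj (sval x) p -> ze (sval x) (inord p) = ze (sval x) (inord p.+1) -> False) -> nondeg x.
Proof.
case: n x => [|n] x mx h; first by move=> l f y _.
apply: contrapT => /not_nondeg[i [y E]].
have d1 : ddeg i (inord i) = i by apply: ord_inj; rewrite dgE inordK ?leqnn //; apply: ltnW (ltn_ord i).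
have d2 : ddeg i (inord i.+1) = i by apply: ord_inj; rewrite dgE inordK ?ltnn // ltnS ltn_ord.
have E' : sval x = act (ddeg i) (sval y) by rewrite E.
have ne : ze (sval y) (ddeg i ord_max) <> ord0 by case: mx => _; rewrite E' ze_act dcE => ->.
have le : (inord i : 'I_n.+2) <= (inord i.+1 : 'I_n.+2).
by rewrite (inordK (ltnW (ltn_ord i) : i < n.+2)) (inordK (ltn_ord i : i.+1 < n.+2)) leqnSn.
apply: (h i (ltn_ord i)).
rewrite /adj E' zf_act // !dcE d1 d2; split=> //.
by rewrite zk_mixed -?E' // kv_act // d1 d2 kv1.
by rewrite E' ze_act !dcE d1 d2.
Qed.

Let G0 : partmap ZS X.
Proof.
refine (@Partmap ZS X (fun n x y => exists h : Zb (sval x), kap n (exist _ (sval x) h) = y) _ _).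
- move=> m n f x _ [h <-]; exists (Zb_act f h); rewrite -smapP; congr (kap m _); exact: sigE.
- by move=> n x y y' [h <-] [h' <-]; rewrite (pirr h h').
Defined.
Let dG0 n (x : ZS n) : pdom G0 x <-> Zb (sval x).
Proof. by split=> [[y [h _]] //|h]; exists (kap n (exist _ (sval x) h)), h. Qed.
(** The first position over the end 1 is doubled, the new copy lying over the end 0 with the same
    vertex and trivial group element. The horn is inner because a simplex off the boundary starts
    over the end 0. *)
Definition zins n (x : ZS n) (z : ZS n.+1) (c : 'I_n.+1) := [/\ zc (sval x) c, zc (sval z) c.+1,
 zf (sval z) = dcomp (zf (sval x)) (ddeg c) & zk (sval z) = act (ddeg c) (zk (sval x))].

Definition ZPair n (x : ZS n) (z : ZS n.+1) (k : 'I_n.+2) := [/\ nondeg x, ~ pdom G0 x, ~ ztypeI x &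
 exists c, k = wd c /\ zins x z c].

Lemma dfd n (c : 'I_n.+1) : dcomp (ddeg c) (dfc (wd c)) = did n.
Proof. by apply: deltaP => i; rewrite dcE dgE dfE /=; case: (ltnP i c) => h; case: leqP; lia. Qed.

Lemma zins_face n (x : ZS n) z c : ~ Zb (sval x) -> zins x z c -> act (dfc (wd c)) z = x.
Proof.
move=> nb [[cn h1] [_ h2] h3 h4]; have [[m0 m1] _ _] := S1_mixed nb; apply: sigE.
change (act (dfc (wd c)) (sval z) = sval x).
have E : ze (act (dfc (wd c)) (sval z)) = ze (sval x).
rewrite ze_act; apply: delta_eq => i; have := h2 (dfc (wd c) i).
have -> : (c < dfc (wd c) i) = (c <= i) by rewrite dfE /=; generalize (nat_of_ord i) (nat_of_ord c) => a b0; case: (ltnP a b0) => h; apply/idP/idP; lia.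
by rewrite -h1 dcE; case: (I2 (ze (sval x) i)) (I2 (ze (sval z) (dfc (wd c) i))) => -> [] ->.
apply: z_ext => //.
rewrite zf_act; last first.
by have := f_equal (fun e : delta n 1 => e ord_max) E; rewrite ze_act dcE => ->; rewrite m1.
by rewrite h3 -[RHS]/(dcomp (zf (sval x)) (did n)) -(dfd c).
by rewrite zk_mixed /zmixed ?E // h4 -actM dfd act1.
Qed.

Lemma zins_uniq n (x : ZS n) z z' c c' : zins x z c -> zins x z' c' -> z = z'.
Proof.
move=> [h1 h2 h3 h4] [h1' h2' h3' h4']; have e : c = c' by apply: ord_inj; apply: zc_uniq h1 h1'.
subst c'; apply: sigE; apply: z_ext; [exact: zc_ext h2 h2'|by rewrite h3|by rewrite h4].
Qed.

Definition dthr n (c : nat) : delta n 1.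
Proof.
refine (@Delta n 1 (fun i => if c <= i then ord_max else ord0) _).
by move=> i j ij; case: ifP => // h; rewrite (leq_trans h ij).
Defined.

Lemma zins_ex n (x : ZS n) : ~ Zb (sval x) -> exists c z, zins x z c.
Proof.
move=> nb; have [[m0 m1] f0 nz] := S1_mixed nb; have [c hc] := zc_ex m1.
have [cn h] := hc; pose c' : 'I_n.+1 := Ordinal (cn : c < n.+1).
pose b := (dthr n.+1 c.+1, (dcomp (zf (sval x)) (ddeg c'), act (ddeg c') (zk (sval x)))).
have bE : sval (zq G M n.+1 b) = b by apply: zq_mixed => //=; rewrite ltnS cn.
have hz : S1p (zq G M n.+1 b).
left=> i; rewrite /ze /zf bE /=; case: ifP => // ci _; rewrite -!/(ddeg c' i); apply: nz.
by apply/eqP; rewrite h dgE /=; move: ci; case: leqP; lia.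
exists c', (exist _ (zq G M n.+1 b) hz); split=> //; rewrite /zc /ze /zf /zk ?bE //=.
by split=> // i; case: ifP.
Qed.

Lemma ztypeI_paired n (z : ZS n) : nondeg z -> ~ Zb (sval z) -> ztypeI z -> paired ZPair z.
Proof.
move=> ndz nb [c [[cn hz] [a1 a2]]]; case: n z ndz nb cn hz a1 a2 => // n z ndz nb cn hz a1 a2.
have [mz f0 nz] := S1_mixed nb; rewrite ltnS in cn.
pose c' : 'I_n.+1 := Ordinal (cn : c < n.+1).
have iE (q : nat) (h : q < n.+2) : inord q = Ordinal h :> 'I_n.+2 by apply: ord_inj; rewrite inordK.
pose c0 := wd c'; have l1 : c.+1 < n.+2 by [].
pose c1 : 'I_n.+2 := Ordinal l1; rewrite (iE c (ltnW l1)) (iE c.+1 l1) in a1 a2.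
have w0 : Ordinal (ltnW l1) = c0 by apply: ord_inj.
rewrite w0 -/c1 in a1 a2.
have fc : zf (sval z) c0 <> ord0 by rewrite a1; apply: nz; apply/eqP; rewrite hz.
have cpos : 0 < c.
by rewrite lt0n; apply/negP => /eqP e; apply: fc; rewrite -f0; congr (zf (sval z) _); apply: ord_inj.
pose y := act (dfc c0) z.
have ne : ze (sval z) (dfc c0 ord_max) <> ord0.
have : ze (sval z) (dfc c0 ord_max) == ord_max.
by rewrite hz dfE /=; have := cn; case: (ltnP n c) => h //; rewrite leqNgt h.
by move=> /eqP ->.
have ey i : (ze (sval y) i == ord_max) = (c <= i).
have -> : ze (sval y) = dcomp (ze (sval z)) (dfc c0) by rewrite -ze_act.
by rewrite dcE hz dfE /=; case: (ltnP i c) => h; [rewrite ltnNge (ltnW h)|rewrite ltnS].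
have zcy : zc (sval y) c by split; [rewrite -ltnS|].
have my : zmixed (sval y).
split; last by apply/eqP; rewrite ey.
by case: (I2 (ze (sval y) ord0)) => // /eqP; rewrite ey leqNgt cpos.
have fy : zf (sval y) = dcomp (zf (sval z)) (dfc c0) by rewrite -zf_act.
have ky : zk (sval y) = act (dfc c0) (zk (sval z)) by rewrite -zk_mixed.
pose r := dcomp (dfc c0) (ddeg c').
have rE (q : 'I_n.+2) : q <> c0 -> r q = q.
move=> ne'; have {}ne' : q <> c :> nat by move=> e; apply: ne'; apply: ord_inj.
by apply: ord_inj; rewrite /r dcE dfE dgE /=; case: (leqP q c) => h; case: ifP; lia.
have rI : r c0 = c1 by apply: ord_inj; rewrite /r dcE dfE dgE /= leqnn ltnn.
have ff : zf (sval z) = dcomp (zf (sval y)) (ddeg c').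
rewrite fy; apply: delta_eq => q; change (zf (sval z) q = zf (sval z) (r q)).
by have [->|/eqP h] := eqVneq q c0; [rewrite rI|rewrite rE].
have c01 : c0 <= c1 by rewrite /= leqnSn.
have kk : zk (sval z) = act (ddeg c') (zk (sval y)).
rewrite ky -actM -/r; apply: BG_ext => q q' qq; rewrite kv_act //.
have [e|/eqP h] := eqVneq q c0; have [e'|/eqP h'] := eqVneq q' c0.
- by subst q q'; rewrite !kv1.
- subst q; rewrite rI rE //; have c1q : c1 <= q'.
have : q' <> c :> nat by move=> e; apply: h'; apply: ord_inj.
by move: qq => /=; lia.
by rewrite (kvM _ c01 c1q) a2 mulg1.
- by subst q'; rewrite rI rE // (kvM _ qq c01) a2 mul1g.
- by rewrite !rE.
have dfp p : p <= n -> dfc c0 (inord p) = inord (if p < c then p else p.+1) :> 'I_n.+2.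
move=> pn; apply: ord_inj; rewrite dfE inordK ?ltnS // inordK //=.
by case: ifP => // _; rewrite ltnS // ltnW.
apply: (@Paired _ _ _ y z c0); split.
- apply: adj_nondeg => // p pn [b1 b2] b3; have pn' := ltnW pn.
have le : (inord p : 'I_n.+1) <= (inord p.+1 : 'I_n.+1) by rewrite !inordK ?ltnS.
rewrite fy !dcE !dfp // in b1; rewrite ky kv_act // !dfp // in b2.
have e3 q : q <= n -> (ze (sval y) (inord q) == ord_max) = (c <= q) by move=> qn; rewrite ey inordK ?ltnS.
have E3 : (c <= p) = (c <= p.+1) by rewrite -!e3 // b3.
case: (ltnP p c) b1 b2 => pc b1 b2.
have pc' : p.+1 < c by rewrite ltnNge -E3 -ltnNge.
rewrite pc' in b1 b2; apply: (nondeg_adj ndz mz (leqW pn)); first by split.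
have hz' q : q <= n.+1 -> (ze (sval z) (inord q) == ord_max) = (c < q) by move=> qn; rewrite hz inordK ?ltnS.
have f1 : (c < p) = false by apply/negbTE; rewrite -leqNgt; exact: ltnW pc.
have f2 : (c < p.+1) = false by apply/negbTE; rewrite -leqNgt; exact: ltnW pc'.
have := hz' p (leqW pn'); have := hz' p.+1 pn'; rewrite f1 f2.
by case: (I2 (ze (sval z) (inord p))) (I2 (ze (sval z) (inord p.+1))) => -> [] ->.
rewrite ltnNge (leqW pc) /= in b1 b2; apply: (@nondeg_adj n z p.+1) => //.
have hz' q : q <= n.+1 -> (ze (sval z) (inord q) == ord_max) = (c < q) by move=> qn; rewrite hz inordK ?ltnS.
have := hz' p.+1 pn'; have := hz' p.+2 pn; rewrite !ltnS pc (leqW pc).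
by move=> /eqP -> /eqP ->.
- move=> /dG0[j hj]; apply: nb; exists j => i; rewrite ff dcE; exact: hj.
- move=> [d [zd [b1 b2]]]; have dc : c = d.+1 by apply: zc_uniq zcy zd.
have dn : d <= n by rewrite -ltnS -dc leqW.
have le : (inord d : 'I_n.+1) <= (inord d.+1 : 'I_n.+1) by rewrite !inordK ?ltnS // -dc.
rewrite fy !dcE !dfp // -?dc // in b1; rewrite ky kv_act // !dfp // -?dc // in b2.
rewrite ltnn dc ltnSn -dc in b1 b2.
have o1 : inord c.+1 = c1 :> 'I_n.+2 by apply: ord_inj; rewrite inordK.
have o0 : inord c = c0 :> 'I_n.+2 by apply: ord_inj; rewrite inordK // ltnW.
have dlt : d < n.+1 by rewrite ltnS.
have dl : (inord d : 'I_n.+2) <= c0 by rewrite inordK /= ?dc ?leqnSn // ltnS ltnW.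
rewrite o1 in b1 b2; rewrite (kvM _ dl c01) a2 mul1g in b2.
apply: (nondeg_adj ndz mz dlt); rewrite -?dc ?o0; first by rewrite /adj -dc o0; split=> //; rewrite b1.
have := hz c0; have := hz (inord d); rewrite ltnn (_ : c < _ = false); last first.
by rewrite inordK ?dc ?ltnS; [apply/negbTE; rewrite -leqNgt; apply: ltnW|apply: ltnW].
by case: (I2 (ze (sval z) (inord d))) (I2 (ze (sval z) c0)) => -> [] ->.
- by exists c'.
Qed.
Definition zmu n (x : ZS n) : nat :=
 if pselect (exists v c, zc (sval x) c /\ v = n.+1 - c) is left h then sval (cid h) else 0.

Lemma zmuE n (x : ZS n) c : zc (sval x) c -> zmu x = n.+1 - c.
Proof.
move=> h; rewrite /zmu; case: pselect => [h'|[]]; last by exists (n.+1 - c), c.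
by case: cid => v /= [c' [zc' ->]]; rewrite (zc_uniq h zc').
Qed.

(** Deleting a position other than the inserted one keeps the doubled pair, unless it removes the
    original copy; then one more position lies over the end 0 and [zmu] drops. *)
Lemma zface_cases n (x : ZS n) z (c : 'I_n.+1) (i : 'I_n.+2) : ~ Zb (sval x) -> zins x z c -> i <> wd c ->
 let y := act (dfc i) z in ~ Zb (sval y) -> ztypeI y \/ zmu y < zmu x.
Proof.
move=> nbx [zx [_ hz] fz kz] ic y nby; have [my _ _] := S1_mixed nby.
have [cy zy] := zc_ex (proj2 my); have [cyn hy] := zy.
have ey p : (ze (sval y) p == ord_max) = (c < dfc i p).
by rewrite -hz (_ : ze (sval y) = dcomp (ze (sval z)) (dfc i)) // -ze_act.
have {}ic : i <> c :> nat by move=> e; apply: ic; apply: ord_inj.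
have ne : ze (sval z) (dfc i ord_max) <> ord0.
have eyF : ze (sval y) = dcomp (ze (sval z)) (dfc i) by rewrite -ze_act.
by case: my => _; rewrite eyF dcE => ->.
have fy : zf (sval y) = dcomp (zf (sval z)) (dfc i) by rewrite -zf_act.
have ky : zk (sval y) = act (dfc i) (zk (sval z)) by rewrite -zk_mixed.
have adjY d : d < n -> dfc i (inord d) = wd c -> dfc i (inord d.+1) = c.+1 :> nat -> adj (sval y) d.
move=> dn e1 e2; have le : (inord d : 'I_n.+1) <= (inord d.+1 : 'I_n.+1) by rewrite !inordK ?ltnS // ltnW.
have g1 : ddeg c (dfc i (inord d)) = c by apply: ord_inj; rewrite e1 dgE /= leqnn.
have g2 : ddeg c (dfc i (inord d.+1)) = c by apply: ord_inj; rewrite dgE e2 ltnn.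
split; first by rewrite fy !dcE fz !dcE g1 g2.
by rewrite ky kv_act // kz kv_act ?(dmono (dfc i)) // g1 g2 kv1.
have tI d : d < n -> cy = d.+1 -> dfc i (inord d) = wd c -> dfc i (inord d.+1) = c.+1 :> nat -> ztypeI y.
by move=> dn e h1 h2; exists d; rewrite -e; split=> //; apply: adjY.
have dI (p : nat) : p <= n -> dfc i (inord p) = (if p < i then p else p.+1) :> nat.
by move=> pn; rewrite dfE inordK ?ltnS.
have cyE (d : nat) : d <= n -> (forall p, p <= n -> (c < (if p < i then p else p.+1)) = (d <= p)) -> cy = d.
move=> dn h; apply: (@zc_uniq _ (sval y)) => //; split=> // p.
have pn : p <= n by rewrite -ltnS ltn_ord.
by rewrite ey -(h p pn) dfE.
have cn : c <= n by rewrite -ltnS ltn_ord.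
have lasty : c < dfc i ord_max by rewrite -ey; apply/eqP; case: my.
have [ic'|ci] := ltnP i c.
left; have c0 : 0 < c by apply: leq_ltn_trans ic'.
apply: (tI c.-1); rewrite ?prednK //.
- apply: cyE => // p pn; move: ic'; generalize (nat_of_ord i) (nat_of_ord c) => a b ab.
by case: (ltnP p a) => h; apply/idP/idP; lia.
- apply: ord_inj; rewrite dI /=; last by rewrite (leq_trans (leq_pred _)).
have hh : (c.-1 < i) = false by apply/negbTE; rewrite -leqNgt -ltnS prednK.
by rewrite hh prednK.
- by rewrite dI // ltnNge (ltnW ic').
have {}ci : c < i by move: ci ic; generalize (nat_of_ord i) (nat_of_ord c); lia.
have cn' : c < n.
move: lasty ci; rewrite dfE /= ; have := ltn_ord i.
by generalize (nat_of_ord i) (nat_of_ord c) => a b; case: ifP; lia.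
have cyc : cy = c.+1.
apply: cyE => // p pn; move: ci; generalize (nat_of_ord i) (nat_of_ord c) => a b ab.
by case: (ltnP p a) => h; apply/idP/idP; lia.
have [iE|iE] := eqVneq (i : nat) c.+1.
by right; rewrite (zmuE zy) (zmuE zx) cyc ltn_sub2l // leqW.
left; have ci2 : c.+1 < i by rewrite ltn_neqAle eq_sym iE.
apply: (tI c) => //; first by apply: ord_inj; rewrite dI // (ltn_trans _ ci2).
by rewrite dI // ci2.
Qed.

Theorem stage1 : exists h : smap ZS X, forall n (x : Z n) hs hb,
 h n (exist _ x hs) = kap n (exist _ x hb).
Proof.
have [||||||h hE] := @pair_ext ZS X G0 ZPair zmu qX.
- by move=> n x z k [_ /dG0 nb _ [c [-> zi]]]; apply: zins_face.
- by move=> n x z z' k k' [_ _ _ [c [_ h]]] [_ _ _ [c' [_ h']]]; apply: zins_uniq h h'.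
- by move=> n x z k [].
- by move=> n x z k [].
- move=> n x z k z' k' [_ /dG0 nb _ [c [_ [zx zz fz kz]]]] [_ _ []]; exists c; split=> //.
have l2 : c.+1 < n.+2 by rewrite ltnS ltn_ord.
have g1 : ddeg c (inord c) = c by apply: ord_inj; rewrite dgE inordK ?leqnn // ltnW.
have g2 : ddeg c (inord c.+1) = c by apply: ord_inj; rewrite dgE inordK // ltnn.
have le : (inord c : 'I_n.+2) <= (inord c.+1 : 'I_n.+2) by rewrite (inordK (ltnW l2)) (inordK l2).
by split; [rewrite fz !dcE g1 g2|rewrite kz kv_act // g1 g2 kv1].
- move=> n x ndx /dG0 nb; have [tI|ntI] := pselect (ztypeI x).
by left; apply: ztypeI_paired.
right; have [c [z zi]] := zins_ex nb; exists z, (wd c); split.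
+ by split=> //; [apply/dG0|exists c].
+ left; rewrite /= ltn_ord andbT lt0n; apply/negP => /eqP c0.
have [[m0 _] _ _] := S1_mixed nb; have [[_ hc] _ _ _] := zi.
by have := hc ord0; rewrite m0 c0.
+ move=> i ic; have [pd|npd] := pselect (pdom G0 (act (dfc i) z)); first by constructor 1.
have [ndy|nndy] := pselect (nondeg (act (dfc i) z)); last by constructor 2.
have nby : ~ Zb (sval (act (dfc i) z)) by move/dG0.
have [tI|lt] := zface_cases nb zi ic nby; last by constructor 4.
by constructor 3; apply: ztypeI_paired.
exists h => n x hs hb; apply: hE; exists hb; congr (kap n _); exact: sigE.
Qed.
End Stage1.

(** * Functors and transformations out of [A # BG] *)

Section IndAlg.
Variables (b : bool) (G : groupType).
Notation cob := (cob b).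
Notation So := (sho (BG G)).
Notation sob a := (@SharpOb _ (BG G) a Datatypes.tt).

Definition iA (A : cob) : mpfunctor A (So A) := @Eu b G true A.
Definition tw (A : cob) (a : A) (g : G) : phom (sob a : So A) (sob a) := @tens (phom a a) G (pid a) g.

Lemma iA_mor (A : cob) (a a' : A) (f : phom a a') : pfmor (iA A) f = @tens (phom a a') G f 1%g.
Proof. by rewrite /= mulVg. Qed.
Lemma tens_split (A : cob) (a a' : A) (f : phom a a') (g : G) :
 @tens (phom a a') G f g = pcmp (pfmor (iA A) f) (tw a g) :> phom (sob a : So A) (sob a').
Proof. by rewrite iA_mor /= sharp_cmpU /= pcmpm1 mul1g. Qed.

(** The image of [A] and the twists generate [A # BG] under composition and sums, so naturality is
    tested on them. *)
Lemma tens_nat (A X : cob) (P Q : mpfunctor (So A) X) (p : forall a : So A, phom (P a) (Q a)) :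
 (forall (a a' : A) (f : phom a a'), pcmp (p (sob a')) (pfmor P (pfmor (iA A) f)) = pcmp (pfmor Q (pfmor (iA A) f)) (p (sob a))) ->
 (forall (a : A) g, pcmp (p (sob a)) (pfmor P (tw a g)) = pcmp (pfmor Q (tw a g)) (p (sob a))) ->
 forall (a a' : So A) (f : phom a a'), pcmp (p a') (pfmor P f) = pcmp (pfmor Q f) (p a).
Proof.
move=> h1 h2 [a []] [a' []]; apply: tens_ext.
- by move=> u v; rewrite (@pfmorD _ _ P) pcmpDr.
- by move=> u v; rewrite (@pfmorD _ _ Q) pcmpDl.
by move=> f g; rewrite tens_split !pfmorM pcmpA h1 -[LHS]pcmpA h2 [LHS]pcmpA.
Qed.

Section Ind.
Variables (A X : cob) (F : G -> mpfunctor A X).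
(** Legs are labelled by group elements. [D] compares two legs across a constant apex, [e] compares
    them across a group element on the side of [A]; [Ra], [Rb], [Rc] are the tetrahedra between
    these triangles. *)
Variable D : forall g h a, phom (F g a) (F h a).
Variable e : forall g k l, l = (k * g)%g -> forall a, phom (F k a) (F l a).
Hypotheses (Dm : forall g h a, marked (D g h a))
 (em : forall g k l p a, marked (@e g k l p a))
 (Dn : forall g h a a' (f : phom a a'), pcmp (D g h a') (pfmor (F g) f) = pcmp (pfmor (F h) f) (D g h a))
 (en : forall g k l p a a' (f : phom a a'), pcmp (@e g k l p a') (pfmor (F k) f) = pcmp (pfmor (F l) f) (@e g k l p a))
 (Ra : forall g h l a, pcmp (D h l a) (D g h a) = D g l a)
 (Rb : forall g k l k' l' p p' a, pcmp (D l l' a) (@e g k l p a) = pcmp (@e g k' l' p' a) (D k k' a))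
 (Rc : forall g h k m l p1 p2 p3 a, pcmp (@e g m l p1 a) (@e h k m p2 a) = @e (h * g)%g k l p3 a).

Lemma D1 g a : D g g a = pid _.
Proof. by apply: (iso_mono (marked_iso (Dm g g a))); rewrite Ra pcmpm1. Qed.
Let e1 g a := @e g 1%g g (esym (mul1g g)) a.
(** Both [e] and [D] compare the leg at 1 with the leg at [g]; their quotient is the action of [g]
    on the leg at 1. *)
Definition irho g a : phom (F 1%g a) (F 1%g a) := pcmp (pinv (marked_iso (em (esym (mul1g g)) a))) (D 1%g g a).

Lemma irhoE g a : pcmp (e1 g a) (irho g a) = D 1%g g a.
Proof. by rewrite /irho pcmpA pinv_r pcmp1m. Qed.

Lemma rho_nat g a a' (f : phom a a') : pcmp (irho g a') (pfmor (F 1%g) f) = pcmp (pfmor (F 1%g) f) (irho g a).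
Proof.
apply: (iso_mono (marked_iso (em (esym (mul1g g)) a'))).
by rewrite -/(e1 g a') pcmpA irhoE pcmpA en -pcmpA -/(e1 g a) irhoE Dn.
Qed.

(** [Rc] composes the comparisons across group elements, and [Rb] moves [D] past [e]. *)
Lemma rhoM g h a : pcmp (irho g a) (irho h a) = irho (g * h)%g a.
Proof.
apply: (iso_mono (marked_iso (em (esym (mul1g (g * h)%g)) a))); rewrite -/(e1 (g * h)%g a) irhoE /e1.
rewrite -(@Rc h g 1%g g (g * h)%g erefl (esym (mul1g g)) (esym (mul1g (g * h)%g)) a) -/(e1 g a).
rewrite -pcmpA (pcmpA (e1 g a)) irhoE pcmpA -(@Rb h 1%g h g (g * h)%g (esym (mul1g h)) erefl a).
by rewrite -pcmpA -/(e1 h a) irhoE Ra.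
Qed.

(** An invertible idempotent is an identity. *)
Lemma rho1 a : irho 1%g a = pid _.
Proof.
have i : p_iso (irho 1%g a).
by apply: p_iso_cmp; [apply: p_iso_inv (pinvP _)|apply: marked_iso].
by apply: (iso_mono i); rewrite rhoM mul1g pcmpm1.
Qed.
Lemma rho_marked g a : marked (irho g a).
Proof. by apply: marked_cmp => //; apply: mk_pinv. Qed.
Let mD (x y : So A) (g : G) : {morph (fun f : phom (sh1 x) (sh1 y) => pcmp (pfmor (F 1%g) f) (irho g (sh1 x))) : f f' / (f + f')%R}.
Proof. by move=> f f'; rewrite pfmorD pcmpDl. Qed.
Definition ind_mor (x y : So A) (u : phom x y) : phom (F 1%g (sh1 x)) (F 1%g (sh1 y)) :=
 @tens_lift (phom (sh1 x) (sh1 y)) G _ (fun g f => pcmp (pfmor (F 1%g) f) (irho g (sh1 x))) u.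

Lemma ind_morU (x y : So A) (f : phom (sh1 x) (sh1 y)) (g : G) :
 @ind_mor x y (@tens (phom (sh1 x) (sh1 y)) G f g) = pcmp (pfmor (F 1%g) f) (irho g (sh1 x)).
Proof. exact: (@tens_liftU _ G _ _ (@mD x y)). Qed.
Lemma ind_morD (x y : So A) : {morph @ind_mor x y : u v / (u + v)%R}.
Proof. exact: (tens_liftD (@mD x y)). Qed.
Lemma ind_mor1 (x : So A) : ind_mor (pid x) = pid (F 1%g (sh1 x)).
Proof. by rewrite ind_morU pfmor1 pcmp1m rho1. Qed.

Lemma ind_morM (x y z : So A) (u : phom y z) (v : phom x y) :
 ind_mor (pcmp u v) = pcmp (ind_mor u) (ind_mor v).
Proof.
move: u; apply: tens_ext => [u u'|u u'|f g].
- by rewrite pcmpDl ind_morD.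
- by rewrite ind_morD pcmpDl.
move: v; apply: tens_ext => [v v'|v v'|f' g'].
- by rewrite pcmpDr ind_morD.
- by rewrite ind_morD pcmpDr.
rewrite [pcmp _ _]sharp_cmpU !ind_morU pfmorM -[LHS]pcmpA -[RHS]pcmpA; congr (pcmp _ _).
by rewrite [RHS]pcmpA (rho_nat g f') -[RHS]pcmpA (rhoM g g' (sh1 x)).
Qed.

(** A marked morphism is an elementary tensor on a marked one or, under the maximal marking, any
    isomorphism; the former is checked by hand, the latter is preserved by functoriality. *)
Lemma ind_marked (x y : So A) (u : phom x y) : marked u -> marked (ind_mor u).
Proof.
move=> mu; suff [i|[f [g [mf ->]]]] : (b /\ p_iso u) \/ @sharp_marked (BG G) A x y u.
- case: i => bt [v [uv vu]]; apply: cob_all => //.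
by exists (ind_mor v); split; rewrite -ind_morM ?uv ?vu ind_mor1.
- by rewrite ind_morU; apply: marked_cmp; [apply: mpf_marked|apply: rho_marked].
have gen (c : bool) : (if c then p_iso u else @sharp_marked (BG G) A x y u) -> (c /\ p_iso u) \/ @sharp_marked (BG G) A x y u.
by case: c; [left|right].
exact: gen mu.
Qed.
Definition Ind : mpfunctor (So A) X :=
 @Mpfunctor (So A) X (@Pfunctor (So A) X (fun x => F 1%g (sh1 x)) ind_mor ind_mor1 ind_morM ind_morD) ind_marked.

Lemma Ind_iA (a a' : A) (f : phom a a') : pfmor Ind (pfmor (iA A) f) = pfmor (F 1%g) f.
Proof. by rewrite iA_mor [LHS]ind_morU rho1 pcmpm1. Qed.
Lemma Ind_tw (a : A) g : pfmor Ind (tw a g) = irho g a.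
Proof. by rewrite [LHS]ind_morU pfmor1 pcmp1m. Qed.

(** The inverse is the convention of the cells of [Gam], which send a group element to the twist by
    its inverse. *)
Lemma Ind_twV (a : A) g k l p : pcmp (D 1%g l a) (pfmor Ind (tw a g^-1)%g) = pcmp (@e g k l p a) (D 1%g k a).
Proof.
have E : pcmp (D 1%g g a) (pfmor Ind (tw a g^-1)%g) = e1 g a.
by rewrite Ind_tw -irhoE -pcmpA (rhoM g) mulgV rho1 pcmpm1.
rewrite -(@Ra 1%g g l a) -pcmpA E /e1.
exact: (@Rb g 1%g g k l (esym (mul1g g)) p a).
Qed.
End Ind.

Section Phi.
Variables (A X1 X2 : cob) (x1 : mpfunctor (So A) X1) (x2 : mpfunctor (So A) X2) (x12 : mpfunctor X1 X2).
Variables (F1 : G -> mpfunctor A X1) (F2 : G -> mpfunctor A X2).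
Variables (D1' : forall g h a, phom (F1 g a) (F1 h a)) (D2' : forall g h a, phom (F2 g a) (F2 h a)).
Variables (e1 : forall g a, phom (F1 1%g a) (F1 g a)) (e2 : forall g a, phom (F2 1%g a) (F2 g a)).
Variables (E1 : forall (g h : G) a, phom (x1 (iA A a)) (F1 h a)) (E2 : forall (g h : G) a, phom (x2 (iA A a)) (F2 h a)).
Variable c : forall (g h : G) (a : A), phom (x12 (F1 g a)) (F2 h a).
Hypotheses (E2m : forall g h a, marked (E2 g h a))
 (E1m : forall g h a, marked (E1 g h a))
 (cm' : forall g h a, marked (c g h a))
 (E1n : forall g h a a' (f : phom a a'), pcmp (E1 g h a') (pfmor x1 (pfmor (iA A) f)) = pcmp (pfmor (F1 h) f) (E1 g h a))
 (E2n : forall g h a a' (f : phom a a'), pcmp (E2 g h a') (pfmor x2 (pfmor (iA A) f)) = pcmp (pfmor (F2 h) f) (E2 g h a))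
 (cn : forall g h a a' (f : phom a a'), pcmp (c g h a') (pfmor x12 (pfmor (F1 g) f)) = pcmp (pfmor (F2 h) f) (c g h a))
 (r1 : forall g h a, E1 g h a = E1 1%g h a)
 (r2 : forall g h a, E2 g h a = E2 1%g h a)
 (d1 : forall g h l a, pcmp (D1' h l a) (E1 g h a) = E1 g l a)
 (d2 : forall g h l a, pcmp (D2' h l a) (E2 g h a) = E2 g l a)
 (c1 : forall g h l a, pcmp (c h l a) (pfmor x12 (D1' g h a)) = c g l a)
 (c2 : forall g h l a, pcmp (D2' h l a) (c g h a) = c g l a)
 (t1 : forall g a, pcmp (E1 1%g g a) (pfmor x1 (tw a g^-1)%g) = pcmp (e1 g a) (E1 1%g 1%g a))
 (t2 : forall g a, pcmp (E2 1%g g a) (pfmor x2 (tw a g^-1)%g) = pcmp (e2 g a) (E2 1%g 1%g a))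
 (t3 : forall g a, pcmp (c g g a) (pfmor x12 (e1 g a)) = pcmp (e2 g a) (c 1%g 1%g a)).

Definition phi (a : So A) : phom (x12 (x1 a)) (x2 a).
Proof.
case: a => a' []; change (phom (x12 (x1 (sob a'))) (x2 (sob a'))).
exact: (pcmp (pcmp (pinv (marked_iso (E2m 1%g 1%g a'))) (c 1%g 1%g a')) (pfmor x12 (E1 1%g 1%g a'))).
Defined.

(** [phi] is defined by this equation at the unit labels; the compatibility of [E1], [E2] and [c]
    with the comparisons spreads it to all labels. *)
Lemma phiE g h l a : pcmp (c h l a) (pfmor x12 (E1 g h a)) = pcmp (E2 g l a) (phi (sob a)).
Proof.
have E : pcmp (E2 1%g 1%g a) (phi (sob a)) = pcmp (c 1%g 1%g a) (pfmor x12 (E1 1%g 1%g a)).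
by rewrite /phi !pcmpA pinv_r pcmp1m.
rewrite r1 -(d1 1%g 1%g) pfmorM pcmpA c1 -(c2 1%g 1%g) -pcmpA -E pcmpA d2.
by rewrite r2.
Qed.

Lemma phi_marked a : marked (phi a).
Proof.
case: a => a [].
change (marked (pcmp (pcmp (pinv (marked_iso (E2m 1%g 1%g a))) (c 1%g 1%g a)) (pfmor x12 (E1 1%g 1%g a)))).
apply: marked_cmp; last by apply: mpf_marked.
by apply: marked_cmp => //; apply: mk_pinv.
Qed.

Lemma phi_nat (a a' : So A) (f : phom a a') :
 pcmp (phi a') (pfmor x12 (pfmor x1 f)) = pcmp (pfmor x2 f) (phi a).
Proof.
move: a a' f; apply: (@tens_nat A X2 (mpfunctor_comp x12 x1) x2 phi) => [a a' f|a g].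
apply: (iso_mono (marked_iso (E2m 1%g 1%g a'))).
rewrite pcmpA -(@phiE 1%g 1%g 1%g a') -pcmpA.
apply: etrans (f_equal (fun z => pcmp (c 1%g 1%g a') z) (esym (@pfmorM _ _ x12 _ _ _ (E1 1%g 1%g a') (pfmor x1 (pfmor (iA A) f))))) _.
rewrite E1n pfmorM pcmpA cn.
by rewrite -pcmpA (@phiE 1%g 1%g 1%g a) pcmpA -E2n -pcmpA.
(* [t1] and [t2] speak of the twist by an inverse, so the given twist is written in that form. *)
suff K g' : pcmp (phi (sob a)) (pfmor x12 (pfmor x1 (tw a g'^-1)%g)) = pcmp (pfmor x2 (tw a g'^-1)%g) (phi (sob a)).
by have := K g^-1%g; rewrite invgK.
apply: (iso_mono (marked_iso (E2m 1%g g' a))).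
rewrite pcmpA -(@phiE 1%g g' g' a) -pcmpA -pfmorM t1 pfmorM pcmpA t3 -pcmpA (@phiE 1%g 1%g 1%g a) pcmpA -t2 -pcmpA.
by [].
Qed.
End Phi.
End IndAlg.

(** * Explicit cells of [Gam] and explicit simplices of the cone *)

Section GammaCells.
Variables (b : bool) (G : groupType) (A : nerve (Cb b) 0).
Notation cob := (cob b).
Notation N := (nerve (Cb b)).
Notation BGn := (nerve (BG G)).
Notation A' := (nob A ord0).
Notation gA k t := (gam (degenerate _ A) k t).
Notation So := (sho (BG G)).

Lemma cell_ext_idc (B0 B1 B2 : cob) (F F' : mpfunctor B0 B1) (K K' : mpfunctor B1 B2) (H H' : mpfunctor B0 B2)
 (p : forall a, phom (K (F a)) (H a)) (p' : forall a, phom (K' (F' a)) (H' a)) :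
 F = F' -> K = K' -> H = H' ->
 (forall a (E : K (F a) = K' (F' a)) (E' : H a = H' a), pcmp (idc E') (p a) = pcmp (p' a) (idc E)) -> Cell p = Cell p'.
Proof.
move=> e1 e2 e3; subst F' K' H' => h; congr Cell; apply: dfext => a.
by have := h a erefl erefl; rewrite /= pcmp1m pcmpm1.
Qed.
Lemma degN n (i j : 'I_n.+1) (h : sle i j) : sF (degenerate n A : N n) h = mpfunctor_id A'.
Proof. exact: (nmor1 A). Qed.

Lemma shid n (i j : 'I_n.+1) (h : sle i j) :
 mpfunctor_comp (shm (BG G) (sF (degenerate n A : N n) h)) (Eu G true A') = iA G A'.
Proof.
rewrite degN (@fmor1 _ _ (sharpC b (BG G)) (A' : Cb b) : shm (BG G) (mpfunctor_id A') = mpfunctor_id (So A')).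
by apply: mpfunctor_eq; apply: pfunctor_eq.
Qed.
Lemma gA_ar (k : BGn 1) : ar_of (gA k d12 : D2 b 1) = Arr (iA G A').
Proof. exact: (f_equal (fun K : mpfunctor A' (So A') => Arr K) (@shid 1 ord0 ord_max stt)). Qed.
Definition d001 : delta 2 1 := @dtri 1 ord0 ord0 ord_max isT isT.
Definition d011 : delta 2 1 := @dtri 1 ord0 ord_max ord_max isT isT.

(** The group element enters through the label [g^-1] of [coreE]; this triangle is where [G] acts on
    the leg. *)
Lemma gA_001 (k : BGn 2) : ce_of (gA k (dcomp d12 d001) : D2 b 2) =
 @Cell b A' A' (So A') (mpfunctor_id A') (iA G A') (iA G A') (fun a => tw a (kv k ord0 o1_3)^-1%g).
Proof.
change (Cell (@Ge b G 2 (degenerate 2 A) k (dcomp d12 d001) ord0 o1_3 ord_max stt stt stt) =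
@Cell b A' A' (So A') (mpfunctor_id A') (iA G A') (iA G A') (fun a => tw a (kv k ord0 o1_3)^-1%g)).
apply: cell_ext_idc.
- exact: degN.
- exact: shid.
- exact: shid.
move=> a E E'; rewrite /Ge; have e1 : sF (degenerate 2 A : N 2) (stt : sle (ord0 : 'I_3) (ord_max : 'I_3)) a = a by rewrite degN.
have e2 : sF (degenerate 2 A : N 2) (stt : sle (o1_3 : 'I_3) (ord_max : 'I_3)) (sF (degenerate 2 A : N 2) (stt : sle (ord0 : 'I_3) o1_3) a) = a by rewrite !degN.
rewrite (sidc E' e1) (sidc E e2) /coreE (tcmp e1 _ e2 erefl).
rewrite /tw -[pid a]/(idc (erefl a)) (tcmp erefl e2 e2 erefl); congr tens.
rewrite /= invg1 !mul1g !mulg1; congr (_^-1)%g.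
by rewrite /gk (kvE k (of_sle (stt : sle (ord0 : 'I_3) o1_3))).
Qed.

Lemma gA_011 (k : BGn 2) : ce_of (gA k (dcomp d12 d011) : D2 b 2) = idcr (Arr (iA G A')).
Proof.
pose K := Eu G true A'.
apply: etrans (@sphi_whisker b A' 2 (nerve_map (sharpC b (BG G)) 2 (degenerate 2 A : N 2)) ord0 o1_3 ord_max stt stt stt K) _.
rewrite /idcr /=; have E : mpfunctor_comp (mpfunctor_id (So A')) (iA G A') = iA G A'.
by apply: mpfunctor_eq; apply: pfunctor_eq.
apply: etrans (_ : comp_cell E = _).
apply: comp_cell_eq; first exact: (@shid 2 ord0 o1_3 stt).
apply: etrans (f_equal (fun F : mpfunctor A' A' => shm (BG G) F) (@degN 2 o1_3 ord_max stt)) _.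
exact: (@fmor1 _ _ (sharpC b (BG G)) (A' : Cb b)).
by rewrite /comp_cell; congr Cell; apply: dfext => a; rewrite idc_id.
Qed.
End GammaCells.

Section ZBuild.
Variables (G : groupType) (M : nat).
Notation BGn := (nerve (BG G)).
Notation Z := (Z G M).

(** Edge labels are differences of a potential [u], which is determined up to right translation;
    faces then become subsequences. *)
Definition BGc n (u : nat -> G) : BGn n.
Proof.
refine (@NerveSimp (BG G) n (fun _ => Datatypes.tt) (fun i j _ => u j * (u i)^-1)%g _ _).
- by move=> i h; rewrite mulgV.
- by move=> i j k ij jk ik; rewrite /= mulgA mulgVK.
Defined.
Lemma kvBGc n u (i j : 'I_n.+1) : i <= j -> kv (BGc n u) i j = (u j * (u i)^-1)%g.
Proof. by move=> h; rewrite (@kvE G n _ i j h). Qed.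
Definition valid n m (s : seq nat) := [&& size s == n.+1, sorted leq s & all (fun v => v <= m) s].

Ltac vlia := by rewrite /valid /=; lia.

Lemma valid_fun n m s : valid n m s -> exists f : delta n m, forall i, f i = nth 0 s i :> nat.
Proof.
case/and3P=> /eqP sz so /(all_nthP 0) al.
have h (i : 'I_n.+1) : nth 0 s i < m.+1 by apply: (al i); rewrite sz; apply: ltn_ord.
have hm (i j : 'I_n.+1) : i <= j -> Ordinal (h i) <= Ordinal (h j).
by move=> ij /=; apply: (sorted_leq_nth leq_trans leqnn 0 so) => //; rewrite inE sz ltn_ord.
by exists (@Delta n m (fun i => Ordinal (h i)) hm).
Qed.
Definition dsq n m (s : seq nat) : delta n m :=
 if pselect (valid n m s) is left h then sval (cid (valid_fun h)) else dconst n ord0.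

Lemma dsqE n m s (i : 'I_n.+1) : valid n m s -> dsq n m s i = nth 0 s i :> nat.
Proof. by rewrite /dsq; case: pselect => // h _; case: cid. Qed.
(** A simplex of the cone by its coordinates in the interval, in the M-simplex and, as a potential,
    in BG. Lists make the finite case analyses computable. *)
Definition sx n e f (u : seq G) : Z n := zq G M n (dsq n 1 e, (dsq n M f, BGc n (nth 1%g u))).

Lemma ze_sx n e f u (i : 'I_n.+1) : valid n 1 e -> ze (sx n e f u) i = nth 0 e i :> nat.
Proof. by move=> h; rewrite /sx ze_q dsqE. Qed.
Lemma zq_ne0 n (e : delta n 1) (f : delta n M) (k : BGn n) : e ord_max <> ord0 -> zf (zq G M n (e, (f, k))) = f.
Proof. by rewrite /zf /= /znf /=; case: eqP => // _ _; case: eqP. Qed.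

Lemma zf_sx n e f u (i : 'I_n.+1) : valid n 1 e -> valid n M f -> nth 0 e n = 1 ->
 zf (sx n e f u) i = nth 0 f i :> nat.
Proof.
move=> h h' e1; rewrite /sx zq_ne0 ?dsqE // => /(f_equal (@nat_of_ord _)).
by rewrite dsqE //= e1.
Qed.

Lemma zk_sx n e f u : valid n 1 e -> nth 0 e 0 = 0 -> nth 0 e n = 1 ->
 zk (sx n e f u) = BGc n (nth 1%g u).
Proof.
move=> h e0 e1; rewrite /zk /sx zq_mixed //; apply: ord_inj; rewrite dsqE //.
Qed.

(** The constant [c] accounts for renormalizing the potential when the first vertex changes. *)
Lemma sx_act n m (phi : delta m n) e f u e' f' u' c :
 valid n 1 e -> valid n M f -> valid m 1 e' -> valid m M f' ->
 (forall p : 'I_m.+1, nth 0 e (phi p) = nth 0 e' p) -> (forall p : 'I_m.+1, nth 0 f (phi p) = nth 0 f' p) ->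
 (forall p : 'I_m.+1, nth 1%g u (phi p) = (nth 1 u' p * c)%g) ->
 act phi (sx n e f u) = sx m e' f' u'.
Proof.
move=> v1 v2 v3 v4 h1 h2 h3; rewrite /sx -smapP; congr (zq G M m (_, (_, _))).
- by apply: deltaP => p; rewrite /= !dsqE.
- by apply: deltaP => p; rewrite /= !dsqE.
apply: BG_ext => i j ij; rewrite kv_act // !kvBGc ?(dmono phi ij) // !h3.
by rewrite invgM mulgA mulgK.
Qed.
Lemma zq_sval n (x : Z n) : zq G M n (ze x, (zf x, zk x)) = x.
Proof. by rewrite -[RHS](@squotK _ (@znf G M) (@znfI G M) n x); congr (zq G M n _); rewrite /ze /zf /zk; case: (sval x) => ? []. Qed.

Lemma sx_of n (x : Z n) e f u : valid n 1 e -> valid n M f ->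
 (forall i : 'I_n.+1, ze x i = nth 0 e i :> nat) -> (forall i : 'I_n.+1, zf x i = nth 0 f i :> nat) ->
 (forall i : 'I_n.+1, nth 1%g u i = kv (zk x) ord0 i) -> x = sx n e f u.
Proof.
move=> v1 v2 h1 h2 h3; rewrite -[LHS]zq_sval /sx; congr (zq G M n (_, (_, _))).
- by apply: deltaP => p; rewrite dsqE.
- by apply: deltaP => p; rewrite dsqE.
apply: BG_ext => i j ij; rewrite kvBGc // !h3.
by rewrite (@kvM G n (zk x) ord0 i j (leq0n i) ij) mulgK.
Qed.

Lemma sx_one n e f u u' : valid n 1 e -> nth 0 e 0 = 1 -> sx n e f u = sx n e f u'.
Proof.
move=> v e0; have E w : ze (sx n e f w) = dsq n 1 e by rewrite /sx ze_q.
have h : dsq n 1 e ord0 = ord_max by apply: ord_inj; rewrite dsqE.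
have h1 : dsq n 1 e ord_max <> ord0 by rewrite (d1_1 _ h).
apply: z_ext; first by rewrite !E.
by rewrite /sx !zq_ne0.
by rewrite !zone ?E.
Qed.

Lemma sx_zero n e f u f' u' : valid n 1 e -> nth 0 e n = 0 -> sx n e f u = sx n e f' u'.
Proof.
move=> v e0; have E g w : ze (sx n e g w) = dsq n 1 e by rewrite /sx ze_q.
have h : dsq n 1 e ord_max = ord0 by apply: ord_inj; rewrite dsqE.
have [h1 h2] := @zzero G M n (sx n e f u) (etrans (f_equal (fun d : delta n 1 => d ord_max) (E f u)) h).
have [h3 h4] := @zzero G M n (sx n e f' u') (etrans (f_equal (fun d : delta n 1 => d ord_max) (E f' u')) h).
by apply: z_ext; rewrite ?E // ?h1 ?h2 ?h3 ?h4.
Qed.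

(** Over the end 1 the group element is forgotten, so a simplex there is pulled back from the top
    M-simplex along its coordinate. *)
Lemma zone_inj n (x : Z n) : ze x ord0 = ord_max -> nondeg x -> injective (zf x).
Proof.
move=> e1 nd; pose ap : Z M := zq G M M (dconst M ord_max, (did M, BG1 G M)).
have E : x = act (zf x) ap.
rewrite /ap -smapP -[LHS]zq_sval.
congr (zq G M n (_, (_, _))); first by apply: delta_eq => i; rewrite (d1_1 i e1).
by rewrite (zone e1) BG1_act.
by rewrite E in nd; apply: (nondeg_inj nd).
Qed.

Lemma sx_vert n e f u (i : 'I_n.+1) : valid n 1 e -> valid n M f ->
 act (dconst 0 i) (sx n e f u) = sx 0 [:: nth 0 e i] [:: nth 0 f i] [::].
Proof.
move=> v1 v2; apply: (@sx_act _ _ _ _ _ _ _ _ _ (nth 1%g u i)) => //.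
- by rewrite /valid /= andbT -(@dsqE n 1 e i v1) leq_ord.
- by rewrite /valid /= andbT -(@dsqE n M f i v2) leq_ord.
- by move=> p; rewrite (ord1 p).
- by move=> p; rewrite (ord1 p).
by move=> p; rewrite (ord1 p) /= mul1g.
Qed.

Section Faces.
Variables (e0 e1 e2 e3 f0 f1 f2 f3 : nat) (g h l : G).
Lemma sxf2 : valid 2 1 [:: e0; e1; e2] -> valid 2 M [:: f0; f1; f2] ->
 let s := sx 2 [:: e0; e1; e2] [:: f0; f1; f2] [:: 1%g; g; h] in
 [/\ act d01 s = sx 1 [:: e0; e1] [:: f0; f1] [:: 1%g; g],
   act d12 s = sx 1 [:: e1; e2] [:: f1; f2] [:: 1%g; (h * g^-1)%g]
  & act d02 s = sx 1 [:: e0; e2] [:: f0; f2] [:: 1%g; h]].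
Proof.
rewrite /valid /= => v1 v2; split.
- by apply: (@sx_act _ _ _ _ _ _ _ _ _ 1%g); [vlia|vlia|vlia|vlia| | |]; apply: ord2P; rewrite //= mulg1.
- by apply: (@sx_act _ _ _ _ _ _ _ _ _ g); [vlia|vlia|vlia|vlia| | |]; apply: ord2P; rewrite //= ?mul1g ?mulgVK.
- by apply: (@sx_act _ _ _ _ _ _ _ _ _ 1%g); [vlia|vlia|vlia|vlia| | |]; apply: ord2P; rewrite //= mulg1.
Qed.

Lemma sxf3 : valid 3 1 [:: e0; e1; e2; e3] -> valid 3 M [:: f0; f1; f2; f3] ->
 let s := sx 3 [:: e0; e1; e2; e3] [:: f0; f1; f2; f3] [:: 1%g; g; h; l] in
 [/\ act (dfc ord_max) s = sx 2 [:: e0; e1; e2] [:: f0; f1; f2] [:: 1%g; g; h],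
   act (dfc o1_4) s = sx 2 [:: e0; e2; e3] [:: f0; f2; f3] [:: 1%g; h; l],
   act (dfc o2_4) s = sx 2 [:: e0; e1; e3] [:: f0; f1; f3] [:: 1%g; g; l]
  & act (dfc ord0) s = sx 2 [:: e1; e2; e3] [:: f1; f2; f3] [:: 1; h * g^-1; l * g^-1]%g].
Proof.
rewrite /valid /= => v1 v2; split.
- by apply: (@sx_act _ _ _ _ _ _ _ _ _ 1%g); [vlia|vlia|vlia|vlia| | |]; apply: ord3P; rewrite //= mulg1.
- by apply: (@sx_act _ _ _ _ _ _ _ _ _ 1%g); [vlia|vlia|vlia|vlia| | |]; apply: ord3P; rewrite //= mulg1.
- by apply: (@sx_act _ _ _ _ _ _ _ _ _ 1%g); [vlia|vlia|vlia|vlia| | |]; apply: ord3P; rewrite //= mulg1.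
- by apply: (@sx_act _ _ _ _ _ _ _ _ _ g); [vlia|vlia|vlia|vlia| | |]; apply: ord3P; rewrite //= ?mul1g ?mulgVK.
Qed.

Lemma sxd2 : valid 1 1 [:: e0; e1] -> valid 1 M [:: f0; f1] ->
 let s := sx 1 [:: e0; e1] [:: f0; f1] [:: 1%g; g] in
 act (ddeg ord0) s = sx 2 [:: e0; e0; e1] [:: f0; f0; f1] [:: 1%g; 1%g; g] /\
 act (ddeg ord_max) s = sx 2 [:: e0; e1; e1] [:: f0; f1; f1] [:: 1%g; g; g].
Proof.
rewrite /valid /= => v1 v2; split.
- by apply: (@sx_act _ _ _ _ _ _ _ _ _ 1%g); [vlia|vlia|vlia|vlia| | |]; apply: ord3P; rewrite ?dgE //= ?mulg1.
- by apply: (@sx_act _ _ _ _ _ _ _ _ _ 1%g); [vlia|vlia|vlia|vlia| | |]; apply: ord3P; rewrite ?dgE //= ?mulg1.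
Qed.

Lemma sxd1 : valid 0 1 [:: e0] -> valid 0 M [:: f0] ->
 act (dconst 1 ord0) (sx 0 [:: e0] [:: f0] [::]) = sx 1 [:: e0; e0] [:: f0; f0] [:: 1%g; 1%g].
Proof.
rewrite /valid /= => v1 v2.
by apply: (@sx_act _ _ _ _ _ _ _ _ _ 1%g); [vlia|vlia|vlia|vlia| | |]; apply: ord2P; rewrite //= ?mulg1.
Qed.
End Faces.

Lemma ex4 (P : 'I_4 -> Prop) : (exists i, P i) -> P ord0 \/ P o1_4 \/ P o2_4 \/ P ord_max.
Proof. by case=> i; move: i; apply: ord4P; tauto. Qed.
Lemma ex3 (P : 'I_3 -> Prop) : (exists i, P i) -> P ord0 \/ P o1_3 \/ P ord_max.
Proof. by case=> i; move: i; apply: ord3P; tauto. Qed.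
Lemma ex2 (P : 'I_2 -> Prop) : (exists i, P i) -> P ord0 \/ P ord_max.
Proof. by case=> i; move: i; apply: ord2P; tauto. Qed.

Lemma nS1 n (x : Z n) : ~ S1p x -> (exists i, ze x i = 1 :> nat /\ zf x i = 0 :> nat) /\
 (forall j, j <= M -> exists i, zf x i = j :> nat).
Proof.
move=> ns; split.
apply: contrapT => h; apply: ns; left=> i e1 e2; apply: h; exists i; by rewrite e1 e2.
move=> j jM; apply: contrapT => h; apply: ns; right; exists (inord j) => i E.
by apply: h; exists i; rewrite E inordK.
Qed.

Lemma nS1_size n (x : Z n) : ~ S1p x -> M <= n.
Proof.
move=> /nS1[_ h]; pose g (j : 'I_M.+1) : 'I_n.+1 := sval (cid (h j (leq_ord j))).
have gE j : zf x (g j) = j :> nat by rewrite /g; case: cid.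
have /leq_card : injective g by move=> j j' E; apply: ord_inj; rewrite -(gE j) E gE.
by rewrite !card_ord.
Qed.

Lemma zone_lt n (x : Z n) (i j : 'I_n.+1) : nondeg x -> i < j -> ze x ord0 = 1 :> nat -> zf x i < zf x j.
Proof.
move=> nd ij e1; rewrite ltn_neqAle (dmono (zf x) (ltnW ij)) andbT; apply/eqP => E.
have := @zone_inj n x (ord_inj (e1 : _ = ord_max :> nat)) nd i j (ord_inj E).
by move=> E'; rewrite E' ltnn in ij.
Qed.

(** Outside [S1p] the M-coordinate is onto and the vertex 0 occurs over the end 1. In low dimension
    this, with nondegeneracy, leaves few coordinate patterns, which arithmetic then enumerates. *)
Lemma facts1 (x : Z 1) : ~ S1p x -> exists e0 e1 f0 f1 g, [/\ x = sx 1 [:: e0; e1] [:: f0; f1] [:: 1%g; g],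
 [/\ e0 <= e1, e1 <= 1, f0 <= f1 & f1 <= M],
 e0 = 1 /\ f0 = 0 \/ e1 = 1 /\ f1 = 0 & forall j, j <= M -> f0 = j \/ f1 = j].
Proof.
move=> ns; have [h1 h2] := nS1 ns.
exists (ze x ord0), (ze x ord_max), (zf x ord0), (zf x ord_max), (kv (zk x) ord0 ord_max).
have a1 : ze x ord0 <= ze x ord_max := dmono (ze x) (isT : (ord0 : 'I_2) <= (ord_max : 'I_2)).
have a2 : zf x ord0 <= zf x ord_max := dmono (zf x) (isT : (ord0 : 'I_2) <= (ord_max : 'I_2)).
have a3 := ltn_ord (ze x ord_max); have a4 := ltn_ord (zf x ord_max); split => //.
- by apply: sx_of; [vlia|vlia| | |]; apply: ord2P; rewrite ?kv1.
- exact: (ex2 h1).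
by move=> j /h2/ex2.
Qed.

Lemma facts2 (x : Z 2) : ~ S1p x -> nondeg x -> exists e0 e1 e2 f0 f1 f2 g h,
 [/\ x = sx 2 [:: e0; e1; e2] [:: f0; f1; f2] [:: 1%g; g; h],
 [/\ e0 <= e1, e1 <= e2, e2 <= 1 & [/\ f0 <= f1, f1 <= f2 & f2 <= M]],
 e0 = 1 /\ f0 = 0 \/ e1 = 1 /\ f1 = 0 \/ e2 = 1 /\ f2 = 0,
 forall j, j <= M -> f0 = j \/ f1 = j \/ f2 = j & e0 = 1 -> f0 < f1 /\ f1 < f2].
Proof.
move=> ns nd; have [h1 h2] := nS1 ns.
exists (ze x ord0), (ze x o1_3), (ze x ord_max), (zf x ord0), (zf x o1_3), (zf x ord_max), (kv (zk x) ord0 o1_3), (kv (zk x) ord0 ord_max).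
have a1 : ze x ord0 <= ze x o1_3 := dmono (ze x) (isT : (ord0 : 'I_3) <= o1_3).
have a2 : zf x ord0 <= zf x o1_3 := dmono (zf x) (isT : (ord0 : 'I_3) <= o1_3).
have b1 : ze x o1_3 <= ze x ord_max := dmono (ze x) (isT : o1_3 <= (ord_max : 'I_3)).
have b2 : zf x o1_3 <= zf x ord_max := dmono (zf x) (isT : o1_3 <= (ord_max : 'I_3)).
have a3 := ltn_ord (ze x ord_max); have a4 := ltn_ord (zf x ord_max); split => //.
- by apply: sx_of; [vlia|vlia| | |]; apply: ord3P; rewrite ?kv1.
- exact: (ex3 h1).
- by move=> j /h2/ex3.
by move=> E; split; apply: zone_lt.
Qed.

Lemma facts3 (x : Z 3) : ~ S1p x -> nondeg x -> exists e0 e1 e2 e3 f0 f1 f2 f3 g h l,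
 [/\ x = sx 3 [:: e0; e1; e2; e3] [:: f0; f1; f2; f3] [:: 1%g; g; h; l],
 [/\ e0 <= e1, e1 <= e2, e2 <= e3, e3 <= 1 & [/\ f0 <= f1, f1 <= f2, f2 <= f3 & f3 <= M]],
 e0 = 1 /\ f0 = 0 \/ e1 = 1 /\ f1 = 0 \/ e2 = 1 /\ f2 = 0 \/ e3 = 1 /\ f3 = 0,
 forall j, j <= M -> f0 = j \/ f1 = j \/ f2 = j \/ f3 = j & e0 = 1 -> [/\ f0 < f1, f1 < f2 & f2 < f3]].
Proof.
move=> ns nd; have [h1 h2] := nS1 ns.
exists (ze x ord0), (ze x o1_4), (ze x o2_4), (ze x ord_max), (zf x ord0), (zf x o1_4), (zf x o2_4), (zf x ord_max),
(kv (zk x) ord0 o1_4), (kv (zk x) ord0 o2_4), (kv (zk x) ord0 ord_max).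
have a1 : ze x ord0 <= ze x o1_4 := dmono (ze x) (isT : (ord0 : 'I_4) <= o1_4).
have a2 : zf x ord0 <= zf x o1_4 := dmono (zf x) (isT : (ord0 : 'I_4) <= o1_4).
have b1 : ze x o1_4 <= ze x o2_4 := dmono (ze x) (isT : o1_4 <= o2_4).
have b2 : zf x o1_4 <= zf x o2_4 := dmono (zf x) (isT : o1_4 <= o2_4).
have c1 : ze x o2_4 <= ze x ord_max := dmono (ze x) (isT : o2_4 <= (ord_max : 'I_4)).
have c2 : zf x o2_4 <= zf x ord_max := dmono (zf x) (isT : o2_4 <= (ord_max : 'I_4)).
have a3 := ltn_ord (ze x ord_max); have a4 := ltn_ord (zf x ord_max); split => //.
- by apply: sx_of; [vlia|vlia| | |]; apply: ord4P; rewrite ?kv1.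
- exact: (ex4 h1).
- by move=> j /h2/ex4.
by move=> E; split; apply: zone_lt.
Qed.
(** A boolean test for [S1p], so that membership is decided by computation on explicit
    coordinates. *)
Definition S1b n e f := (nth 0 e n == 0) ||
 all (fun i => (nth 0 e i == 1) ==> (nth 0 f i != 0)) (iota 0 n.+1) ||
 has (fun j => all (fun i => nth 0 f i != j) (iota 0 n.+1)) (iota 0 M.+1).

Lemma S1p_sx n e f u : 0 < M -> valid n 1 e -> valid n M f -> S1b n e f -> S1p (sx n e f u).
Proof.
move=> M0 v1 v2; have [e0|e1] := eqVneq (nth 0 e n) 0.
by move=> _; right; apply: Zb_0 => //; apply: ord_inj; rewrite ze_sx.
have {}e1 : nth 0 e n = 1.
by move: e1; rewrite -(@dsqE n 1 e ord_max v1); case: (I2 (dsq n 1 e ord_max)) => ->.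
rewrite /S1b e1 [1 == 0]/= orFb => /orP[/allP h|/hasP[j jM /allP h]]; [left|right].
move=> i Ei Fi; have := h i; rewrite mem_iota add0n ltn_ord -(ze_sx f u i v1) Ei -(zf_sx u i v1 v2 e1) Fi /=.
by move/(_ isT).
exists (inord j) => i E; have := h i; rewrite mem_iota add0n ltn_ord -(zf_sx u i v1 v2 e1) E.
by rewrite mem_iota in jM; rewrite inordK // eqxx => /(_ isT).
Qed.

Lemma S1p_sxN n e f u : valid n 1 e -> valid n M f -> ~~ S1b n e f -> ~ S1p (sx n e f u).
Proof.
move=> v1 v2 /norP[/norP[e0 /allPn[i]]]; rewrite mem_iota add0n => iN.
have {}e0 : nth 0 e n = 1.
by move: e0; rewrite -(@dsqE n 1 e ord_max v1); case: (I2 (dsq n 1 e ord_max)) => ->.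
rewrite negb_imply negbK => /andP[/eqP Ei /eqP Fi] /hasPn h [H|[j H]].
apply: (H (Ordinal iN)); apply: ord_inj; first by rewrite ze_sx.
by rewrite zf_sx.
have : (j : nat) \in iota 0 M.+1 by rewrite mem_iota add0n ltn_ord.
move/h => /allPn[i']; rewrite mem_iota add0n => iN'; rewrite negbK => /eqP E.
by apply: (H (Ordinal iN')); apply: ord_inj; rewrite zf_sx.
Qed.
End ZBuild.

(** * Second stage: the universal property in dimensions 1 to 3 *)

Section Stage2.
Variables (b : bool) (G : groupType) (M : nat).
Hypothesis M0 : 0 < M.
Variable A : nerve (Cb b) 0.
Notation cob := (cob b).
Notation BGn := (nerve (BG G)).
Notation A' := (nob A ord0).
Notation gA k t := (gam (degenerate _ A) k t).
Notation So := (sho (BG G)).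
Notation Z := (Z G M).
Notation sx := (@sx G M).
Variable kap1 : smap (@ZS G M M0) (D2 b).
Hypothesis hG : forall n (x : ZS G M0 n), (forall i, zf (sval x) i = ord0) ->
 kap1 n x = gA (zk (sval x)) (dcomp d12 (ze (sval x))).

(** The values of the first stage in bundled form, made total; outside [S1p] the values are junk. *)
Definition obS (v : Z 0) : cob := if pselect (S1p v) is left h then ob_of (kap1 0 (exist _ v h)) else A'.
Definition arS (e : Z 1) : arr b := if pselect (S1p e) is left h then ar_of (kap1 1 (exist _ e h)) else arr1 A'.
Definition ceS (s : Z 2) : cell b :=
 if pselect (S1p s) is left h then ce_of (kap1 2 (exist _ s h)) else idcl (arr1 A').

Lemma obSE v (h : S1p v) : obS v = ob_of (kap1 0 (exist _ v h)).
Proof. by rewrite /obS; case: pselect => [h'|//]; rewrite (pirr h' h). Qed.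
Lemma arSE e (h : S1p e) : arS e = ar_of (kap1 1 (exist _ e h)).
Proof. by rewrite /arS; case: pselect => [h'|//]; rewrite (pirr h' h). Qed.
Lemma ceSE s (h : S1p s) : ceS s = ce_of (kap1 2 (exist _ s h)).
Proof. by rewrite /ceS; case: pselect => [h'|//]; rewrite (pirr h' h). Qed.
Lemma S1p_v (v : Z 0) : S1p v.
Proof. by apply: contrapT => /nS1_size; rewrite leqNgt M0. Qed.
Lemma act_kap m n (f : delta m n) x (h : S1p x) (h' : S1p (act f x)) :
 kap1 m (exist _ (act f x) h') = act f (kap1 n (exist _ x h)).
Proof. by rewrite -smapP; congr (kap1 m _); apply: sigE. Qed.
Lemma arS_bd e : S1p e -> aS (arS e) = obS (source e) /\ aT (arS e) = obS (target e).
Proof.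
by move=> h; rewrite (arSE h) !(obSE (S1_act M0 _ h)) !(act_kap h _).
Qed.

Lemma ceS_bd s : S1p s -> goodc (ceS s) /\ cell_bd (ceS s) (arS (act d01 s)) (arS (act d12 s)) (arS (act d02 s)).
Proof.
move=> h; rewrite (ceSE h) !(arSE (S1_act M0 _ h)) !(act_kap h _); split; last exact: ce_of_bd.
exact: fcell_good.
Qed.
Lemma tetS t : S1p t -> tet (ceS (act (dfc ord_max) t)) (ceS (act (dfc o1_4) t))
   (ceS (act (dfc o2_4) t)) (ceS (act (dfc ord0) t)).
Proof. by move=> h; rewrite !(ceSE (S1_act M0 _ h)) !(act_kap h _); apply: dtetE. Qed.

Lemma arS_deg v : arS (act (dconst 1 ord0) v) = arr1 (obS v).
Proof.
rewrite (obSE (S1p_v v)) (arSE (S1_act M0 _ (S1p_v v))) (act_kap (S1p_v v) _); set y := kap1 _ _.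
by rewrite (@ar_ofE b 0 y _ ord0 ord0 stt) //; apply: farr_id.
Qed.

Lemma ceS_degl e : S1p e -> ceS (act (ddeg ord0) e) = idcl (arS e).
Proof.
move=> h; rewrite (arSE h) (ceSE (S1_act M0 _ h)) (act_kap h _); set y := kap1 _ _.
apply: etrans (@fcell_l b 1 y ord0 ord_max stt stt).
by apply: (@ce_ofE b 1 y) => //; apply: ord_inj; rewrite dgE.
Qed.

Lemma ceS_degr e : S1p e -> ceS (act (ddeg ord_max) e) = idcr (arS e).
Proof.
move=> h; rewrite (arSE h) (ceSE (S1_act M0 _ h)) (act_kap h _); set y := kap1 _ _.
apply: etrans (@fcell_r b 1 y ord0 ord_max stt stt).
by apply: (@ce_ofE b 1 y) => //; apply: ord_inj; rewrite dgE.
Qed.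
Definition X j : cob := obS (sx 0 [:: 1] [:: j] [::]).

Lemma zf0_sx n e u i : valid n 1 e -> zf (sx n e (nseq n.+1 0) u) i = ord0.
Proof.
move=> v1; have v2 : valid n M (nseq n.+1 0).
by rewrite /valid size_nseq eqxx all_nseq leq0n orbT andbT /=; elim: n {e u i v1} => //= n ->.
have [h|h] := I2 (ze (sx n e (nseq n.+1 0) u) ord_max).
by have [-> _] := zzero h.
have e1 : nth 0 e n = 1 by rewrite -(@ze_sx G M n e (nseq n.+1 0) u ord_max v1) h.
by apply: ord_inj; rewrite zf_sx // nth_nseq; case: ifP.
Qed.

Lemma obS0 f u : obS (sx 0 [:: 0] f u) = A'.
Proof.
rewrite (@sx_zero G M 0 [:: 0] f u [:: 0] [::]) // (obSE (S1p_v _)) hG; last by move=> i; apply: (@zf0_sx 0).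
rewrite (_ : dcomp d12 _ = dconst 0 o1_3) //; apply: delta_eq => i; rewrite dcE.
by rewrite (_ : ze _ i = ord0) //; apply: ord_inj; rewrite ze_sx // (ord1 i).
Qed.

Lemma X0 : X 0 = So A'.
Proof.
rewrite /X (obSE (S1p_v _)) hG; last by move=> i; apply: (@zf0_sx 0).
rewrite (_ : dcomp d12 _ = dconst 0 ord_max) //; apply: delta_eq => i; rewrite dcE.
by rewrite (_ : ze _ i = ord_max) //; apply: ord_inj; rewrite ze_sx // (ord1 i).
Qed.
Lemma S1_0 n e u : valid n 1 e -> S1p (sx n e (nseq n.+1 0) u).
Proof.
move=> v1; right; exists ord_max => i; rewrite zf0_sx // => /esym; exact: (M1 M0).
Qed.

Lemma ar_iA g : arS (sx 1 [:: 0; 1] [:: 0; 0] [:: 1%g; g]) = Arr (iA G A').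
Proof.
rewrite (arSE (@S1_0 1 [:: 0; 1] [:: 1%g; g] isT)) hG; last by move=> i; apply: (@zf0_sx 1).
rewrite (_ : dcomp d12 _ = d12); first exact: gA_ar.
apply: delta_eq => i; rewrite dcE; congr (d12 _); apply: ord_inj; rewrite ze_sx //.
by move: i; apply: ord2P.
Qed.

Lemma ce_tw g l : ceS (sx 2 [:: 0; 0; 1] [:: 0; 0; 0] [:: 1%g; g; l]) =
 @Cell b A' A' (So A') (mpfunctor_id A') (iA G A') (iA G A') (fun a => tw a g^-1%g).
Proof.
rewrite (ceSE (@S1_0 2 [:: 0; 0; 1] [:: 1%g; g; l] isT)) hG; last by move=> i; apply: (@zf0_sx 2).
rewrite (_ : dcomp d12 _ = dcomp d12 d001).
rewrite gA_001; congr (@Cell b A' A' (So A') (mpfunctor_id A') (iA G A') (iA G A') _).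
by rewrite /= zk_sx // kvBGc //= invg1 mulg1.
apply: delta_eq => i; rewrite !dcE; congr (d12 _); apply: ord_inj; rewrite ze_sx //.
by move: i; apply: ord3P.
Qed.

Lemma ce_011 g l : ceS (sx 2 [:: 0; 1; 1] [:: 0; 0; 0] [:: 1%g; g; l]) = idcr (Arr (iA G A')).
Proof.
rewrite (ceSE (@S1_0 2 [:: 0; 1; 1] [:: 1%g; g; l] isT)) hG; last by move=> i; apply: (@zf0_sx 2).
rewrite (_ : dcomp d12 _ = dcomp d12 d011); first exact: gA_011.
apply: delta_eq => i; rewrite !dcE; congr (d12 _); apply: ord_inj; rewrite ze_sx //.
by move: i; apply: ord3P.
Qed.

Lemma ar00 f u : arS (sx 1 [:: 0; 0] f u) = arr1 A'.
Proof.
rewrite (@sx_zero G M 1 [:: 0; 0] f u [:: 0; 0] [:: 1%g; 1%g]) // -sxd1 // arS_deg.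
by rewrite obS0.
Qed.

Lemma ar11 j u : j <= M -> arS (sx 1 [:: 1; 1] [:: j; j] u) = arr1 (X j).
Proof.
move=> jM; rewrite (@sx_one G M 1 [:: 1; 1] _ u [:: 1%g; 1%g]) // -sxd1 ?arS_deg //.
by rewrite /valid /= jM.
Qed.

Lemma arT (A0 A1 : cob) e0 e1 f0 f1 g : valid 1 1 [:: e0; e1] -> valid 1 M [:: f0; f1] ->
 S1p (sx 1 [:: e0; e1] [:: f0; f1] [:: 1%g; g]) ->
 obS (sx 0 [:: e0] [:: f0] [::]) = A0 -> obS (sx 0 [:: e1] [:: f1] [::]) = A1 ->
 exists F : mpfunctor A0 A1, Arr F = arS (sx 1 [:: e0; e1] [:: f0; f1] [:: 1%g; g]).
Proof.
by move=> v1 v2 /arS_bd[]; rewrite /source /target !sx_vert // => h1 h2 h3 h4; apply: arr_typed; rewrite ?h1 ?h2.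
Qed.

Lemma cellT (A0 A1 A2 : cob) (F : mpfunctor A0 A1) (K : mpfunctor A1 A2) (H : mpfunctor A0 A2) e0 e1 e2 f0 f1 f2 g h :
 valid 2 1 [:: e0; e1; e2] -> valid 2 M [:: f0; f1; f2] ->
 S1p (sx 2 [:: e0; e1; e2] [:: f0; f1; f2] [:: 1%g; g; h]) ->
 arS (sx 1 [:: e0; e1] [:: f0; f1] [:: 1%g; g]) = Arr F ->
 arS (sx 1 [:: e1; e2] [:: f1; f2] [:: 1%g; (h * g^-1)%g]) = Arr K ->
 arS (sx 1 [:: e0; e2] [:: f0; f2] [:: 1%g; h]) = Arr H ->
 exists p : (forall a, phom (K (F a)) (H a)), [/\ Cell p = ceS (sx 2 [:: e0; e1; e2] [:: f0; f1; f2] [:: 1%g; g; h]),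
  forall a, marked (p a) & forall a a' (f : phom a a'), pcmp (p a') (pfmor K (pfmor F f)) = pcmp (pfmor H f) (p a)].
Proof.
move=> v1 v2 /ceS_bd[]; have [-> -> ->] := sxf2 g h v1 v2 => gc bd h1 h2 h3.
rewrite h1 h2 h3 in bd; have [p pE] := cellP bd; exists p; rewrite -pE in gc *.
by case: gc.
Qed.

Lemma tetT (A0 A1 A2 A3 : cob) (F01 : mpfunctor A0 A1) (F12 : mpfunctor A1 A2)
  (F23 : mpfunctor A2 A3) (F02 : mpfunctor A0 A2) (F13 : mpfunctor A1 A3) (F03 : mpfunctor A0 A3)
  (p012 : forall a, phom (F12 (F01 a)) (F02 a)) (p023 : forall a, phom (F23 (F02 a)) (F03 a))
  (p013 : forall a, phom (F13 (F01 a)) (F03 a)) (p123 : forall a, phom (F23 (F12 a)) (F13 a))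
  e0 e1 e2 e3 f0 f1 f2 f3 g h l :
 valid 3 1 [:: e0; e1; e2; e3] -> valid 3 M [:: f0; f1; f2; f3] ->
 S1p (sx 3 [:: e0; e1; e2; e3] [:: f0; f1; f2; f3] [:: 1%g; g; h; l]) ->
 ceS (sx 2 [:: e0; e1; e2] [:: f0; f1; f2] [:: 1%g; g; h]) = Cell p012 ->
 ceS (sx 2 [:: e0; e2; e3] [:: f0; f2; f3] [:: 1%g; h; l]) = Cell p023 ->
 ceS (sx 2 [:: e0; e1; e3] [:: f0; f1; f3] [:: 1%g; g; l]) = Cell p013 ->
 ceS (sx 2 [:: e1; e2; e3] [:: f1; f2; f3] [:: 1; h * g^-1; l * g^-1]%g) = Cell p123 ->
 forall a, pcmp (p023 a) (pfmor F23 (p012 a)) = pcmp (p013 a) (p123 (F01 a)).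
Proof.
move=> v1 v2 /tetS; have [-> -> -> ->] := sxf3 g h l v1 v2 => T h1 h2 h3 h4.
by rewrite h1 h2 h3 h4 in T; apply: tet_inv T.
Qed.
Lemma S1pos n e f u : valid n 1 e -> valid n M f ->
 all (fun i => (nth 0 e i == 1) ==> (nth 0 f i != 0)) (iota 0 n.+1) -> S1p (sx n e f u).
Proof. by move=> v1 v2 al; apply: S1p_sx => //; rewrite /S1b al orbT. Qed.

Lemma ce_deg1 i k u : i <= k <= M -> S1p (sx 1 [:: 1; 1] [:: i; k] [:: 1%g; 1%g]) ->
 ceS (sx 2 [:: 1; 1; 1] [:: i; i; k] u) = idcl (arS (sx 1 [:: 1; 1] [:: i; k] [:: 1%g; 1%g])) /\
 ceS (sx 2 [:: 1; 1; 1] [:: i; k; k] u) = idcr (arS (sx 1 [:: 1; 1] [:: i; k] [:: 1%g; 1%g])).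
Proof.
move=> ik s; rewrite !(@sx_one G M 2 [:: 1; 1; 1] _ u [:: 1%g; 1%g; 1%g]) //.
have v : valid 1 M [:: i; k] by rewrite /valid /=; lia.
have [<- <-] := sxd2 (1%g : G) (isT : valid 1 1 [:: 1; 1]) v.
by rewrite ceS_degl // ceS_degr.
Qed.

Section Legs.
Variable j' : nat.
Notation j := j'.+1.
Hypothesis jM : j <= M.

(** The quotient keeps the group element on an edge between the two ends, so there is one leg for
    each label; [lD] and [le] will relate them. *)
Lemma legF g : exists F : mpfunctor A' (X j), Arr F = arS (sx 1 [:: 0; 1] [:: 0; j] [:: 1%g; g]).
Proof.
apply: arT => //; first by rewrite /valid /= jM.
by apply: S1pos => //; rewrite /valid /= jM.
exact: obS0.
Qed.
Definition lF g := sval (cid (legF g)).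
Lemma lFE g : arS (sx 1 [:: 0; 1] [:: 0; j] [:: 1%g; g]) = Arr (lF g).
Proof. by rewrite /lF; case: cid. Qed.

Lemma legD g h : exists p : (forall a, phom (mpfunctor_id (X j) (lF g a)) (lF h a)),
 [/\ Cell p = ceS (sx 2 [:: 0; 1; 1] [:: 0; j; j] [:: 1%g; g; h]),
  forall a, marked (p a) & forall a a' (f : phom a a'), pcmp (p a') (pfmor (lF g) f) = pcmp (pfmor (lF h) f) (p a)].
Proof.
apply: (@cellT A' (X j) (X j) (lF g) (mpfunctor_id (X j)) (lF h)) => //; rewrite ?lFE ?ar11 //; try by rewrite /valid /= jM leqnn.
by apply: S1pos => //; rewrite /valid /= jM leqnn.
Qed.
Definition lD g h : forall a, phom (lF g a) (lF h a) := sval (cid (legD g h)).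
Lemma lDE g h : ceS (sx 2 [:: 0; 1; 1] [:: 0; j; j] [:: 1%g; g; h]) =
 @Cell b A' (X j) (X j) (lF g) (mpfunctor_id (X j)) (lF h) (lD g h).
Proof. by rewrite /lD; case: cid => p []. Qed.
Lemma lDm g h a : marked (lD g h a).
Proof. by have [_ mk _] := svalP (cid (legD g h)); exact: (mk a). Qed.
Lemma lDn g h a a' (f : phom a a') : pcmp (lD g h a') (pfmor (lF g) f) = pcmp (pfmor (lF h) f) (lD g h a).
Proof. by rewrite /lD; case: cid => p []. Qed.

Lemma leg_e g k l (E : l = (k * g)%g) : exists p : (forall a, phom (lF k (mpfunctor_id A' a)) (lF l a)),
 [/\ Cell p = ceS (sx 2 [:: 0; 0; 1] [:: 0; 0; j] [:: 1%g; g; l]),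
  forall a, marked (p a) & forall a a' (f : phom a a'), pcmp (p a') (pfmor (lF k) f) = pcmp (pfmor (lF l) f) (p a)].
Proof.
apply: (@cellT A' A' (X j) (mpfunctor_id A') (lF k) (lF l)) => //; rewrite ?ar00 ?E ?mulgK ?lFE //; try by rewrite /valid /= jM.
by apply: S1pos => //; rewrite /valid /= jM.
Qed.
Definition le g k l (E : l = (k * g)%g) : forall a, phom (lF k a) (lF l a) := sval (cid (leg_e E)).
Lemma leE g k l (E : l = (k * g)%g) : ceS (sx 2 [:: 0; 0; 1] [:: 0; 0; j] [:: 1%g; g; l]) =
 @Cell b A' A' (X j) (mpfunctor_id A') (lF k) (lF l) (le E).
Proof. by rewrite /le; case: cid => p []. Qed.
Lemma lem g k l (E : l = (k * g)%g) a : marked (le E a).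
Proof. by have [_ mk _] := svalP (cid (leg_e E)); exact: (mk a). Qed.
Lemma len g k l (E : l = (k * g)%g) a a' (f : phom a a') : pcmp (le E a') (pfmor (lF k) f) = pcmp (pfmor (lF l) f) (le E a).
Proof. by rewrite /le; case: cid => p []. Qed.

(** This and the next two lemmas are the relations demanded by [Ind], each being the cocycle
    condition of one 3-simplex of the cone. *)
Lemma lRa g h l a : pcmp (lD h l a) (lD g h a) = lD g l a.
Proof.
have s : S1p (sx 1 [:: 1; 1] [:: j; j] [:: 1%g; 1%g]).
by apply: S1pos => //; rewrite /valid /= jM leqnn.
have jj : j <= j <= M by rewrite leqnn.
have [E _] := ce_deg1 [:: 1; h * g^-1; l * g^-1]%g jj s.
rewrite ar11 // in E.
rewrite -[RHS]pcmpm1.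
apply: (@tetT A' (X j) (X j) (X j) (lF g) (mpfunctor_id _) (mpfunctor_id _) (lF h) (mpfunctor_id _) (lF l)
(lD g h) (lD h l) (lD g l) (fun a => pid _) _ _ _ _ _ _ _ _ _ _ _ _ _ _ (lDE g h) (lDE h l) (lDE g l) E a) => //.
by rewrite /valid /= jM leqnn.
by apply: S1pos => //; rewrite /valid /= jM leqnn.
Qed.

Lemma lRb g k l k' l' (p : l = (k * g)%g) (p' : l' = (k' * g)%g) a :
 pcmp (lD l l' a) (le p a) = pcmp (le p' a) (lD k k' a).
Proof.
have E := lDE k k'; rewrite -{1}(mulgK g k) -{1}(mulgK g k') -p -p' in E.
apply: (@tetT A' A' (X j) (X j) (mpfunctor_id _) (lF k) (mpfunctor_id _) (lF l) (lF k') (lF l')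
(le p) (lD l l') (le p') (lD k k') _ _ _ _ _ _ _ _ _ _ _ _ _ _ (leE p) (lDE l l') (leE p') E a) => //.
by rewrite /valid /= jM leqnn.
by apply: S1pos => //; rewrite /valid /= jM leqnn.
Qed.

Lemma lRc g h k m l (p1 : l = (m * g)%g) (p2 : m = (k * h)%g) (p3 : l = (k * (h * g))%g) a :
 pcmp (le p1 a) (le p2 a) = le p3 a.
Proof.
have E := leE p2; rewrite -{1}(mulgK g h) -{1}(mulgK g m) -p1 in E.
have E0 : ceS (sx 2 [:: 0; 0; 0] [:: 0; 0; 0] [:: 1; g; h * g]%g) = idcl (arr1 A').
rewrite (@sx_zero G M 2 [:: 0; 0; 0] _ _ [:: 0; 0; 0] [:: 1%g; 1%g; 1%g]) //.
have [<- _] := sxd2 (1%g : G) (isT : valid 1 1 [:: 0; 0]) (isT : valid 1 M [:: 0; 0]).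
by rewrite ceS_degl ?ar00 //; apply: (@S1_0 1).
have T := (@tetT A' A' A' (X j) (mpfunctor_id _) (mpfunctor_id _) (lF k) (mpfunctor_id _) (lF m) (lF l)
(fun a => pid _) (le p3) (le p1) (le p2) 0 0 0 1 0 0 0 j g (h * g)%g l isT _ _ E0 (leE p3) (leE p1) E a).
rewrite -T ?pfmor1 ?pcmpm1 //; first by rewrite /valid /= jM.
by apply: S1pos => //; rewrite /valid /= jM.
Qed.
End Legs.
End Stage2.

Section Stage2End.
Variables (b : bool) (G : groupType) (M : nat).
Hypothesis M0 : 0 < M.
Variable A : nerve (Cb b) 0.
Notation cob := (cob b).
Notation BGn := (nerve (BG G)).
Notation A' := (nob A ord0).
Notation gA k t := (gam (degenerate _ A) k t).
Notation So := (sho (BG G)).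
Notation sob a := (@SharpOb _ (BG G) a Datatypes.tt).
Notation Z := (Z G M).
Notation sx := (@sx G M).
Variable kap1 : smap (@ZS G M M0) (D2 b).
Hypothesis hG : forall n (x : ZS G M0 n), (forall i, zf (sval x) i = ord0) ->
 kap1 n x = gA (zk (sval x)) (dcomp d12 (ze (sval x))).
Notation obS := (obS A kap1).
Notation arS := (arS A kap1).
Notation ceS := (ceS A kap1).
Notation X := (X A kap1).
Notation goal := (exists h : smap Z (D2 b), forall n (x : ZS G M0 n), h n (sval x) = kap1 n x).

(** What [d2_extend] still asks for after the first stage; each of the cases M = 1, 2, 3 has to
    supply one new kind of datum or equation. *)
Lemma ext2 (ar : Z 1 -> arr b) (ce : Z 2 -> cell b) :
 (forall e, S1p e -> ar e = arS e) -> (forall s, S1p s -> ce s = ceS s) ->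
 (forall e, ~ S1p e -> aS (ar e) = obS (source e) /\ aT (ar e) = obS (target e)) ->
 (forall s, ~ S1p s -> nondeg s -> goodc (ce s) /\
   cell_bd (ce s) (ar (act d01 s)) (ar (act d12 s)) (ar (act d02 s))) ->
 (forall e, ~ S1p e -> ce (act (ddeg ord0) e) = idcl (ar e)) ->
 (forall e, ~ S1p e -> ce (act (ddeg ord_max) e) = idcr (ar e)) ->
 (forall t : Z 3, ~ S1p t -> nondeg t -> tet (ce (act (dfc ord_max) t)) (ce (act (dfc o1_4) t))
   (ce (act (dfc o2_4) t)) (ce (act (dfc ord0) t))) -> goal.
Proof.
move=> h1 h2 h3 h4 h5 h6 h7; pose P : partmap Z (D2 b) := pm_sub kap1.
have dP n (x : Z n) : pdom P x <-> S1p x by split=> [[y [p _]]//|p]; exists (kap1 n (exist _ x p)), p.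
have [||||||||h [hE _ _]] := @d2_extend b Z P ar ce.
- by move=> v; apply/dP; apply: (S1p_v M0).
- by move=> e y [p <-]; rewrite h1 // (arSE A kap1 p).
- by move=> s y [p <-]; rewrite h2 // (ceSE A kap1 p).
- by move=> e y y' /dP ne [p <-] [p' <-]; rewrite -(obSE A kap1 p) -(obSE A kap1 p'); apply: h3.
- by move=> s /dP ns nd; apply: h4.
- by move=> e /dP ne; apply: h5.
- by move=> e /dP ne; apply: h6.
- by move=> t /dP nt nd; apply: h7.
by exists h => n [x p]; apply: hE; exists p.
Qed.

Section One.
Hypothesis ME : M = 1.
Notation F := (lF hG M0).
Notation D := (lD hG M0).

(** The universal property in dimension 1: the legs at the vertex 1 with their comparisons induce
    the missing functor out of [A # BG]. *)
Definition I1 : mpfunctor (So A') (X 1) :=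
 @Ind b G A' (X 1) F D (fun g k l p => le hG M0 p) (lDm hG M0) (fun g k l p a => lem hG M0 p a) (lDn hG M0)
  (fun g k l p a a' f => len hG M0 p f) (lRa hG M0) (fun g k l k' l' p p' a => lRb hG M0 p p' a)
  (fun g h k m l p1 p2 p3 a => lRc hG M0 p1 p2 p3 a).

Definition ar1 (e : Z 1) : arr b := if pselect (S1p e) then arS e else Arr I1.
Definition newc h : cell b := @Cell b A' (So A') (X 1) (iA G A') I1 (F h) (fun a => D 1%g h a).
(** The first component of a new triangle decides: over the end 1 it is a degeneracy of the edge
    [I1], otherwise its cell is [D 1 h], since [I1] restricts on [A] to the leg labelled 1. *)
Definition ce1 (s : Z 2) : cell b := if pselect (S1p s) then ceS s else
 if ze s ord0 == ord_max then (if zf s o1_3 == ord0 then idcl (Arr I1) else idcr (Arr I1))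
 else newc (kv (zk s) ord0 ord_max).

Lemma ar1S e : S1p e -> ar1 e = arS e. Proof. by rewrite /ar1; case: pselect. Qed.
Lemma ce1S s : S1p s -> ce1 s = ceS s. Proof. by rewrite /ce1; case: pselect. Qed.
Lemma s1 n e f u : valid n 1 e -> valid n 1 f -> S1b 1 n e f -> S1p (sx n e f u).
Proof. by move=> v1 v2 v3; apply: S1p_sx => //; rewrite ME. Qed.
Lemma s1N n e f u : valid n 1 e -> valid n 1 f -> ~~ S1b 1 n e f -> ~ S1p (sx n e f u).
Proof. by move=> v1 v2 v3; apply: S1p_sxN => //; rewrite ME. Qed.
Lemma ar1_01 u : ar1 (sx 1 [:: 1; 1] [:: 0; 1] u) = Arr I1.
Proof. by rewrite /ar1; case: pselect => // h; case: (@s1N 1 [:: 1; 1] [:: 0; 1] u isT isT isT h). Qed.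

Lemma ce1_new g h : ce1 (sx 2 [:: 0; 1; 1] [:: 0; 0; 1] [:: 1%g; g; h]) = newc h.
Proof.
rewrite /ce1; case: (pselect (S1p _)) => [s|ns]; first by case: (@s1N 2 [:: 0; 1; 1] [:: 0; 0; 1] [:: 1%g; g; h] isT isT isT s).
rewrite (_ : _ == _ = false); last by apply/eqP => /(f_equal (@nat_of_ord _)); rewrite ze_sx.
by rewrite zk_sx // kvBGc //= invg1 mulg1.
Qed.

Lemma ce1_l u : ce1 (sx 2 [:: 1; 1; 1] [:: 0; 0; 1] u) = idcl (Arr I1).
Proof.
rewrite /ce1; case: (pselect (S1p _)) => [s|ns]; first by case: (@s1N 2 [:: 1; 1; 1] [:: 0; 0; 1] u isT isT isT s).
rewrite (_ : _ == _ = true); last by apply/eqP; apply: ord_inj; rewrite ze_sx.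
by rewrite (_ : _ == _ = true) //; apply/eqP; apply: ord_inj; rewrite zf_sx //= /valid ME.
Qed.

Lemma ce1_r u : ce1 (sx 2 [:: 1; 1; 1] [:: 0; 1; 1] u) = idcr (Arr I1).
Proof.
rewrite /ce1; case: (pselect (S1p _)) => [s|ns]; first by case: (@s1N 2 [:: 1; 1; 1] [:: 0; 1; 1] u isT isT isT s).
rewrite (_ : _ == _ = true); last by apply/eqP; apply: ord_inj; rewrite ze_sx.
by rewrite (_ : _ == _ = false) //; apply/eqP => /(f_equal (@nat_of_ord _)); rewrite zf_sx //= /valid ME.
Qed.

Lemma only1 e : ~ S1p e -> exists g, e = sx 1 [:: 1; 1] [:: 0; 1] [:: 1%g; g].
Proof.
case/facts1=> e0 [e1 [f0 [f1 [g [E [a1 a2 a3 a4] h1 h2]]]]]; exists g; rewrite E.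
have h3 := h2 1 M0; have h4 := h2 0 isT; rewrite ME in a4.
have -> : e0 = 1 by lia.
have -> : e1 = 1 by lia.
have -> : f0 = 0 by lia.
by have -> : f1 = 1 by lia.
Qed.

Lemma stage2_1 : goal.
Proof.
have v2 f0 f1 f2 : f0 <= f1 -> f1 <= f2 -> f2 <= 1 -> valid 2 M [:: f0; f1; f2] by rewrite /valid ME /=; lia.
have v1 : valid 1 M [:: 0; 1] by rewrite /valid ME.
apply: (@ext2 ar1 ce1); [exact: ar1S|exact: ce1S| | | | |].
- move=> e /only1[g ->]; rewrite ar1_01 /source /target !sx_vert //=; split=> //.
exact: (esym (X0 hG)).
- move=> s ns nd; have [e0 [e1 [e2 [f0 [f1 [f2 [g [h [E [a1 a2 a3 [a4 a5 a6]] h1 h2 h3]]]]]]]]] := facts2 ns nd.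
have h4 := h2 1 M0; have h5 := h2 0 isT; rewrite ME in a6.
have [q1 q2 q3] : [/\ e0 = 0, e1 = 1 & e2 = 1] by split; lia.
have [q4 q5 q6] : [/\ f0 = 0, f1 = 0 & f2 = 1] by split; lia.
subst s e0 e1 e2 f0 f1 f2; rewrite ce1_new; have [-> -> ->] := sxf2 g h (isT : valid 2 1 [:: 0; 1; 1]) (v2 0 0 1 isT isT isT).
split.
split=> [a|a a' f]; first exact: lDm.
change (pcmp (D 1%g h a') (pfmor I1 (pfmor (iA G A') f)) = pcmp (pfmor (F h) f) (D 1%g h a)).
by rewrite Ind_iA lDn.
rewrite ar1_01 !ar1S; try exact: s1.
by rewrite (ar_iA hG) lFE.
- move=> e /only1[g ->]; rewrite ar1_01; have [-> _] := sxd2 g (isT : valid 1 1 [:: 1; 1]) v1; exact: ce1_l.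
- move=> e /only1[g ->]; rewrite ar1_01; have [_ ->] := sxd2 g (isT : valid 1 1 [:: 1; 1]) v1; exact: ce1_r.
move=> s ns nd; have [e0 [e1 [e2 [e3 [f0 [f1 [f2 [f3 [g [h [l [E [a1 a2 a3 a4 [a5 a6 a7 a8]] h1 h2 h3]]]]]]]]]]]] := facts3 ns nd.
have h4 := h2 1 M0; have h5 := h2 0 isT; rewrite ME in a8.
have q0 : e0 = 0 by case: (e0 =P 1) => [/h3[]|]; lia.
have [q1 q2 q3] : [/\ e0 = 0, e3 = 1 & f0 = 0 /\ f3 = 1] by split; lia.
(* Three tetrahedra remain: one is compatibility with twists, one is trivial, and one is composition
   of the comparisons [D]. *)
have q : [/\ e1 = 0, e2 = 1, f1 = 0 & f2 = 0] \/ [/\ e1 = 1, e2 = 1, f1 = 0 & f2 = 0] \/ [/\ e1 = 1, e2 = 1, f1 = 0 & f2 = 1].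
have [|[|]] : (e1 = 0 /\ e2 = 1 /\ f1 = 0 /\ f2 = 0) \/ (e1 = 1 /\ e2 = 1 /\ f1 = 0 /\ f2 = 0) \/ (e1 = 1 /\ e2 = 1 /\ f1 = 0 /\ f2 = 1) by lia.
- by case=> ? [? [? ?]]; left.
- by case=> ? [? [? ?]]; right; left.
- by case=> ? [? [? ?]]; right; right.
have v3 i j : i <= j -> j <= 1 -> valid 3 M [:: 0; i; j; 1] by rewrite /valid ME /=; lia.
case: q3 => ? ?; case: q => [[? ? ? ?]|[[? ? ? ?]|[? ? ? ?]]]; subst s e0 e1 e2 e3 f0 f1 f2 f3.
- have [-> -> -> ->] := sxf3 g h l (isT : valid 3 1 [:: 0; 0; 1; 1]) (v3 0 0 isT isT).
have El : l = ((l * g^-1) * g)%g by rewrite mulgVK.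
rewrite !ce1_new !ce1S; try exact: s1.
rewrite (ce_tw hG) (leE hG M0 El).
apply: (@Tet b A' A' (So A') (X 1) (mpfunctor_id A') (iA G A') I1 (iA G A') (F (l * g^-1)%g) (F l)
(fun a => tw a g^-1%g) (fun a => D 1%g l a) (le hG M0 El) (fun a => D 1%g (l * g^-1)%g a)) => a.
exact: Ind_twV.
- have [-> -> -> ->] := sxf3 g h l (isT : valid 3 1 [:: 0; 1; 1; 1]) (v3 0 0 isT isT).
rewrite !ce1_new ce1_l !ce1S; try exact: s1.
rewrite (ce_011 hG).
apply: (@Tet b A' (So A') (So A') (X 1) (iA G A') (mpfunctor_id _) I1 (iA G A') I1 (F l)
(fun a => pid _) (fun a => D 1%g l a) (fun a => D 1%g l a) (fun a => pid _)) => a.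
by rewrite pfmor1.
- have [-> -> -> ->] := sxf3 g h l (isT : valid 3 1 [:: 0; 1; 1; 1]) (v3 0 1 isT isT).
rewrite !ce1_new ce1_r !ce1S; try exact: s1.
rewrite lDE.
apply: (@Tet b A' (So A') (X 1) (X 1) (iA G A') I1 (mpfunctor_id _) (F h) I1 (F l)
(fun a => D 1%g h a) (lD hG M0 h l) (fun a => D 1%g l a) (fun a => pid _)) => a.
by rewrite [RHS]pcmpm1; apply: lRa.
Qed.
End One.

Section Multi.
Hypothesis M2 : 1 < M.

(** For [M] at least 2, two vertices do not exhaust the M-simplex, so the simplex lies in the
    boundary. *)
Lemma S1two n e f u i j : valid n 1 e -> valid n M f -> size f = n.+1 ->
 all (fun v => (v == i) || (v == j)) f -> S1p (sx n e f u).
Proof.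
move=> v1 v2 sz al; apply: S1p_sx => //; apply/orP; right.
have [k [kM ki kj]] : exists k, [/\ k <= M, k <> i & k <> j].
have : (0 <> i /\ 0 <> j) \/ (1 <> i /\ 1 <> j) \/ (2 <> i /\ 2 <> j) by lia.
by case=> [[? ?]|[[? ?]|[? ?]]]; [exists 0|exists 1|exists 2]; split=> //; apply: ltnW.
apply/hasP; exists k; first by rewrite mem_iota.
apply/allP => p; rewrite mem_iota add0n -sz => pz.
by apply/eqP => E; have /orP[/eqP|/eqP] := all_nthP 0 al p pz; rewrite E.
Qed.

Section XLeg.
Variable j' : nat.
Notation j := j'.+1.
Hypothesis jM : j <= M.
Notation F := (lF hG jM).

Lemma legX0 : exists F : mpfunctor (So A') (X j), Arr F = arS (sx 1 [:: 1; 1] [:: 0; j] [:: 1%g; 1%g]).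
Proof.
have v : valid 1 M [:: 0; j] by rewrite /valid /= jM.
apply: arT => //; last exact: (X0 hG).
by apply: (@S1two _ _ _ _ 0 j) => //=; rewrite ?eqxx ?orbT.
Qed.
Definition x0 := sval (cid legX0).
Lemma x0E u : arS (sx 1 [:: 1; 1] [:: 0; j] u) = Arr x0.
Proof. by rewrite (@sx_one G M 1 [:: 1; 1] _ u [:: 1%g; 1%g]) // /x0; case: cid. Qed.

Lemma legE g h : exists p : (forall a, phom (x0 (iA G A' a)) (F h a)),
 [/\ Cell p = ceS (sx 2 [:: 0; 1; 1] [:: 0; 0; j] [:: 1%g; g; h]),
  forall a, marked (p a) & forall a a' (f : phom a a'), pcmp (p a') (pfmor x0 (pfmor (iA G A') f)) = pcmp (pfmor (F h) f) (p a)].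
Proof.
have v : valid 2 M [:: 0; 0; j] by rewrite /valid /= jM.
apply: cellT => //; rewrite ?(ar_iA hG) ?x0E ?lFE //.
by apply: (@S1two _ _ _ _ 0 j) => //=; rewrite ?eqxx ?orbT.
Qed.
Definition lE g h : forall a, phom (x0 (iA G A' a)) (F h a) := sval (cid (legE g h)).
Lemma lEE g h : ceS (sx 2 [:: 0; 1; 1] [:: 0; 0; j] [:: 1%g; g; h]) = Cell (lE g h).
Proof. by rewrite /lE; case: cid => p []. Qed.
Lemma lEm g h a : marked (lE g h a).
Proof. by have [_ mk _] := svalP (cid (legE g h)); exact: (mk a). Qed.
Lemma lEn g h a a' (f : phom a a') : pcmp (lE g h a') (pfmor x0 (pfmor (iA G A') f)) = pcmp (pfmor (F h) f) (lE g h a).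
Proof. by have [_ _ nt] := svalP (cid (legE g h)); exact: (nt a a' f). Qed.
Let v3 (f1 f2 : nat) : f1 <= f2 <= j -> valid 3 M [:: 0; f1; f2; j].
Proof. by rewrite /valid /=; lia. Qed.
Let s3 e f1 f2 u : valid 3 1 e -> (f1 == 0) || (f1 == j) -> (f2 == 0) || (f2 == j) -> f1 <= f2 <= j ->
 S1p (sx 3 e [:: 0; f1; f2; j] u).
Proof.
move=> v h1 h2 h3; apply: (@S1two _ _ _ _ 0 j) => //; first exact: v3.
by rewrite /= h1 h2 ?eqxx ?orbT.
Qed.
Let sj : S1p (sx 1 [:: 1; 1] [:: 0; j] [:: 1%g; 1%g]).
Proof. by apply: (@S1two _ _ _ _ 0 j) => //=; rewrite ?eqxx ?orbT // /valid /= jM. Qed.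

(** The label on the edge into the vertex 0 is compared by an identity cell, by [ce_011], so it does
    not affect the cell. *)
Lemma lEr g h a : lE g h a = lE 1%g h a.
Proof.
have [E _] := ce_deg1 A kap1 [:: 1; 1 * g^-1; h * g^-1]%g (jM : 0 <= j <= M) sj; rewrite x0E in E.
have := @tetT b G M M0 A kap1 A' (So A') (So A') (X j) (iA G A') (mpfunctor_id _) x0 (iA G A') x0 (F h)
(fun a => pid _) (lE 1%g h) (lE g h) (fun a => pid _) 0 1 1 1 0 0 0 j g 1%g h isT (@v3 0 0 isT)
(@s3 [:: 0; 1; 1; 1] 0 0 _ isT isT isT isT) (ce_011 hG _ _) (lEE _ _) (lEE _ _) E a.
by rewrite pfmor1 !pcmpm1.
Qed.

Lemma lEd g h l a : pcmp (lD hG jM h l a) (lE g h a) = lE g l a.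
Proof.
have [_ E] := ce_deg1 A kap1 [:: 1; h * g^-1; l * g^-1]%g (jM : 0 <= j <= M) sj; rewrite x0E in E.
have jj : 0 <= j <= j by rewrite leqnn.
rewrite -[RHS]pcmpm1.
exact: (@tetT b G M M0 A kap1 A' (So A') (X j) (X j) (iA G A') x0 (mpfunctor_id _) (F h) x0 (F l)
(lE g h) (lD hG jM h l) (lE g l) (fun a => pid _) 0 1 1 1 0 0 j j g h l isT (v3 jj)
(@s3 [:: 0; 1; 1; 1] 0 j _ isT isT (eqxx j) jj) (lEE _ _) (lDE _ _ _ _) (lEE _ _) E a).
Qed.

Lemma lEt g a : pcmp (lE 1%g g a) (pfmor x0 (tw a g^-1)%g) = pcmp (le hG jM (esym (mul1g g)) a) (lE 1%g 1%g a).
Proof.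
rewrite -(lEr g g a).
have E : ceS (sx 2 [:: 0; 1; 1] [:: 0; 0; j] [:: 1; g * g^-1; g * g^-1]%g) = Cell (lE 1%g 1%g) by rewrite !mulgV lEE.
exact: (@tetT b G M M0 A kap1 A' A' (So A') (X j) (mpfunctor_id _) (iA G A') x0 (iA G A') (F 1%g) (F g)
(fun a => tw a g^-1)%g (lE g g) (le hG jM (esym (mul1g g))) (lE 1%g 1%g) 0 0 1 1 0 0 0 j g g g isT (@v3 0 0 isT)
(@s3 [:: 0; 0; 1; 1] 0 0 _ isT isT isT isT) (ce_tw hG _ _) (lEE _ _) (leE _ _ _) E a).
Qed.
End XLeg.

Section CLeg.
Variables i' j' : nat.
Notation i := i'.+1.
Notation j := j'.+1.
Hypotheses (ij : i <= j) (jM : j <= M) (iM : i <= M).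

Let v2 : valid 2 M [:: 0; i; j].
Proof. by rewrite /valid /= ij jM iM. Qed.

Lemma legXX : exists F : mpfunctor (X i) (X j), Arr F = arS (sx 1 [:: 1; 1] [:: i; j] [:: 1%g; 1%g]).
Proof.
have v : valid 1 M [:: i; j] by rewrite /valid /= ij jM iM.
by apply: arT => //; apply: S1pos.
Qed.
Definition xx := sval (cid legXX).
Lemma xxE u : arS (sx 1 [:: 1; 1] [:: i; j] u) = Arr xx.
Proof. by rewrite (@sx_one G M 1 [:: 1; 1] _ u [:: 1%g; 1%g]) // /xx; case: cid. Qed.

Lemma legC g h : exists p : (forall a, phom (xx (lF hG iM g a)) (lF hG jM h a)),
 [/\ Cell p = ceS (sx 2 [:: 0; 1; 1] [:: 0; i; j] [:: 1%g; g; h]),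
  forall a, marked (p a) & forall a a' (f : phom a a'), pcmp (p a') (pfmor xx (pfmor (lF hG iM g) f)) = pcmp (pfmor (lF hG jM h) f) (p a)].
Proof. by apply: cellT => //; rewrite ?xxE ?lFE //; apply: S1pos. Qed.
Definition lC g h : forall a, phom (xx (lF hG iM g a)) (lF hG jM h a) := sval (cid (legC g h)).
Lemma lCE g h : ceS (sx 2 [:: 0; 1; 1] [:: 0; i; j] [:: 1%g; g; h]) = Cell (lC g h).
Proof. by rewrite /lC; case: cid => p []. Qed.
Lemma lCm g h a : marked (lC g h a).
Proof. by have [_ mk _] := svalP (cid (legC g h)); exact: (mk a). Qed.
Lemma lCn g h a a' (f : phom a a') : pcmp (lC g h a') (pfmor xx (pfmor (lF hG iM g) f)) = pcmp (pfmor (lF hG jM h) f) (lC g h a).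
Proof. by have [_ _ nt] := svalP (cid (legC g h)); exact: (nt a a' f). Qed.
Let sij : S1p (sx 1 [:: 1; 1] [:: i; j] [:: 1%g; 1%g]).
Proof. by apply: S1pos => //; rewrite /valid /= ij jM iM. Qed.
Let ijM : i <= j <= M. Proof. by rewrite ij. Qed.

Lemma lC1 g h l a : pcmp (lC h l a) (pfmor xx (lD hG iM g h a)) = lC g l a.
Proof.
have [E _] := ce_deg1 A kap1 [:: 1; h * g^-1; l * g^-1]%g ijM sij; rewrite xxE in E.
have v : valid 3 M [:: 0; i; i; j] by rewrite /valid /= leqnn ij jM iM.
have s := @S1pos G M M0 3 [:: 0; 1; 1; 1] _ [:: 1%g; g; h; l] isT v isT.
rewrite -[RHS]pcmpm1.
exact: (@tetT b G M M0 A kap1 A' (X i) (X i) (X j) (lF hG iM g) (mpfunctor_id _) xx (lF hG iM h) xx (lF hG jM l)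
(lD hG iM g h) (lC h l) (lC g l) (fun a => pid _) 0 1 1 1 0 i i j g h l isT v s (lDE _ _ _ _) (lCE _ _) (lCE _ _) E a).
Qed.

Lemma lC2 g h l a : pcmp (lD hG jM h l a) (lC g h a) = lC g l a.
Proof.
have [_ E] := ce_deg1 A kap1 [:: 1; h * g^-1; l * g^-1]%g ijM sij; rewrite xxE in E.
have v : valid 3 M [:: 0; i; j; j] by rewrite /valid /= leqnn ij jM iM.
have s := @S1pos G M M0 3 [:: 0; 1; 1; 1] _ [:: 1%g; g; h; l] isT v isT.
rewrite -[RHS]pcmpm1.
exact: (@tetT b G M M0 A kap1 A' (X i) (X j) (X j) (lF hG iM g) xx (mpfunctor_id _) (lF hG jM h) xx (lF hG jM l)
(lC g h) (lD hG jM h l) (lC g l) (fun a => pid _) 0 1 1 1 0 i j j g h l isT v s (lCE _ _) (lDE _ _ _ _) (lCE _ _) E a).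
Qed.

Lemma lC3 g a : pcmp (lC g g a) (pfmor xx (le hG iM (esym (mul1g g)) a)) = pcmp (le hG jM (esym (mul1g g)) a) (lC 1%g 1%g a).
Proof.
have E : ceS (sx 2 [:: 0; 1; 1] [:: 0; i; j] [:: 1; g * g^-1; g * g^-1]%g) = Cell (lC 1%g 1%g) by rewrite !mulgV lCE.
have v : valid 3 M [:: 0; 0; i; j] by rewrite /valid /= ij jM iM.
have s := @S1pos G M M0 3 [:: 0; 0; 1; 1] _ [:: 1%g; g; g; g] isT v isT.
exact: (@tetT b G M M0 A kap1 A' A' (X i) (X j) (mpfunctor_id _) (lF hG iM 1%g) xx (lF hG iM g) (lF hG jM 1%g) (lF hG jM g)
(le hG iM (esym (mul1g g))) (lC g g) (le hG jM (esym (mul1g g))) (lC 1%g 1%g) 0 0 1 1 0 0 i j g g g isT v s (leE _ _ _) (lCE _ _) (leE _ _ _) E a).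
Qed.
(** In dimension 2 the missing cell is a transformation of functors out of [A # BG]; it is
    determined by its restriction to the legs. *)
Definition ph : forall a : So A', phom (xx (x0 iM a)) (x0 jM a) := phi (lE iM) lC (lEm jM).
Lemma phE g h l a : pcmp (lC h l a) (pfmor xx (lE iM g h a)) = pcmp (lE jM g l a) (ph (sob a)).
Proof. exact: (phiE (lEm jM) (lEr iM) (lEr jM) (lEd iM) (lEd jM) lC1 lC2). Qed.
Lemma ph_good : goodc (@Cell b (So A') (X i) (X j) (x0 iM) xx (x0 jM) ph).
Proof.
split=> [a|a a' f]; first exact: (phi_marked (lEm jM) (lEm iM) lCm).
exact: (phi_nat (lEm jM) (lEn iM) (lEn jM) lCn (lEr iM) (lEr jM) (lEd iM) (lEd jM) lC1 lC2 (lEt iM) (lEt jM) lC3).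
Qed.
End CLeg.
End Multi.

(** The missing triangle has vertices 0, 1, 2 over the end 1 and is filled by [ph]. The missing
    tetrahedron repeats the vertex 0 at both ends; its equation is [phE]. *)
Lemma stage2_2 : M = 2 -> goal.
Proof.
move=> ME; have M2 : 1 < M by rewrite ME.
pose cphi := @Cell b (So A') (X 1) (X 2) (x0 M2 M0) (xx (isT : 1 <= 2) M2 M0) (x0 M2 M2) (ph M2 (isT : 1 <= 2) M2 M0).
pose ce (s : Z 2) : cell b := if pselect (S1p s) then ceS s else cphi.
have ceS' s : S1p s -> ce s = ceS s by rewrite /ce; case: pselect.
have v2 : valid 2 M [:: 0; 1; 2] by rewrite /valid ME.
have ceN u : ce (sx 2 [:: 1; 1; 1] [:: 0; 1; 2] u) = cphi.
rewrite /ce; case: (pselect (S1p _)) => // h; exfalso; apply: (@S1p_sxN G M 2 [:: 1; 1; 1] [:: 0; 1; 2] u) h => //.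
by rewrite ME.
have no1 (e : Z 1) : ~ S1p e -> False by move/nS1_size; rewrite ME.
apply: (@ext2 arS ce) => //; try (by move=> e /no1).
- move=> s ns nd; have [e0 [e1 [e2 [f0 [f1 [f2 [g [h [E [a1 a2 a3 [a4 a5 a6]] h1 h2 h3]]]]]]]]] := facts2 ns nd.
have h4 := h2 0 isT; have h5 := h2 1 M0; have h6 := h2 2 M2; rewrite ME in a6.
have [q4 q5 q6] : [/\ f0 = 0, f1 = 1 & f2 = 2] by split; lia.
have [q1 q2 q3] : [/\ e0 = 1, e1 = 1 & e2 = 1] by split; lia.
subst s e0 e1 e2 f0 f1 f2; rewrite ceN; have [-> -> ->] := sxf2 g h (isT : valid 2 1 [:: 1; 1; 1]) v2.
split; first exact: ph_good.
by rewrite (x0E M2 M0) (x0E M2 M2) (xxE (isT : 1 <= 2) M2 M0); split.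
move=> s ns nd; have [e0 [e1 [e2 [e3 [f0 [f1 [f2 [f3 [g [h [l [E [a1 a2 a3 a4 [a5 a6 a7 a8]] h1 h2 h3]]]]]]]]]]]] := facts3 ns nd.
have h4 := h2 0 isT; have h5 := h2 1 M0; have h6 := h2 2 M2; rewrite ME in a8.
have q0 : e0 = 0.
by case: (e0 =P 1) => [/h3[]|]; lia.
have [q4 q5 q6 q7] : [/\ f0 = 0, f1 = 0, f2 = 1 & f3 = 2] by split; lia.
have [q1 q2 q3] : [/\ e1 = 1, e2 = 1 & e3 = 1] by split; lia.
subst s e0 e1 e2 e3 f0 f1 f2 f3; have v3 : valid 3 M [:: 0; 0; 1; 2] by rewrite /valid ME.
have [-> -> -> ->] := sxf3 g h l (isT : valid 3 1 [:: 0; 1; 1; 1]) v3.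
rewrite ceN !ceS'; try by apply: S1p_sx; rewrite // ?/valid ME.
rewrite (lEE M2 M0) (lEE M2 M2) (lCE (isT : 1 <= 2) M2 M0).
apply: (@Tet b A' (So A') (X 1) (X 2) (iA G A') (x0 M2 M0) (xx (isT : 1 <= 2) M2 M0)
(lF hG _ h) (x0 M2 M2) (lF hG M2 l) (lE M2 _ g h) (lC (isT : 1 <= 2) M2 M0 h l) (lE M2 M2 g l) (ph M2 (isT : 1 <= 2) M2 M0)) => a.
exact: phE.
Qed.

(** All cells are given; missing is the equation of the tetrahedron over the end 1. After composing
    with an invertible leg cell it follows from four tetrahedra through the cone point and the
    naturality of [p123]. *)
Lemma stage2_3 : M = 3 -> goal.
Proof.
move=> ME; have M2 : 1 < M by rewrite ME.
have M3 : 2 < M by rewrite ME.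
have no n (x : Z n) : ~ S1p x -> 3 <= n by move/nS1_size; rewrite ME.
apply: (@ext2 arS ceS) => //; try (by move=> e /no).
move=> s ns nd; have [e0 [e1 [e2 [e3 [f0 [f1 [f2 [f3 [g [h [l [E [a1 a2 a3 a4 [a5 a6 a7 a8]] h1 h2 h3]]]]]]]]]]]] := facts3 ns nd.
have h4 := h2 0 isT; have h5 := h2 1 M0; have h6 := h2 2 M2; have h7 := h2 3 M3; rewrite ME in a8.
have [q4 q5 q6 q7] : [/\ f0 = 0, f1 = 1, f2 = 2 & f3 = 3] by split; lia.
have [q0 q1 q2 q3] : [/\ e0 = 1, e1 = 1, e2 = 1 & e3 = 1] by split; lia.
have v3 : valid 3 M [:: 0; 1; 2; 3] by rewrite /valid ME.
subst s e0 e1 e2 e3 f0 f1 f2 f3; have [-> -> -> ->] := sxf3 g h l (isT : valid 3 1 [:: 1; 1; 1; 1]) v3.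
have oE e f u u' : ceS (sx 2 [:: 1; 1; 1] f u) = e -> ceS (sx 2 [:: 1; 1; 1] f u') = e.
by rewrite (@sx_one G M 2 [:: 1; 1; 1] f u' u).
have [p12 [P12 _ _]] : exists p : (forall a, phom (xx (isT : 1 <= 2) M2 M0 (x0 M2 M0 a)) (x0 M2 M2 a)),
[/\ Cell p = ceS (sx 2 [:: 1; 1; 1] [:: 0; 1; 2] [:: 1%g; 1%g; 1%g]), forall a, marked (p a) & _] :=
@cellT b G M M0 A kap1 _ _ _ (x0 M2 M0) (xx (isT : 1 <= 2) M2 M0) (x0 M2 M2) 1 1 1 0 1 2 1%g 1%g isT (ltac:(by rewrite /valid ME))
(ltac:(by apply: S1p_sx; rewrite // ?/valid ME)) (x0E _ _ _) (xxE _ _ _ _) (x0E _ _ _).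
have [p13 [P13 _ _]] : exists p : (forall a, phom (xx (isT : 1 <= 3) M3 M0 (x0 M2 M0 a)) (x0 M2 M3 a)),
[/\ Cell p = ceS (sx 2 [:: 1; 1; 1] [:: 0; 1; 3] [:: 1%g; 1%g; 1%g]), forall a, marked (p a) & _] :=
@cellT b G M M0 A kap1 _ _ _ (x0 M2 M0) (xx (isT : 1 <= 3) M3 M0) (x0 M2 M3) 1 1 1 0 1 3 1%g 1%g isT (ltac:(by rewrite /valid ME))
(ltac:(by apply: S1p_sx; rewrite // ?/valid ME)) (x0E _ _ _) (xxE _ _ _ _) (x0E _ _ _).
have [p23 [P23 _ _]] : exists p : (forall a, phom (xx (isT : 2 <= 3) M3 M2 (x0 M2 M2 a)) (x0 M2 M3 a)),
[/\ Cell p = ceS (sx 2 [:: 1; 1; 1] [:: 0; 2; 3] [:: 1%g; 1%g; 1%g]), forall a, marked (p a) & _] :=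
@cellT b G M M0 A kap1 _ _ _ (x0 M2 M2) (xx (isT : 2 <= 3) M3 M2) (x0 M2 M3) 1 1 1 0 2 3 1%g 1%g isT (ltac:(by rewrite /valid ME))
(ltac:(by apply: S1p_sx; rewrite // ?/valid ME)) (x0E _ _ _) (xxE _ _ _ _) (x0E _ _ _).
have [p123 [P123 _ N123]] := @cellT b G M M0 A kap1 _ _ _ (xx (isT : 1 <= 2) M2 M0) (xx (isT : 2 <= 3) M3 M2) (xx (isT : 1 <= 3) M3 M0)
1 1 1 1 2 3 1%g 1%g isT (ltac:(by rewrite /valid ME)) (ltac:(by apply: S1p_sx; rewrite // ?/valid ME)) (xxE _ _ _ _) (xxE _ _ _ _) (xxE _ _ _ _).
have S3 e f u : valid 3 1 e -> valid 3 3 f -> S1b 3 3 e f -> S1p (sx 3 e f u).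
by move=> w1 w2 w3; apply: S1p_sx; rewrite // ME.
have V3 f : valid 3 3 f -> valid 3 M f by rewrite ME.
have T12 := @tetT b G M M0 A kap1 _ _ _ _ (iA G A') (x0 M2 M0) (xx (isT : 1 <= 2) M2 M0) (lF hG _ 1%g) (x0 M2 M2) (lF hG M2 1%g)
(lE M2 M0 1%g 1%g) (lC (isT : 1 <= 2) M2 M0 1%g 1%g) (lE M2 M2 1%g 1%g) p12 0 1 1 1 0 0 1 2 1%g 1%g 1%g isT (V3 [:: 0; 0; 1; 2] isT)
(@S3 [:: 0; 1; 1; 1] [:: 0; 0; 1; 2] _ isT isT isT) (lEE _ _ _ _) (lCE _ _ _ _ _) (lEE _ _ _ _) (oE _ _ _ _ (esym P12)).
have T13 := @tetT b G M M0 A kap1 _ _ _ _ (iA G A') (x0 M2 M0) (xx (isT : 1 <= 3) M3 M0) (lF hG _ 1%g) (x0 M2 M3) (lF hG M3 1%g)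
(lE M2 M0 1%g 1%g) (lC (isT : 1 <= 3) M3 M0 1%g 1%g) (lE M2 M3 1%g 1%g) p13 0 1 1 1 0 0 1 3 1%g 1%g 1%g isT (V3 [:: 0; 0; 1; 3] isT)
(@S3 [:: 0; 1; 1; 1] [:: 0; 0; 1; 3] _ isT isT isT) (lEE _ _ _ _) (lCE _ _ _ _ _) (lEE _ _ _ _) (oE _ _ _ _ (esym P13)).
have T23 := @tetT b G M M0 A kap1 _ _ _ _ (iA G A') (x0 M2 M2) (xx (isT : 2 <= 3) M3 M2) (lF hG _ 1%g) (x0 M2 M3) (lF hG M3 1%g)
(lE M2 M2 1%g 1%g) (lC (isT : 2 <= 3) M3 M2 1%g 1%g) (lE M2 M3 1%g 1%g) p23 0 1 1 1 0 0 2 3 1%g 1%g 1%g isT (V3 [:: 0; 0; 2; 3] isT)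
(@S3 [:: 0; 1; 1; 1] [:: 0; 0; 2; 3] _ isT isT isT) (lEE _ _ _ _) (lCE _ _ _ _ _) (lEE _ _ _ _) (oE _ _ _ _ (esym P23)).
have T := @tetT b G M M0 A kap1 _ _ _ _ (lF hG M0 1%g) (xx (isT : 1 <= 2) M2 M0) (xx (isT : 2 <= 3) M3 M2) (lF hG M2 1%g) (xx (isT : 1 <= 3) M3 M0) (lF hG M3 1%g)
(lC (isT : 1 <= 2) M2 M0 1%g 1%g) (lC (isT : 2 <= 3) M3 M2 1%g 1%g) (lC (isT : 1 <= 3) M3 M0 1%g 1%g) p123 0 1 1 1 0 1 2 3 1%g 1%g 1%g isT (V3 [:: 0; 1; 2; 3] isT)
(@S3 [:: 0; 1; 1; 1] [:: 0; 1; 2; 3] _ isT isT isT) (lCE _ _ _ _ _) (lCE _ _ _ _ _) (lCE _ _ _ _ _) (oE _ _ _ _ (esym P123)).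
rewrite (oE _ _ _ _ (esym P12)) (oE _ _ _ _ (esym P23)) (oE _ _ _ _ (esym P13)) (oE _ _ _ _ (esym P123)).
apply: (@Tet b (So A') (X 1) (X 2) (X 3) (x0 M2 M0) (xx (isT : 1 <= 2) M2 M0) (xx (isT : 2 <= 3) M3 M2) (x0 M2 M2) (xx (isT : 1 <= 3) M3 M0) (x0 M2 M3)
p12 p23 p13 p123) => -[a []].
apply: (iso_mono (marked_iso (lEm M2 M3 1%g 1%g a))).
rewrite pcmpA -[X in pcmp X _ = _]T23 -[LHS]pcmpA -[X in pcmp _ X = _]pfmorM -T12 pfmorM [LHS]pcmpA T -[LHS]pcmpA.
rewrite [RHS]pcmpA -[X in _ = pcmp X _]T13 -[RHS]pcmpA; congr (pcmp _ _).
exact: (N123 _ _ (lE M2 M0 1%g 1%g a)).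
Qed.

(** A simplex outside [S1p] maps onto the vertices of the M-simplex, so its dimension is at least
    [M], beyond what [D2] can see. *)
Lemma stage2_4 : 3 < M -> goal.
Proof.
move=> ME; have no n (x : Z n) : n <= 3 -> ~ S1p x -> False.
by move=> n3 /nS1_size h; have := leq_trans ME (leq_trans h n3); rewrite ltnn.
by apply: (@ext2 arS ceS) => //; move=> e /no => /(_ isT).
Qed.

Lemma stage2 : goal.
Proof.
have [h|[h|[h|h]]] : M = 1 \/ M = 2 \/ M = 3 \/ 3 < M by lia.
- exact: stage2_1.
- exact: stage2_2.
- exact: stage2_3.
exact: stage2_4.
Qed.
End Stage2End.

Section ConeFill.
Variables (b : bool) (G : groupType) (M : nat).
Hypothesis M0 : 0 < M.
Variable A : nerve (Cb b) 0.

(** The cocone at the vertex 0 is required to equal [Gam] on the nose; this is why boundaries coming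
    from [L] have to be deformed before they are filled. *)
Lemma cone_fill (kap : smap (@ZB G M M0) (D2 b)) :
 (forall n (x : ZB G M0 n), (forall i, zf (sval x) i = ord0) ->
   kap n x = gam (degenerate _ A) (zk (sval x)) (dcomp d12 (ze (sval x)))) ->
 exists h : smap (Z G M) (D2 b), forall n (x : ZB G M0 n), h n (sval x) = kap n x.
Proof.
move=> hk; have [k1 k1E] := stage1 (@quasi_D2 b) kap.
have [|h hE] := @stage2 b G M M0 A k1.
move=> n [x xs] x0; have xb : Zb x by exists ord_max => i; rewrite x0 => /esym; apply: (M1 M0).
by rewrite (k1E n x xs xb); apply: (hk n (exist _ x xb)).
exists h => n [x xb]; have xs : S1p x by right.
by rewrite -(k1E n x xs xb); apply: (hE n (exist _ x xs)).
Qed.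
End ConeFill.

(** * Transport of fillings and initiality of the cocone *)

Section Transport.
Variables (B X : sset) (A : forall m, B m -> Prop).
Hypotheses (Aact : forall m l (f : delta m l) (b : B l), A b -> A (act f b))
 (qX : quasicategory X).
Notation SA := (@ssub B A Aact).
Definition extends (a : smap SA X) := exists h : smap B X, forall n (x : SA n), h n (sval x) = a n x.

(** The homotopy on the subcomplex is extended to all of [B] starting from the known extension; its
    other end extends [a1]. *)
Lemma extends_eqv (a0 a1 : smap SA X) :
 eqve (sFun_vertex a0 : sFun SA X 0) (sFun_vertex a1) -> extends a0 -> extends a1.
Proof.
case=> e [eqe se te] [h hE].
have e0 n x : e n (x, dconst n ord0) = a0 n x.
have := f_equal (fun z : smap (sprod SA (simplex 0)) X => z n (x, dconst n ord0)) se.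
by rewrite /= => <-; congr (e n (x, _)); apply: delta_eq.
have e1 n x : e n (x, dconst n ord_max) = a1 n x.
have := f_equal (fun z : smap (sprod SA (simplex 0)) X => z n (x, dconst n ord0)) te.
by rewrite /= => <-; congr (e n (x, _)); apply: delta_eq.
have H : {H : partmap (sprod (simplex 1) B) X | forall n x y, H n x y <-> exists p : A x.2, e n (exist _ x.2 p, x.1) = y}.
unshelve eexists (@Partmap (sprod (simplex 1) B) X (fun n x y => exists p : A x.2, e n (exist _ x.2 p, x.1) = y) _ _); last by [].
- move=> m n f x _ [p <-]; exists (Aact f p); rewrite -smapP; congr (e m (_, _)); exact: sigE.
- by move=> n x y y' [p <-] [p' <-]; rewrite (pirr p p').
case: H => H HE; have [|||h' [h1 _ _]] := @hep B X A h qX Aact H.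
- by move=> m x; split=> [[y /HE[p _]]//|p]; exists (e m (exist _ x.2 p, x.1)); apply/HE; exists p.
- by move=> m b y /HE[/= p <-]; rewrite e0 -hE.
- move=> b p; exists (e 1 (degenerate 1 (exist _ b p : SA 0), did 1)); split; last exact: (smap_eqv (seval X (exist _ b p : SA 0)) eqe).
apply/HE; exists (Aact (dconst 1 ord0) p); congr (e 1 (_, _)); exact: sigE.
exists (@Smap B X (fun n x => h' n (dconst n ord_max, x)) (fun m n f x => smapP h' f (dconst n ord_max, x))) => n [x p].
by rewrite /= -e1; apply: h1; apply/HE; exists p.
Qed.
End Transport.

Section Core.
Variables (b : bool) (G : groupType) (L : sset).
Notation N := (nerve (Cb b)).
Notation BGn := (nerve (BG G)).
Notation D := (D2 b).
Variables (ell : smap N L) (s : smap D L) (r : smap L D) (u v : smap L L).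
Hypotheses (qL : quasicategory L)
 (ellW : forall e, nerve_class (@cweq b) e -> is_equivalence (ell 1 e))
 (sE : forall n x, s n (strict b n x) = ell n x)
 (rE : eqve (sFun_vertex (scomp r ell) : sFun N D 0) (sFun_vertex (strict b)))
 (sr1 : eqve (sFun_vertex (scomp s r) : sFun L L 0) (sFun_vertex u))
 (sr2 : eqve (sFun_vertex u : sFun L L 0) (sFun_vertex v))
 (sr3 : eqve (sFun_vertex v : sFun L L 0) (sFun_vertex (sid L))).
Notation gA A k t := (gam (degenerate _ A) k t).

Section Extend.
Variables (M : nat) (M0 : 0 < M) (A : N 0).
Notation ZB := (@ZB G M M0).
Notation Z0 x := (forall i, zf (sval x) i = ord0).

Lemma Z0_act m n (f : delta m n) (x : ZB n) : Z0 x -> Z0 (act f x).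
Proof.
move=> h i; change (zf (act f (sval x)) i = ord0); have [h0|h1] := I2 (ze (sval x) (f ord_max)).
by rewrite (zf_act0 h0).
by rewrite zf_act ?h1 // dcE h.
Qed.

(** Over the vertex 0, [r be] is [r (s Gam)], which is only equivalent to [Gam]. The homotopy of
    [Theta_ex] is extended from there to the whole boundary, its other end is filled by [cone_fill],
    and the filling is transported back. *)
Lemma rb_extends (be : smap ZB L) :
 (forall n (x : ZB n), Z0 x -> be n x = s n (gA A (zk (sval x)) (dcomp d12 (ze (sval x))))) ->
 extends (scomp r be).
Proof.
move=> hb; have [Th [T0 T1 Te Ti]] := Theta_ex G A ellW sE rE (@quasi_D2 b).
(* [zk] commutes with the action on mixed simplices; on the collapsed ends the last clause of
   [Theta_ex] takes care of the difference. *)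
have Tk m (t : simplex 1 m) (x : ZB m) n (f : delta n m) :
Th n (act f t, (zk (sval (act f x)), ze (sval (act f x)))) = act f (Th m (t, (zk (sval x), ze (sval x)))).
rewrite -smapP; change (Th n (act f t, (zk (act f (sval x)), ze (act f (sval x)))) = Th n (act f t, (act f (zk (sval x)), dcomp (ze (sval x)) f))).
rewrite ze_act; have [h0|h0] := I2 (dcomp (ze (sval x)) f ord0); have [h1|h1] := I2 (dcomp (ze (sval x)) f ord_max).
- by apply: Ti; left; apply: delta_eq => i; rewrite (d1_0 i h1).
- by rewrite zk_mixed // /zmixed ze_act.
- by apply: Ti; right; apply: delta_eq => i; rewrite (d1_1 i h0).
- by apply: Ti; right; apply: delta_eq => i; rewrite (d1_1 i h0).
have @H : partmap (sprod (simplex 1) ZB) D.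
refine (@Partmap (sprod (simplex 1) ZB) D (fun n x y => Z0 x.2 /\ Th n (x.1, (zk (sval x.2), ze (sval x.2))) = y) _ _).
- by move=> m n f [t x] _ [/= z <-]; split; [apply: Z0_act|apply: Tk].
- by move=> n x y y' [_ <-] [_ <-].
have [|||h [h1 h0 he]] := @hep ZB D (fun n x => Z0 x) (scomp r be) (@quasi_D2 b) Z0_act H.
- by move=> m x; split=> [[y []]//|z]; exists (Th m (x.1, (zk (sval x.2), ze (sval x.2)))).
- by move=> m x y [/= z <-]; rewrite T0 hb.
- move=> x z; exists (Th 1 (did 1, (zk (sval (degenerate 1 x)), ze (sval (degenerate 1 x))))).
split; first by split=> //; apply: Z0_act.
have E : ze (sval (degenerate 1 x)) = degenerate 1 (ze (sval x) : simplex 1 0) by exact: (ze_act (dconst 1 ord0) (sval x)).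
rewrite (Ti 1 (did 1) _ (degenerate 1 (zk (sval x)))) ?E; first exact: Te.
by case: (I2 (ze (sval x) ord0)) => e0; [left|right]; apply: delta_eq => i; rewrite /= -e0.
pose kap : smap ZB D := @Smap ZB D (fun n x => h n (dconst n ord_max, x)) (fun m n f x => smapP h f (dconst n ord_max, x)).
have kE : extends kap.
by apply: (@cone_fill b G M M0 A) => n x z; rewrite -T1; apply: h1; split.
pose e : sFun ZB D 1 := @Smap (sprod ZB (simplex 1)) D (fun n x => h n (x.2, x.1)) (fun m n f x => smapP h f (x.2, x.1)).
have eqe : is_equivalence e by apply: (pw_is_eqv (@quasi_D2 b)) => x; apply: he.
apply: (@extends_eqv _ _ _ _ (@quasi_D2 b) kap) kE.
have [g [h3 h4 h5]] := eqv_inv eqe; exists g; split=> //.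
rewrite h4; apply: smap_eq => n [x t]; rewrite /=; congr (h n (_, _)); exact: delta_eq.
rewrite h5; apply: smap_eq => n [x t]; rewrite /=; apply: etrans (h0 n x); congr (h n (_, _)); exact: delta_eq.
Qed.

(** Applying [s] to the filling of [r be] fills [s r be], and transport along the three equivalences
    from [s r] to the identity fills [be]. *)
Lemma be_extends (be : smap ZB L) :
 (forall n (x : ZB n), Z0 x -> be n x = s n (gA A (zk (sval x)) (dcomp d12 (ze (sval x))))) ->
 extends be.
Proof.
move=> hb; have [h hE] := rb_extends hb.
have pre (f g : smap L L) : eqve (sFun_vertex f : sFun L L 0) (sFun_vertex g) ->
extends (scomp f be) -> extends (scomp g be).
move=> /(smap_eqe (precomp L be)) E; apply: (extends_eqv qL).
have P (w : smap L L) : precomp L be 0 (sFun_vertex w : sFun L L 0) = sFun_vertex (scomp w be) by apply: smap_eq.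
by rewrite !P in E.
have : extends (scomp (sid L) be).
apply: (pre _ _ sr3); apply: (pre _ _ sr2); apply: (pre _ _ sr1).
by exists (scomp s h) => n x; rewrite /= hE.
by case=> h' hE'; exists h'.
Qed.
End Extend.

(** The coordinate of the cocone runs along the edge 12 of [Gam], whose ends are the constant
    diagram and [A # BG]. *)
Definition Tfun n (x : N n) (t : delta n 1) : sFun BGn L n.
Proof.
refine (@Smap (sprod BGn (simplex n)) L
(fun m kf => s m (Gam b G m ((act kf.2 x, kf.1), dcomp d12 (dcomp t kf.2)))) _).
by move=> m l f kf; rewrite -!smapP.
Defined.

Definition Tmap : smap (sprod N (simplex 1)) (sFun BGn L).
Proof.
refine (@Smap (sprod N (simplex 1)) (sFun BGn L) (fun n x => Tfun x.1 x.2) _).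
by move=> m n f x; apply: smap_eq.
Defined.

Notation Dg := (scomp (postcomp BGn ell) (const_diagram BGn N)).
Notation Fc := (scomp ell (nerve_map (sharpC b (BG G)))).

Lemma Tmap0 n (x : N n) : Tmap n (x, dconst n ord0) = Dg n x.
Proof.
apply: smap_eq => m [k f] /=; rewrite -sE; congr (s m _).
exact: (Gam0 (act f x) k).
Qed.
Lemma Tmap1 n (x : N n) : Tmap n (x, dconst n ord_max) = const_diagram BGn L n (Fc n x).
Proof.
apply: smap_eq => m [k f] /=; rewrite -smapP -sE; congr (s m _).
Qed.

Section Initial.
Variable A : N 0.
Notation p := (Dg 0 A).
Notation cc := (const_diagram BGn L).

Definition cocone : comma cc p 0.
Proof.
refine (@CommaSimp L (sFun BGn L) cc p 0 (Fc 0 A)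
(@Smap (sprod (simplex 1) (simplex 0)) (sFun BGn L) (fun m x => at_vertex Tmap A m x.1)
(fun m n f x => smapP (at_vertex Tmap A) f x.1)) _ _).
- by move=> m f; rewrite [LHS]Tmap0 smap_deg.
- move=> m f; rewrite [LHS]Tmap1 !smap_deg /degenerate; congr (act _ _).
by apply: delta_eq => i; rewrite [RHS]ord1.
Defined.
(** The uncurried form of a simplex of cocones, in which a boundary of cocones becomes a map out of
    [ZB]. *)
Definition cv m (Y : comma_simp cc p m) l (e : delta l 1) (f : delta l m) (k : BGn l) : L l :=
 (leg Y l (e, f) : smap (sprod BGn (simplex l)) L) l (k, did l).

Lemma cv_leg m (Y : comma_simp cc p m) l (e : delta l 1) (f : delta l m) l' (k : BGn l') (g : delta l' l) :
 (leg Y l (e, f) : smap (sprod BGn (simplex l)) L) l' (k, g) = cv Y (dcomp e g) (dcomp f g) k.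
Proof.
have := f_equal (fun z : smap (sprod BGn (simplex l')) L => z l' (k, did l')) (smapP (leg Y) g (e, f)).
by move=> /= <-.
Qed.
Lemma cv_act m (Y : comma_simp cc p m) l (e : delta l 1) (f : delta l m) (k : BGn l) l' (g : delta l' l) :
 cv Y (dcomp e g) (dcomp f g) (act g k) = act g (cv Y e f k).
Proof. by rewrite -cv_leg -smapP. Qed.

Lemma cv0 m (Y : comma_simp cc p m) l (e : delta l 1) (f : delta l m) k : e ord_max = ord0 ->
 cv Y e f k = ell l (degenerate l A).
Proof.
move=> h; have -> : e = dconst l ord0 by apply: delta_eq => i; rewrite (d1_0 i h).
by rewrite /cv leg0.
Qed.

Lemma cv1 m (Y : comma_simp cc p m) l (e : delta l 1) (f : delta l m) k : e ord0 = ord_max ->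
 cv Y e f k = act f (apex Y).
Proof.
move=> h; have -> : e = dconst l ord_max by apply: delta_eq => i; rewrite (d1_1 i h).
by rewrite /cv leg1.
Qed.
Lemma cv_pre m (Y : comma cc p m) l (g : delta l m) l' (e : delta l' 1) (f : delta l' l) k :
 cv (act g Y : comma_simp cc p l) e f k = cv (Y : comma_simp cc p m) e (dcomp g f) k.
Proof. by []. Qed.

(** Uncurried, a boundary of cocones with the given vertex 0 is a map on [ZB] equal to [s Gam] over
    that vertex. [be_extends] fills it, and currying the filling gives the apex and the legs. *)
Lemma cocone_initial : is_initial cocone.
Proof.
move=> n bd hv; pose M := n.+1; have M0 : 0 < M by [].
pose fx m (x : ZB G M0 m) : boundary M m := exist _ (zf (sval x)) (svalP x).
pose bv m (x : ZB G M0 m) : L m := cv (bd m (fx m x)) (ze (sval x)) (did m) (zk (sval x)).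
(* Renormalization has to be accounted for: over the end 0 the value is constant, over the end 1 it
   ignores the simplex of BG. *)
have bvP m l (g : delta m l) (x : ZB G M0 l) : bv m (act g x) = act g (bv l x).
rewrite /bv -cv_act; change (sval (act g x)) with (act g (sval x)).
have [h|h] := I2 (ze (sval x) (g ord_max)); first by rewrite !cv0 // ze_act.
have -> : fx m (act g x) = act g (fx l x).
by apply: sigE; change (zf (act g (sval x)) = dcomp (zf (sval x)) g); rewrite zf_act // h.
rewrite (smapP bd) cv_pre ze_act.
have [h'|h'] := I2 (ze (sval x) (g ord0)); last by rewrite !cv1.
by rewrite zk_mixed // /zmixed ze_act.
pose be : smap (ZB G M0) L := Smap bvP.
have hb m (x : ZB G M0 m) : (forall i, zf (sval x) i = ord0) -> be m x = s m (gA A (zk (sval x)) (dcomp d12 (ze (sval x)))).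
move=> z; have nb : exists i : 'I_M.+1, forall j, dconst 0 (ord0 : 'I_M.+1) j <> i.
by exists ord_max => j /esym; apply: (M1 M0).
pose v0 : boundary M 0 := exist _ (dconst 0 ord0) nb.
have E : fx m x = act (dconst m ord0) v0 by apply: sigE; apply: delta_eq => i; rewrite /= z.
by rewrite /= /bv E (smapP bd) (hv v0 erefl).
have [h hE] := be_extends hb.
(* The apex is read over the end 1, where BG is collapsed; [BG1] is the normal representative. *)
pose ap : L M := h M (zq G M M (dconst M ord_max, (did M, BG1 G M))).
have q1 m (e : delta m 1) (f : delta m M) (k k' : BGn m) : e ord0 = ord_max -> zq G M m (e, (f, k)) = zq G M m (e, (f, k')).
move=> e0; have e1 : e ord_max <> ord0 by rewrite (d1_1 _ e0).
by apply: z_ext; rewrite ?ze_q ?zq_ne0 // !zone ?ze_q.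
pose lg m (ef : sprod (simplex 1) (simplex M) m) : sFun BGn L m := @Smap (sprod BGn (simplex m)) L
(fun l kg => h l (zq G M l (dcomp ef.1 kg.2, (dcomp ef.2 kg.2, kg.1))))
(fun l l' g kg => etrans (f_equal (h l) (smapP (zq G M) g (dcomp ef.1 kg.2, (dcomp ef.2 kg.2, kg.1)))) (smapP h g _)).
have lgP m l (g : delta m l) (ef : sprod (simplex 1) (simplex M) l) : lg m (act g ef) = act g (lg l ef).
by apply: smap_eq.
pose LG : smap (sprod (simplex 1) (simplex M)) (sFun BGn L) := Smap lgP.
have hB m (x : Z G M m) (hx : Zb x) : h m x = bv m (exist _ x hx) by exact: (hE m (exist _ x hx)).
have hz m (e : delta m 1) (f : delta m M) (k : BGn m) : e ord_max = ord0 -> h m (zq G M m (e, (f, k))) = ell m (degenerate m A).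
move=> e0; have hx : Zb (zq G M m (e, (f, k))) by apply: Zb_0 => //; rewrite ze_q.
by rewrite (hB m _ hx) /bv cv0 // ze_q.
have L0 m (f : delta m M) : LG m (dconst m ord0, f) = degenerate m p.
by apply: smap_eq => l [k g]; rewrite [LHS]hz.
have L1 m (f : delta m M) : LG m (dconst m ord_max, f) = act f (cc M ap).
apply: smap_eq => l [k g]; change (h l (zq G M l (dconst l ord_max, (dcomp f g, k))) = act (dcomp f g) ap).
rewrite /ap -(smapP h) -(smapP (zq G M)); congr (h l _); exact: q1.
exists (@CommaSimp L (sFun BGn L) cc p M ap LG L0 L1) => m f.
have hf l (e : delta l 1) (g : delta l m) (k : BGn l) :
h l (zq G M l (e, (dcomp (sval f) g, k))) = cv (bd m f) e g k.
have [e0|e1] := I2 (e ord_max); first by rewrite hz // cv0.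
have e1' : e ord_max <> ord0 by rewrite e1.
have zE : zf (zq G M l (e, (dcomp (sval f) g, k))) = dcomp (sval f) g by apply: zq_ne0.
have hx : Zb (zq G M l (e, (dcomp (sval f) g, k))).
by rewrite /Zb zE; case: (svalP f) => i hi; exists i => q; apply: hi.
rewrite (hB l _ hx) /bv.
have -> : fx l (exist _ _ hx) = act g f by apply: sigE; exact: zE.
rewrite (smapP bd) cv_pre; change (sval (exist _ (zq G M l (e, (dcomp (sval f) g, k))) hx)) with (zq G M l (e, (dcomp (sval f) g, k))).
rewrite ze_q; have [e0|e0] := I2 (e ord0); last by rewrite !cv1.
by rewrite /zk zq_mixed.
apply: comma_eq.
change (act (sval f) ap = apex (bd m f)); rewrite /ap -(smapP h) -(smapP (zq G M)).
have := hf m (dconst m ord_max) (did m) (BG1 G m); rewrite cv1 // act1 => <-.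
congr (h m _); exact: q1.
apply: smap_eq => l [e g]; apply: smap_eq => l' [k g'].
change (h l' (zq G M l' (dcomp e g', (dcomp (sval f) (dcomp g g'), k))) = (leg (bd m f) l (e, g) : smap (sprod BGn (simplex l)) L) l' (k, g')).
by rewrite hf cv_leg.
Qed.
End Initial.

Theorem core_colimit : natural_colimit Dg Fc.
Proof.
exists Tmap; split; [exact: Tmap0|exact: Tmap1|move=> A].
by exists (cocone A); split=> //; apply: cocone_initial.
Qed.
End Core.

(** * Both cases of the theorem from the common one *)

Section Reduction.
Variables (b : bool) (G : groupType) (X0 L : sset) (W : X0 1 -> Prop) (ell : smap X0 L).
Variables (P : smap X0 (nerve (Cb b))) (U : smap (nerve (Cb b)) X0) (F : smap X0 X0).
Hypotheses (UP : forall n x, U n (P n x) = x)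
 (PU : forall n x, P n (U n x) = x)
 (WU : forall e, nerve_class (@cweq b) e -> W (U 1 e))
 (WP : forall e, W e -> nerve_class (@cweq b) (P 1 e))
 (FE : forall n x, U n (nerve_map (sharpC b (BG G)) n (P n x)) = F n x)
 (loc : is_localization W ell).

(** [loc_ex] supplies [r] and [section_ex] supplies [s]. As [s] after [strict] is the localization
    map on the nose, [s r] agrees with the identity after restriction along [ell], and [loc_un]
    makes it equivalent to the identity. *)
Theorem reduction_colimit : natural_colimit (scomp (postcomp (nerve (BG G)) ell) (const_diagram (nerve (BG G)) X0)) (scomp ell F).
Proof.
pose ell' := scomp ell U; have qL := loc_quasi loc.
have ellW e : nerve_class (@cweq b) e -> is_equivalence (ell' 1 e) by move/WU/(loc_inv loc).
have [s sE] := section_ex qL ellW.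
have [r rE0] : exists r : smap L (D2 b), eqve (sFun_vertex (scomp r ell) : sFun X0 (D2 b) 0) (sFun_vertex (scomp (strict b) P)).
by apply: (loc_ex loc (@quasi_D2 b)) => e /WP/strict_inv.
have rE : eqve (sFun_vertex (scomp r ell') : sFun (nerve (Cb b)) (D2 b) 0) (sFun_vertex (strict b)).
have := smap_eqe (precomp (D2 b) U) rE0.
have -> : precomp (D2 b) U 0 (sFun_vertex (scomp r ell) : sFun X0 (D2 b) 0) = sFun_vertex (scomp r ell') by apply: smap_eq.
by have -> : precomp (D2 b) U 0 (sFun_vertex (scomp (strict b) P) : sFun X0 (D2 b) 0) = sFun_vertex (strict b) by apply: smap_eq => n [x t] /=; rewrite PU.
have Es : eqve (sFun_vertex (scomp (scomp s r) ell) : sFun X0 L 0) (sFun_vertex ell).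
have := smap_eqe (postcomp X0 s) rE0.
have -> : postcomp X0 s 0 (sFun_vertex (scomp r ell) : sFun X0 (D2 b) 0) = sFun_vertex (scomp (scomp s r) ell) by apply: smap_eq.
by have -> : postcomp X0 s 0 (sFun_vertex (scomp (strict b) P) : sFun X0 (D2 b) 0) = sFun_vertex ell by apply: smap_eq => n [x t] /=; rewrite sE /= UP.
have [u [v [h1 h2 h3]]] := loc_un loc Es.
have core := core_colimit G qL ellW sE rE h1 h2 h3.
apply: (natural_colimit_transfer (P := P) (U := U) (F1 := scomp ell' (nerve_map (sharpC b (BG G)))) UP) core => n x.
by rewrite /= FE.
Qed.
End Reduction.

Lemma nat_iso_true (A B : preadd) (P : forall x y : B, phom x y -> Prop) (F H : pfunctor A B) :
 nat_iso P F H -> nat_iso (fun _ _ _ => True) F H.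
Proof. by case=> eta [h1 h2]; exists eta; split=> // x; case: (h1 x). Qed.
Lemma nat_iso_max (A B : preadd) (F H : pfunctor A B) :
 nat_iso (fun _ _ _ => True) F H -> nat_iso (@p_iso B) F H.
Proof. by case=> eta [h1 h2]; exists eta; split=> // x; case: (h1 x). Qed.

Theorem theorem3p10 (G : groupType) :
 (forall (preAdd_oo : sset) (ell : smap (nerve preAdd) preAdd_oo),
   is_localization (@nerve_class preAdd (@preadd_weq)) ell ->
   natural_colimit
    (scomp (postcomp (nerve (BG G)) ell)
       (const_diagram (nerve (BG G)) (nerve preAdd)))
    (scomp ell (nerve_map (sharp_functor (BG G)))))
 /\
 (forall (preAddplus_oo : sset) (ell : smap (nerve preAddplus) preAddplus_oo),
   is_localization (@nerve_class preAddplus (@mpreadd_weq)) ell ->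
   natural_colimit
    (scomp (postcomp (nerve (BG G)) ell)
       (const_diagram (nerve (BG G)) (nerve preAddplus)))
    (scomp ell (nerve_map (msharp_functor (BG G))))).
Proof.
split=> L ell loc.
- apply: (@reduction_colimit true G (nerve preAdd) L _ ell (nerve_map PhiT) (nerve_map UT) (nerve_map (sharp_functor (BG G)))) loc.
+ exact: UPhiT.
+ exact: PhiUT.
+ by move=> e [H [h1 h2]]; exists (mpf H); split; [apply: nat_iso_true h1|apply: nat_iso_true h2].
+ move=> e [H [h1 h2]]; exists (@Mpfunctor (maxmk _) (maxmk _) H (fun x y f h => pfmor_iso H h)).
by split; [apply: (nat_iso_max h1)|apply: (nat_iso_max h2)].
+ exact: sharpT.
apply: (@reduction_colimit false G (nerve preAddplus) L _ ell (nerve_map PhiF) (nerve_map UF) (nerve_map (msharp_functor (BG G)))) loc.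
- exact: UPhiF.
- exact: PhiUF.
- by move=> e h; exact: h.
- by move=> e h; exact: h.
- exact: sharpF.
Qed.
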